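(* Fix a type of Fock space, i.e. either fix $p\in[1,\infty]$ and put $\mathbb F_t=F_t^p$ for all $t>0$, or put $\mathbb F_t=f_t^\infty$ for all $t>0$. Let $\mathcal D_0$ be a closed subspace of $\operatorname{BUC}(\mathbb C^n)$ which is $\alpha$-invariant and $\delta$-invariant. Then the following are equivalent: (1) $\mathcal D_0$ is a Banach algebra; (2) $\mathcal T_{lin}^{\mathbb F_t}(\mathcal D_0)$ is a Banach algebra for every $t>0$; (3) $\mathcal T_{lin}^{\mathbb F_{t_0}}(\mathcal D_0)$ is a Banach algebra for one $t_0>0$. If $\mathcal D_0$ satisfies (1)-(3) and $\mathcal I_0\subset\mathcal D_0$ is a closed subspace which is both $\alpha$- and $\delta$-invariant, then the following are equivalent (for each of the readings ''left ideal'', ''right ideal'', ''two-sided ideal'' in (2* ) and (3* )): (1* ) $\mathcal I_0$ is an ideal of $\mathcal D_0$; (2* ) $\mathcal T_{lin}^{\mathbb F_t}(\mathcal I_0)$ is a (left- or right-)ideal of $\mathcal T_{lin}^{\mathbb F_t}(\mathcal D_0)$ for every $t>0$; (3* ) $\mathcal T_{lin}^{\mathbb F_{t_0}}(\mathcal I_0)$ is a (left- or right-)ideal of $\mathcal T_{lin}^{\mathbb F_{t_0}}(\mathcal D_0)$ for some $t_0>0$.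
   Context: Fix $n\in\mathbb N$. For $s>0$ let $d\mu_s(z)=(\pi s)^{-n}e^{-|z|^2/s}dz$ on $\mathbb C^n$. For $t>0$ and $1\le p<\infty$ let $L_t^p=L^p(\mathbb C^n,\mu_{2t/p})$ and let $F_t^p$ be the closed subspace of entire functions in $L_t^p$, with the $L_t^p$ norm. Let $L_t^\infty$ be the measurable functions $f$ with $\|f\|_{L_t^\infty}=\|fe^{-|\cdot|^2/(2t)}\|_\infty<\infty$, $F_t^\infty$ the entire functions in $L_t^\infty$, and $f_t^\infty=\{f\in F_t^\infty: fe^{-|\cdot|^2/(2t)}\in C_0(\mathbb C^n)\}$. $P_tf(z)=\int_{\mathbb C^n} f(w)e^{z\cdot\bar w/t}\,d\mu_t(w)$, where $z\cdot\bar w=\sum_jz_j\overline{w_j}$, is a bounded projection of $L_t^p$ onto $F_t^p$ for $1\le p\le\infty$. For $f\in L^\infty(\mathbb C^n)$, the Toeplitz operator is $T_f^tg=P_t(fg)$, bounded on every $F_t^p$ and on $f_t^\infty$. For $S\subset L^\infty(\mathbb C^n)$, $\mathcal T_{lin}^{\mathbb F_t}(S)$ is the operator-norm closed linear span of $\{T_f^t: f\in S\}$ in $\mathcal L(\mathbb F_t)$. $\operatorname{BUC}(\mathbb C^n)$ denotes the bounded uniformly continuous functions with sup norm and pointwise product. A subset of $\operatorname{BUC}(\mathbb C^n)$ is $\alpha$-invariant if it is invariant under all translations $\alpha_z(f)(w)=f(w-z)$, $z\in\mathbb C^n$, and $\delta$-invariant if it is invariant under $\delta_\lambda f(z)=f(\lambda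 z)$ for every $\lambda>0$. Products in $\mathcal T_{lin}^{\mathbb F_t}(\mathcal D_0)$ are operator products. *)

(* Defs.v *)
From HB Require Import structures.
From mathcomp Require Import all_boot all_order all_algebra.
From mathcomp Require Import all_classical all_reals all_analysis.
From mathcomp Require Import measurable_realfun.
From mathcomp.real_closed Require Import complex.

Set Implicit Arguments.
Unset Strict Implicit.
Unset Printing Implicit Defensive.

Import Order.TTheory GRing.Theory Num.Theory.
Import numFieldNormedType.Exports.
Import Normc.

Local Open Scope classical_set_scope.
Local Open Scope ring_scope.

(* R[i]^o is R[i] seen as a normed space over itself; with it, 'rV[C R]_n is a
   normed space over R[i] (for the max norm). *)
Notation C R := (R[i]^o).
Notation Cn R n := ('rV[C R]_n).

Section product_sigma_finite.
Local Open Scope ereal_scope.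
Context d1 d2 (T1 : measurableType d1) (T2 : measurableType d2) (R : realType).
Variable m1 : {sigma_finite_measure set T1 -> \bar R}.
Variable m2 : {sigma_finite_measure set T2 -> \bar R}.

Lemma product_sigma_finite : sigma_finite setT (m1 \x m2).
Proof.
have /sigma_finiteP[F [TF ndF Foo]] := sigma_finiteT m1.
have /sigma_finiteP[G [TG ndG Goo]] := sigma_finiteT m2.
exists (fun n => F n `*` G n).
  rewrite -setXTT TF TG predeqE => -[x y]; split.
    move=> [/= [n _ Fnx] [k _ Gky]]; exists (maxn n k) => //; split.
    - by move: x Fnx; exact/subsetPset/ndF/leq_maxl.
    - by move: y Gky; exact/subsetPset/ndG/leq_maxr.
  by move=> [n _ []/= ? ?]; split; exists n.
move=> k; have [? ?] := Foo k; have [? ?] := Goo k.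
split; first exact: measurableX.
by rewrite product_measure1E// lte_mul_pinfty// ge0_fin_numE.
Qed.

(* The library's sigma-finiteness instance on [\x] is not found by unification,
   hence the explicit packing. *)
Definition product_sfmeasure : {sigma_finite_measure set (T1 * T2)%type -> \bar R} :=
  HB.pack_for (sigma_finite_measure (T1 * T2)%type R) (m1 \x m2)
    (Measure_isSigmaFinite.Build _ _ _ (m1 \x m2) product_sigma_finite).

End product_sigma_finite.

Section LebesgueMeasure.
Context {R : realType}.

(* C^n is measured through its real coordinates, as (R * R)^n via [to_Cn]. *)
Definition R2 : Type := (measurableTypeR R * measurableTypeR R)%type.
HB.instance Definition _ := Measurable.on R2.

Definition tcons (n : nat) (x : R2 * n.-tuple R2) : n.+1.-tuple R2 :=
  [tuple of x.1 :: x.2].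

Lemma measurable_tcons n : measurable_fun [set: R2 * n.-tuple R2] (@tcons n).
Proof. exact: (measurable_cons measurable_fst measurable_snd). Qed.

Section tuple_product.
Local Open Scope ereal_scope.
Variables (m : {sigma_finite_measure set R2 -> \bar R}) (n : nat).
Variable mn : {sigma_finite_measure set (n.-tuple R2) -> \bar R}.

Definition tuple_product : set (n.+1.-tuple R2) -> \bar R :=
  pushforward (m \x mn) (@tcons n).

Let tuple_product0 : tuple_product set0 = 0.
Proof. by rewrite /tuple_product /pushforward preimage_set0 measure0. Qed.

Let tuple_product_ge0 A : 0 <= tuple_product A.
Proof. by rewrite /tuple_product /pushforward; exact: measure_ge0. Qed.

Let tuple_product_sigma_additive : semi_sigma_additive tuple_product.
Proof.
move=> F mF tF mUF; rewrite /tuple_product /pushforward preimage_bigcup.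
apply: measure_semi_sigma_additive.
- by move=> k; rewrite -[X in measurable X]setTI; exact: measurable_tcons.
- apply/trivIsetP => /= i j _ _ ij; rewrite -preimage_setI.
  by move/trivIsetP : tF => /(_ _ _ _ _ ij) ->//; rewrite preimage_set0.
- rewrite -preimage_bigcup -[X in measurable X]setTI.
  exact: measurable_tcons.
Qed.

HB.instance Definition _ := isMeasure.Build _ _ _ tuple_product
  tuple_product0 tuple_product_ge0 tuple_product_sigma_additive.

Let tuple_product_sigma_finite : sigma_finite setT tuple_product.
Proof.
have [F TF mF] := product_sigma_finite m mn.
pose uncons (x : n.+1.-tuple R2) : R2 * n.-tuple R2 :=
  (thead x, [tuple of behead x]).
have unconsK : cancel (@tcons n) uncons.
  by case=> a t; congr pair; apply/val_inj.
have tconsK : cancel uncons (@tcons n).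
  by move=> x; rewrite [RHS]tuple_eta; apply/val_inj.
have muncons : measurable_fun setT uncons.
  by apply/measurable_fun_pair => /=;
    [exact: measurable_tnth|exact: measurable_behead].
exists (fun k => uncons @^-1` F k).
  by rewrite -preimage_bigcup -TF preimage_setT.
move=> k; have [mFk Fkoo] := mF k; split.
  by rewrite -[X in measurable X]setTI; exact: muncons.
rewrite /tuple_product /pushforward.
suff -> : @tcons n @^-1` (uncons @^-1` F k) = F k by [].
by apply/seteqP; split => x /=; rewrite unconsK.
Qed.

HB.instance Definition _ := @Measure_isSigmaFinite.Build _ _ _ tuple_product
  tuple_product_sigma_finite.

End tuple_product.

Definition lebesgue_R2 : {sigma_finite_measure set R2 -> \bar R} :=
  product_sfmeasure (@lebesgue_measure R) (@lebesgue_measure R).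

Fixpoint lebesgue_Cn (n : nat) :
    {sigma_finite_measure set (n.-tuple R2) -> \bar R} :=
  if n is m.+1 then tuple_product lebesgue_R2 (lebesgue_Cn m)
  else \d_ [tuple].

End LebesgueMeasure.
Arguments R2 : clear implicits.

Section GaussianMeasure.
Context {R : realType}.
Implicit Types (n : nat) (s : R).

Definition to_Cn {n} (x : n.-tuple (R2 R)) : Cn R n :=
  \row_j ((tnth x j).1 +i* (tnth x j).2)%C.

(* The squared Euclidean norm |z|^2; the library's norm on 'rV is the maximum
   of the moduli of the coordinates. *)
Definition sqnorm {n} (z : Cn R n) : R := \sum_(j < n) normc (z ord0 j) ^+ 2.

(* (pi s)^{-n} e^{-|z|^2/s}; [powR] is nonnegative even when s is not. *)
Definition gauss_density n s (z : Cn R n) : R :=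
  (pi * s) `^ (- n%:R) * expR (- sqnorm z / s).

Lemma gauss_density_ge0 n s (z : Cn R n) : 0 <= gauss_density s z.
Proof. by rewrite mulr_ge0 ?powR_ge0 ?expR_ge0. Qed.

Lemma measurable_gauss_density n s :
  measurable_fun setT (fun x : n.-tuple (R2 R) => gauss_density s (to_Cn x)).
Proof.
apply: measurable_funM => //; apply: measurableT_comp => //.
apply: measurable_funM => //; apply: measurableT_comp => //.
rewrite (_ : (fun _ => _) = fun x : n.-tuple (R2 R) =>
  \sum_(j < n) ((tnth x j).1 ^+ 2 + (tnth x j).2 ^+ 2)); last first.
  apply/funext => x; apply: eq_bigr => j _.
  by rewrite mxE /= sqr_sqrtr// addr_ge0// sqr_ge0.
apply: measurable_sum => j; apply: measurable_funD; apply: measurable_funX.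
  exact: (measurableT_comp measurable_fst (measurable_tnth j)).
exact: (measurableT_comp measurable_snd (measurable_tnth j)).
Qed.

Definition gauss n s : set (n.-tuple (R2 R)) -> \bar R := fun A =>
  (\int[lebesgue_Cn n]_(x in A) (gauss_density s (to_Cn x))%:E)%E.

Section gauss_measure.
Variables (n : nat) (s : R).

Let gauss0 : gauss s (set0 : set (n.-tuple (R2 R))) = 0%E.
Proof. exact: integral_set0. Qed.

Let gauss_ge0 (A : set (n.-tuple (R2 R))) : (0 <= gauss s A)%E.
Proof. by apply: integral_ge0 => x _; rewrite lee_fin gauss_density_ge0. Qed.

Let gauss_sigma_additive :
  semi_sigma_additive (gauss s : set (n.-tuple (R2 R)) -> \bar R).
Proof.
apply: semi_sigma_additive_nng_induced => [|x].
  by apply/measurable_EFinP; apply: measurable_gauss_density.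
by rewrite lee_fin gauss_density_ge0.
Qed.

HB.instance Definition _ := isMeasure.Build _ _ _
  (gauss s : set (n.-tuple (R2 R)) -> \bar R)
  gauss0 gauss_ge0 gauss_sigma_additive.

End gauss_measure.

Definition cintegral {n} (mu : {measure set (n.-tuple (R2 R)) -> \bar R})
    (f : Cn R n -> C R) : C R :=
  ((\int[mu]_x complex.Re (f (to_Cn x)))%R +i*
   (\int[mu]_x complex.Im (f (to_Cn x)))%R)%C.

Definition cmeasurable {n} (f : Cn R n -> C R) : Prop :=
  measurable_fun setT (fun x : n.-tuple (R2 R) => complex.Re (f (to_Cn x))) /\
  measurable_fun setT (fun x : n.-tuple (R2 R) => complex.Im (f (to_Cn x))).

Definition cexp (z : C R) : C R :=
  ((expR (complex.Re z) * cos (complex.Im z)) +i*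
   (expR (complex.Re z) * sin (complex.Im z)))%C.

End GaussianMeasure.

Section BanachAlgebras.
Context {R : realType} {V : lmodType R[i]}.
Implicit Types (N : V -> \bar R) (mul : V -> V -> V) (A I S W : set V).

Definition is_subspace A : Prop :=
  A 0 /\ forall (c : R[i]) u v, A u -> A v -> A (c *: u + v).

Definition is_closed_subspace W N A : Prop :=
  [/\ A `<=` W, is_subspace A &
      forall u, W u ->
        (forall e : R, 0 < e -> exists2 v, A v & (N (u - v)%R < e%:E)%E) -> A u].

Definition is_complete N A : Prop :=
  forall u : nat -> V, (forall k, A (u k)) ->
    (forall e : R, 0 < e -> exists K : nat, forall k l, (K <= k)%N -> (K <= l)%N ->
       (N (u k - u l)%R < e%:E)%E) ->
    exists2 v, A v & forall e : R, 0 < e -> exists K : nat, forall k, (K <= k)%N ->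
       (N (u k - v)%R < e%:E)%E.

(* Meant for subsets of an ambient normed algebra (BUC, or the bounded operators
   on a Fock space): the axioms of the norm and the product are inherited, and
   no unit is required. *)
Definition is_banach_algebra N mul A : Prop :=
  [/\ is_subspace A, (forall u v, A u -> A v -> A (mul u v)) &
      is_complete N A].

Variant ideal_side := LeftIdeal | RightIdeal | TwoSidedIdeal.

Definition is_ideal (side : ideal_side) mul A I : Prop :=
  let left := forall a u, A a -> I u -> I (mul a u) in
  let right := forall a u, A a -> I u -> I (mul u a) in
  [/\ I `<=` A, is_subspace I &
      match side with
      | LeftIdeal => left
      | RightIdeal => right
      | TwoSidedIdeal => left /\ right
      end].

Definition lin_span S : set V :=
  [set v | exists (m : nat) (c : 'I_m -> R[i]) (s : 'I_m -> V),
     (forall i, S (s i)) /\ v = \sum_(i < m) c i *: s i].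

Definition closed_span W N S : set V :=
  [set u | W u /\
     forall e : R, 0 < e -> exists2 v, lin_span S v & (N (u - v)%R < e%:E)%E].

End BanachAlgebras.

Section BUC.
Context {R : realType} {n : nat}.
Implicit Types (f g : Cn R n -> C R) (D : set (Cn R n -> C R)).

Definition sup_norm f : \bar R :=
  ereal_sup [set (normc (f z))%:E | z in [set: Cn R n]].

Definition BUC : set (Cn R n -> C R) :=
  [set f : Cn R n -> C R | (sup_norm f < +oo)%E /\ unif_continuous f].

Definition C0 : set (Cn R n -> C R) :=
  [set f : Cn R n -> C R | continuous f /\
     forall e : R, 0 < e ->
       exists2 K : set (Cn R n), compact K & forall z, ~ K z -> normc (f z) < e].

Definition fun_mul f g : Cn R n -> C R := f \* g.

Definition alpha_invariant D : Prop :=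
  forall (z : Cn R n) f, D f -> D (fun w => f (w - z)).

Definition delta_invariant D : Prop :=
  forall lambda : R, 0 < lambda ->
    forall f, D f -> D (fun z => f (lambda%:C%C *: z)).

End BUC.

(* [FockP p _] stands for F_t^p with 1 <= p < oo, [FockInf] for F_t^oo and
   [FockZero] for f_t^oo. *)
Variant fock_kind (R : realType) :=
  FockP (p : R) of 1 <= p | FockInf | FockZero.
Arguments FockInf {R}.
Arguments FockZero {R}.

Section FockSpaces.
Context {R : realType} {n : nat}.
Implicit Types (k : fock_kind R) (t : R) (f g : Cn R n -> C R).
Implicit Types (A B : (Cn R n -> C R) -> (Cn R n -> C R)).

Definition entire f : Prop := forall z : Cn R n, differentiable f z.

Definition weight t (z : Cn R n) : R := expR (- sqnorm z / (2 * t)).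

Definition fock_norm k t f : \bar R :=
  match k with
  | FockP p _ =>
      Lnorm (gauss (2 * t / p)) p%:E
        (fun x : n.-tuple (R2 R) => (normc (f (to_Cn x)))%:E)
  | FockInf | FockZero =>
      Lnorm (lebesgue_Cn n) +oo%E
        (fun x : n.-tuple (R2 R) =>
           (normc (f (to_Cn x)) * weight t (to_Cn x))%:E)
  end.

Definition fock_space k t : set (Cn R n -> C R) :=
  [set f : Cn R n -> C R | [/\ cmeasurable f, (fock_norm k t f < +oo)%E, entire f &
     if k is FockZero then C0 (fun z => f z * (weight t z)%:C%C) else True]].

(* An operator on the Fock space is represented by a map on all functions
   C^n -> C, whose values outside the Fock space are irrelevant: the operator
   norm and the sets of operators below only depend on its restriction. *)
Definition op_norm k t A : \bar R :=
  ereal_sup [set fock_norm k t (A g)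
            | g in [set g | fock_space k t g /\ (fock_norm k t g <= 1)%E]].

Definition bounded_operators k t : set ((Cn R n -> C R) -> (Cn R n -> C R)) :=
  [set A | [/\ forall g, fock_space k t g -> fock_space k t (A g),
     forall (c : R[i]) g h, fock_space k t g -> fock_space k t h ->
       A (c *: g + h) = c *: A g + A h &
     (op_norm k t A < +oo)%E]].

Definition op_mul A B : (Cn R n -> C R) -> (Cn R n -> C R) := A \o B.

Definition fock_projection t f : Cn R n -> C R := fun z =>
  cintegral (gauss t) (fun w =>
    f w * cexp ((\sum_(j < n) z ord0 j * (w ord0 j)^*%C) / t%:C%C)).

Definition toeplitz t f g : Cn R n -> C R := fock_projection t (fun_mul f g).

Definition Tlin k t (S : set (Cn R n -> C R)) :
    set ((Cn R n -> C R) -> (Cn R n -> C R)) :=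
  closed_span (bounded_operators k t) (op_norm k t) [set toeplitz t f | f in S].

End FockSpaces.

(* Main.v *)
(** Everything follows from one equivalence: for closed invariant D, E, G, the
    inclusion D E <= G of symbols holds iff Tlin(D) Tlin(E) <= Tlin(G).

    From symbols to operators, write T_f T_g phi(z) as an integral over u and
    x of f(u + x) g(u) phi(u) against Gaussian factors, x being distributed
    according to mu_t.  The Toeplitz operator T_h with h(u) an integral over
    |x|^2 <= r and over y of f(u + y + x) g(u + y) against a kernel
    concentrated at y = 0 at scale e turns out to be given by the same formula
    with phi(u) replaced by a point value near u.  Its symbol is a uniform
    limit of combinations of products of translates, hence lies in G, and the
    error is bounded pointwise by the convolution of |phi| e^(-|.|^2 / 2t) with
    a Gaussian of arbitrarily small mass, so that Young's inequality bounds it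
    in all the Fock norms at once.

    From operators to symbols, the Berezin transform maps Tlin(G) into G
    (convolution with mu_t on Toeplitz operators, and bounded).  Applying it to
    T_f T_g with f and g dilated by l, and dilating the result by 1/l, yields
    functions of G that converge uniformly to f g as l tends to 0. *)

Require Import Defs.
From HB Require Import structures.
From mathcomp Require Import all_boot all_order all_algebra.
From mathcomp Require Import all_classical all_reals all_analysis.
From mathcomp Require Import measurable_realfun ess_sup_inf ring lra.
From mathcomp.real_closed Require Import complex.

Set Implicit Arguments.
Unset Strict Implicit.
Unset Printing Implicit Defensive.

Import Order.TTheory GRing.Theory Num.Theory.
Import numFieldNormedType.Exports.
Import Normc.
Local Open Scope classical_set_scope.
Local Open Scope ring_scope.

(** * Complex numbers and the space C^n *)

(** The kernel of [T_f T_g] carries the factor [e^((z-u).x/t)], which involves [z] and so cannot be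
    part of a symbol. Holomorphy of [phi] gets rid of it: integrating translates by [y] of [phi(u)]
    and its Bergman kernel against a suitable Gaussian in [y] produces this very factor, and the
    only price is that [phi(u)] turns into a value at [u + (e/t)(z - u)]. Hence the need for a
    reproducing formula for entire functions at arbitrary scales, deduced here from Goursat's
    theorem; it also yields the pointwise bounds and the completeness of the Fock spaces. The cutoff
    [|x|^2 <= r] is forced, since the L^1 norm of the kernel in [y] grows with [x] at least as fast
    as mu_t decays; [r] and [e] are chosen independently in the end. For the converse, dilating the
    symbols by [l] at fixed [t] amounts to replacing [t] by [l^2 t], so that delta-invariance turns
    a single [t] into the limit of small [t]. Commutativity of the product of symbols makes left,
    right and two-sided ideals of operators correspond to the same ideals of symbols. *)

Section ComplexBasics.
Context {R : realType}.
Implicit Types (z w q : C R) (a b s : R).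
Local Notation Re := (@complex.Re R).
Local Notation Im := (@complex.Im R).

Lemma ReD z w : Re (z + w) = Re z + Re w. Proof. by case: z => ? ?; case: w. Qed.
Lemma ImD z w : Im (z + w) = Im z + Im w. Proof. by case: z => ? ?; case: w. Qed.
Lemma ReN z : Re (- z) = - Re z. Proof. by case: z. Qed.
Lemma ImN z : Im (- z) = - Im z. Proof. by case: z. Qed.
Lemma ReB z w : Re (z - w) = Re z - Re w. Proof. by rewrite ReD ReN. Qed.
Lemma ImB z w : Im (z - w) = Im z - Im w. Proof. by rewrite ImD ImN. Qed.
Lemma ReM z w : Re (z * w) = Re z * Re w - Im z * Im w.
Proof. by case: z => ? ?; case: w. Qed.
Lemma ImM z w : Im (z * w) = Re z * Im w + Im z * Re w.
Proof. by case: z => ? ?; case: w. Qed.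
Lemma complex_eqP z w : Re z = Re w -> Im z = Im w -> z = w.
Proof. by case: z => ? ?; case: w => ? ? /= -> ->. Qed.

Lemma normc_ge0 z : 0 <= normc z.
Proof. by case: z => a b; exact: sqrtr_ge0. Qed.

Lemma sqr_normc_def z : normc z ^+ 2 = Re z ^+ 2 + Im z ^+ 2.
Proof. by case: z => a b /=; rewrite sqr_sqrtr// addr_ge0// sqr_ge0. Qed.

Lemma le_Re_normc z : `|Re z| <= normc z.
Proof.
rewrite -(@ler_pXn2r _ 2)// ?nnegrE ?normc_ge0// sqr_normc_def real_normK ?num_real//.
by rewrite lerDl sqr_ge0.
Qed.

Lemma le_Im_normc z : `|Im z| <= normc z.
Proof.
rewrite -(@ler_pXn2r _ 2)// ?nnegrE ?normc_ge0// sqr_normc_def real_normK ?num_real//.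
by rewrite lerDr sqr_ge0.
Qed.

Lemma Re_le_normc z : Re z <= normc z.
Proof. exact: le_trans (ler_norm _) (le_Re_normc z). Qed.

Lemma normc_le_ReIm z : normc z <= `|Re z| + `|Im z|.
Proof.
rewrite -(@ler_pXn2r _ 2)// ?nnegrE ?normc_ge0 ?addr_ge0// sqr_normc_def sqrrD.
rewrite !real_normK ?num_real// -addrA [X in _ <= _ + X]addrC addrA lerDl.
by rewrite mulrn_wge0// mulr_ge0.
Qed.

Lemma normcD z w : normc (z + w) <= normc z + normc w.
Proof. exact: le_normcD. Qed.

Lemma normcB z w : normc (z - w) <= normc z + normc w.
Proof. by rewrite -(normcN w); exact: normcD. Qed.

Lemma normc_distC z w : normc (z - w) = normc (w - z).
Proof. by rewrite -normcN opprB. Qed.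

Lemma normc_sum (I : Type) (r : seq I) (P : pred I) (F : I -> C R) :
  normc (\sum_(i <- r | P i) F i) <= \sum_(i <- r | P i) normc (F i).
Proof.
elim/big_rec2: _ => [|i y x _ h]; first by rewrite normc0.
by apply: le_trans (normcD _ _) _; rewrite lerD2l.
Qed.

Lemma normcR a : normc (a%:C)%C = `|a|.
Proof. by rewrite /= expr0n /= addr0 sqrtr_sqr. Qed.

Lemma normc_conj z : normc (z^*)%C = normc z.
Proof. by case: z => a b /=; rewrite sqrrN. Qed.

Lemma norm_normc z : `|z| = (normc z)%:C%C.
Proof. by case: z. Qed.

Lemma normc_eq0 z : normc z = 0 -> z = 0. Proof. exact: eq0_normc. Qed.

Lemma mulRC_Re a z : Re (a%:C%C * z) = a * Re z.
Proof. by rewrite ReM /= mul0r subr0. Qed.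
Lemma mulRC_Im a z : Im (a%:C%C * z) = a * Im z.
Proof. by rewrite ImM /= mul0r addr0. Qed.

Lemma realCV a : (a%:C%C)^-1 = (a^-1)%:C%C :> C R.
Proof. by rewrite -(fmorphV (real_complex R)). Qed.

Lemma cexpD z w : cexp (z + w) = cexp z * cexp w.
Proof.
by apply: complex_eqP; rewrite ?ReM ?ImM /cexp /= ReD ImD expRD ?cosD ?sinD; ring.
Qed.

Lemma cexp0 : cexp 0 = 1 :> C R.
Proof. by apply: complex_eqP; rewrite /cexp /= expR0 ?cos0 ?sin0 mul1r. Qed.

Lemma normc_cexp z : normc (cexp z) = expR (Re z).
Proof.
apply/eqP; rewrite -(@eqrXn2 _ 2)// ?normc_ge0 ?expR_ge0// sqr_normc_def /cexp /=.
by rewrite !exprMn -mulrDr cos2Dsin2 mulr1.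
Qed.

Lemma cexp_neq0 z : cexp z != 0.
Proof.
apply/eqP => h; have := normc_cexp z; rewrite h normc0 => /eqP.
by rewrite eq_sym gt_eqF// expR_gt0.
Qed.

Lemma cexpR a : cexp a%:C%C = (expR a)%:C%C :> C R.
Proof. by apply: complex_eqP; rewrite /cexp /= ?cos0 ?sin0 ?mulr1 ?mulr0. Qed.

(* The mean value theorem applied to both components; hence the factor 2. *)
Lemma complex_MVT_bound (f df : R -> C R) (M : R) :
  (forall s, is_derive s 1 (fun u => Re (f u)) (Re (df s))) ->
  (forall s, is_derive s 1 (fun u => Im (f u)) (Im (df s))) ->
  (forall s, 0 <= s <= 1 -> normc (df s) <= M) ->
  normc (f 1 - f 0) <= 2 * M.
Proof.
move=> dR dI hM.
have key (g dg : R -> R) : (forall s, is_derive s 1 g (dg s)) ->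
    (forall s, 0 <= s <= 1 -> `|dg s| <= M) -> `|g 1 - g 0| <= M.
  move=> dg_ gM.
  have [s /[!in_itv]/= /andP[s0 s1] ->] : exists2 c, c \in `]0, 1[ &
      g 1 - g 0 = dg c * (1 - 0).
    apply: MVT => //.
    apply: derivable_within_continuous => x _.
    by have [] := dg_ x.
  by rewrite subr0 mulr1 gM// !ltW.
apply: le_trans (normc_le_ReIm _) _; rewrite ReB ImB mulrDl mul1r lerD//.
  by apply: (key (Re \o f) (Re \o df)) => // s hs; exact: le_trans (le_Re_normc _) (hM _ hs).
by apply: (key (Im \o f) (Im \o df)) => // s hs; exact: le_trans (le_Im_normc _) (hM _ hs).
Qed.

Lemma is_derive_Re_cexp q s :
  is_derive s 1 (fun u => Re (cexp (u%:C%C * q))) (Re (q * cexp (s%:C%C * q))).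
Proof.
rewrite /cexp.
have -> : (fun u : R => Re ((expR (Re (u%:C%C * q)) * cos (Im (u%:C%C * q))) +i*
   (expR (Re (u%:C%C * q)) * sin (Im (u%:C%C * q))))%C) =
   (fun u => expR (Re q * u) * cos (Im q * u)).
  by apply/funext => u /=; rewrite mulRC_Re mulRC_Im ![u * _]mulrC.
apply: is_derive_eq; rewrite /GRing.scale /= ReM /= mulRC_Re mulRC_Im.
by rewrite ![_ * s]mulrC; ring.
Qed.

Lemma is_derive_Im_cexp q s :
  is_derive s 1 (fun u => Im (cexp (u%:C%C * q))) (Im (q * cexp (s%:C%C * q))).
Proof.
rewrite /cexp.
have -> : (fun u : R => Im ((expR (Re (u%:C%C * q)) * cos (Im (u%:C%C * q))) +i*
   (expR (Re (u%:C%C * q)) * sin (Im (u%:C%C * q))))%C) =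
   (fun u => expR (Re q * u) * sin (Im q * u)).
  by apply/funext => u /=; rewrite mulRC_Re mulRC_Im ![u * _]mulrC.
apply: is_derive_eq; rewrite /GRing.scale /= ImM /= mulRC_Re mulRC_Im.
by rewrite ![_ * s]mulrC; ring.
Qed.

Lemma normc_cexp_le (c : R) q : 0 <= c <= 1 -> normc (cexp (c%:C%C * q)) <= expR (normc q).
Proof.
move=> /andP[c0 c1]; rewrite normc_cexp ler_expR mulRC_Re.
apply: le_trans (ler_norm _) _; rewrite normrM (ger0_norm c0).
by apply: le_trans (le_Re_normc q); rewrite ler_piMl.
Qed.

Lemma normc_cexpB1 q : normc (cexp q - 1) <= 2 * (normc q * expR (normc q)).
Proof.
have := @complex_MVT_bound (fun s => cexp (s%:C%C * q)) (fun s => q * cexp (s%:C%C * q))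
  (normc q * expR (normc q)) (is_derive_Re_cexp q) (is_derive_Im_cexp q).
rewrite mul1r mul0r cexp0; apply => s hs.
by rewrite normcM ler_wpM2l ?normc_ge0// normc_cexp_le.
Qed.

(** The function [s -> cexp (s q) - s q] has derivative [q (cexp (s q) - 1)], already controlled by
    [normc_cexpB1]; the constant 4 is the factor 2 of [complex_MVT_bound] taken twice. *)
Lemma normc_cexpB1B q :
  normc (cexp q - 1 - q) <= 4 * (normc q ^+ 2 * expR (normc q)).
Proof.
have dlin (x s : R) : is_derive s 1 (fun u : R => u * x) x.
  by apply: is_derive_eq; rewrite /GRing.scale /= ; ring.
rewrite (_ : 4 * _ = 2 * (2 * (normc q ^+ 2 * expR (normc q)))); last by ring.
rewrite (_ : cexp q - 1 - q = (cexp (1%:C%C * q) - 1%:C%C * q) -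
  (cexp (0%:C%C * q) - 0%:C%C * q)); last by rewrite mul1r mul0r cexp0 subr0 addrAC.
apply: (@complex_MVT_bound (fun s => cexp (s%:C%C * q) - s%:C%C * q)
  (fun s => q * cexp (s%:C%C * q) - q)).
- move=> s; rewrite (_ : (fun u : R => _) =
    (fun u => Re (cexp (u%:C%C * q)) - u * Re q)); last first.
    by apply/funext => u; rewrite ReB mulRC_Re.
  have := is_derive_Re_cexp q s; have := dlin (Re q) s.
  by rewrite ReB => ? ?; exact: is_deriveB.
- move=> s; rewrite (_ : (fun u : R => _) =
    (fun u => Im (cexp (u%:C%C * q)) - u * Im q)); last first.
    by apply/funext => u; rewrite ImB mulRC_Im.
  have := is_derive_Im_cexp q s; have := dlin (Im q) s.
  by rewrite ImB => ? ?; exact: is_deriveB.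
move=> s /andP[s0 s1]; 
rewrite (_ : _ - _ = q * (cexp (s%:C%C * q) - 1)); last by rewrite mulrBr mulr1.
rewrite normcM (_ : 2 * _ = normc q * (2 * (normc q * expR (normc q)))); last by ring.
rewrite ler_wpM2l ?normc_ge0//; apply: le_trans (normc_cexpB1 _) _.
rewrite ler_wpM2l//; apply: ler_pM; rewrite ?normc_ge0 ?expR_ge0 ?ler_expR//;
  rewrite normcM normcR ger0_norm// ler_piMl ?normc_ge0//.
Qed.

End ComplexBasics.

Arguments normc : simpl never.
Arguments cexp : simpl never.

Section DotProduct.
Context {R : realType} {n : nat}.
Implicit Types (z w u v : Cn R n) (c : C R) (a : R).
Local Notation Re := (@complex.Re R).
Local Notation Im := (@complex.Im R).

Definition dot z w : C R := \sum_(j < n) z ord0 j * (w ord0 j)^*%C.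

Lemma dotDl z w v : dot (z + w) v = dot z v + dot w v.
Proof. by rewrite /dot -big_split; apply: eq_bigr => j _; rewrite mxE mulrDl. Qed.
Lemma dotDr z w v : dot v (z + w) = dot v z + dot v w.
Proof. by rewrite /dot -big_split; apply: eq_bigr => j _; rewrite mxE rmorphD mulrDr. Qed.
Lemma dotZl c z v : dot (c *: z) v = c * dot z v.
Proof. by rewrite /dot mulr_sumr; apply: eq_bigr => j _; rewrite mxE mulrA. Qed.
Lemma dotZr c z v : dot v (c *: z) = c^*%C * dot v z.
Proof. by rewrite /dot mulr_sumr; apply: eq_bigr => j _; rewrite mxE rmorphM mulrCA. Qed.
Lemma dotNl z v : dot (- z) v = - dot z v.
Proof. by rewrite -scaleN1r dotZl mulN1r. Qed.
Lemma dotNr z v : dot v (- z) = - dot v z.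
Proof. by rewrite -scaleN1r dotZr rmorphN rmorph1 mulN1r. Qed.
Lemma dotBl z w v : dot (z - w) v = dot z v - dot w v.
Proof. by rewrite dotDl dotNl. Qed.
Lemma dotBr z w v : dot v (z - w) = dot v z - dot v w.
Proof. by rewrite dotDr dotNr. Qed.
Lemma dot0l v : dot 0 v = 0.
Proof. by rewrite -(scale0r (0 : Cn R n)) dotZl mul0r. Qed.
Lemma dot0r v : dot v 0 = 0.
Proof. by rewrite -(scale0r (0 : Cn R n)) dotZr conjc0 mul0r. Qed.
Lemma conj_dot z w : (dot z w)^*%C = dot w z.
Proof. by rewrite /dot rmorph_sum; apply: eq_bigr => j _; rewrite rmorphM /= conjcK mulrC. Qed.
Lemma dotzz z : dot z z = (sqnorm z)%:C%C.
Proof.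
rewrite /sqnorm rmorph_sum; apply: eq_bigr => j _; rewrite sqr_normc_def.
by case: (z ord0 j) => a b; apply: complex_eqP; rewrite ?ReM ?ImM /=; ring.
Qed.
Lemma Re_dotC z w : Re (dot z w) = Re (dot w z).
Proof. by rewrite -(conj_dot z w); case: (dot z w). Qed.

Lemma sqnorm_ge0 z : 0 <= sqnorm z.
Proof. by apply: sumr_ge0 => j _; rewrite sqr_ge0. Qed.
Lemma sqnormE z : sqnorm z = Re (dot z z). Proof. by rewrite dotzz. Qed.
Lemma sqnormD z w : sqnorm (z + w) = sqnorm z + sqnorm w + 2 * Re (dot z w).
Proof.
rewrite !sqnormE dotDl !dotDr !ReD (Re_dotC w z); ring.
Qed.
Lemma sqnormN z : sqnorm (- z) = sqnorm z.
Proof. by rewrite !sqnormE dotNl dotNr opprK. Qed.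
Lemma sqnormB z w : sqnorm (z - w) = sqnorm z + sqnorm w - 2 * Re (dot z w).
Proof. by rewrite sqnormD sqnormN dotNr ReN; ring. Qed.
Lemma sqnormBC z w : sqnorm (z - w) = sqnorm (w - z).
Proof. by rewrite -sqnormN opprB. Qed.
Lemma sqnormZ c z : sqnorm (c *: z) = normc c ^+ 2 * sqnorm z.
Proof. by rewrite /sqnorm mulr_sumr; apply: eq_bigr => j _; rewrite mxE normcM exprMn. Qed.
Lemma sqnormZR a z : sqnorm (a%:C%C *: z) = a ^+ 2 * sqnorm z.
Proof. by rewrite sqnormZ normcR real_normK ?num_real. Qed.
Lemma sqnorm0 : sqnorm (0 : Cn R n) = 0.
Proof. by rewrite sqnormE dot0l. Qed.

(** The inequality [2 x y <= a x^2 + y^2 / a] in each coordinate. The free parameter [a] distributes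
    a Gaussian exponent between the two arguments, and does most of the work of Cauchy-Schwarz
    without square roots. *)
Lemma normc_dot_le a z w : 0 < a -> normc (dot z w) <= (a * sqnorm z + sqnorm w / a) / 2.
Proof.
move=> a0; apply: le_trans (normc_sum _ _ _) _.
rewrite /sqnorm mulr_sumr mulr_suml -big_split mulr_suml; apply: ler_sum => j _ /=.
rewrite normcM normc_conj; move: (normc (z _ _)) (normc (w _ _)) => x y.
have -> : a * x ^+ 2 + y ^+ 2 / a = (a * x - y) ^+ 2 / a + 2 * (x * y).
  by field; rewrite gt_eqF.
by rewrite mulrDl [2 * _]mulrC mulfK ?pnatr_eq0// lerDr divr_ge0// divr_ge0 ?sqr_ge0 ?ltW.
Qed.

Lemma normc_dot_le1 z w : normc (dot z w) <= (sqnorm z + sqnorm w) / 2.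
Proof. by have := @normc_dot_le 1 z w ltr01; rewrite mul1r divr1. Qed.

Lemma Re_dot_le a z w : 0 < a -> Re (dot z w) <= (a * sqnorm z + sqnorm w / a) / 2.
Proof. move=> a0; exact: le_trans (Re_le_normc _) (normc_dot_le _ _ a0). Qed.

Lemma sqnormD_le z w : sqnorm (z + w) <= 2 * (sqnorm z + sqnorm w).
Proof.
have := @Re_dot_le 1 z w ltr01; rewrite sqnormD mul1r divr1; lra.
Qed.

Lemma normc_coord_le z j : normc (z ord0 j) ^+ 2 <= sqnorm z.
Proof.
rewrite /sqnorm (bigD1 j)//= lerDl; apply: sumr_ge0 => i _; exact: sqr_ge0.
Qed.

Lemma sqnorm_eq0 z : sqnorm z = 0 -> z = 0.
Proof.
move=> h; apply/rowP => j; rewrite mxE; apply: normc_eq0.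
apply/eqP; rewrite -sqrf_eq0 eq_le sqr_ge0 andbT -h; exact: normc_coord_le.
Qed.

Lemma mx_ball_sqnorm z w (e : R) : 0 < e -> sqnorm (z - w) < e ^+ 2 ->
  ball z (e%:C)%C w.
Proof.
move=> e0 h; split=> [|i j]; first by rewrite ltcR.
rewrite (ord1 i) -ball_normE /ball_ /= norm_normc ltcR.
rewrite -(@ltr_pXn2r _ 2)// ?nnegrE ?normc_ge0 ?ltW//.
by apply: le_lt_trans h; have := normc_coord_le (z - w) j; rewrite !mxE.
Qed.

Lemma sqnorm_mx_ball z w (e : R) : 0 < e -> ball z (e%:C)%C w ->
  sqnorm (z - w) <= n%:R * e ^+ 2.
Proof.
move=> e0 [_ h]; rewrite -[n in n%:R]card_ord -sum1_card natr_sum mulr_suml.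
apply: ler_sum => j _; rewrite mul1r ler_pXn2r// ?nnegrE ?normc_ge0 ?(ltW e0)//.
have := h ord0 j; rewrite -ball_normE /ball_ /= norm_normc ltcR !mxE; exact: ltW.
Qed.

Lemma posc_real (e : R[i]) : 0 < e -> exists2 a, 0 < a & e = (a%:C)%C.
Proof. by case: e => a b; rewrite ltcE /= => /andP[/eqP -> a0]; exists a. Qed.

(** Bridge from the topology of the maximum norm, whose balls have complex radii, to estimates in
    [sqnorm] with real tolerances. *)
Lemma continuous_epsP (f : Cn R n -> C R) z :
  {for z, continuous f} <->
  forall e : R, 0 < e -> exists2 d : R, 0 < d & forall w, sqnorm (w - z) < d -> normc (f w - f z) < e.
Proof.
split=> [fz e e0|h].
  have e0C : 0 < (e%:C)%C :> R[i] by rewrite ltcR.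
  move/cvg_ballP : fz => /(_ _ e0C) fz.
  have [_ /= /posc_real[a a0 ->] hr] := (nbhs_ballP z (fun w => ball (f z) (e%:C)%C (f w))).1 fz.
  exists (a ^+ 2); first exact: exprn_gt0 a0.
  move=> w; rewrite sqnormBC => hw; have := hr w (mx_ball_sqnorm a0 hw).
  by rewrite /= -ball_normE /ball_ /= norm_normc ltcR normc_distC.
move=> A /(nbhs_ballP (f z) A).1 [_ /= /posc_real[e e0 ->] hA].
have [d d0 hd] := h _ e0.
(* With [n.+1] instead of [n] the division is safe in dimension 0 and [n * r ^+ 2 < d] is strict. *)
pose r := Num.sqrt (d / n.+1%:R).
have r0 : 0 < r by rewrite sqrtr_gt0 divr_gt0.
apply: (nbhs_ballP z (f @^-1` A)).2; exists (r%:C)%C; first by rewrite /= ltcR.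
move=> w /(sqnorm_mx_ball r0) hzw; apply: hA.
rewrite -ball_normE /ball_ /= norm_normc ltcR normc_distC; apply: hd.
rewrite sqnormBC; apply: le_lt_trans hzw _.
by rewrite sqr_sqrtr ?divr_ge0 ?ltW// mulrCA gtr_pMr// ltr_pdivrMr// mul1r ltr_nat.
Qed.

Lemma unif_continuous_epsP (f : Cn R n -> C R) :
  unif_continuous f <->
  forall e : R, 0 < e -> exists2 d : R, 0 < d &
    forall z w, sqnorm (z - w) < d -> normc (f z - f w) < e.
Proof.
rewrite unif_continuousP; split=> [fu e e0|h _ /posc_real[e e0 ->]].
  have [_ /posc_real[a a0 ->] hr] := fu (e%:C)%C (ltac:(by rewrite ltcR)).
  exists (a ^+ 2); first exact: exprn_gt0 a0.
  move=> z w hw; have := hr (z, w) (mx_ball_sqnorm a0 hw).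
  by rewrite /= -ball_normE /ball_ /= norm_normc ltcR.
have [d d0 hd] := h _ e0.
pose r := Num.sqrt (d / n.+1%:R).
have r0 : 0 < r by rewrite sqrtr_gt0 divr_gt0.
exists (r%:C)%C; first by rewrite ltcR.
move=> [z w] /= /(sqnorm_mx_ball r0) hzw.
rewrite -ball_normE /ball_ /= norm_normc ltcR; apply: hd.
apply: le_lt_trans hzw _.
by rewrite sqr_sqrtr ?divr_ge0 ?ltW// mulrCA gtr_pMr// ltr_pdivrMr// mul1r ltr_nat.
Qed.

End DotProduct.

(** * Lebesgue measure on C^n and complex integrals *)

Section MeasurableCn.
Context {R : realType}.
Variable n : nat.
Local Notation X := (n.-tuple (R2 R)).

Definition of_Cn (z : Cn R n) : X :=
  [tuple (complex.Re (z ord0 j), complex.Im (z ord0 j)) | j < n].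

Lemma of_CnK : cancel of_Cn to_Cn.
Proof.
move=> z; apply/rowP => j; rewrite mxE tnth_mktuple /=.
by case: (z ord0 j).
Qed.

Lemma to_CnK : cancel (@to_Cn R n) of_Cn.
Proof.
move=> x; apply: eq_from_tnth => j; rewrite tnth_mktuple !mxE /=.
by case: (tnth x j).
Qed.

(** The sigma-algebra is transported along the bijection [to_Cn]; that continuous functions are
    measurable for it is the content of [measurable_continuous]. *)
Definition measurable_Cn : set (set (Cn R n)) :=
  [set A | measurable (@to_Cn R n @^-1` A)].

Let measurable_Cn0 : measurable_Cn set0.
Proof. by rewrite /measurable_Cn /= preimage_set0. Qed.

Let measurable_CnC A : measurable_Cn A -> measurable_Cn (~` A).
Proof. by rewrite /measurable_Cn /= => mA; rewrite preimage_setC; exact: measurableC. Qed.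

Let measurable_Cn_bigcup (F : (set (Cn R n))^nat) :
  (forall i, measurable_Cn (F i)) -> measurable_Cn (\bigcup_i F i).
Proof.
move=> mF; rewrite /measurable_Cn /= preimage_bigcup.
by apply: bigcup_measurable => k _; exact: mF.
Qed.

(** Sealed by [Qed], so that this display is not identified with that of another measurable
    structure. *)
Definition Cn_display : measure_display. Proof. exact: default_measure_display. Qed.

HB.instance Definition _ := @isMeasurable.Build Cn_display (Cn R n)
  measurable_Cn measurable_Cn0 measurable_CnC measurable_Cn_bigcup.

Lemma measurable_to_Cn : measurable_fun setT (@to_Cn R n : X -> Cn R n).
Proof. by move=> _ A mA; rewrite setTI; exact: mA. Qed.

Lemma measurable_of_Cn : measurable_fun setT (of_Cn : Cn R n -> X).
Proof.
move=> _ A mA; rewrite setTI /measurable /= /measurable_Cn /=.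
rewrite -comp_preimage (_ : _ \o _ = id) ?preimage_id//.
by apply/funext => x /=; rewrite to_CnK.
Qed.

Lemma measurable_CnE d (T : measurableType d) (f : Cn R n -> T) :
  measurable_fun setT f <-> measurable_fun setT (f \o @to_Cn R n : X -> T).
Proof.
split=> mf; first exact: measurableT_comp mf measurable_to_Cn.
rewrite (_ : f = (f \o @to_Cn R n) \o of_Cn); first exact: measurableT_comp mf measurable_of_Cn.
by apply/funext => z /=; rewrite of_CnK.
Qed.

Lemma measurable_to_CnP d (T : measurableType d) (g : T -> Cn R n) :
  (forall j, measurable_fun setT (fun x => complex.Re (g x ord0 j))) ->
  (forall j, measurable_fun setT (fun x => complex.Im (g x ord0 j))) ->
  measurable_fun setT g.
Proof.
move=> mR mI; rewrite (_ : g = @to_Cn R n \o (of_Cn \o g)); last first.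
  by apply/funext => z /=; rewrite of_CnK.
apply: (measurableT_comp measurable_to_Cn).
apply/measurable_fun_tnthP => j.
rewrite (_ : _ \o _ = (fun x => (complex.Re (g x ord0 j), complex.Im (g x ord0 j)))); last first.
  by apply/funext => x /=; rewrite tnth_mktuple.
by apply/measurable_fun_pair => /=; [exact: mR|exact: mI].
Qed.

Lemma measurable_coord_Re j : measurable_fun setT (fun z : Cn R n => complex.Re (z ord0 j)).
Proof.
apply/measurable_CnE; rewrite (_ : _ \o _ = fun x : X => (tnth x j).1); last first.
  by apply/funext => x; rewrite /= mxE.
exact: (measurableT_comp measurable_fst (measurable_tnth j)).
Qed.

Lemma measurable_coord_Im j : measurable_fun setT (fun z : Cn R n => complex.Im (z ord0 j)).
Proof.
apply/measurable_CnE; rewrite (_ : _ \o _ = fun x : X => (tnth x j).2); last first.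
  by apply/funext => x; rewrite /= mxE.
exact: (measurableT_comp measurable_snd (measurable_tnth j)).
Qed.

(** Lebesgue measure carried from tuples of real pairs to vectors, so that translations, rotations
    and convolutions can be written with the vector operations of C^n. *)
Definition lebC0 : set (Cn R n) -> \bar R :=
  pushforward (@lebesgue_Cn R n) (@to_Cn R n : X -> Cn R n).

Let lebC00 : lebC0 set0 = 0%E.
Proof. by rewrite /lebC0 /pushforward preimage_set0 measure0. Qed.
Let lebC0_ge0 A : (0 <= lebC0 A)%E. Proof. by rewrite /lebC0 /pushforward. Qed.
Let lebC0_sigma : semi_sigma_additive lebC0.
Proof.
move=> F mF tF mUF; rewrite /lebC0 /pushforward preimage_bigcup.
apply: measure_semi_sigma_additive.
- by move=> k; exact: mF.
- apply/trivIsetP => /= i j _ _ ij; rewrite -preimage_setI.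
  by move/trivIsetP : tF => /(_ _ _ _ _ ij) ->//; rewrite preimage_set0.
- by rewrite -preimage_bigcup; exact: mUF.
Qed.
HB.instance Definition _ := isMeasure.Build _ _ _ lebC0 lebC00 lebC0_ge0 lebC0_sigma.

Let lebC0_sigma_finite : sigma_finite setT lebC0.
Proof.
have [F TF mF] := sigma_finiteT (@lebesgue_Cn R n).
exists (fun k => of_Cn @^-1` F k).
  by rewrite -preimage_bigcup -TF preimage_setT.
move=> k; have [mFk Fkoo] := mF k; split.
  by rewrite -[X in measurable X]setTI; exact: measurable_of_Cn.
rewrite /lebC0 /pushforward.
suff -> : @to_Cn R n @^-1` (of_Cn @^-1` F k) = F k by [].
by apply/seteqP; split => x /=; rewrite to_CnK.
Qed.
HB.instance Definition _ := @Measure_isSigmaFinite.Build _ _ _ lebC0 lebC0_sigma_finite.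

Definition lebC : {sigma_finite_measure set (Cn R n) -> \bar R} := lebC0.

Lemma ge0_integral_lebC (f : Cn R n -> \bar R) : measurable_fun setT f ->
  (forall x, 0 <= f x)%E ->
  (\int[lebC]_z f z = \int[@lebesgue_Cn R n]_x f (to_Cn x))%E.
Proof.
move=> mf f0; rewrite ge0_integral_pushforward ?preimage_setT//.
exact: measurable_to_Cn.
Qed.

End MeasurableCn.

(** * Countable measurable partitions of C^n into small cells *)

Section Discretization.
Context {R : realType} {n : nat}.
Local Notation Re := (@complex.Re R).
Local Notation Im := (@complex.Im R).

(** The cells of a cubic grid, numbered by [pickle] applied to the integer parts of the rescaled
    coordinates. They serve twice: for the measurability of continuous functions, and for
    approximating integrals of function-valued maps by finite sums. *)
Lemma exists_discretization (d : R) : 0 < d ->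
  exists (m : Cn R n -> nat) (r : nat -> Cn R n),
    (forall i, measurable (m @^-1` [set i])) /\
    forall z, sqnorm (z - r (m z)) <= d.
Proof.
(* There are [2 n] real coordinates, each rounded with a squared error of at most [N ^- 2]; the
   extra 1 keeps [N] positive in dimension 0. *)
move=> d0; pose N : R := Num.sqrt ((2 * n%:R + 1) / d).
have N2 : N ^+ 2 = (2 * n%:R + 1) / d.
  by rewrite sqr_sqrtr// divr_ge0 ?ltW// addr_ge0// mulr_ge0.
have N0 : 0 < N by rewrite sqrtr_gt0 divr_gt0// ltr_wpDl// mulr_ge0.
pose c (z : Cn R n) : {ffun 'I_n -> int * int} :=
  [ffun j => (Num.floor (N * Re (z ord0 j)), Num.floor (N * Im (z ord0 j)))].
pose r i : Cn R n := if unpickle i is Some c' then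
  \row_j ((((c' : {ffun 'I_n -> int * int}) j).1%:~R / N) +i* ((c' j).2%:~R / N))%C else 0.
exists (fun z => pickle (c z)), r; split=> [i|z].
  case E : (pickle_inv i : option {ffun 'I_n -> int * int}) => [c'|]; last first.
    rewrite (_ : _ @^-1` _ = set0) ?measurable0//.
    by apply/seteqP; split=> // z /= zi; move: E; rewrite -zi pickleK_inv.
  have [ci|ci] := eqVneq (pickle c') i; last first.
    rewrite (_ : _ @^-1` _ = set0) ?measurable0//.
    apply/seteqP; split=> // z /= zi; move: E; rewrite -zi pickleK_inv => -[cz].
    by rewrite -zi cz eqxx in ci.
  rewrite (_ : _ @^-1` _ = \bigcap_(j in [set: 'I_n])
      (((fun z : Cn R n => N * Re (z ord0 j)) @^-1` `[(c' j).1%:~R, ((c' j).1 + 1)%:~R[) `&`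
      ((fun z : Cn R n => N * Im (z ord0 j)) @^-1` `[(c' j).2%:~R, ((c' j).2 + 1)%:~R[))); last first.
    apply/seteqP; split=> z /=.
      rewrite -ci => /(pcan_inj pickleK) <- j _; rewrite ffunE /= !in_itv /=.
      by split; exact: floor_itv.
    move=> h; rewrite -ci; congr pickle; apply/ffunP => j; rewrite ffunE.
    have [] := h j Logic.I; rewrite /= !in_itv /= => /floor_def -> /floor_def ->.
    by case: (c' j).
  apply: fin_bigcap_measurable => // j _; apply: measurableI.
    rewrite -[X in measurable X]setTI; apply: measurable_funM => //.
    exact: measurable_coord_Re.
  rewrite -[X in measurable X]setTI; apply: measurable_funM => //.
  exact: measurable_coord_Im.
have key (x : R) : (x - (Num.floor (N * x))%:~R / N) ^+ 2 <= N ^- 2.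
  have /andP[h1 h2] := floor_itv (N * x).
  rewrite -exprVn ler_pXn2r ?nnegrE ?invr_ge0 ?(ltW N0)//.
    rewrite lerBlDl -[X in _ + X]mul1r -mulrDl ler_pdivlMr// [x * N]mulrC.
    by move/ltW : h2; rewrite intrD.
  by rewrite subr_ge0 ler_pdivrMr// [x * N]mulrC.
have -> : d = (2 * n%:R + 1) * N ^- 2.
  by rewrite N2 invf_div mulrC mulfVK// gt_eqF// ltr_wpDl// mulr_ge0.
apply: (@le_trans _ _ (\sum_(j < n) 2 * N ^- 2)).
  apply: ler_sum => j _; rewrite /r pickleK sqr_normc_def !mxE ReD ImD ReN ImN /= ffunE /=.
  by rewrite mulrDl mul1r lerD.
rewrite sumr_const card_ord -[X in X <= _]mulr_natr mulrAC ler_wpM2r ?lerDl//.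
by rewrite invr_ge0 exprn_ge0// ltW.
Qed.

Lemma measurable_discretized d (T : measurableType d) (m : T -> nat)
    d' (T' : measurableType d') (f : nat -> T') :
  (forall i, measurable (m @^-1` [set i])) ->
  measurable_fun setT (fun z => f (m z)).
Proof.
move=> mm _ B mB; rewrite setTI.
rewrite (_ : _ @^-1` _ = \bigcup_(i in [set i | B (f i)]) (m @^-1` [set i])); last first.
  apply/seteqP; split=> z /=; first by move=> h; exists (m z).
  by case=> i /= h ->.
by apply: bigcup_measurable => i _; exact: mm.
Qed.

(** A continuous function is the pointwise limit of its values at the representatives of finer and
    finer cells, and each of these approximations takes countably many values on measurable
    cells. *)
Lemma measurable_continuous (f : Cn R n -> R) :
  (forall z e, 0 < e -> exists2 d : R, 0 < d &
     forall w, sqnorm (w - z) < d -> `|f w - f z| < e) ->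
  measurable_fun setT f.
Proof.
move=> cf.
have H (k : nat) : 0 < k.+1%:R^-1 :> R by rewrite invr_gt0.
pose m k := projT1 (cid (exists_discretization (H k))).
pose r k := projT1 (cid (projT2 (cid (exists_discretization (H k))))).
have mr k : (forall i, measurable (m k @^-1` [set i])) /\
    forall z, sqnorm (z - r k (m k z)) <= k.+1%:R^-1.
  exact: (projT2 (cid (projT2 (cid (exists_discretization (H k)))))).
apply: (@measurable_fun_cvg _ _ _ _ (fun k z => f (r k (m k z)))).
  by move=> k; apply: (@measurable_discretized _ _ (m k) _ _ (fun i => f (r k i))); case: (mr k).
move=> z _; apply/cvgrPdist_lt => e e0.
have [d d0 hd] := cf z e e0.
near=> k; rewrite distrC; apply: hd; rewrite sqnormBC.
apply: le_lt_trans (proj2 (mr k) z) _.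
by near: k; exact: near_infty_natSinv_lt (PosNum d0).
Unshelve. all: by end_near. Qed.

End Discretization.

(** * Complex-valued measurable functions and their integrals *)

Section ComplexMeasurable.
Context {R : realType} d (T : measurableType d).
Implicit Types (f g : T -> C R).
Local Notation Re := (@complex.Re R).
Local Notation Im := (@complex.Im R).

Definition cmfun f : Prop :=
  measurable_fun setT (fun x => Re (f x)) /\ measurable_fun setT (fun x => Im (f x)).

Lemma cmfun_ext f g : f =1 g -> cmfun f -> cmfun g.
Proof. by move=> /funext ->. Qed.

Lemma cmfun_cst (c : C R) : cmfun (fun=> c).
Proof. by split; exact: measurable_cst. Qed.

Lemma cmfunD f g : cmfun f -> cmfun g -> cmfun (fun x => f x + g x).
Proof.
move=> [f1 f2] [g1 g2]; split.
  by under eq_fun do rewrite ReD; exact: measurable_funD.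
by under eq_fun do rewrite ImD; exact: measurable_funD.
Qed.

Lemma cmfunM f g : cmfun f -> cmfun g -> cmfun (fun x => f x * g x).
Proof.
move=> [f1 f2] [g1 g2]; split.
  by under eq_fun do rewrite ReM; apply: measurable_funB; exact: measurable_funM.
by under eq_fun do rewrite ImM; apply: measurable_funD; exact: measurable_funM.
Qed.

Lemma cmfunN f : cmfun f -> cmfun (fun x => - f x).
Proof.
move=> /(cmfunM (cmfun_cst (-1))); apply: cmfun_ext => x; exact: mulN1r.
Qed.

Lemma cmfunB f g : cmfun f -> cmfun g -> cmfun (fun x => f x - g x).
Proof. by move=> mf /cmfunN; exact: cmfunD. Qed.

Lemma cmfun_conj f : cmfun f -> cmfun (fun x => (f x)^*%C).
Proof.
move=> [f1 f2]; split.
  by rewrite (_ : (fun _ => _) = (fun x => Re (f x)))//; apply/funext => x; case: (f x).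
rewrite (_ : (fun _ => _) = (fun x => - Im (f x))); last by apply/funext => x; case: (f x).
exact: measurable_funN.
Qed.

Lemma cmfun_sum (I : Type) (r : seq I) (F : I -> T -> C R) :
  (forall i, cmfun (F i)) -> cmfun (fun x => \sum_(i <- r) F i x).
Proof.
move=> mF; elim: r => [|i r IH].
  by apply: cmfun_ext (cmfun_cst 0) => x; rewrite big_nil.
by apply: cmfun_ext (cmfunD (mF i) IH) => x; rewrite big_cons.
Qed.

Lemma cmfunR (g : T -> R) : measurable_fun setT g -> cmfun (fun x => (g x)%:C%C).
Proof. by move=> mg; split => //=; exact: measurable_cst. Qed.

Lemma measurable_normc f : cmfun f -> measurable_fun setT (fun x => normc (f x)).
Proof.
move=> [f1 f2]; rewrite (_ : (fun _ => _) =
    (fun x => Num.sqrt (Re (f x) ^+ 2 + Im (f x) ^+ 2))); last first.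
  by apply/funext => x; case: (f x).
apply: measurableT_comp; first exact: (continuous_measurable_fun (@sqrt_continuous R)).
by apply: measurable_funD; exact: measurable_funX.
Qed.

Lemma cmfun_cexp f : cmfun f -> cmfun (fun x => cexp (f x)).
Proof.
move=> [f1 f2]; split; apply: measurable_funM => /=.
- exact: measurableT_comp f1.
- by apply: measurableT_comp f2; exact: (continuous_measurable_fun (@continuous_cos R)).
- exact: measurableT_comp f1.
- by apply: measurableT_comp f2; exact: (continuous_measurable_fun (@continuous_sin R)).
Qed.

Lemma cmfun_comp d' (T' : measurableType d') (h : T' -> T) f :
  measurable_fun setT h -> cmfun f ->
  measurable_fun setT (fun x => Re (f (h x))) /\ measurable_fun setT (fun x => Im (f (h x))).
Proof.
move=> mh [f1 f2]; split; first exact: (measurableT_comp f1 mh).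
exact: (measurableT_comp f2 mh).
Qed.

End ComplexMeasurable.
Arguments cmfun_cst {R d T} c.

Definition ccvg {R : realType} (u : nat -> C R) (l : C R) : Prop :=
  forall e : R, 0 < e -> exists K : nat, forall k, (K <= k)%N -> normc (u k - l) < e.

Section ccvg.
Context {R : realType}.
Implicit Types (u : nat -> C R) (l : C R).
Local Notation Re := (@complex.Re R).
Local Notation Im := (@complex.Im R).

Lemma ccvg_Re u l : ccvg u l -> (fun k => Re (u k)) @ \oo --> Re l.
Proof.
move=> h; apply/cvgrPdist_lt => e e0; have [K hK] := h e e0.
exists K => // k /= /hK; rewrite normc_distC; apply: le_lt_trans.
by rewrite -ReB le_Re_normc.
Qed.

Lemma ccvg_Im u l : ccvg u l -> (fun k => Im (u k)) @ \oo --> Im l.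
Proof.
move=> h; apply/cvgrPdist_lt => e e0; have [K hK] := h e e0.
exists K => // k /= /hK; rewrite normc_distC; apply: le_lt_trans.
by rewrite -ImB le_Im_normc.
Qed.

Lemma ccvg_ReIm u l : (fun k => Re (u k)) @ \oo --> Re l ->
  (fun k => Im (u k)) @ \oo --> Im l -> ccvg u l.
Proof.
move=> /cvgrPdist_lt h1 /cvgrPdist_lt h2 e e0.
have e2 : 0 < e / 2 by rewrite divr_gt0.
have [K1 _ hK1] := h1 _ e2; have [K2 _ hK2] := h2 _ e2.
exists (maxn K1 K2) => k; rewrite geq_max => /andP[k1 k2].
apply: le_lt_trans (normc_le_ReIm _) _; rewrite [ltRHS]splitr ReB ImB ltrD//.
  by rewrite distrC; exact: hK1.
by rewrite distrC; exact: hK2.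
Qed.

Lemma ccvg_unique u l l' : ccvg u l -> ccvg u l' -> l = l'.
Proof.
move=> h h'; apply: complex_eqP.
  by rewrite -(cvg_lim (@norm_hausdorff _ _) (ccvg_Re h)) -(cvg_lim (@norm_hausdorff _ _) (ccvg_Re h')).
by rewrite -(cvg_lim (@norm_hausdorff _ _) (ccvg_Im h)) -(cvg_lim (@norm_hausdorff _ _) (ccvg_Im h')).
Qed.

End ccvg.

Lemma cmfun_cvg {R : realType} d (T : measurableType d) (F : nat -> T -> C R) (f : T -> C R) :
  (forall k, cmfun (F k)) -> (forall x, ccvg (F ^~ x) (f x)) -> cmfun f.
Proof.
move=> mF h; split.
  apply: (@measurable_fun_cvg _ _ _ _ (fun k x => complex.Re (F k x))) => [k|x _].
    by case: (mF k).
  exact: ccvg_Re (h x).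
apply: (@measurable_fun_cvg _ _ _ _ (fun k x => complex.Im (F k x))) => [k|x _].
  by case: (mF k).
exact: ccvg_Im (h x).
Qed.

Lemma cmfun_continuous {R : realType} {n} (f : Cn R n -> C R) : continuous f -> cmfun f.
Proof.
move=> cf; split; apply: measurable_continuous => z e e0;
  have [d d0 hd] := (continuous_epsP f z).1 (cf z) e e0; exists d => // w /hd;
  apply: le_lt_trans.
  by rewrite -ReB le_Re_normc.
by rewrite -ImB le_Im_normc.
Qed.

Section ComplexIntegral.
Context {R : realType} d (T : measurableType d) (mu : {measure set T -> \bar R}).
Implicit Types (f g : T -> C R).
Local Notation Re := (@complex.Re R).
Local Notation Im := (@complex.Im R).

Definition cL1 f : Prop := cmfun f /\ (\int[mu]_x (normc (f x))%:E < +oo)%E.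

(** A total function: an infinite component integral is sent to 0 by [fine], hence the recurring
    side conditions [cL1]. *)
Definition cint f : C R :=
  ((\int[mu]_x Re (f x))%R +i* (\int[mu]_x Im (f x))%R)%C.

Lemma eq_cint f g : f =1 g -> cint f = cint g.
Proof. by move=> /funext ->. Qed.

Lemma cL1_ext f g : f =1 g -> cL1 f -> cL1 g.
Proof. by move=> /funext ->. Qed.

Lemma le_ge0_integral (g h : T -> R) : measurable_fun setT g -> measurable_fun setT h ->
  (forall x, 0 <= g x) -> (forall x, g x <= h x) ->
  (\int[mu]_x (g x)%:E <= \int[mu]_x (h x)%:E)%E.
Proof.
move=> mg mh g0 gh; apply: ge0_le_integral => //=.
- by move=> x _; rewrite lee_fin.
- exact/measurable_EFinP.
- exact/measurable_EFinP.
- by move=> x _; rewrite lee_fin.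
Qed.

Lemma cL1_dom f (g : T -> R) : cmfun f -> measurable_fun setT g ->
  (forall x, normc (f x) <= g x) -> (\int[mu]_x (g x)%:E < +oo)%E -> cL1 f.
Proof.
move=> mf mg fg gfin; split => //; apply: le_lt_trans gfin.
by apply: le_ge0_integral => // [|x]; [exact: measurable_normc|exact: normc_ge0].
Qed.

Lemma cL1_Re f : cL1 f -> mu.-integrable setT (EFin \o (fun x => Re (f x))).
Proof.
move=> [[f1 f2] fi]; apply/integrableP; split; first exact/measurable_EFinP.
apply: le_lt_trans fi => /=; apply: le_ge0_integral => //.
- exact: measurableT_comp f1.
- exact: measurable_normc.
- by move=> x; exact: le_Re_normc.
Qed.

Lemma cL1_Im f : cL1 f -> mu.-integrable setT (EFin \o (fun x => Im (f x))).
Proof.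
move=> [[f1 f2] fi]; apply/integrableP; split; first exact/measurable_EFinP.
apply: le_lt_trans fi => /=; apply: le_ge0_integral => //.
- exact: measurableT_comp f2.
- exact: measurable_normc.
- by move=> x; exact: le_Im_normc.
Qed.

Lemma cL1_normc f : cL1 f -> mu.-integrable setT (EFin \o (fun x => normc (f x))).
Proof.
move=> [mf fi]; apply/integrableP; split.
  by apply/measurable_EFinP; exact: measurable_normc.
by under eq_integral do rewrite /= ger0_norm ?normc_ge0//.
Qed.

Lemma cL1D f g : cL1 f -> cL1 g -> cL1 (fun x => f x + g x).
Proof.
move=> hf hg; apply: (@cL1_dom _ (fun x => normc (f x) + normc (g x))).
- by apply: cmfunD; [case: hf|case: hg].
- by apply: measurable_funD; apply: measurable_normc; [case: hf|case: hg].
- by move=> x; exact: normcD.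
case: hf => mf fi; case: hg => mg gi.
under eq_integral do rewrite EFinD.
rewrite ge0_integralD//.
- by rewrite lte_add_pinfty.
- by move=> x _; rewrite lee_fin normc_ge0.
- by apply/measurable_EFinP; exact: measurable_normc.
- by move=> x _; rewrite lee_fin normc_ge0.
- by apply/measurable_EFinP; exact: measurable_normc.
Qed.

Lemma cL1Z f (c : C R) : cL1 f -> cL1 (fun x => c * f x).
Proof.
move=> [mf fi]; split; first exact: (cmfunM (cmfun_cst c) mf).
under eq_integral do rewrite normcM EFinM.
rewrite ge0_integralZl//.
- by rewrite lte_mul_pinfty// lee_fin normc_ge0.
- by apply/measurable_EFinP; exact: measurable_normc.
- by move=> x _; rewrite lee_fin normc_ge0.
- by rewrite lee_fin normc_ge0.
Qed.

Lemma cL1N f : cL1 f -> cL1 (fun x => - f x).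
Proof. by move=> /(cL1Z (-1)); apply: cL1_ext => x; exact: mulN1r. Qed.

Lemma cL1B f g : cL1 f -> cL1 g -> cL1 (fun x => f x - g x).
Proof. by move=> mf /cL1N; exact: cL1D. Qed.

Lemma cL1_0 : cL1 (fun=> 0).
Proof.
by split; [exact: cmfun_cst|under eq_integral do rewrite normc0; rewrite integral0].
Qed.

Lemma cL1_sum (I : Type) (r : seq I) (F : I -> T -> C R) :
  (forall i, cL1 (F i)) -> cL1 (fun x => \sum_(i <- r) F i x).
Proof.
move=> mF; elim: r => [|i r IH].
  by apply: cL1_ext cL1_0 => x; rewrite big_nil.
by apply: cL1_ext (cL1D (mF i) IH) => x; rewrite big_cons.
Qed.

Lemma cintD f g : cL1 f -> cL1 g -> cint (fun x => f x + g x) = cint f + cint g.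
Proof.
move=> hf hg; apply: complex_eqP; rewrite ?ReD ?ImD /cint /=.
  under eq_Rintegral do rewrite ReD.
  by rewrite RintegralD//; exact: cL1_Re.
under eq_Rintegral do rewrite ImD.
by rewrite RintegralD//; exact: cL1_Im.
Qed.

Lemma cintZ f (c : C R) : cL1 f -> cint (fun x => c * f x) = c * cint f.
Proof.
move=> hf; have h1 := cL1_Re hf; have h2 := cL1_Im hf.
have iZ (g : T -> R) r : mu.-integrable setT (EFin \o g) ->
   mu.-integrable setT (EFin \o (fun x => r * g x)).
  move=> ig; rewrite (_ : _ \o _ = (fun x => r%:E * (EFin \o g) x)%E)//.
  exact: integrableZl.
apply: complex_eqP; rewrite ?ReM ?ImM /cint /=.
  under eq_Rintegral do rewrite ReM.
  by rewrite RintegralB//; [rewrite !RintegralZl|exact: iZ|exact: iZ].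
under eq_Rintegral do rewrite ImM.
by rewrite RintegralD//; [rewrite !RintegralZl|exact: iZ|exact: iZ].
Qed.

Lemma cintN f : cL1 f -> cint (fun x => - f x) = - cint f.
Proof.
by move=> hf; rewrite -mulN1r -cintZ//; apply: eq_cint => x; rewrite mulN1r.
Qed.

Lemma cintB f g : cL1 f -> cL1 g -> cint (fun x => f x - g x) = cint f - cint g.
Proof. by move=> hf hg; rewrite cintD ?cintN//; exact: cL1N. Qed.

Lemma cint0 : cint (fun=> 0) = 0.
Proof. by apply: complex_eqP; rewrite /= Rintegral_cst//= mul0r. Qed.

Lemma cint_sum (I : Type) (r : seq I) (F : I -> T -> C R) : (forall i, cL1 (F i)) ->
  cint (fun x => \sum_(i <- r) F i x) = \sum_(i <- r) cint (F i).
Proof.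
move=> mF; elim: r => [|i r IH].
  by rewrite big_nil -[RHS]cint0; apply: eq_cint => x; rewrite big_nil.
rewrite big_cons -IH -cintD//; last exact: cL1_sum.
by apply: eq_cint => x; rewrite big_cons.
Qed.

Lemma normc_cint_le f : cL1 f -> ((normc (cint f))%:E <= \int[mu]_x (normc (f x))%:E)%E.
Proof.
move=> hf; have [I0|I0] := eqVneq (cint f) 0.
  by rewrite I0 normc0; apply: integral_ge0 => x _; rewrite lee_fin normc_ge0.
(* The unit number that rotates the integral onto the positive half-line; there the integral equals
   that of [Re (u * f x)], which is at most [normc (f x)]. *)
pose u := (cint f)^*%C / (normc (cint f))%:C%C.
have nI : normc (cint f) != 0 by apply: contra_neq I0; exact: normc_eq0.
have nu : normc u = 1 by rewrite normcM realCV normc_conj normcR ger0_norm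
   ?invr_ge0 ?normc_ge0// mulfV.
have -> : normc (cint f) = Re (cint (fun x => u * f x)).
  rewrite cintZ// /u mulrAC [_^*%C * _]mulrC realCV [_ * (_%:C)%C]mulrC mulRC_Re.
  have -> : Re (cint f * (cint f)^*%C) = normc (cint f) ^+ 2.
    by rewrite sqr_normc_def ReM; case: (cint f) => a b /=; ring.
  by rewrite expr2 mulKf.
have huf := cL1Z u hf.
rewrite /= /Rintegral fineK; last by apply: integrable_fin_num => //; exact: cL1_Re.
apply: le_trans (_ : \int[mu]_x (normc (u * f x))%:E <= _)%E.
  apply: le_integral => //; [exact: cL1_Re|exact: cL1_normc|].
  by move=> x _; rewrite lee_fin Re_le_normc.
by under eq_integral do rewrite normcM nu mul1r.
Qed.

Lemma normc_cint_dom f (g : T -> R) : cmfun f -> measurable_fun setT g ->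
  (forall x, normc (f x) <= g x) -> (\int[mu]_x (g x)%:E < +oo)%E ->
  ((normc (cint f))%:E <= \int[mu]_x (g x)%:E)%E.
Proof.
move=> mf mg fg gfin; apply: le_trans (normc_cint_le (cL1_dom mf mg fg gfin)) _.
by apply: le_ge0_integral => // [|x]; [exact: measurable_normc|exact: normc_ge0].
Qed.

Lemma cint_DCT (F : nat -> T -> C R) f (g : T -> R) :
  (forall k, cmfun (F k)) -> measurable_fun setT g -> (\int[mu]_x (g x)%:E < +oo)%E ->
  (forall k x, normc (F k x) <= g x) -> (forall x, ccvg (F ^~ x) (f x)) ->
  ccvg (fun k => cint (F k)) (cint f).
Proof.
move=> mF mg gfin Fg Ff; have mf := cmfun_cvg mF Ff.
have g0 x : 0 <= g x := le_trans (normc_ge0 _) (Fg 0%N x).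
have ig : mu.-integrable setT (EFin \o g).
  apply/integrableP; split; first exact/measurable_EFinP.
  by under eq_integral do rewrite /= ger0_norm//.
have key (p : C R -> R) : (forall k, measurable_fun setT (fun x => p (F k x))) ->
   measurable_fun setT (fun x => p (f x)) -> (forall z, `|p z| <= normc z) ->
   (forall x, (fun k => p (F k x)) @ \oo --> p (f x)) ->
   (fun k => \int[mu]_x p (F k x))%R @ \oo --> (\int[mu]_x p (f x))%R.
  move=> mpF mpf pn pc.
  have [] := @dominated_convergence _ _ _ mu setT measurableT (fun k x => (p (F k x))%:E)
     (fun x => (p (f x))%:E) (EFin \o g).
  - by move=> k; exact/measurable_EFinP.
  - exact/measurable_EFinP.
  - by apply: aeW => x _; apply: cvg_EFin; [exact: nearW|exact: pc].
  - exact: ig.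
  - by apply: aeW => x k _; rewrite /= lee_fin; exact: le_trans (pn _) (Fg _ _).
  move=> if_ _ h; apply: fine_cvg; rewrite fineK//; exact: integrable_fin_num.
apply: ccvg_ReIm; apply: key.
- by move=> k; case: (mF k).
- by case: mf.
- exact: le_Re_normc.
- by move=> x; exact: ccvg_Re.
- by move=> k; case: (mF k).
- by case: mf.
- exact: le_Im_normc.
- by move=> x; exact: ccvg_Im.
Qed.

End ComplexIntegral.

Arguments cint : simpl never.

(** * Transformations that preserve Lebesgue measure *)

Section MeasurePreserving.
Context {R : realType}.

(** Invariance is stated on integrals of nonnegative functions rather than on sets: this form
    composes directly and passes through Tonelli's theorem. *)
Definition mpres d (T : measurableType d) (mu : {measure set T -> \bar R}) (h : T -> T) : Prop :=
  measurable_fun setT h /\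
  forall f : T -> \bar R, measurable_fun setT f -> (forall x, 0 <= f x)%E ->
    (\int[mu]_x f (h x) = \int[mu]_x f x)%E.

Section Basics.
Context d (T : measurableType d) (mu : {measure set T -> \bar R}).

Lemma mpres_id : mpres mu id. Proof. by split => //; exact: measurable_id. Qed.

Lemma mpres_comp h k : mpres mu h -> mpres mu k -> mpres mu (h \o k).
Proof.
move=> [mh eh] [mk ek]; split; first exact: (measurableT_comp mh mk).
move=> f mf f0 /=; rewrite -(eh f)//.
by apply: (ek (f \o h)) => [|x /=]; [exact: (measurableT_comp mf mh)|exact: f0].
Qed.

Lemma mpres_ext h k : h =1 k -> mpres mu h -> mpres mu k.
Proof. by move=> /funext ->. Qed.

Lemma integral_mpres h (f : T -> \bar R) : mpres mu h -> measurable_fun setT f ->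
  (\int[mu]_x f (h x) = \int[mu]_x f x)%E.
Proof.
move=> [mh eh] mf; rewrite (_ : (fun x => f (h x)) = f \o h)//.
rewrite integralE [RHS]integralE funepos_comp funeneg_comp; congr (_ - _)%E.
  by apply: eh => //; exact: measurable_funepos.
by apply: eh => //; exact: measurable_funeneg.
Qed.

Lemma cint_mpres h (f : T -> C R) : mpres mu h -> cmfun f ->
  cint mu (fun x => f (h x)) = cint mu f.
Proof.
move=> ph [m1 m2]; apply: complex_eqP; rewrite /cint /= /Rintegral; congr fine.
  by apply: (integral_mpres (f := EFin \o (fun x => complex.Re (f x))) ph); exact/measurable_EFinP.
by apply: (integral_mpres (f := EFin \o (fun x => complex.Im (f x))) ph); exact/measurable_EFinP.
Qed.

Lemma cL1_mpres h (f : T -> C R) : mpres mu h -> cL1 mu f -> cL1 mu (fun x => f (h x)).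
Proof.
move=> ph [mf fi]; split; first exact: (cmfun_comp (proj1 ph) mf).
case: ph => mh eh; rewrite (eh (fun x => (normc (f x))%:E))//.
  by apply/measurable_EFinP; exact: measurable_normc.
by move=> x; rewrite lee_fin normc_ge0.
Qed.

End Basics.

(** The image measure agrees with Lebesgue measure on bounded half-open intervals, which determine
    it. *)
Lemma mpres_lebesgue_shift (a : R) :
  mpres (@lebesgue_measure R) (fun x : measurableTypeR R => x + a : measurableTypeR R).
Proof.
have mh : measurable_fun setT (fun x : measurableTypeR R => x + a : measurableTypeR R).
  exact: measurable_funD.
split=> // f mf f0.
pose nu0 : {measure set (measurableTypeR R) -> \bar R} :=
  pushforward (@lebesgue_measure R) (fun x : measurableTypeR R => x + a : measurableTypeR R).
pose nu := nu0 mh.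
have E A : measurable A -> lebesgue_measure A = nu A.
  apply: lebesgue_measure_unique => X [[u v] _ <-].
  rewrite /nu /= /pushforward.
  rewrite (_ : _ @^-1` _ = [set` `]u - a, v - a]]); last first.
    by apply/seteqP; split => x /=; rewrite !in_itv /= ltrBlDr lerBrDr.
  rewrite !lebesgue_measure_itv /= !lte_fin ltrD2r.
  by case: ifP => // _; rewrite -!EFinB opprB addrA subrK.
rewrite [RHS](eq_measure_integral nu) => [|A mA _]; last exact: E mA.
by rewrite [RHS](ge0_integral_pushforward mh) ?preimage_setT.
Qed.

End MeasurePreserving.

Section ProductPreserving.
Context {R : realType} d1 d2 (T1 : measurableType d1) (T2 : measurableType d2).
Variables (m1 : {sigma_finite_measure set T1 -> \bar R})
          (m2 : {sigma_finite_measure set T2 -> \bar R}).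
Local Open Scope ereal_scope.

(** By Tonelli, a map that moves one coordinate only preserves the product measure as soon as it
    does so on each slice. Shears and translations of the plane are of this kind. *)
Lemma mpres_prod_l (h : T2 -> T1 -> T1) :
  measurable_fun setT (fun p : T1 * T2 => (h p.2 p.1, p.2)) ->
  (forall y, mpres m1 (h y)) -> mpres (m1 \x m2) (fun p => (h p.2 p.1, p.2)).
Proof.
move=> mh hp; split=> // f mf f0.
have mfh := measurableT_comp mf mh.
have f0h x : 0 <= (f \o (fun p : T1 * T2 => (h p.2 p.1, p.2))) x by exact: f0.
rewrite (fubini_tonelli1 (f \o (fun p : T1 * T2 => (h p.2 p.1, p.2))) mfh f0h).
rewrite (fubini_tonelli1 f mf f0).
rewrite /fubini_F (fubini_tonelli (f \o (fun p : T1 * T2 => (h p.2 p.1, p.2))) mfh f0h).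
rewrite (fubini_tonelli f mf f0).
apply: eq_integral => y _ /=; apply: (proj2 (hp y) (fun x => f (x, y))) => [|x]; last exact: f0.
exact: (measurableT_comp mf (measurable_pair2 y)).
Qed.

Lemma mpres_prod_r (h : T1 -> T2 -> T2) :
  measurable_fun setT (fun p : T1 * T2 => (p.1, h p.1 p.2)) ->
  (forall y, mpres m2 (h y)) -> mpres (m1 \x m2) (fun p => (p.1, h p.1 p.2)).
Proof.
move=> mh hp; split=> // f mf f0.
have mfh := measurableT_comp mf mh.
have f0h x : 0 <= (f \o (fun p : T1 * T2 => (p.1, h p.1 p.2))) x by exact: f0.
rewrite (fubini_tonelli1 (f \o (fun p : T1 * T2 => (p.1, h p.1 p.2))) mfh f0h).
rewrite (fubini_tonelli1 f mf f0).
apply: eq_integral => x _ /=; apply: (proj2 (hp x) (fun y => f (x, y))) => [|y]; last exact: f0.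
exact: (measurableT_comp mf (measurable_pair1 x)).
Qed.

End ProductPreserving.

Section InvarianceR2.
Context {R : realType}.
Local Notation mR := (measurableTypeR R).

Lemma mpres_shear1 (k : R) : mpres (@lebesgue_R2 R) (fun p : R2 R => (p.1 + k * p.2, p.2) : R2 R).
Proof.
have mh : measurable_fun setT (fun p : mR * mR => (p.1 + k * p.2, p.2) : mR * mR).
  apply/measurable_fun_pair => /=; last exact: measurable_snd.
  by apply: measurable_funD; [exact: measurable_fst|apply: measurable_funM => //; exact: measurable_snd].
apply: (@mpres_prod_l _ _ _ _ _ (@lebesgue_measure R) (@lebesgue_measure R) (fun y x => x + k * y)) => //.
by move=> y; exact: mpres_lebesgue_shift.
Qed.

Lemma mpres_shear2 (k : R) : mpres (@lebesgue_R2 R) (fun p : R2 R => (p.1, p.2 + k * p.1) : R2 R).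
Proof.
have mh : measurable_fun setT (fun p : mR * mR => (p.1, p.2 + k * p.1) : mR * mR).
  apply/measurable_fun_pair => /=; first exact: measurable_fst.
  by apply: measurable_funD; [exact: measurable_snd|apply: measurable_funM => //; exact: measurable_fst].
apply: (@mpres_prod_r _ _ _ _ _ (@lebesgue_measure R) (@lebesgue_measure R) (fun x y => y + k * x)) => //.
by move=> y; exact: mpres_lebesgue_shift.
Qed.

Lemma mpres_R2_shift (a b : R) :
  mpres (@lebesgue_R2 R) (fun p : R2 R => (p.1 + a, p.2 + b) : R2 R).
Proof.
have m1 : mpres (@lebesgue_R2 R) (fun p : R2 R => (p.1 + a, p.2) : R2 R).
  apply: (@mpres_prod_l _ _ _ _ _ (@lebesgue_measure R) (@lebesgue_measure R) (fun y x => x + a)) => //.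
    apply/measurable_fun_pair => /=; last exact: measurable_snd.
    by apply: measurable_funD; [exact: measurable_fst|exact: measurable_cst].
  by move=> y; exact: mpres_lebesgue_shift.
have m2 : mpres (@lebesgue_R2 R) (fun p : R2 R => (p.1, p.2 + b) : R2 R).
  apply: (@mpres_prod_r _ _ _ _ _ (@lebesgue_measure R) (@lebesgue_measure R) (fun x y => y + b)) => //.
    apply/measurable_fun_pair => /=; first exact: measurable_fst.
    by apply: measurable_funD; [exact: measurable_snd|exact: measurable_cst].
  by move=> y; exact: mpres_lebesgue_shift.
exact: mpres_comp m1 m2.
Qed.

(* A rotation is a product of three shears, unless its angle is [pi]. *)
Lemma mpres_R2_rot (a b : R) : a ^+ 2 + b ^+ 2 = 1 ->
  mpres (@lebesgue_R2 R) (fun p : R2 R => (a * p.1 - b * p.2, a * p.2 + b * p.1) : R2 R).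
Proof.
have gen (u v : R) : u != -1 -> u ^+ 2 + v ^+ 2 = 1 ->
    mpres (@lebesgue_R2 R) (fun p : R2 R => (u * p.1 - v * p.2, u * p.2 + v * p.1) : R2 R).
  move=> u1 uv; have u0 : 1 + u != 0 by apply: contra_neq u1 => h; lra.
  (* Minus the tangent of half the rotation angle, [u] and [v] being its cosine and sine. *)
  pose k := - (v / (1 + u)).
  have kv : k * v = u - 1.
    rewrite /k mulNr mulrAC -expr2 (_ : v ^+ 2 = (1 - u) * (1 + u)); last first.
      by rewrite -[LHS](addKr (u ^+ 2)) uv; ring.
    by rewrite mulfK// opprB.
  have ku : k * (1 + u) = - v by rewrite /k mulNr mulfVK.
  apply: mpres_ext (mpres_comp (mpres_shear1 k) (mpres_comp (mpres_shear2 v) (mpres_shear1 k))).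
  move=> [x y] /=; congr pair.
    rewrite (_ : _ + _ = x + (k * v) * x + (k + k + k * (k * v)) * y); last by ring.
    rewrite kv (_ : k + k + k * (u - 1) = k * (1 + u)); last by ring.
    by rewrite ku; ring.
  rewrite (_ : _ + _ = y + v * x + (k * v) * y); last by ring.
  by rewrite kv; ring.
move=> ab; have [a1|a1] := eqVneq a (-1); last exact: gen.
have b0 : b = 0 by apply/eqP; rewrite -sqrf_eq0; apply/eqP; move: ab; rewrite a1; lra.
(* The half-turn is a quarter-turn applied twice. *)
have g := @gen 0 1; apply: mpres_ext (mpres_comp (g _ _) (g _ _)).
- by move=> [x y] /=; rewrite a1 b0; congr pair; ring.
- by rewrite eq_sym oppr_eq0 oner_eq0.
- by rewrite expr0n expr1n add0r.
- by rewrite eq_sym oppr_eq0 oner_eq0.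
- by rewrite expr0n expr1n add0r.
Qed.

End InvarianceR2.

Section Density.
Local Open Scope ereal_scope.
Context {R : realType} d (T : measurableType d).
Variables (mu nu : {measure set T -> \bar R}) (rho : T -> R).
Hypothesis mrho : measurable_fun setT rho.
Hypothesis rho0 : forall x, (0 <= rho x)%R.
Hypothesis nuE : forall A, measurable A -> nu A = \int[mu]_(x in A) (rho x)%:E.

Import HBNNSimple.

Let mErho : measurable_fun setT (fun x => (rho x)%:E). Proof. exact/measurable_EFinP. Qed.

Let density_nnsfun (h : {nnsfun T >-> R}) :
  \int[nu]_x (h x)%:E = \int[mu]_x ((rho x)%:E * (h x)%:E).
Proof.
have mind r : measurable_fun setT (fun x : T => (r * \1_(h @^-1` [set r]) x)%:E).
  by apply/measurable_EFinP; exact: measurable_funM.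
have t0 (y : R) (x : T) : 0 <= (y * \1_(h @^-1` [set y]) x)%:E.
  by rewrite EFinM; exact: nnfun_muleindic_ge0.
rewrite [RHS](eq_integral (fun x => \sum_(y \in range h)
    ((y * \1_(h @^-1` [set y]) x)%:E * (rho x)%:E))); last first.
  move=> x _; rewrite -ge0_mule_fsuml => [|y]; last exact: t0.
  by rewrite muleC fsumEFin// -(fimfunE _ x).
rewrite [LHS](eq_integral (fun x => \sum_(y \in range h)
    (y * \1_(h @^-1` [set y]) x)%:E)); last first.
  by move=> x _; rewrite fimfunE -fsumEFin.
rewrite ge0_integral_fsum//.
rewrite ge0_integral_fsum//; last 2 first.
- by move=> y; exact: emeasurable_funM.
- by move=> y x _; rewrite mule_ge0 ?t0 ?lee_fin.
apply: eq_fsbigr => r; rewrite inE => -[t _ rt].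
have r0 : (0 <= r)%R by rewrite -rt.
under eq_integral do rewrite EFinM.
rewrite integralZl_indic_nnsfun// integral_indic// setIT nuE//.
under [RHS]eq_integral do rewrite EFinM -muleA.
rewrite ge0_integralZl//.
- congr (_ * _); rewrite integral_mkcond; apply: eq_integral => x _.
  by rewrite epatch_indic/= muleC.
- by apply: emeasurable_funM => //; exact/measurable_EFinP.
- by move=> x _; rewrite mule_ge0 ?lee_fin.
Qed.

(** [nu] is known only through its values on sets, as [gauss] is. Simple functions come first, then
    monotone convergence along [nnsfun_approx]. *)
Lemma ge0_integral_density (f : T -> \bar R) : measurable_fun setT f ->
  (forall x, 0 <= f x) -> \int[nu]_x f x = \int[mu]_x ((rho x)%:E * f x).
Proof.
move=> mf f0; pose h := nnsfun_approx measurableT mf.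
have hf x : (fun n => (h n x)%:E) @ \oo --> f x by exact: cvg_nnsfun_approx.
have hnd x : {homo (fun n => h n x) : a b / (a <= b)%N >-> (a <= b)%R}.
  by move=> a b ab; exact/lefP/nd_nnsfun_approx.
have mh n : measurable_fun setT (fun x => (h n x)%:E).
  by apply/measurable_EFinP.
rewrite (eq_integral (fun x => limn (fun n => (h n x)%:E))) => [|x _]; last first.
  exact/esym/cvg_lim/hf.
rewrite [RHS](eq_integral (fun x => limn (fun n => (rho x)%:E * (h n x)%:E))) => [|x _]; last first.
  by apply/esym/cvg_lim => //; apply: cvgeZl => //; exact: hf.
rewrite monotone_convergence//; last 2 first.
- by move=> n x _; rewrite lee_fin.
- by move=> x _ a b ab; rewrite lee_fin; exact: hnd.
rewrite monotone_convergence//; last 3 first.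
- by move=> n; exact: emeasurable_funM.
- by move=> n x _; rewrite mule_ge0 ?lee_fin.
- by move=> x _ a b ab; rewrite lee_wpmul2l ?lee_fin//; exact: hnd.
by congr (limn _); apply/funext => n; exact: density_nnsfun.
Qed.

Lemma cint_density (f : T -> C R) : cmfun f ->
  cint nu f = cint mu (fun x => (rho x)%:C%C * f x)%R.
Proof.
have key (g : T -> R) : measurable_fun setT g ->
    \int[nu]_x (g x)%:E = \int[mu]_x (rho x * g x)%:E.
  move=> mg; have mEg : measurable_fun setT (EFin \o g) by exact/measurable_EFinP.
  rewrite integralE [RHS]integralE; congr (_ - _).
    rewrite ge0_integral_density//; last exact: measurable_funepos.
    apply: eq_integral => x _; rewrite !funeposE /= EFinM -[0 in RHS](mule0 (rho x)%:E).
    by rewrite maxe_pMr ?lee_fin.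
  rewrite ge0_integral_density//; last exact: measurable_funeneg.
  apply: eq_integral => x _; rewrite !funenegE /= -mulrN EFinM -[0 in RHS](mule0 (rho x)%:E).
  by rewrite maxe_pMr ?lee_fin.
move=> [m1 m2]; apply: complex_eqP; rewrite /cint /= /Rintegral; congr fine; rewrite key//.
  by apply: eq_integral => x _; rewrite mulRC_Re.
by apply: eq_integral => x _; rewrite mulRC_Im.
Qed.

End Density.

Section InvarianceCn.
Context {R : realType}.
Local Notation X n := (n.-tuple (R2 R)).

Lemma ge0_integral_tcons n (f : X n.+1 -> \bar R) : measurable_fun setT f ->
  (forall x, 0 <= f x)%E ->
  (\int[lebesgue_Cn n.+1]_x f x =
   \int[@lebesgue_R2 R]_a \int[lebesgue_Cn n]_x f (tcons (a, x)))%E.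
Proof.
move=> mf f0.
have mft := measurableT_comp mf (@measurable_tcons R n).
transitivity (\int[(@lebesgue_R2 R \x lebesgue_Cn n)%E]_p f (tcons p))%E; last first.
  by rewrite (fubini_tonelli1 (f \o @tcons R n))// => x; exact: f0.
have := @ge0_integral_pushforward _ _ _ _ R _ (@measurable_tcons R n)
  (@lebesgue_R2 R \x lebesgue_Cn n)%E setT f measurableT mf.
by rewrite preimage_setT; apply => x _; exact: f0.
Qed.

(** Induction on the number of coordinates, peeling off one plane with [ge0_integral_tcons]; the
    invariance of Lebesgue measure on C^n is thereby reduced to the plane. *)
Lemma mpres_tuple n (H : 'I_n -> R2 R -> R2 R) :
  (forall j, mpres (@lebesgue_R2 R) (H j)) ->
  mpres (@lebesgue_Cn R n) (fun x : X n => [tuple H j (tnth x j) | j < n]).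
Proof.
elim: n H => [|n IH] H hH.
  by apply: mpres_ext (@mpres_id _ _ _ _) => x; rewrite [RHS]tuple0 [LHS]tuple0.
have mh : measurable_fun setT (fun x : X n.+1 => [tuple H j (tnth x j) | j < n.+1]).
  apply/measurable_fun_tnthP => j.
  rewrite (_ : _ \o _ = (H j) \o (fun x : X n.+1 => tnth x j)); last first.
    by apply/funext => x /=; rewrite tnth_mktuple.
  by apply: measurableT_comp; [case: (hH j)|exact: measurable_tnth].
split => // f mf f0.
rewrite (ge0_integral_tcons (measurableT_comp mf mh))//; last by move=> x; exact: f0.
rewrite ge0_integral_tcons//.
have [mh' eh'] := IH (fun j => H (lift ord0 j)) (fun j => hH (lift ord0 j)).
have E a x : [tuple H j (tnth (tcons (a, x)) j) | j < n.+1] =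
    tcons (H ord0 a, [tuple H (lift ord0 j) (tnth x j) | j < n]).
  apply: eq_from_tnth => j; rewrite tnth_mktuple.
  by case: (unliftP ord0 j) => [i|] ->; rewrite /tcons /= ?tnthS ?tnth0 ?tnth_mktuple.
pose F (a : R2 R) : \bar R := (\int[lebesgue_Cn n]_x f (tcons (a, x)))%E.
have mft := measurableT_comp mf (@measurable_tcons R n).
have mF : measurable_fun setT F.
  by apply: (measurable_fun_fubini_tonelli_F (f \o @tcons R n)) => // x; exact: f0.
rewrite -(proj2 (hH ord0) F mF); last by move=> a; apply: integral_ge0 => x _; exact: f0.
apply: eq_integral => a _.
rewrite /F -(eh' (fun x => f (tcons (H ord0 a, x)))).
- by apply: eq_integral => x _; rewrite /= E.
- exact: (measurableT_comp mft (measurable_pair1 (H ord0 a))).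
- by move=> x; exact: f0.
Qed.

Lemma mpres_lebC n (H : 'I_n -> R2 R -> R2 R) (h : Cn R n -> Cn R n) :
  (forall j, mpres (@lebesgue_R2 R) (H j)) ->
  (forall x, h (to_Cn x) = to_Cn [tuple H j (tnth x j) | j < n]) ->
  mpres (@lebC R n) h.
Proof.
move=> hH hE; have [mh eh] := mpres_tuple hH.
have m1 : measurable_fun setT h.
  apply/measurable_CnE; rewrite (_ : _ \o _ = (@to_Cn R n) \o (fun x : X n => [tuple H j (tnth x j) | j < n])).
    exact: (measurableT_comp (@measurable_to_Cn R n) mh).
  by apply/funext => x /=; rewrite hE.
split=> // f mf f0.
rewrite (ge0_integral_lebC (measurableT_comp mf m1)) => [|x]; last exact: f0.
rewrite (ge0_integral_lebC mf f0).
rewrite -(eh (f \o @to_Cn R n)) => [|//|x]; last exact: f0.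
by apply: eq_integral => x _; rewrite /= hE.
Qed.

Lemma mpres_shift n (a : Cn R n) : mpres (@lebC R n) (fun z => z + a).
Proof.
apply: (@mpres_lebC n (fun j p => (p.1 + complex.Re (a ord0 j), p.2 + complex.Im (a ord0 j)))).
  by move=> j; exact: mpres_R2_shift.
move=> x; apply/rowP => j; rewrite !mxE tnth_mktuple.
by apply: complex_eqP; rewrite ?ReD ?ImD.
Qed.

(** These are the rotations over which [gauss_mean_value] averages. *)
Lemma mpres_unit n (c : C R) : normc c = 1 -> mpres (@lebC R n) (fun z => c *: z).
Proof.
move=> c1; have cc : complex.Re c ^+ 2 + complex.Im c ^+ 2 = 1.
  by rewrite -sqr_normc_def c1 expr1n.
apply: (@mpres_lebC n (fun j p => (complex.Re c * p.1 - complex.Im c * p.2,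
   complex.Re c * p.2 + complex.Im c * p.1))).
  by move=> j; exact: mpres_R2_rot.
move=> x; apply/rowP => j; rewrite !mxE tnth_mktuple.
by apply: complex_eqP; rewrite ?ReM ?ImM.
Qed.

Lemma mpres_opp n : mpres (@lebC R n) (fun z => - z).
Proof.
apply: mpres_ext (@mpres_unit n (-1) _) => [z|]; first by rewrite scaleN1r.
by rewrite normcN normc1.
Qed.

Lemma mpres_reflect n (a : Cn R n) : mpres (@lebC R n) (fun z => a - z).
Proof.
apply: mpres_ext (mpres_comp (mpres_shift a) (mpres_opp n)) => z /=; exact: addrC.
Qed.

Lemma gauss_densityE n (s : R) (z : Cn R n) : 0 < s ->
  gauss_density s z = (pi * s) ^- n * expR (- sqnorm z / s).
Proof.
by move=> s0; rewrite /gauss_density powRN powR_mulrn// mulr_ge0 ?pi_ge0// ltW.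
Qed.

(** In each real coordinate mu_s is the normal law of mean 0 and variance [s / 2]. *)
Lemma integral_gauss_R (s : R) : 0 < s ->
  (\int[@lebesgue_measure R]_x ((Num.sqrt (pi * s))^-1%:E * (expR (- x ^+ 2 / s))%:E) = 1)%E.
Proof.
move=> s0; have h0 : Num.sqrt (s / 2) != 0 by rewrite gt_eqF// sqrtr_gt0 divr_gt0.
have sE : (Num.sqrt (s / 2)) ^+ 2 = s / 2 by rewrite sqr_sqrtr// divr_ge0 ?ltW.
rewrite -[RHS](integral_normal_pdf 0 (Num.sqrt (s / 2))); apply: eq_integral => x _.
rewrite normal_pdfE// /normal_peak /normal_fun sE subr0 -EFinM.
congr (_%:E); congr ((Num.sqrt _)^-1 * expR (_ / _)).
  by rewrite -mulr_natr; field.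
by rewrite -mulr_natr; field.
Qed.

Lemma integral_gauss_R2 (s : R) : 0 < s ->
  (\int[@lebesgue_R2 R]_p ((pi * s)^-1 * expR (- (p.1 ^+ 2 + p.2 ^+ 2) / s))%:E = 1)%E.
Proof.
move=> s0; have q0 : 0 <= pi * s by rewrite mulr_ge0 ?pi_ge0 ?ltW.
have mg : measurable_fun setT (fun x : R => expR (- x ^+ 2 / s)).
  apply: measurableT_comp => //; apply: measurable_funM => //.
  by apply: measurableT_comp => //; exact: measurable_funX.
have mE : measurable_fun setT (fun p : measurableTypeR R * measurableTypeR R =>
    ((pi * s)^-1 * expR (- (p.1 ^+ 2 + p.2 ^+ 2) / s))%:E).
  apply/measurable_EFinP; apply: measurable_funM => //.
  apply: measurableT_comp => //; apply: measurable_funM => //.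
  apply: measurableT_comp => //; apply: measurable_funD; apply: measurable_funX.
    exact: measurable_fst.
  exact: measurable_snd.
transitivity (\int[@lebesgue_measure R]_x \int[@lebesgue_measure R]_y
   ((pi * s)^-1 * expR (- (x ^+ 2 + y ^+ 2) / s))%:E)%E.
  apply: (fubini_tonelli1 (fun p : measurableTypeR R * measurableTypeR R =>
    ((pi * s)^-1 * expR (- (p.1 ^+ 2 + p.2 ^+ 2) / s))%:E)) => // p.
  by rewrite lee_fin mulr_ge0 ?expR_ge0// invr_ge0.
rewrite -[RHS](integral_gauss_R s0); apply: eq_integral => x _.
set c := (Num.sqrt (pi * s))^-1.
have -> : (\int[@lebesgue_measure R]_y ((pi * s)^-1 * expR (- (x ^+ 2 + y ^+ 2) / s))%:E =
  \int[@lebesgue_measure R]_y ((c * expR (- x ^+ 2 / s))%:E * (c%:E * (expR (- y ^+ 2 / s))%:E)))%E.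
  apply: eq_integral => y _; rewrite -!EFinM; congr (_%:E).
  rewrite (_ : (pi * s)^-1 = c * c); last by rewrite -invfM -expr2 sqr_sqrtr.
  by rewrite opprD mulrDl expRD; ring.
rewrite ge0_integralZl//.
- by rewrite integral_gauss_R// mule1.
- apply: emeasurable_funM => //; exact/measurable_EFinP.
- by move=> y _; rewrite mule_ge0 ?lee_fin ?expR_ge0// invr_ge0 sqrtr_ge0.
- by rewrite lee_fin mulr_ge0 ?expR_ge0// invr_ge0 sqrtr_ge0.
Qed.

Lemma integral_gauss_density n (s : R) : 0 < s ->
  (\int[@lebesgue_Cn R n]_x (gauss_density s (to_Cn x))%:E = 1)%E.
Proof.
move=> s0; elim: n => [|n IH].
  rewrite integral_dirac//; last by apply/measurable_EFinP; exact: measurable_gauss_density.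
  rewrite diracT mul1e gauss_densityE// /sqnorm big_ord0 oppr0 mul0r expR0 mulr1.
  by rewrite expr0 invr1.
have mg m : measurable_fun setT (fun x : X m => (gauss_density s (to_Cn x))%:E).
  by apply/measurable_EFinP; exact: measurable_gauss_density.
have g0 m (x : X m) : (0 <= (gauss_density s (to_Cn x))%:E)%E.
  by rewrite lee_fin gauss_density_ge0.
rewrite ge0_integral_tcons//.
rewrite -[RHS](integral_gauss_R2 s0); apply: eq_integral => -[a b] _.
rewrite -[RHS]mule1 -IH -ge0_integralZl//; last first.
  by rewrite lee_fin mulr_ge0 ?expR_ge0// invr_ge0 mulr_ge0 ?pi_ge0 ?ltW.
  exact: mg.
apply: eq_integral => x _; rewrite -EFinM; congr (_%:E).
rewrite !gauss_densityE// exprS invfM.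
have -> : sqnorm (to_Cn (tcons ((a, b), x))) = (a ^+ 2 + b ^+ 2) + sqnorm (to_Cn x).
  rewrite /sqnorm big_ord_recl; congr (_ + _).
    by rewrite mxE /tcons tnth0 sqr_normc_def.
  by apply: eq_bigr => j _; rewrite !mxE /tcons tnthS.
rewrite (_ : - (a ^+ 2 + b ^+ 2 + sqnorm (to_Cn x)) / s =
  - (a ^+ 2 + b ^+ 2) / s + - sqnorm (to_Cn x) / s); last by ring.
by rewrite expRD /=; ring.
Qed.

End InvarianceCn.

Section Fubini.
Context {R : realType} d1 d2 (T1 : measurableType d1) (T2 : measurableType d2).
Variables (m1 : {sigma_finite_measure set T1 -> \bar R})
          (m2 : {sigma_finite_measure set T2 -> \bar R}).
Local Notation Re := (@complex.Re R).
Local Notation Im := (@complex.Im R).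

Lemma measurable_Rintegral_section (g : T1 * T2 -> R) : measurable_fun setT g ->
  measurable_fun setT (fun x => \int[m2]_y g (x, y))%R.
Proof.
move=> mg; have mEg : measurable_fun setT (EFin \o g) by exact/measurable_EFinP.
rewrite /Rintegral; apply: (measurableT_comp (f := fine)); first exact: fine_measurable.
under eq_fun do rewrite integralE.
apply: emeasurable_funB.
  rewrite (_ : (fun x => _) = fubini_F m2 ((EFin \o g)^\+)%E).
    by apply: measurable_fun_fubini_tonelli_F => //; exact: measurable_funepos.
  by apply/funext => x; apply: eq_integral => y _; rewrite !funeposE.
rewrite (_ : (fun x => _) = fubini_F m2 ((EFin \o g)^\-)%E).
  by apply: measurable_fun_fubini_tonelli_F => //; exact: measurable_funeneg.
by apply/funext => x; apply: eq_integral => y _; rewrite !funenegE.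
Qed.

Lemma cmfun_cint (f : T1 * T2 -> C R) : cmfun f ->
  cmfun (fun x => cint m2 (fun y => f (x, y))).
Proof.
move=> [f1 f2]; split; first exact: (measurable_Rintegral_section f1).
exact: (measurable_Rintegral_section f2).
Qed.

(** Sections are assumed integrable at every point, not only almost everywhere: the inner integrals
    pass through [fine], and the integrands are compared point by point. *)
Lemma cint_fubini (f : T1 * T2 -> C R) : cmfun f ->
  (forall x, cL1 m2 (fun y => f (x, y))) -> (forall y, cL1 m1 (fun x => f (x, y))) ->
  (\int[m1]_x \int[m2]_y (normc (f (x, y)))%:E < +oo)%E ->
  cint m1 (fun x => cint m2 (fun y => f (x, y))) =
  cint m2 (fun y => cint m1 (fun x => f (x, y))).
Proof.
move=> mf h2 h1 fin.
have key (p : C R -> R) : measurable_fun setT (fun q => p (f q)) ->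
    (forall z, `|p z| <= normc z) ->
    (forall x, m2.-integrable setT (EFin \o (fun y => p (f (x, y))))) ->
    (forall y, m1.-integrable setT (EFin \o (fun x => p (f (x, y))))) ->
    (\int[m1]_x \int[m2]_y p (f (x, y)) = \int[m2]_y \int[m1]_x p (f (x, y)))%R.
  move=> mp pn i2 i1; rewrite /Rintegral; congr fine.
  have ip : (m1 \x m2)%E.-integrable setT (EFin \o (fun q => p (f q))).
    apply/integrable12ltyP; first exact/measurable_EFinP.
    apply: le_lt_trans fin; apply: ge0_le_integral => //=.
    - by move=> x _; apply: integral_ge0 => y _; rewrite lee_fin.
    - apply: (measurable_fun_fubini_tonelli_F (fun q => `|(p (f q))%:E|%E)) => //.
      by apply: measurableT_comp => //; exact/measurable_EFinP.
    - apply: (measurable_fun_fubini_tonelli_F (fun q => (normc (f q))%:E)) => //.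
        by apply/measurable_EFinP; exact: measurable_normc.
      by move=> q; rewrite lee_fin normc_ge0.
    - move=> x _; apply: le_ge0_integral => //.
      + by apply: measurableT_comp => //; apply: (measurableT_comp mp); exact: measurable_pair1.
      + exact: (measurable_normc (proj1 (h2 x))).
  have := Fubini ip => /= E.
  rewrite (eq_integral (fun x => \int[m2]_y (p (f (x, y)))%:E)%E); last first.
    by move=> x _; rewrite fineK//; apply: integrable_fin_num => //; exact: i2.
  by rewrite E; apply: eq_integral => y _; rewrite fineK//; apply: integrable_fin_num => //; exact: i1.
by apply: complex_eqP; rewrite /cint /=; apply: key => //;
  [case: mf|exact: le_Re_normc|move=> x; exact: cL1_Re|move=> y; exact: (cL1_Re (h1 y))
  |case: mf|exact: le_Im_normc|move=> x; exact: cL1_Im|move=> y; exact: (cL1_Im (h1 y))].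
Qed.

End Fubini.

Section MeasurableMaps.
Context {R : realType} {n : nat} d (T : measurableType d).
Implicit Types (a b : T -> Cn R n).
Local Notation Re := (@complex.Re R).
Local Notation Im := (@complex.Im R).

Lemma cmfun_coord a j : measurable_fun setT a -> cmfun (fun x => a x ord0 j).
Proof.
move=> ma; split; first exact: (measurableT_comp (measurable_coord_Re j) ma).
exact: (measurableT_comp (measurable_coord_Im j) ma).
Qed.

Lemma measurable_cmfunP a : (forall j, cmfun (fun x => a x ord0 j)) -> measurable_fun setT a.
Proof. by move=> h; apply: measurable_to_CnP => j; case: (h j). Qed.

Lemma measurable_CnD a b : measurable_fun setT a -> measurable_fun setT b ->
  measurable_fun setT (fun x => a x + b x).
Proof.
move=> ma mb; apply: measurable_cmfunP => j.
by apply: cmfun_ext (cmfunD (cmfun_coord j ma) (cmfun_coord j mb)) => x; rewrite mxE.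
Qed.

Lemma measurable_CnZ (c : T -> C R) a : cmfun c -> measurable_fun setT a ->
  measurable_fun setT (fun x => c x *: a x).
Proof.
move=> mc ma; apply: measurable_cmfunP => j.
by apply: cmfun_ext (cmfunM mc (cmfun_coord j ma)) => x; rewrite mxE.
Qed.

Lemma measurable_CnN a : measurable_fun setT a -> measurable_fun setT (fun x => - a x).
Proof.
move=> ma; apply: measurable_cmfunP => j.
by apply: cmfun_ext (cmfunN (cmfun_coord j ma)) => x; rewrite mxE.
Qed.

Lemma measurable_CnB a b : measurable_fun setT a -> measurable_fun setT b ->
  measurable_fun setT (fun x => a x - b x).
Proof. by move=> ma mb; apply: measurable_CnD => //; exact: measurable_CnN. Qed.

Lemma cmfun_dot a b : measurable_fun setT a -> measurable_fun setT b ->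
  cmfun (fun x => dot (a x) (b x)).
Proof.
move=> ma mb; apply: cmfun_sum => j; apply: cmfunM; first exact: cmfun_coord.
by apply: cmfun_conj; exact: cmfun_coord.
Qed.

Lemma measurable_sqnorm a : measurable_fun setT a -> measurable_fun setT (fun x => sqnorm (a x)).
Proof.
move=> ma; under eq_fun do rewrite sqnormE.
by case: (cmfun_dot ma ma).
Qed.

End MeasurableMaps.

(** * Gaussian integrals over C^n *)

Section GaussianIntegrals.
Context {R : realType} {n : nat}.
Implicit Types (z u v : Cn R n) (a s : R).
Local Notation L := (@lebC R n).
Local Notation Re := (@complex.Re R).

Lemma ge0_integral_gauss s (f : Cn R n -> \bar R) : measurable_fun setT f ->
  (forall z, 0 <= f z)%E ->
  (\int[gauss s]_x f (to_Cn x) = \int[L]_z ((gauss_density s z)%:E * f z))%E.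
Proof.
move=> mf f0.
have mg : measurable_fun setT (@gauss_density R n s).
  by apply/measurable_CnE; exact: measurable_gauss_density.
rewrite ge0_integral_lebC; last 2 first.
- by apply: emeasurable_funM => //; exact/measurable_EFinP.
- by move=> z; rewrite mule_ge0// lee_fin gauss_density_ge0.
have := (@ge0_integral_density _ _ _ (@lebesgue_Cn R n) (gauss s)
  (fun x => gauss_density s (to_Cn x)) (@measurable_gauss_density R n s)
  (fun x => gauss_density_ge0 s (to_Cn x)) (fun A _ => erefl)
  (fun x => f (to_Cn x)) (measurableT_comp mf (@measurable_to_Cn R n))).
by apply => x; exact: f0.
Qed.

Lemma integral_lebC (f : Cn R n -> \bar R) : measurable_fun setT f ->
  (\int[L]_z f z = \int[@lebesgue_Cn R n]_x f (to_Cn x))%E.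
Proof.
move=> mf; rewrite integralE [RHS]integralE; congr (_ - _)%E.
  rewrite ge0_integral_lebC//; last exact: measurable_funepos.
  by apply: eq_integral => x _; rewrite !funeposE.
rewrite ge0_integral_lebC//; last exact: measurable_funeneg.
by apply: eq_integral => x _; rewrite !funenegE.
Qed.

Lemma cintegral_gauss s (f : Cn R n -> C R) : cmfun f ->
  cintegral (gauss s) f = cint L (fun w => (gauss_density s w)%:C%C * f w).
Proof.
move=> mf.
have mg : measurable_fun setT (@gauss_density R n s).
  by apply/measurable_CnE; exact: measurable_gauss_density.
have [m1 m2] : cmfun (fun w => (gauss_density s w)%:C%C * f w).
  by apply: cmfunM => //; exact: cmfunR.
have mft := cmfun_comp (@measurable_to_Cn R n) mf.
transitivity (cint (@lebesgue_Cn R n) (fun x => (gauss_density s (to_Cn x))%:C%C * f (to_Cn x))).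
  apply: (@cint_density _ _ _ (@lebesgue_Cn R n) (gauss s)
    (fun x => gauss_density s (to_Cn x)) (@measurable_gauss_density R n s)
    (fun x => gauss_density_ge0 s (to_Cn x)) (fun A _ => erefl)
    (fun x => f (to_Cn x)) mft).
apply: complex_eqP; rewrite /cint /= /Rintegral; congr fine.
  by rewrite (integral_lebC (f := fun w => (Re ((gauss_density s w)%:C%C * f w))%:E))//;
    exact/measurable_EFinP.
by rewrite (integral_lebC (f := fun w => (complex.Im ((gauss_density s w)%:C%C * f w))%:E))//;
  exact/measurable_EFinP.
Qed.

Lemma cmeasurableE (f : Cn R n -> C R) : cmeasurable f <-> cmfun f.
Proof.
split=> -[h1 h2]; split.
- exact/measurable_CnE.
- exact/measurable_CnE.
- exact: ((measurable_CnE _).1 h1).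
- exact: ((measurable_CnE _).1 h2).
Qed.

Lemma gauss_density_expR s z : 0 < s ->
  gauss_density s z = (pi * s) ^- n * expR (- (s^-1 * sqnorm z)).
Proof. by move=> s0; rewrite gauss_densityE// mulNr [sqnorm z / s]mulrC. Qed.

Lemma measurable_expR_comp d (T : measurableType d) (f : T -> R) :
  measurable_fun setT f -> measurable_fun setT (fun x => expR (f x)).
Proof. by move=> mf; exact: (measurableT_comp (@measurable_expR R) mf). Qed.

Lemma measurable_gaussian a : measurable_fun setT (fun z : Cn R n => expR (- (a * sqnorm z))).
Proof.
apply: measurable_expR_comp; apply: measurable_funN; apply: measurable_funM => //.
by apply: measurable_sqnorm; exact: measurable_id.
Qed.

Lemma integral_gaussian a : 0 < a ->
  (\int[L]_z (expR (- (a * sqnorm z)))%:E = ((pi / a) ^+ n)%:E)%E.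
Proof.
move=> a0; have c0 : 0 < (pi * a^-1) ^+ n by rewrite exprn_gt0// divr_gt0// pi_gt0.
rewrite ge0_integral_lebC; last 2 first.
- by apply/measurable_EFinP; exact: measurable_gaussian.
- by move=> z; rewrite lee_fin expR_ge0.
have := @integral_gauss_density R n (a^-1); rewrite invr_gt0 => /(_ a0) E.
rewrite -[RHS]mule1 -E -ge0_integralZl//; last 3 first.
- by apply/measurable_EFinP; exact: measurable_gauss_density.
- by move=> x _; rewrite lee_fin gauss_density_ge0.
- by rewrite lee_fin ltW.
apply: eq_integral => x _; rewrite gauss_density_expR ?invr_gt0// invrK -EFinM mulrA.
by rewrite mulfV ?mul1r// gt_eqF.
Qed.

Lemma gaussian_complete_square a z v : 0 < a ->
  - (a * sqnorm z) + Re (dot z v) =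
  sqnorm v / (4 * a) - a * sqnorm (z - ((2 * a)^-1)%:C%C *: v).
Proof.
move=> a0; rewrite sqnormB sqnormZR dotZr conjc_real mulRC_Re; field.
by rewrite gt_eqF.
Qed.

(** The Laplace transform of a Gaussian: completing the square turns it into a translate of a
    centred Gaussian. Every later growth factor in [sqnorm v] originates here. *)
Lemma integral_gaussian_linear a v : 0 < a ->
  (\int[L]_z (expR (- (a * sqnorm z) + Re (dot z v)))%:E =
   ((pi / a) ^+ n * expR (sqnorm v / (4 * a)))%:E)%E.
Proof.
move=> a0; under eq_integral do rewrite gaussian_complete_square// expRD EFinM.
have mg : measurable_fun setT (fun z : Cn R n => (expR (- (a * sqnorm z)))%:E).
  by apply/measurable_EFinP; exact: measurable_gaussian.
have [msh esh] := mpres_shift (- (((2 * a)^-1)%:C%C *: v)).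
rewrite ge0_integralZl//.
- rewrite (esh (fun z => (expR (- (a * sqnorm z)))%:E) mg).
    by rewrite integral_gaussian// -EFinM mulrC.
  by move=> z; rewrite lee_fin expR_ge0.
- exact: (measurableT_comp mg msh).
Qed.

End GaussianIntegrals.

(** * Cauchy's theorem and the reproducing formula *)

Section IntervalIntegral.
Context {R : realType}.
Implicit Types (a b c : R) (f g : R -> C R).
Local Notation lam := (@lebesgue_measure R).

(** Open on the left, so that adjacent intervals are disjoint and [cintR_split] holds exactly. *)
Definition itv_ind a b (x : R) : R := \1_(`]a, b]%classic : set R) x.

Definition locally_cL1 f := forall a b, cL1 lam (fun x : measurableTypeR R => (itv_ind a b x)%:C%C * f x).

Definition cintR f a b : C R :=
  cint lam (fun x : measurableTypeR R => (itv_ind a b x)%:C%C * f x).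

Lemma itv_indE a b x : itv_ind a b x = ((a < x <= b)%R : bool)%:R.
Proof.
rewrite /itv_ind indicE; congr (nat_of_bool _)%:R.
by apply/idP/idP => [/set_mem|h]; [|apply/mem_set]; rewrite /= in_itv.
Qed.

Lemma itv_ind_ge0 a b x : 0 <= itv_ind a b x. Proof. by rewrite itv_indE ler0n. Qed.

Lemma measurable_itv_ind a b : measurable_fun setT (itv_ind a b : measurableTypeR R -> R).
Proof. by apply: measurable_indic; exact: measurable_itv. Qed.

Lemma itv_ind_split a m b x : a <= m -> m <= b ->
  itv_ind a b x = itv_ind a m x + itv_ind m b x.
Proof.
move=> am mb; rewrite !itv_indE.
have [xm|mx] := leP x m.
  by rewrite (le_trans xm mb) !andbT addr0.
by rewrite (le_lt_trans am mx) andbF add0r.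
Qed.

Lemma integral_itv_ind a b M : a <= b -> 0 <= M ->
  (\int[lam]_x (itv_ind a b x * M)%:E = (M * (b - a))%:E)%E.
Proof.
move=> ab M0; under eq_integral do rewrite mulrC EFinM.
rewrite ge0_integralZl//.
- rewrite /itv_ind integral_indic// setIT.
  rewrite [X in (_ * X)%E](@lebesgue_measure_itv R `]a, b]) /= lte_fin -EFinD EFinM.
  by case: ltgtP ab => // ->; rewrite subrr.
- by apply/measurable_EFinP; exact: measurable_itv_ind.
- by move=> x _; rewrite lee_fin itv_ind_ge0.
Qed.

Lemma cintR_split f a m b : locally_cL1 f -> a <= m -> m <= b ->
  cintR f a b = cintR f a m + cintR f m b.
Proof.
move=> hf am mb; rewrite /cintR -cintD; [|exact: hf|exact: hf].
by apply: eq_cint => x; rewrite (itv_ind_split _ am mb) rmorphD mulrDl.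
Qed.

Lemma cintRB f g a b : locally_cL1 f -> locally_cL1 g ->
  cintR (fun x => f x - g x) a b = cintR f a b - cintR g a b.
Proof.
move=> hf hg; rewrite /cintR -cintB; [|exact: hf|exact: hg].
by apply: eq_cint => x; rewrite mulrBr.
Qed.

Lemma locally_cL1B f g : locally_cL1 f -> locally_cL1 g -> locally_cL1 (fun x => f x - g x).
Proof.
move=> hf hg a b; apply: cL1_ext (cL1B (hf a b) (hg a b)) => x; by rewrite mulrBr.
Qed.

Lemma locally_cL1_bounded f : cmfun (f : measurableTypeR R -> C R) ->
  (forall a b, exists M, forall x, a < x <= b -> normc (f x) <= M) -> locally_cL1 f.
Proof.
move=> mf hb a b; have [M hM] := hb a b.
have [ab|ba] := leP a b; last first.
  apply: cL1_ext (cL1_0 _) => x; rewrite itv_indE.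
  by case: (boolP (a < x <= b)) => [/andP[h1 h2]|_]; [have := lt_le_trans h1 h2; rewrite ltNge ltW|rewrite mul0r].
(* The absolute value matters at [a = b], where the bound on [f] is vacuous and [M] may be
   negative. *)
apply: (@cL1_dom R _ (measurableTypeR R) lam _ (fun x => itv_ind a b x * `|M|)).
- by apply: cmfunM => //; apply: cmfunR; exact: measurable_itv_ind.
- by apply: measurable_funM => //; exact: measurable_itv_ind.
- move=> x; rewrite normcM normcR ger0_norm ?itv_ind_ge0// itv_indE.
  case: (boolP (a < x <= b)) => h; last by rewrite !mul0r.
  by rewrite !mul1r (le_trans (hM _ h))// ler_norm.
- by rewrite integral_itv_ind// ltry.
Qed.

Lemma locally_cL1_cst (k : C R) : locally_cL1 (fun=> k).
Proof.
apply: locally_cL1_bounded; first exact: cmfun_cst.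
by move=> a b; exists (normc k).
Qed.

Lemma cintR_bound f a b M : a <= b -> 0 <= M -> locally_cL1 f ->
  (forall x, a < x <= b -> normc (f x) <= M) -> normc (cintR f a b) <= M * (b - a).
Proof.
move=> ab M0 hf hM; rewrite -lee_fin -integral_itv_ind//.
apply: normc_cint_dom.
- by case: (hf a b).
- by apply: measurable_funM => //; exact: measurable_itv_ind.
- move=> x; rewrite normcM normcR ger0_norm ?itv_ind_ge0// itv_indE.
  by case: (boolP (a < x <= b)) => h; rewrite ?mul0r// !mul1r hM.
- by rewrite integral_itv_ind// ltry.
Qed.

Lemma cintR_cst (k : C R) a b : a <= b -> cintR (fun=> k) a b = k * (b - a)%:C%C.
Proof.
move=> ab; rewrite /cintR.
under eq_cint do rewrite mulrC.
rewrite cintZ; last by apply: cL1_ext (locally_cL1_cst 1 a b) => x; exact: mulr1.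
congr (_ * _); apply: complex_eqP; rewrite /cint /= /Rintegral.
  rewrite (_ : (\int[lam]_x _)%E = (1 * (b - a))%:E) /=; first by rewrite mul1r.
  rewrite -integral_itv_ind//; apply: eq_integral => x _; by rewrite mulr1.
by rewrite integral0.
Qed.

Lemma cintR_approx f a b (k : C R) M : a <= b -> 0 <= M -> locally_cL1 f ->
  (forall x, a < x <= b -> normc (f x - k) <= M) ->
  normc (cintR f a b - k * (b - a)%:C%C) <= M * (b - a).
Proof.
move=> ab M0 hf hM; rewrite -cintR_cst// -cintRB//; last exact: locally_cL1_cst.
by apply: cintR_bound => //; apply: locally_cL1B => //; exact: locally_cL1_cst.
Qed.

End IntervalIntegral.

Lemma nested_intervals {R : realType} (u v : nat -> R) :
  (forall k, u k <= u k.+1) -> (forall k, v k.+1 <= v k) -> (forall k, u k <= v k) ->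
  exists x, forall k, u k <= x <= v k.
Proof.
move=> hu hv uv.
have mu : {homo u : i j / (i <= j)%N >-> (i <= j)%R} by apply/nondecreasing_seqP.
have mv : {homo v : i j / (i <= j)%N >-> (i >= j)%R} by apply/nonincreasing_seqP.
have uv2 i j : u i <= v j.
  apply: le_trans (mu _ _ (leq_maxl i j)) _.
  by apply: le_trans (uv _) _; apply: mv; exact: leq_maxr.
have hs : has_sup (range u).
  by split; [exists (u 0%N), 0%N|exists (v 0%N) => _ [k _ <-]].
exists (sup (range u)) => k; apply/andP; split.
  by apply: ub_le_sup; [case: hs|exists k].
by apply: ge_sup; [case: hs|move=> _ [i _ <-]].
Qed.

(** The pigeonhole argument behind the bisection: four quarters, each smaller than a quarter of [x],
    cannot add up to [x]. *)
Lemma four_quarters {R : realFieldType} (x p q r s y z : R) :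
  4 * p < x -> 4 * q < x -> 4 * r < x -> 4 * s < x ->
  y <= p + q -> z <= r + s -> x <= y + z -> False.
Proof. lra. Qed.

(** * Goursat's theorem on rectangles *)

Section Goursat.
Context {R : realType}.
Variable F : R -> R -> C R.
Hypothesis F1 : forall c, locally_cL1 (F ^~ c).
Hypothesis F2 : forall a, locally_cL1 (F a).
Hypothesis dF : forall x0 y0, exists al : C R, forall e : R, 0 < e ->
  exists2 d : R, 0 < d & forall x y, `|x - x0| < d -> `|y - y0| < d ->
    normc (F x y - F x0 y0 - al * ((x - x0) +i* (y - y0))%C) <= e * (`|x - x0| + `|y - y0|).

(** The contour integral of [F dz], counterclockwise around the boundary of [[a, b] x [c, d]]:
    bottom minus top side, plus [i] times right minus left side. *)
Definition rect_integral (Q : (R * R) * (R * R)) : C R :=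
  let: ((a, b), (c, d)) := Q in
  cintR (F ^~ c) a b - cintR (F ^~ d) a b + 'i%C * (cintR (F b) c d - cintR (F a) c d).
Arguments rect_integral : simpl never.
Local Notation E := rect_integral.

Lemma rect_integral_splitx a m b c d : a <= m -> m <= b ->
  E ((a, b), (c, d)) = E ((a, m), (c, d)) + E ((m, b), (c, d)).
Proof.
move=> am mb; rewrite /E (cintR_split (F1 c) am mb) (cintR_split (F1 d) am mb); ring.
Qed.

Lemma rect_integral_splity a b c m d : c <= m -> m <= d ->
  E ((a, b), (c, d)) = E ((a, b), (c, m)) + E ((a, b), (m, d)).
Proof.
move=> am mb; rewrite /E (cintR_split (F2 a) am mb) (cintR_split (F2 b) am mb); ring.
Qed.

Definition half_pick (P : bool) (I : R * R) : R * R :=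
  let m := (I.1 + I.2) / 2 in if P then (I.1, m) else (m, I.2).

Lemma bisect_rect Q : Q.1.1 <= Q.1.2 -> Q.2.1 <= Q.2.2 ->
  exists p : bool * bool, normc (E Q) <= 4 * normc (E (half_pick p.1 Q.1, half_pick p.2 Q.2)).
Proof.
case: Q => -[a b] [c d] /= ab cd.
set m := (a + b) / 2; set k := (c + d) / 2.
have am : a <= m by rewrite /m; lra.
have mb : m <= b by rewrite /m; lra.
have ck : c <= k by rewrite /k; lra.
have kd : k <= d by rewrite /k; lra.
apply: contrapT => /forallNP h.
have h' p := introN idP (h p).
have := h' (true, true); have := h' (true, false); have := h' (false, true); have := h' (false, false).
rewrite /half_pick /= -/m -/k -!ltNge => h1 h2 h3 h4.
have := rect_integral_splitx c d am mb.
rewrite (rect_integral_splity a m ck kd) (rect_integral_splity m b ck kd) => EE.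
have := normcD (E (a, m, (c, k)) + E (a, m, (k, d))) (E (m, b, (c, k)) + E (m, b, (k, d))).
rewrite -EE; apply: four_quarters h4 h3 h2 h1 (normcD _ _) (normcD _ _).
Qed.

(** Passes to a quarter that retains at least a fourth of the contour integral; one exists by
    [bisect_rect] whenever the sides are ordered, so the default of [xget] is never reached along
    the construction. *)
Definition bisect_next Q :=
  let p := xget (true, true) [set p : bool * bool |
    normc (E Q) <= 4 * normc (E (half_pick p.1 Q.1, half_pick p.2 Q.2))] in
  (half_pick p.1 Q.1, half_pick p.2 Q.2).

Lemma half_pickP P I : I.1 <= I.2 ->
  [/\ I.1 <= (half_pick P I).1, (half_pick P I).2 <= I.2 &
   (half_pick P I).2 - (half_pick P I).1 = (I.2 - I.1) / 2].
Proof. by case: I => u v /= uv; case: P => /=; split; lra. Qed.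

Theorem goursat a b c d : a <= b -> c <= d -> E ((a, b), (c, d)) = 0.
Proof.
move=> ab cd; pose Q k := iter k bisect_next ((a, b), (c, d)).
pose l := (b - a) + (d - c).
have l0 : 0 <= l by rewrite addr_ge0 ?subr_ge0.
have HQ k : (Q k).1.2 - (Q k).1.1 = (b - a) / 2 ^+ k /\ (Q k).2.2 - (Q k).2.1 = (d - c) / 2 ^+ k.
  elim: k => [|k [I1 I2]]; first by rewrite /Q /= expr0 !divr1.
  rewrite /Q iterS -/(Q k) /bisect_next; set p := xget _ _.
  have h1 : (Q k).1.1 <= (Q k).1.2 by rewrite -subr_ge0 I1 divr_ge0 ?subr_ge0 ?exprn_ge0.
  have h2 : (Q k).2.1 <= (Q k).2.2 by rewrite -subr_ge0 I2 divr_ge0 ?subr_ge0 ?exprn_ge0.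
  have [_ _ /= ->] := half_pickP p.1 h1; have [_ _ /= ->] := half_pickP p.2 h2.
  by rewrite I1 I2 exprSr invfM !mulrA.
have Q1 k : (Q k).1.1 <= (Q k).1.2.
  by rewrite -subr_ge0; have [-> _] := HQ k; rewrite divr_ge0 ?subr_ge0 ?exprn_ge0.
have Q2 k : (Q k).2.1 <= (Q k).2.2.
  by rewrite -subr_ge0; have [_ ->] := HQ k; rewrite divr_ge0 ?subr_ge0 ?exprn_ge0.
have QS k : [/\ (Q k).1.1 <= (Q k.+1).1.1, (Q k.+1).1.2 <= (Q k).1.2,
    (Q k).2.1 <= (Q k.+1).2.1 & (Q k.+1).2.2 <= (Q k).2.2].
  rewrite {2 4 5 7}/Q iterS -/(Q k) /bisect_next; set p := xget _ _.
  have [? ? _] := half_pickP p.1 (Q1 k); have [? ? _] := half_pickP p.2 (Q2 k).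
  by split.
have QE k : normc (E (Q 0%N)) <= 4 ^+ k * normc (E (Q k)).
  elim: k => [|k IH]; first by rewrite expr0 mul1r.
  apply: le_trans IH _; rewrite exprSr -mulrA ler_wpM2l ?exprn_ge0//.
  rewrite /Q iterS -/(Q k) /bisect_next.
  exact: (@xgetPex _ (true, true) (fun p : bool * bool => normc (E (Q k)) <= 4 * normc (E (half_pick p.1 (Q k).1, half_pick p.2 (Q k).2)))
    (bisect_rect (Q1 k) (Q2 k))).
have [x0 hx0] := @nested_intervals R (fun k => (Q k).1.1) (fun k => (Q k).1.2)
  (fun k => let: And4 h _ _ _ := QS k in h) (fun k => let: And4 _ h _ _ := QS k in h) Q1.
have [y0 hy0] := @nested_intervals R (fun k => (Q k).2.1) (fun k => (Q k).2.2)
  (fun k => let: And4 _ _ h _ := QS k in h) (fun k => let: And4 _ _ _ h := QS k in h) Q2.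
have [al hal] := dF x0 y0.
apply: normc_eq0; apply/eqP; rewrite eq_le normc_ge0 andbT.
apply/ler_addgt0Pr => e e0; rewrite add0r.
(* At depth [k] the factor [4 ^+ k] meets the square of [l / 2 ^+ k], so the final bound is
   [2 * e' * l ^+ 2]. Dividing by [(l + 1) ^+ 2] instead of [l ^+ 2] covers degenerate
   rectangles. *)
pose e' := e / (2 * (l + 1) ^+ 2).
have e'0 : 0 < e' by rewrite divr_gt0// mulr_gt0// exprn_gt0// ltr_wpDl.
have [de de0 hde] := hal _ e'0.
have [k hk] : exists k, l / 2 ^+ k < de.
  have := @cvg_geometric R l 2^-1; rewrite ger0_norm// invf_lt1// ltr1n => /(_ isT).
  move/cvgrPdist_lt => /(_ _ de0) [k _ /(_ k (leqnn k))] /=.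
  rewrite sub0r normrN ger0_norm; last by rewrite mulr_ge0// exprn_ge0.
  by rewrite exprVn => hk; exists k.
have {QE} : normc (E ((a, b), (c, d))) <= 4 ^+ k * normc (E (Q k)) := QE k.
have [] := HQ k; move: (Q1 k) (Q2 k) (hx0 k) (hy0 k).
case: (Q k) => -[a' b'] [c' d'] /= ab' cd' /andP[ax xb] /andP[cy yd] hb hd QE.
have lk : (b' - a') + (d' - c') = l / 2 ^+ k by rewrite hb hd -mulrDl.
pose r x y := F x y - F x0 y0 - al * ((x - x0) +i* (y - y0))%C.
have hr x y : a' <= x <= b' -> c' <= y <= d' -> normc (r x y) <= e' * (l / 2 ^+ k).
  move=> /andP[x1 x2] /andP[y1 y2].
  have hx : `|x - x0| <= b' - a' by rewrite ler_norml; apply/andP; split; lra.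
  have hy : `|y - y0| <= d' - c' by rewrite ler_norml; apply/andP; split; lra.
  apply: le_trans (hde x y _ _) _.
  - by apply: le_lt_trans hk; rewrite -lk; lra.
  - by apply: le_lt_trans hk; rewrite -lk; lra.
  by rewrite ler_pM2l// -lk lerD.
have e'l : 0 <= e' * (l / 2 ^+ k) by rewrite mulr_ge0 ?(ltW e'0)// divr_ge0// exprn_ge0.
(* Opposite sides are paired. In the difference of [F] along two of them the value [F x0 y0] and the
   part of the linear term that varies along the side cancel; what remains is a constant plus
   remainders. The constants of the two pairs cancel each other in [EE]. *)
have B1 : normc (cintR (fun x => F x c' - F x d') a' b' -
    (al * (0 +i* (c' - d'))%C) * (b' - a')%:C%C) <= 2 * (e' * (l / 2 ^+ k)) * (b' - a').
  apply: cintR_approx => //; first by rewrite mulr_ge0.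
    by apply: locally_cL1B; exact: F1.
  move=> x /andP[/ltW x1 x2].
  rewrite (_ : _ - _ = r x c' - r x d'); last first.
    have -> : (0 +i* (c' - d') = (x - x0) +i* (c' - y0) - ((x - x0) +i* (d' - y0)) :> C R)%C.
      by apply: complex_eqP => /=; ring.
    by rewrite /r; ring.
  apply: le_trans (normcB _ _) _.
  by rewrite mulrDl !mul1r lerD// hr ?x1 ?x2 ?lexx ?cd'.
have B2 : normc (cintR (fun y => F b' y - F a' y) c' d' -
    (al * (b' - a')%:C%C) * (d' - c')%:C%C) <= 2 * (e' * (l / 2 ^+ k)) * (d' - c').
  apply: cintR_approx => //; first by rewrite mulr_ge0.
    by apply: locally_cL1B; exact: F2.
  move=> y /andP[/ltW y1 y2].
  rewrite (_ : _ - _ = r b' y - r a' y); last first.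
    have -> : ((b' - a')%:C = (b' - x0) +i* (y - y0) - ((a' - x0) +i* (y - y0)) :> C R)%C.
      by apply: complex_eqP => /=; ring.
    by rewrite /r; ring.
  apply: le_trans (normcB _ _) _.
  by rewrite mulrDl !mul1r lerD// hr ?y1 ?y2 ?lexx ?ab'.
have EE : E (a', b', (c', d')) =
    (cintR (fun x => F x c' - F x d') a' b' - (al * (0 +i* (c' - d'))%C) * (b' - a')%:C%C) +
    'i%C * (cintR (fun y => F b' y - F a' y) c' d' - (al * (b' - a')%:C%C) * (d' - c')%:C%C).
  rewrite /E (cintRB _ _ (F1 c') (F1 d')) (cintRB _ _ (F2 b') (F2 a')).
  have -> : (0 +i* (c' - d'))%C = - ('i%C * (d' - c')%:C%C) :> C R.
    by apply: complex_eqP; rewrite ?ReN ?ImN ?ReM ?ImM /=; ring.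
  ring.
apply: le_trans QE _; rewrite EE.
have ni : normc ('i%C : C R) = 1 by rewrite /normc expr0n /= expr1n add0r sqrtr1.
have h4 : 0 <= (4 : R) ^+ k by rewrite exprn_ge0.
apply: le_trans (ler_wpM2l h4 (normcD _ _)) _.
rewrite normcM ni mul1r.
apply: le_trans (ler_wpM2l h4 (lerD B1 B2)) _.
rewrite -mulrDr lk.
have -> : 4 ^+ k * (2 * (e' * (l / 2 ^+ k)) * (l / 2 ^+ k)) = 2 * e' * l ^+ 2.
  rewrite (_ : (4 : R) = 2 * 2) ?exprMn; last by ring.
  by field; rewrite expf_neq0.
have l1 : 0 < l + 1 by rewrite ltr_wpDl.
rewrite (_ : 2 * e' * l ^+ 2 = e * (l ^+ 2 / (l + 1) ^+ 2)); last first.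
  by rewrite /e'; field; rewrite gt_eqF.
rewrite ger_pMr// ler_pdivrMr ?exprn_gt0// mul1r ler_pXn2r ?nnegrE ?(ltW l1)//.
by rewrite lerDl.
Qed.

End Goursat.

Lemma muli_eq0 {R : realType} (z : C R) : 'i%C * z = 0 -> z = 0.
Proof.
case: z => a b h; apply: complex_eqP => /=.
  by have := congr1 (@complex.Im R) h; rewrite ImM /= mul0r add0r mul1r.
by have := congr1 (@complex.Re R) h; rewrite ReM /= mul0r sub0r mul1r => /eqP; rewrite oppr_eq0 => /eqP.
Qed.

Lemma muli_cancel {R : realType} (u v w : C R) : u - u + 'i%C * (v - w) = 0 -> w = v.
Proof. by rewrite subrr add0r => /muli_eq0/eqP; rewrite subr_eq0 => /eqP. Qed.

(** * Mean values of entire functions over circles *)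

Section CircleMean.
Context {R : realType} {n : nat}.
Implicit Types (phi : Cn R n -> C R) (z w : Cn R n).

(** The spaces are normed over the complex numbers, so the derivative along [w] is a complex one;
    restricting to the line through [w] reduces to one complex variable. *)
Lemma differentiable_direction phi z w : differentiable phi z ->
  exists al : C R, forall e : R, 0 < e -> exists2 d : R, 0 < d & forall xi : C R,
    normc xi < d -> normc (phi (z + xi *: w) - phi z - xi * al) <= e * normc xi.
Proof.
move=> /(@diff_derivable _ _ _ _ _ w) /cvg_ex[al hal].
exists al => e e0; have e0C : 0 < (e%:C)%C :> R[i] by rewrite ltcR.
move/cvgrPdist_lt : hal => /(_ _ e0C) hal.
have [_ /= /posc_real[d d0 ->] hd] := (nbhs_ballP (0 : C R) _).1 hal.
exists d => // xi hxi; have [->|xi0] := eqVneq xi 0.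
  by rewrite scale0r addr0 subrr mul0r subr0 normc0 mulr0.
have := hd xi; rewrite -ball_normE /ball_ /= sub0r normrN norm_normc ltcR => /(_ hxi xi0).
rewrite norm_normc ltcR => h.
have -> : phi (z + xi *: w) - phi z - xi * al =
    - (xi * (al - xi^-1 * (phi (xi *: w + z) - phi z))).
  by rewrite mulrBr mulrA mulfV// mul1r opprB [xi *: w + z]addrC.
by rewrite normcN normcM mulrC ler_wpM2r ?normc_ge0// ltW.
Qed.

Lemma normc_rect (x y : R) : normc (x +i* y)%C <= `|x| + `|y|.
Proof. exact: normc_le_ReIm. Qed.

Variables (phi : Cn R n -> C R) (w : Cn R n).
Hypothesis ephi : entire phi.

Let cphi : continuous phi.
Proof. by move=> z; apply: differentiable_continuous; exact: ephi. Qed.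

(** Logarithmic polar coordinates on the complex line through [w]: circles about 0 become vertical
    segments of length [2 * pi], and the function is periodic in [y]. *)
Definition polar_pullback (x y : R) : C R := phi (cexp (x +i* y)%C *: w).
Local Notation F := polar_pullback.

Lemma polar_pullback_derivable x0 y0 : exists al : C R, forall e : R, 0 < e ->
  exists2 d : R, 0 < d & forall x y, `|x - x0| < d -> `|y - y0| < d ->
    normc (F x y - F x0 y0 - al * ((x - x0) +i* (y - y0))%C) <= e * (`|x - x0| + `|y - y0|).
Proof.
set z0 := cexp (x0 +i* y0)%C *: w.
have [al hal] := differentiable_direction w (@ephi z0).
pose K := expR x0; pose E1 : R := expR 1.
have K0 : 0 < K by exact: expR_gt0.
have E0 : 0 < E1 by exact: expR_gt0.
exists (cexp (x0 +i* y0)%C * al) => e e0.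
pose B := 2 * (K * E1).
have B0 : 0 < B by rewrite !mulr_gt0.
have [d' d'0 hd'] := hal (e / (2 * B)) (divr_gt0 e0 (mulr_gt0 (ltr0Sn _ 1) B0)).
pose A := 4 * (normc al * (K * E1)) + 1.
have A0 : 0 < A by rewrite ltr_wpDl// !mulr_ge0// ?normc_ge0// ltW.
(* The three bounds ensure that [normc q <= 1], that the increment [xi] stays where the derivative
   of [phi] is controlled, and that the second-order remainder of [cexp] is small. *)
pose d := Num.min 2^-1 (Num.min (d' / (2 * B)) (e / (4 * A))).
have d0 : 0 < d by rewrite !lt_min invr_gt0 ltr0n/= !divr_gt0 ?mulr_gt0.
exists d => // x y hx hy.
set q : C R := ((x - x0) +i* (y - y0))%C.
have hq : normc q <= `|x - x0| + `|y - y0| := normc_rect _ _.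
have hqd : normc q < 2 * d.
  by apply: le_lt_trans hq _; rewrite mulrDl mul1r ltrD.
have q1 : normc q <= 1.
  apply: ltW; apply: lt_le_trans hqd _.
  by rewrite mulrC -ler_pdivlMr// mul1r ge_min lexx.
have qB : normc q * B < d'.
  rewrite -ltr_pdivlMr//; apply: lt_le_trans hqd _.
  rewrite mulrC -ler_pdivlMr// -mulrA -invfM [B * 2]mulrC.
  by rewrite /d !ge_min lexx orbT.
have qA : normc q * A <= e / 2.
  rewrite -ler_pdivlMr//; apply: ltW; apply: lt_le_trans hqd _.
  rewrite mulrC -ler_pdivlMr// -!mulrA -!invfM (_ : 2 * (A * 2) = 4 * A); last by ring.
  by rewrite /d !ge_min lexx !orbT.
pose xi := cexp (x0 +i* y0)%C * (cexp q - 1).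
have eq1 : expR (normc q) <= E1 by rewrite ler_expR.
have nK : normc (cexp (x0 +i* y0)%C) = K by rewrite normc_cexp.
have hxi : normc xi <= normc q * B.
  rewrite normcM nK; apply: le_trans (ler_wpM2l (ltW K0) (normc_cexpB1 q)) _.
  rewrite (_ : normc q * B = K * (2 * (normc q * E1))); last by rewrite /B; ring.
  by rewrite ler_wpM2l ?(ltW K0)// ler_wpM2l// ler_wpM2l ?normc_ge0.
have -> : F x y = phi (z0 + xi *: w).
  rewrite /F /z0 -scalerDl /xi mulrBr mulr1 addrC subrK -cexpD.
  congr (phi (cexp _ *: _)); apply: complex_eqP; rewrite ?ReD ?ImD /=; ring.
have -> : phi (z0 + xi *: w) - F x0 y0 - cexp (x0 +i* y0)%C * al * q =
   (phi (z0 + xi *: w) - phi z0 - xi * al) + cexp (x0 +i* y0)%C * al * (cexp q - 1 - q).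
  by rewrite /F -/z0 /xi; ring.
apply: le_trans (normcD _ _) _.
have T1 : normc (phi (z0 + xi *: w) - phi z0 - xi * al) <= e / 2 * normc q.
  apply: le_trans (hd' xi (le_lt_trans hxi qB)) _.
  apply: le_trans (ler_wpM2l _ hxi) _; first by rewrite divr_ge0 ?mulr_ge0 ?ltW.
  rewrite (_ : e / (2 * B) * (normc q * B) = e / 2 * normc q)//.
  by field; rewrite gt_eqF.
have T2 : normc (cexp (x0 +i* y0)%C * al * (cexp q - 1 - q)) <= e / 2 * normc q.
  rewrite !normcM nK.
  have h : K * normc al * normc (cexp q - 1 - q) <= K * normc al * (4 * (normc q ^+ 2 * E1)).
    rewrite ler_wpM2l ?mulr_ge0 ?normc_ge0 ?(ltW K0)//.
    apply: le_trans (normc_cexpB1B q) _.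
    by rewrite ler_wpM2l// ler_wpM2l// exprn_ge0 ?normc_ge0.
  apply: le_trans h _.
  rewrite (_ : K * normc al * (4 * (normc q ^+ 2 * E1)) = normc q * (A - 1) * normc q); last first.
    by rewrite /A; ring.
  rewrite ler_wpM2r ?normc_ge0//; apply: le_trans qA.
  by rewrite ler_wpM2l ?normc_ge0// gerBl.
apply: le_trans (lerD T1 T2) _.
by rewrite -mulrDl -splitr ler_wpM2l// ltW.
Qed.

Lemma continuous_bounded_itv (g : R -> C R) :
  (forall y0 e, 0 < e -> exists2 d : R, 0 < d & forall y, `|y - y0| < d -> normc (g y - g y0) < e) ->
  forall a b, exists M, forall y, a < y <= b -> normc (g y) <= M.
Proof.
move=> cg a b; have [ab|ba] := leP a b; last first.
  exists 0 => y /andP[h1 h2]; have := lt_le_trans h1 h2; by rewrite ltNge ltW.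
have cn : continuous (fun y => normc (g y)).
  move=> y0; apply/cvgrPdist_lt => e e0; have [d d0 hd] := cg y0 e e0.
  near=> y; have hy : normc (g y - g y0) < e.
    by apply: hd; rewrite distrC; near: y; exact: (nbhsx_ballx y0 d d0).
  apply: le_lt_trans hy; rewrite ler_norml; apply/andP; split.
    by have := normcD (g y - g y0) (g y0); rewrite subrK; lra.
  have := normcD (g y0 - g y) (g y); rewrite subrK normc_distC; lra.
have [c _ hc] := EVT_max ab (continuous_subspaceT cn).
by exists (normc (g c)) => y /andP[h1 h2]; apply: hc; rewrite in_itv /= ltW.
Unshelve. all: by end_near. Qed.

Let cF x0 y0 e : 0 < e -> exists2 d : R, 0 < d & forall x y,
  `|x - x0| < d -> `|y - y0| < d -> normc (F x y - F x0 y0) < e.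
Proof.
move=> e0; have [al hal] := polar_pullback_derivable x0 y0.
have [d d0 hd] := hal 1 ltr01.
pose M := 2 * (normc al + 1).
have M0 : 0 < M by rewrite mulr_gt0// ltr_wpDl ?normc_ge0.
exists (Num.min d (e / M)); first by rewrite lt_min d0 divr_gt0.
move=> x y; rewrite !lt_min => /andP[x1 x2] /andP[y1 y2].
have := hd x y x1 y1; rewrite mul1r.
set q : C R := ((x - x0) +i* (y - y0))%C => h.
have hq : normc q <= `|x - x0| + `|y - y0| := normc_rect _ _.
have := normcD (F x y - F x0 y0 - al * q) (al * q); rewrite subrK => /le_lt_trans; apply.
rewrite normcM.
have s : `|x - x0| + `|y - y0| < 2 * (e / M) by lra.
have Me : (normc al + 1) * (2 * (e / M)) = e by rewrite /M; field; rewrite gt_eqF// ltr_wpDl ?normc_ge0.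
have := ler_wpM2l (normc_ge0 al) hq.
have : (normc al + 1) * (`|x - x0| + `|y - y0|) < e.
  by rewrite -Me ltr_pM2l// ltr_wpDl ?normc_ge0.
rewrite mulrDl mul1r; lra.
Qed.

Let mF1 c : cmfun (F ^~ c : measurableTypeR R -> C R).
Proof.
apply: (@cmfun_comp _ _ _ _ _ (fun x : measurableTypeR R => cexp (x +i* c)%C *: w) phi);
  last exact: (cmfun_continuous cphi).
apply: measurable_CnZ; last exact: measurable_cst.
apply: cmfun_cexp; split; first exact: measurable_id.
exact: measurable_cst.
Qed.

Let mF2 a : cmfun (F a : measurableTypeR R -> C R).
Proof.
apply: (@cmfun_comp _ _ _ _ _ (fun y : measurableTypeR R => cexp (a +i* y)%C *: w) phi);
  last exact: (cmfun_continuous cphi).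
apply: measurable_CnZ; last exact: measurable_cst.
apply: cmfun_cexp; split; first exact: measurable_cst.
exact: measurable_id.
Qed.

Let LF1 c : locally_cL1 (F ^~ c).
Proof.
apply: locally_cL1_bounded => //; apply: continuous_bounded_itv => x0 e e0.
have [d d0 hd] := cF x0 c e0; exists d => // x hx; apply: hd => //.
by rewrite subrr normr0.
Qed.

Lemma locally_cL1_circle a : locally_cL1 (F a).
Proof.
apply: locally_cL1_bounded => //; apply: continuous_bounded_itv => x0 e e0.
have [d d0 hd] := cF a x0 e0; exists d => // x hx; apply: hd => //.
by rewrite subrr normr0.
Qed.

(** By periodicity the horizontal sides of the rectangle cancel, and Goursat's theorem compares the
    two vertical ones, that is, the means over circles of radii [e^a] and [e^b] times [w]. *)
Lemma circle_mean_indep a b : a <= b ->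
  cintR (F a) 0 (2 * pi) = cintR (F b) 0 (2 * pi).
Proof.
move=> ab; have pi2 : 0 <= 2 * pi :> R by rewrite mulr_ge0// pi_ge0.
have := goursat LF1 locally_cL1_circle polar_pullback_derivable ab pi2.
rewrite /rect_integral (_ : F ^~ (2 * pi) = F ^~ 0); last first.
  apply/funext => x; rewrite /F /cexp /= mulr_natl cos2pi sin2pi.
  by rewrite cos0 sin0.
by move/(@muli_cancel R).
Qed.

Theorem circle_mean_value :
  cintR (fun y => phi (cexp (0 +i* y)%C *: w)) 0 (2 * pi) = phi 0 * (2 * pi)%:C%C.
Proof.
have pi2 : 0 <= 2 * pi :> R by rewrite mulr_ge0// pi_ge0.
rewrite -[LHS]/(cintR (F 0) 0 (2 * pi)).
apply/eqP; rewrite -subr_eq0; apply/eqP/normc_eq0/eqP; rewrite eq_le normc_ge0 andbT.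
apply/ler_addgt0Pr => e e0; rewrite add0r.
have p0 : 0 < 2 * pi + 1 :> R by rewrite ltr_wpDl.
have [d d0 hd] := (continuous_epsP phi 0).1 (@cphi 0) (e / (2 * pi + 1)) (divr_gt0 e0 p0).
(* The radius is shrunk by [e^(- |w|^2 / d)]: since [e^s >= 1 + s], the square norm of the shrunken
   vector is below [d], and continuity at 0 concludes. *)
have x1 : - (sqnorm w / d) <= 0 by rewrite oppr_le0 divr_ge0 ?sqnorm_ge0// ltW.
rewrite -(circle_mean_indep x1).
have M0 : 0 <= e / (2 * pi + 1) by rewrite divr_ge0 ?ltW.
have hM y : 0 < y <= 2 * pi -> normc (F (- (sqnorm w / d)) y - phi 0) <= e / (2 * pi + 1).
  move=> _; apply: ltW; apply: hd; rewrite subr0 sqnormZ normc_cexp /=.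
  have := expR_ge1Dx (sqnorm w / d); set s := sqnorm w / d => hs.
  have wE : sqnorm w = d * s by rewrite /s mulrC mulfVK// gt_eqF.
  have s0 : 0 <= s by rewrite divr_ge0 ?sqnorm_ge0// ltW.
  have h1 : 0 < expR s by exact: expR_gt0.
  rewrite expRN exprVn wE mulrCA gtr_pMr// mulrC ltr_pdivrMr ?exprn_gt0// mul1r.
  nra.
have := cintR_approx pi2 M0 (locally_cL1_circle _) hM; rewrite subr0 => /le_trans; apply.
by rewrite mulrAC ler_pdivrMr// ler_wpM2l ?(ltW e0)// lerDl.
Qed.

End CircleMean.

(** * Criteria for entire functions *)

Section Differentiability.
Context {R : realType} {n : nat}.
Implicit Types (f g : Cn R n -> C R) (z w h l : Cn R n).

Lemma normc_dot_sqr z w : normc (dot z w) ^+ 2 <= sqnorm z * sqnorm w.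
Proof.
have [z0|z0] := eqVneq (sqnorm z) 0.
  by rewrite (sqnorm_eq0 z0) dot0l normc0 expr0n /= mulr_ge0 ?sqnorm_ge0.
have [w0|w0] := eqVneq (sqnorm w) 0.
  by rewrite (sqnorm_eq0 w0) dot0r normc0 expr0n /= mulr_ge0 ?sqnorm_ge0.
have zp : 0 < sqnorm z by rewrite lt_def z0 sqnorm_ge0.
have wp : 0 < sqnorm w by rewrite lt_def w0 sqnorm_ge0.
pose a := Num.sqrt (sqnorm z); pose b := Num.sqrt (sqnorm w).
have a0 : 0 < a by rewrite sqrtr_gt0.
have b0 : 0 < b by rewrite sqrtr_gt0.
have aE : sqnorm z = a ^+ 2 by rewrite sqr_sqrtr// sqnorm_ge0.
have bE : sqnorm w = b ^+ 2 by rewrite sqr_sqrtr// sqnorm_ge0.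
(* The optimal parameter, the ratio of the two norms, turns the weighted inequality into
   Cauchy-Schwarz. *)
have := normc_dot_le z w (divr_gt0 b0 a0); rewrite aE bE.
rewrite (_ : (_ + _) / 2 = a * b); last by field; rewrite !gt_eqF.
by rewrite -exprMn ler_pXn2r ?nnegrE ?normc_ge0// mulr_ge0 ?ltW.
Qed.

Definition dotl l h : C R := dot h l.

Lemma dotl_is_linear l : linear (dotl l).
Proof. by move=> c u v; rewrite /dotl dotDl dotZl. Qed.

HB.instance Definition _ l := GRing.isLinear.Build R[i] (Cn R n) (C R) *:%R (dotl l) (dotl_is_linear l).

Lemma dotl_continuous l : continuous (dotl l).
Proof.
move=> z; apply/continuous_epsP => e e0.
have l0 : 0 < sqnorm l + 1 by rewrite ltr_wpDl ?sqnorm_ge0.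
exists (e ^+ 2 / (sqnorm l + 1)); first by rewrite divr_gt0// exprn_gt0.
move=> w; rewrite ltr_pdivlMr// => hw.
rewrite /dotl -dotBl -(@ltr_pXn2r _ 2)// ?nnegrE ?normc_ge0 ?(ltW e0)//.
apply: le_lt_trans (normc_dot_sqr _ _) _; apply: le_lt_trans hw.
by rewrite ler_wpM2l ?sqnorm_ge0// lerDl.
Qed.

(** The factor 4 comes from using the open ball of radius [2 r]: a vector of norm [r] is not in the
    open ball of radius [r]. *)
Lemma mx_norm_sqnorm h : exists r : R, [/\ 0 <= r, `|h| = (r%:C)%C & sqnorm h <= 4 * n%:R * r ^+ 2].
Proof.
have : 0 <= `|h| by exact: normr_ge0.
case E : (`|h|) => [r i]; rewrite lecE /= => /andP[/eqP i0 r0].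
rewrite i0 in E *; exists r; split=> //.
move: r0; rewrite le_eqVlt => /orP[/eqP r0|r0].
  have /eqP : `|h| = 0 by rewrite E -r0.
  by rewrite normr_eq0 => /eqP ->; rewrite sqnorm0 mulr_ge0// sqr_ge0.
have r2 : 0 < 2 * r by rewrite mulr_gt0.
have : ball 0 ((2 * r)%:C)%C h.
  by rewrite -ball_normE /ball_ /= sub0r normrN E ltcR mulr2n mulrDl mul1r ltrDl.
move=> /(sqnorm_mx_ball r2); rewrite sub0r sqnormN => /le_trans; apply.
by rewrite exprMn -natrX mulrCA mulrA.
Qed.

(** A quadratic remainder in the Euclidean norm suffices. The functions to which this is applied are
    built from exponentials, for which [normc_cexpB1B] provides such a remainder. *)
Lemma differentiable_of_bound f z l (K d : R) : 0 < d ->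
  (forall h, sqnorm h < d -> normc (f (z + h) - f z - dot h l) <= K * sqnorm h) ->
  differentiable f z.
Proof.
move=> d0 hK; apply/diffP => /=.
(* The differential is picked by choice among the maps with this property, so it is enough to
   exhibit one. *)
apply: (@getPex _ (fun (df : {linear (Cn R n) -> (C R)}) => continuous df /\
  forall y, f y = f (lim (nbhs z)) + df (y - lim (nbhs z))
                  +o_(y \near z) (y - lim (nbhs z)))).
exists (dotl l : {linear (Cn R n) -> (C R)}); split; first exact: dotl_continuous.
rewrite lim_id //.
suff H : f = (fun y => f z + dotl l (y - z)) +o_ (nbhs z) (fun y => y - z).
  by move=> y; rewrite {1}H.
apply/eqaddoP => _ /posc_real[e e0 ->].
pose c := 4 * n%:R * (`|K| + 1) + 1.
have c0 : 0 < c by rewrite ltr_wpDl// !mulr_ge0.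
pose r1 := Num.sqrt (d / (4 * n%:R + 1)).
have n0 : 0 < 4 * n%:R + 1 :> R by rewrite ltr_wpDl// mulr_ge0.
have r10 : 0 < r1 by rewrite sqrtr_gt0 divr_gt0.
apply: (nbhs_ballP z _).2; exists ((Num.min r1 (e / c))%:C)%C.
  by rewrite /= ltcR lt_min r10 divr_gt0.
move=> y; rewrite -ball_normE /ball_ /= distrC.
have [r [r0 -> hr]] := mx_norm_sqnorm (y - z).
rewrite ltcR lt_min => /andP[rr1 rc].
have hs : sqnorm (y - z) < d.
  apply: le_lt_trans hr _.
  have : (4 * n%:R + 1) * r ^+ 2 < d.
    rewrite mulrC -ltr_pdivlMr//.
    have -> : d / (4 * n%:R + 1) = r1 ^+ 2 by rewrite sqr_sqrtr// divr_ge0 ?ltW.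
    by rewrite ltr_pXn2r ?nnegrE// ltW.
  apply: le_lt_trans; rewrite ler_wpM2r ?sqr_ge0// lerDl//.
have := hK _ hs; rewrite [z + _]addrC subrK => hb.
rewrite norm_normc -rmorphM lecR /= -[X in normc X]/(f y - (f z + dot (y - z) l)) opprD addrA.
apply: le_trans hb _; apply: le_trans (ler_wpM2r (sqnorm_ge0 _) (ler_norm K)) _.
apply: le_trans (ler_wpM2l (normr_ge0 K) hr) _.
rewrite expr2 !mulrA ler_wpM2r//; move/ltW: rc; rewrite ler_pdivlMr//; apply: le_trans.
rewrite mulrC ler_wpM2l// /c.
have : 0 <= 4 * n%:R :> R by rewrite mulr_ge0.
rewrite -mulrA mulrC mulrDr mulr1; lra.
Qed.

Lemma entire_continuous f : entire f -> continuous f.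
Proof. by move=> ef z; apply: differentiable_continuous; exact: ef. Qed.

Lemma entire_cmfun f : entire f -> cmfun f.
Proof. by move=> /entire_continuous; exact: cmfun_continuous. Qed.

Lemma entire_cexp_dot (c : C R) l : entire (fun z => cexp (c * dot z l)).
Proof.
move=> z; pose c' := normc c.
pose M := 4 * (c' ^+ 2 * (sqnorm l * expR (c' * (1 + sqnorm l)))).
apply: (@differentiable_of_bound _ z ((c * cexp (c * dot z l))^*%C *: l)
   (normc (cexp (c * dot z l)) * M) 1) => // h h1.
rewrite dotZr conjcK dotDl mulrDr cexpD.
rewrite (_ : _ - _ - _ = cexp (c * dot z l) * (cexp (c * dot h l) - 1 - c * dot h l)); last first.
  by ring.
rewrite normcM -mulrA ler_wpM2l ?normc_ge0//.
apply: le_trans (normc_cexpB1B _) _; rewrite /M -[leRHS]mulrA ler_wpM2l//.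
have q2 : normc (c * dot h l) ^+ 2 <= c' ^+ 2 * (sqnorm l * sqnorm h).
  by rewrite normcM exprMn ler_wpM2l ?sqr_ge0// mulrC normc_dot_sqr.
have q1 : normc (c * dot h l) <= c' * (1 + sqnorm l).
  rewrite normcM ler_wpM2l ?normc_ge0//; apply: le_trans (normc_dot_le1 _ _) _.
  by have := sqnorm_ge0 l; lra.
have e1 : expR (normc (c * dot h l)) <= expR (c' * (1 + sqnorm l)) by rewrite ler_expR.
apply: le_trans (ler_pM (sqr_ge0 _) (expR_ge0 _) q2 e1) _.
by rewrite le_eqVlt; apply/orP; left; apply/eqP; ring.
Qed.

Lemma entireM f g : entire f -> entire g -> entire (fun z => f z * g z).
Proof. by move=> ef eg z; apply: differentiableM; [exact: ef|exact: eg]. Qed.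

Lemma entireD f g : entire f -> entire g -> entire (fun z => f z + g z).
Proof. by move=> ef eg z; apply: differentiableD; [exact: ef|exact: eg]. Qed.

Lemma entireZ (c : C R) f : entire f -> entire (fun z => c * f z).
Proof. by move=> ef; apply: entireM => // z; exact: differentiable_cst. Qed.

Lemma entire_comp_affine f (c : C R) z0 : entire f -> entire (fun z => f (z0 + c *: z)).
Proof.
move=> ef z; apply: (@differentiable_comp _ _ _ _ (fun z : Cn R n => z0 + c *: z) f); last exact: ef.
apply: differentiableD; first exact: differentiable_cst.
by apply: differentiableZ; exact: ex_diff.
Qed.

End Differentiability.

(** * Gaussian mean values and the reproducing formula *)

Section MeanValue.
Context {R : realType} {n : nat}.
Implicit Types (phi F : Cn R n -> C R) (z w v : Cn R n) (s t a : R).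
Local Notation L := (@lebC R n).
Local Notation Re := (@complex.Re R).

Lemma measurable_gaussian_linear (a : R) v :
  measurable_fun setT (fun w : Cn R n => expR (- (a * sqnorm w) + Re (dot w v))).
Proof.
apply: measurable_expR_comp; apply: measurable_funD.
  apply: measurable_funN; apply: measurable_funM => //.
  by apply: measurable_sqnorm; exact: measurable_id.
by case: (cmfun_dot (@measurable_id _ (Cn R n) setT) (measurable_cst v)).
Qed.

Lemma integral_scaled_gaussian (K a : R) v : 0 < a -> 0 <= K ->
  (\int[L]_w (K * expR (- (a * sqnorm w) + Re (dot w v)))%:E =
   (K * ((pi / a) ^+ n * expR (sqnorm v / (4 * a))))%:E)%E.
Proof.
move=> a0 K0; under eq_integral do rewrite EFinM.
rewrite ge0_integralZl// ?integral_gaussian_linear// -?EFinM//.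
by apply/measurable_EFinP; exact: measurable_gaussian_linear.
Qed.

Lemma cL1_gaussian_dom F (K a : R) v : 0 < a -> cmfun F ->
  (forall w, normc (F w) <= K * expR (- (a * sqnorm w) + Re (dot w v))) -> cL1 L F.
Proof.
move=> a0 mF hF.
have K0 : 0 <= K.
  by have := le_trans (normc_ge0 _) (hF 0); rewrite pmulr_lge0// expR_gt0.
apply: (cL1_dom (g := fun w => K * expR (- (a * sqnorm w) + Re (dot w v)))) => //.
  by apply: measurable_funM => //; exact: measurable_gaussian_linear.
by rewrite integral_scaled_gaussian// ltry.
Qed.

Lemma measurable_gauss_density_Cn s : measurable_fun setT (@gauss_density R n s).
Proof. by apply/measurable_CnE; exact: measurable_gauss_density. Qed.

Lemma cmfun_gauss s F : cmfun F -> cmfun (fun w => (gauss_density s w)%:C%C * F w).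
Proof.
by move=> mF; apply: cmfunM => //; apply: cmfunR; exact: measurable_gauss_density_Cn.
Qed.

(** The Gaussian integral is unchanged when [phi] is rotated. Averaging over all angles and
    exchanging the integrals replaces [phi] by its mean over circles, which is [phi 0]. *)
Theorem gauss_mean_value phi s : entire phi ->
  cL1 L (fun w => (gauss_density s w)%:C%C * phi w) ->
  (0 < s) -> cint L (fun w => (gauss_density s w)%:C%C * phi w) = phi 0.
Proof.
move=> ephi Lphi s0.
pose lam := @lebesgue_measure R.
pose g w : C R := (gauss_density s w)%:C%C * phi w.
pose u (y : R) : C R := cexp (0 +i* y)%C.
have nu y : normc (u y) = 1 by rewrite normc_cexp expR0.
have pi2 : 0 <= 2 * pi :> R by rewrite mulr_ge0// pi_ge0.
have gu y w : g (u y *: w) = (gauss_density s w)%:C%C * phi (u y *: w).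
  by rewrite /g /gauss_density sqnormZ nu expr1n mul1r.
pose f (p : measurableTypeR R * Cn R n) : C R := (itv_ind 0 (2 * pi) p.1)%:C%C * g (u p.1 *: p.2).
have mu : cmfun (u : measurableTypeR R -> C R).
  by apply: cmfun_cexp; split; [exact: measurable_cst|exact: measurable_id].
have mg : cmfun g by case: Lphi.
have mf : cmfun f.
  apply: cmfunM.
    apply: cmfunR; exact: (measurableT_comp (@measurable_itv_ind R 0 (2 * pi)) measurable_fst).
  apply: (@cmfun_comp _ _ _ _ _ (fun p : measurableTypeR R * Cn R n => u p.1 *: p.2) g) => //.
  apply: measurable_CnZ; last exact: measurable_snd.
  exact: (@cmfun_comp _ _ _ _ _ (fun p : measurableTypeR R * Cn R n => p.1) u measurable_fst mu).
have inv y : cint L (fun w => g (u y *: w)) = cint L g.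
  by apply: (cint_mpres (h := fun w => u y *: w)) => //; exact: mpres_unit.
have Linv y : cL1 L (fun w => g (u y *: w)).
  by apply: (cL1_mpres (h := fun w => u y *: w)) => //; exact: mpres_unit.
have h2 y : cL1 L (fun w => f (y, w)) := cL1Z (itv_ind 0 (2 * pi) y)%:C%C (Linv y).
have h1 w : cL1 lam (fun y => f (y, w)).
  apply: cL1_ext (cL1Z (gauss_density s w)%:C%C (locally_cL1_circle w ephi 0 0 (2 * pi))) => y.
  by rewrite /f /= gu mulrCA.
have fin : (\int[lam]_y \int[L]_w (normc (f (y, w)))%:E < +oo)%E.
  have E y : (\int[L]_w (normc (f (y, w)))%:E =
      (itv_ind 0 (2 * pi) y * fine (\int[L]_w (normc (g w))%:E))%:E)%E.
    under eq_integral do rewrite /f /= normcM normcR ger0_norm ?itv_ind_ge0// EFinM.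
    rewrite ge0_integralZl//.
    - rewrite EFinM fineK; last first.
        rewrite ge0_fin_numE; first by case: Lphi.
        by apply: integral_ge0 => w _; rewrite lee_fin normc_ge0.
      congr (_ * _)%E.
      apply: (proj2 (mpres_unit n (nu y)) (fun w => (normc (g w))%:E)).
        by apply/measurable_EFinP; exact: measurable_normc.
      by move=> w; rewrite lee_fin normc_ge0.
    - by apply/measurable_EFinP; apply: measurable_normc; case: (Linv y).
    - by move=> w _; rewrite lee_fin normc_ge0.
    - by rewrite lee_fin itv_ind_ge0.
  under eq_integral do rewrite E.
  rewrite integral_itv_ind ?ltry// fine_ge0//.
  by apply: integral_ge0 => w _; rewrite lee_fin normc_ge0.
have := cint_fubini mf h2 h1 fin.
have -> : cint lam (fun y => cint L (fun w => f (y, w))) = cint L g * (2 * pi)%:C%C.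
  rewrite (_ : (fun y => _) = (fun y : measurableTypeR R => (itv_ind 0 (2 * pi) y)%:C%C * cint L g)).
    by rewrite -[LHS]/(cintR (fun=> cint L g) 0 (2 * pi)) cintR_cst// subr0.
  by apply/funext => y; rewrite /f /= (cintZ _ (Linv y)) inv.
have -> : cint L (fun w => cint lam (fun y => f (y, w))) = (phi 0 * (2 * pi)%:C%C) * cint L (fun w => (gauss_density s w)%:C%C).
  rewrite -cintZ.
    apply: eq_cint => w; rewrite mulrC -(circle_mean_value w ephi) /cintR -cintZ.
      by apply: eq_cint => y; rewrite /f /= gu mulrCA.
    exact: (locally_cL1_circle w ephi 0 0 (2 * pi)).
  split; first by apply: cmfunR; exact: measurable_gauss_density_Cn.
  under eq_integral do rewrite normcR ger0_norm ?gauss_density_ge0//.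
  rewrite ge0_integral_lebC; first by rewrite integral_gauss_density// ltry.
    by apply/measurable_EFinP; exact: measurable_gauss_density_Cn.
  by move=> x; rewrite lee_fin gauss_density_ge0.
have -> : cint L (fun w => (gauss_density s w)%:C%C) = 1.
  apply: complex_eqP; rewrite /cint /= /Rintegral; last by rewrite integral0.
  rewrite ge0_integral_lebC; first by rewrite integral_gauss_density.
    by apply/measurable_EFinP; exact: measurable_gauss_density_Cn.
  by move=> x; rewrite lee_fin gauss_density_ge0.
have p0 : (2 * pi)%:C%C != 0 :> C R.
  by apply/eqP => -[] /eqP; rewrite mulf_eq0 pnatr_eq0/= gt_eqF// pi_gt0.
by rewrite mulr1 => /(mulIf p0).
Qed.

(** Translating by [z] turns the integrand into the centred Gaussian times
    [phi (z + w) * cexp (- dot w z / s)], an entire function of [w] with value [phi z] at 0. *)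
Theorem reproducing phi s z : entire phi -> 0 < s ->
  cL1 L (fun w => (gauss_density s w)%:C%C * (phi w * cexp (dot z w / s%:C%C))) ->
  cint L (fun w => (gauss_density s w)%:C%C * (phi w * cexp (dot z w / s%:C%C))) = phi z.
Proof.
move=> ephi s0 hL.
have E w : (gauss_density s (w + z))%:C%C * (phi (w + z) * cexp (dot z (w + z) / s%:C%C)) =
   (gauss_density s w)%:C%C * (phi (z + (1 : C R) *: w) * cexp (- (s^-1)%:C%C * dot w z)).
  rewrite scale1r [z + w]addrC ![phi _ * _]mulrC !mulrA; congr (_ * _).
  rewrite !gauss_densityE// !rmorphM /= -!mulrA; congr (_ * _).
  rewrite -!cexpR -!cexpD; congr cexp.
  rewrite sqnormD dotDr dotzz realCV; apply: complex_eqP.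
    by rewrite !(ReD, ImD, ReM, ImM, ReN, ImN) /= (Re_dotC w z); ring.
  rewrite !(ReD, ImD, ReM, ImM, ReN, ImN) /=.
  by rewrite -(conj_dot z w); case: (dot z w) => x y /=; ring.
rewrite -(cint_mpres (mpres_shift z)); last by case: hL.
rewrite (eq_cint _ E) gauss_mean_value//.
- by rewrite scaler0 addr0 dot0l mulr0 cexp0 mulr1.
- apply: entireM; first exact: entire_comp_affine.
  exact: entire_cexp_dot.
- by have := cL1_mpres (mpres_shift z) hL; apply: cL1_ext.
Qed.

End MeanValue.

(** * Fock norms and Gaussian convolutions *)

Section Projection.
Context {R : realType} {n : nat}.
Implicit Types (phi F : Cn R n -> C R) (z w v h : Cn R n) (s t a M : R).
Local Notation L := (@lebC R n).
Local Notation Re := (@complex.Re R).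

(** Every norm in question depends on [F] through this function alone: for finite exponents, the
    Gaussian of mu_{2t/p} is the [p]-th power of [weight t] up to a constant. *)
Definition wmod t F z : R := normc (F z) * weight t z.

Definition Pt t F z : C R :=
  cint L (fun w => (gauss_density t w)%:C%C * (F w * cexp (dot z w / t%:C%C))).

Lemma weight_gt0 t z : 0 < weight t z. Proof. exact: expR_gt0. Qed.

Lemma wmod_ge0 t F z : 0 <= wmod t F z.
Proof. by rewrite mulr_ge0 ?normc_ge0// ltW ?weight_gt0. Qed.

Lemma measurable_weight t : measurable_fun setT (@weight R n t).
Proof.
apply: measurable_expR_comp; apply: measurable_funM => //; apply: measurable_funN.
by apply: measurable_sqnorm; exact: measurable_id.
Qed.

Lemma measurable_wmod t F : cmfun F -> measurable_fun setT (wmod t F).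
Proof. by move=> mF; apply: measurable_funM; [exact: measurable_normc|exact: measurable_weight]. Qed.

Lemma cmfun_kernel t F z : cmfun F ->
  cmfun (fun w => (gauss_density t w)%:C%C * (F w * cexp (dot z w / t%:C%C))).
Proof.
move=> mF; apply: cmfun_gauss; apply: cmfunM => //; apply: cmfun_cexp.
apply: cmfunM; last exact: cmfun_cst.
by apply: cmfun_dot; [exact: measurable_cst|exact: measurable_id].
Qed.

(** Weighted on both sides, the Bergman kernel is in modulus a Gaussian of [z - w]. All bounds on
    Toeplitz operators thus become bounds on convolutions. *)
Lemma normc_kernel t F z w : 0 < t ->
  normc ((gauss_density t w)%:C%C * (F w * cexp (dot z w / t%:C%C))) * weight t z =
  (pi * t) ^- n * (expR (- ((2 * t)^-1 * sqnorm (z - w))) * wmod t F w).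
Proof.
move=> t0; rewrite !normcM normcR ger0_norm ?gauss_density_ge0// gauss_densityE//.
rewrite normc_cexp /wmod /weight !realCV [dot z w * _]mulrC mulRC_Re sqnormB.
rewrite -!mulrA; congr (_ * _).
rewrite mulrCA [RHS]mulrCA; congr (_ * _).
rewrite -!expRD; congr expR.
by field; rewrite gt_eqF.
Qed.

Lemma cL1_kernel t F z M : 0 < t -> cmfun F -> (forall w, wmod t F w <= M) ->
  cL1 L (fun w => (gauss_density t w)%:C%C * (F w * cexp (dot z w / t%:C%C))).
Proof.
move=> t0 mF hM.
have a0 : 0 < (2 * t)^-1 by rewrite invr_gt0 mulr_gt0.
apply: (cL1_gaussian_dom (K := (pi * t) ^- n * M) (v := (t^-1)%:C%C *: z) a0).
  exact: cmfun_kernel.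
move=> w; rewrite -(ler_pM2r (weight_gt0 t z)) normc_kernel// -!mulrA.
rewrite ler_wpM2l ?invr_ge0 ?exprn_ge0 ?mulr_ge0 ?pi_ge0 ?(ltW t0)//.
rewrite mulrC; apply: le_trans (ler_wpM2r (expR_ge0 _) (hM w)) _.
have M0 : 0 <= M by apply: le_trans (hM 0); exact: wmod_ge0.
rewrite ler_wpM2l// /weight -expRD ler_expR dotZr conjc_real mulRC_Re sqnormB (Re_dotC w z).
by rewrite le_eqVlt; apply/orP; left; apply/eqP; field; rewrite gt_eqF.
Qed.

Lemma fock_projectionE t F : cmfun F -> fock_projection t F = Pt t F.
Proof.
move=> mF; apply/funext => z; rewrite /fock_projection cintegral_gauss//.
apply: cmfunM => //; apply: cmfun_cexp; apply: cmfunM; last exact: cmfun_cst.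
by apply: cmfun_dot; [exact: measurable_cst|exact: measurable_id].
Qed.

Lemma Pt_entire_id t phi M : 0 < t -> entire phi -> (forall w, wmod t phi w <= M) ->
  Pt t phi = phi.
Proof.
move=> t0 ephi hM; apply/funext => z; apply: reproducing => //.
by apply: cL1_kernel hM => //; exact: entire_cmfun.
Qed.

(** Differentiation under the integral, by expanding the exponential to second order in [h]. Half of
    the Gaussian decay in [kb] is set aside to absorb the growth in [w] of the coefficients and of
    the remainder. *)
Lemma entire_Pt t F M : 0 < t -> cmfun F -> (forall w, wmod t F w <= M) -> entire (Pt t F).
Proof.
move=> t0 mF hM z.
pose k w : C R := (gauss_density t w)%:C%C * (F w * cexp (dot z w / t%:C%C)).
pose G w : R := expR (- ((4 * t)^-1 * sqnorm w) + Re (dot w ((t^-1)%:C%C *: z))).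
have a0 : 0 < (4 * t)^-1 by rewrite invr_gt0 mulr_gt0.
have M0 : 0 <= M by apply: le_trans (hM 0); exact: wmod_ge0.
have c0 : 0 <= (pi * t) ^- n by rewrite invr_ge0 exprn_ge0 ?mulr_ge0 ?pi_ge0 ?(ltW t0).
have mk : cmfun k by exact: cmfun_kernel.
have kb w : normc (k w) <= (pi * t) ^- n * M * (G w * expR (- ((4 * t)^-1 * sqnorm w))).
  rewrite -(ler_pM2r (weight_gt0 t z)) normc_kernel// -!mulrA.
  rewrite ler_wpM2l// mulrC; apply: le_trans (ler_wpM2r (expR_ge0 _) (hM w)) _.
  rewrite ler_wpM2l// /weight -!expRD ler_expR dotZr conjc_real mulRC_Re sqnormB (Re_dotC w z).
  by rewrite le_eqVlt; apply/orP; left; apply/eqP; field; rewrite gt_eqF.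
have xe (x : R) : x <= expR x by apply: le_trans (expR_ge1Dx x); rewrite lerDr.
have Lk (q : Cn R n -> C R) (B : R) : cmfun q ->
    (forall w, normc (q w) <= B * expR ((4 * t)^-1 * sqnorm w)) -> cL1 L (fun w => k w * q w).
  move=> mq hq; apply: (cL1_gaussian_dom (K := (pi * t) ^- n * M * B) (v := (t^-1)%:C%C *: z) a0).
    exact: cmfunM.
  move=> w; rewrite normcM -/(G w); apply: le_trans (ler_pM _ _ (kb w) (hq w)) _;
    rewrite ?normc_ge0//.
  rewrite (_ : _ * _ * (_ * _) * _ = (pi * t) ^- n * M * B * G w *
     (expR (- ((4 * t)^-1 * sqnorm w)) * expR ((4 * t)^-1 * sqnorm w))); last by ring.
  by rewrite -expRD addNr expR0 mulr1.
have mcoord j : cmfun (fun w : Cn R n => (w ord0 j)^*%C * (t^-1)%:C%C).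
  apply: cmfunM; last exact: cmfun_cst.
  by apply: cmfun_conj; apply: cmfun_coord; exact: measurable_id.
have Lj j : cL1 L (fun w => k w * ((w ord0 j)^*%C * (t^-1)%:C%C)).
  apply: (Lk _ ((1 + 4 * t) * t^-1)) => // w.
  rewrite normcM normc_conj normcR ger0_norm ?invr_ge0 ?(ltW t0)//.
  rewrite mulrAC ler_wpM2r ?invr_ge0 ?(ltW t0)//.
  have h1 : normc (w ord0 j) <= 1 + sqnorm w.
    have := normc_coord_le w j; have := sqr_ge0 (normc (w ord0 j) - 1).
    move: (normc _) => x; have : 0 <= x ^+ 2 by exact: sqr_ge0.
    nra.
  apply: le_trans h1 _; rewrite mulrDl mul1r lerD//.
    rewrite -[leLHS]expR0 ler_expR mulr_ge0 ?sqnorm_ge0// ltW//.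
  rewrite -ler_pdivrMl ?mulr_gt0//.
pose l : Cn R n := \row_j (cint L (fun w => k w * ((w ord0 j)^*%C * (t^-1)%:C%C)))^*%C.
pose q h w : C R := dot h w * (t^-1)%:C%C.
have hl h : dot h l = cint L (fun w => k w * q h w).
  rewrite /dot (eq_bigr (fun j => cint L (fun w => h ord0 j * (k w * ((w ord0 j)^*%C * (t^-1)%:C%C))))).
    rewrite -cint_sum; last by move=> j; exact: cL1Z.
    apply: eq_cint => w; rewrite /q /dot mulr_suml mulr_sumr; apply: eq_bigr => j _; ring.
  by move=> j _; rewrite mxE conjcK cintZ.
have Lq h : cL1 L (fun w => k w * q h w).
  apply: cL1_ext (cL1_sum (index_enum 'I_n) (fun j => cL1Z (h ord0 j) (Lj j))) => w.
  by rewrite /q /dot mulr_suml mulr_sumr; apply: eq_bigr => j _; ring.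
(* The factor 4 is that of [normc_cexpB1B]. The bounds [e1] on the exponential and [e2] on the
   square each spend a factor [expR ((8 * t)^-1 * sqnorm w)], which together is exactly the reserve
   of [kb]. *)
pose B' := 4 * (8 / t * expR (2 / t)).
have hq h w : sqnorm h < 1 ->
    normc (cexp (q h w) - 1 - q h w) <= B' * sqnorm h * expR ((4 * t)^-1 * sqnorm w).
  move=> h1; apply: le_trans (normc_cexpB1B _) _; rewrite /B' -2!mulrA ler_wpM2l//.
  have e1 : expR (normc (q h w)) <= expR (2 / t) * expR ((8 * t)^-1 * sqnorm w).
    rewrite -expRD ler_expR /q normcM normcR ger0_norm ?invr_ge0 ?(ltW t0)//.
    have hd := @normc_dot_le R n 4 h w (ltr0Sn R 3).
    have := ler_wpM2r (_ : 0 <= t^-1) hd; rewrite invr_ge0 ltW// => /(_ isT) /le_trans; apply.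
    rewrite (_ : (4 * sqnorm h + sqnorm w / 4) / 2 * t^-1 = (4 * sqnorm h / 2) / t + (8 * t)^-1 * sqnorm w); last first.
      by field; rewrite gt_eqF.
    by rewrite lerD2r ler_wpM2r ?invr_ge0 ?(ltW t0)//; lra.
  have e2 : normc (q h w) ^+ 2 <= sqnorm h * (8 / t * expR ((8 * t)^-1 * sqnorm w)).
    rewrite /q normcM exprMn normcR ger0_norm ?invr_ge0 ?(ltW t0)//.
    apply: le_trans (ler_wpM2r (sqr_ge0 _) (normc_dot_sqr h w)) _.
    rewrite -[leLHS]mulrA ler_wpM2l ?sqnorm_ge0//.
    rewrite (_ : sqnorm w * _ = 8 / t * ((8 * t)^-1 * sqnorm w)); last first.
      by field; rewrite gt_eqF.
    by rewrite ler_wpM2l ?xe// divr_ge0// ltW.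
  apply: le_trans (ler_pM (sqr_ge0 _) (expR_ge0 _) e2 e1) _.
  have -> : (4 * t)^-1 * sqnorm w = (8 * t)^-1 * sqnorm w + (8 * t)^-1 * sqnorm w.
    by field; rewrite gt_eqF.
  by rewrite expRD le_eqVlt; apply/orP; left; apply/eqP; ring.
apply: (@differentiable_of_bound _ _ _ z l ((pi * t) ^- n * M * B' *
   ((pi / (4 * t)^-1) ^+ n * expR (sqnorm ((t^-1)%:C%C *: z) / (4 * (4 * t)^-1)))) 1) => // h h1.
have E : Pt t F (z + h) - Pt t F z - dot h l = cint L (fun w => k w * (cexp (q h w) - 1 - q h w)).
  rewrite hl /Pt -cintB; [|exact: (cL1_kernel _ t0 mF hM)|exact: (cL1_kernel _ t0 mF hM)].
  rewrite -cintB//; last by apply: cL1B; exact: (cL1_kernel _ t0 mF hM).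
  apply: eq_cint => w; rewrite /k /q dotDl mulrDl cexpD -realCV; ring.
have B0 : 0 <= B' by rewrite mulr_ge0// mulr_ge0 ?expR_ge0// divr_ge0// ltW.
rewrite E -lee_fin.
have K0 : 0 <= (pi * t) ^- n * M * (B' * sqnorm h).
  by apply: mulr_ge0; apply: mulr_ge0 => //; exact: sqnorm_ge0.
have hb w : normc (k w * (cexp (q h w) - 1 - q h w)) <= (pi * t) ^- n * M * (B' * sqnorm h) * G w.
  rewrite normcM; apply: le_trans (ler_pM _ _ (kb w) (hq h w h1)) _; rewrite ?normc_ge0//.
  rewrite [leLHS](_ : _ = (pi * t) ^- n * M * (B' * sqnorm h) * G w *
     (expR (- ((4 * t)^-1 * sqnorm w)) * expR ((4 * t)^-1 * sqnorm w))); last by ring.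
  by rewrite -expRD addNr expR0 mulr1.
apply: le_trans (normc_cint_dom (g := fun w => (pi * t) ^- n * M * (B' * sqnorm h) * G w) _ _ hb _) _.
- apply: cmfunM => //; apply: cmfunB; last by case: (Lq h) => _ _; apply: cmfunM; [apply: cmfun_dot; [exact: measurable_cst|exact: measurable_id]|exact: cmfun_cst].
  apply: cmfunB; last exact: cmfun_cst.
  by apply: cmfun_cexp; apply: cmfunM; [apply: cmfun_dot; [exact: measurable_cst|exact: measurable_id]|exact: cmfun_cst].
- by apply: measurable_funM => //; exact: measurable_gaussian_linear.
- by rewrite integral_scaled_gaussian// ltry.
rewrite integral_scaled_gaussian// lee_fin le_eqVlt; apply/orP; left; apply/eqP; ring.
Qed.

End Projection.

(** * Fock norms in terms of the weighted modulus *)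

Section FockNorm.
Context {R : realType} {n : nat}.
Implicit Types (phi f g : Cn R n -> C R) (z w : Cn R n) (t M p A : R).
Local Notation L := (@lebC R n).

Lemma ae_lebCE (P : Cn R n -> Prop) :
  (\forall x \ae (@lebesgue_Cn R n), P (to_Cn x)) <-> (\forall z \ae L, P z).
Proof.
split=> -[N [mN N0 hN]].
  exists (@of_Cn R n @^-1` N); split.
  - by rewrite -[X in measurable X]setTI; exact: measurable_of_Cn.
  - rewrite -N0 /lebC /= /lebC0 /pushforward -comp_preimage.
    by congr (lebesgue_Cn n _); apply/seteqP; split=> x /=; rewrite to_CnK.
  - by move=> z /= hz; apply: hN; rewrite /= of_CnK.
by exists (@to_Cn R n @^-1` N); split=> // x hx; exact: hN.
Qed.

(** The infinity norm is an essential supremum only for a nonzero measure. A null measure could not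
    carry a Gaussian of mass 1. *)
Lemma lebesgue_Cn_gt0 : (0 < @lebesgue_Cn R n [set: n.-tuple (R2 R)])%E.
Proof.
rewrite lt_neqAle measure_ge0 andbT eq_sym; apply/eqP => h.
have := @integral_gauss_density R n 1 ltr01.
have mg : measurable_fun setT (fun x : n.-tuple (R2 R) => (gauss_density 1 (to_Cn x))%:E).
  by apply/measurable_EFinP; exact: measurable_gauss_density.
by rewrite (null_set_integral measurableT mg h) => -[] /eqP; rewrite eq_sym oner_eq0.
Qed.

(* [wbound k t Phi M] says that the norm of a function of weighted modulus
   [Phi] is at most [M]; see [fock_norm_leP]. *)
Definition wbound (k : fock_kind R) t (Phi : Cn R n -> R) M : Prop :=
  match k with
  | FockP p _ => (\int[L]_z (Phi z `^ p)%:E <= ((pi * (2 * t / p)) ^+ n * M `^ p)%:E)%E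
  | _ => \forall z \ae L, Phi z <= M
  end.

Lemma measurable_powR_comp (Phi : Cn R n -> R) p : measurable_fun setT Phi ->
  measurable_fun setT (fun z => Phi z `^ p).
Proof.
by move=> mPhi; apply: (measurableT_comp (f := (@powR R)^~ p)) => //; exact: measurable_powR.
Qed.

(** For finite [p], passing from mu_{2t/p} to Lebesgue measure multiplies the [p]-th power of the
    norm by [c], the inverse of the constant of the Gaussian density. *)
Lemma fock_norm_leP k t f M : 0 < t -> cmfun f -> 0 <= M ->
  (fock_norm k t f <= M%:E)%E <-> wbound k t (wmod t f) M.
Proof.
move=> t0 mf M0.
have sup_case : (Lnorm (lebesgue_Cn n) +oo%E (fun x : n.-tuple (R2 R) =>
     (normc (f (to_Cn x)) * weight t (to_Cn x))%:E) <= M%:E)%E <->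
     \forall z \ae L, wmod t f z <= M.
  rewrite unlock lebesgue_Cn_gt0; split=> [/ess_supP h|h].
    by apply/ae_lebCE; apply: filterS h => x /=; rewrite lee_fin => /(le_trans (ler_norm _)).
  apply/ess_supP; move/ae_lebCE : h; apply: filterS => x /=.
  by rewrite lee_fin ger0_norm//; exact: wmod_ge0.
case: k => [p p1| |] //=.
have p0 : 0 < p by exact: lt_le_trans p1.
have s0 : 0 < 2 * t / p by rewrite divr_gt0// mulr_gt0.
set c := (pi * (2 * t / p)) ^+ n.
have c0 : 0 < c by rewrite exprn_gt0// mulr_gt0// pi_gt0.
set F := fun x : n.-tuple (R2 R) => (normc (f (to_Cn x)))%:E.
have mn : measurable_fun setT (fun z : Cn R n => normc (f z)) by exact: measurable_normc.
have E : (c%:E * \int[gauss (2 * t / p)]_x (`|F x| `^ p) = \int[L]_z (wmod t f z `^ p)%:E)%E.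
  rewrite (eq_integral (fun x : n.-tuple (R2 R) => (normc (f (to_Cn x)) `^ p)%:E)); last first.
    by move=> x _; rewrite /F /= ger0_norm ?normc_ge0// poweR_EFin.
  have mp := measurable_powR_comp p mn.
  rewrite (ge0_integral_gauss _ (f := fun z => (normc (f z) `^ p)%:E)); last 2 first.
  - exact/measurable_EFinP.
  - by move=> z; rewrite lee_fin powR_ge0.
  have mg := @measurable_gauss_density_Cn R n (2 * t / p).
  rewrite -ge0_integralZl//; last 3 first.
  - by apply: emeasurable_funM; exact/measurable_EFinP.
  - by move=> z _; rewrite mule_ge0 ?lee_fin ?powR_ge0 ?gauss_density_ge0.
  - by rewrite lee_fin ltW.
  apply: eq_integral => z _; rewrite -!EFinM; congr (_%:E).
  rewrite /wmod powRM ?normc_ge0 ?(ltW (weight_gt0 _ _))// gauss_densityE// -/c.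
  rewrite mulrA mulrA mulfV ?gt_eqF// mul1r mulrC; congr (_ * _).
  rewrite /weight /powR gt_eqF ?expR_gt0// expRK; congr expR; field.
  by rewrite !gt_eqF.
have NE : (Lnorm (gauss (2 * t / p)) p%:E F `^ p = \int[gauss (2 * t / p)]_x (`|F x| `^ p))%E.
  by apply: powR_Lnorm; rewrite gt_eqF.
have N0 : (0 <= Lnorm (gauss (2 * t / p)) p%:E F)%E by exact: Lnorm_ge0.
have Mp : ((M%:E `^ p)%E = (M `^ p)%:E) by [].
rewrite -E -NE EFinM lee_pmul2l ?lte_fin// -Mp; split => h.
  by apply: gt0_ler_poweR => //; rewrite ?(ltW p0)// in_itv /= ?leey ?andbT.
have -> : Lnorm (gauss (2 * t / p)) p%:E F = ((Lnorm (gauss (2 * t / p)) p%:E F `^ p) `^ p^-1)%E.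
  by rewrite -poweRrM mulfV ?gt_eqF// poweRe1.
have -> : M%:E = ((M%:E `^ p) `^ p^-1)%E.
  by rewrite -poweRrM mulfV ?gt_eqF// poweRe1// lee_fin.
apply: gt0_ler_poweR => //; first by rewrite invr_ge0 ltW.
  by rewrite in_itv /= leey andbT poweR_ge0.
by rewrite in_itv /= leey andbT lee_fin powR_ge0.
Qed.

Lemma fock_norm_ge0 k t f : (0 <= fock_norm k t f)%E.
Proof. by case: k => [p p1| |]; exact: Lnorm_ge0. Qed.

End FockNorm.

(** * Young's inequality for convolutions *)

Section NormedConvolution.
Context {R : realType} {n : nat}.
Implicit Types (phi f : Cn R n -> C R) (z w : Cn R n) (t M p m : R) (Phi Psi : Cn R n -> R).
Local Notation L := (@lebC R n).

(** Clear below [m]; above [m], write [x] as [x^(1-p) x^p] and use that [x^(1-p)] decreases. Being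
    affine in [x^p], the bound can be integrated against any kernel and takes the place of Hoelder's
    inequality. *)
Lemma le_powR_split (x m p : R) : 0 <= x -> 0 < m -> 1 <= p -> x <= m + m `^ (1 - p) * x `^ p.
Proof.
move=> x0 m0 p1; have [xm|mx] := leP x m.
  by apply: le_trans xm _; rewrite lerDl mulr_ge0 ?powR_ge0.
have xp : 0 < x by exact: lt_trans mx.
apply: (@le_trans _ _ (m `^ (1 - p) * x `^ p)); last by rewrite lerDr ltW.
have -> : x = x `^ (1 - p) * x `^ p.
  rewrite -powRD; first by rewrite subrK powRr1.
  by rewrite (gt_eqF xp) implybT.
have -> : (x `^ (1 - p) * x `^ p) `^ p = x `^ p.
  rewrite -powRD; first by rewrite subrK powRr1.
  by rewrite (gt_eqF xp) implybT.
rewrite ler_wpM2r ?powR_ge0// -opprB !powRN lef_pV2 ?posrE ?powR_gt0//.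
by apply: ge0_ler_powR; rewrite ?nnegrE ?subr_ge0 ?(ltW mx) ?(ltW m0) ?(ltW xp).
Qed.

Variables (g : Cn R n -> R) (A : R).
Hypothesis mg : measurable_fun setT g.
Hypothesis g0 : forall z, 0 <= g z.
Hypothesis gA : (\int[L]_z (g z)%:E <= A%:E)%E.

Lemma kernel_mass_ge0 : 0 <= A.
Proof.
by rewrite -lee_fin; apply: le_trans gA; apply: integral_ge0 => z _; rewrite lee_fin.
Qed.

Lemma integral_reflect z : (\int[L]_w (g (z - w))%:E = \int[L]_w (g w)%:E)%E.
Proof.
apply: (proj2 (mpres_reflect z) (fun w => (g w)%:E)); first exact/measurable_EFinP.
by move=> w; rewrite lee_fin.
Qed.

Lemma integral_shift z : (\int[L]_w (g (w - z))%:E = \int[L]_w (g w)%:E)%E.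
Proof.
apply: (proj2 (mpres_shift (- z)) (fun w => (g w)%:E)); first exact/measurable_EFinP.
by move=> w; rewrite lee_fin.
Qed.

Lemma measurable_reflect z : measurable_fun setT (fun w : Cn R n => g (z - w)).
Proof.
apply: (measurableT_comp mg); apply: measurable_CnB; [exact: measurable_cst|exact: measurable_id].
Qed.

Definition gconv Phi z : \bar R := (\int[L]_w (g (z - w) * Phi w)%:E)%E.

Lemma gconv_split Phi z m p : measurable_fun setT Phi -> (forall w, 0 <= Phi w) ->
  0 < m -> 1 <= p ->
  (gconv Phi z <= (m * A)%:E + (m `^ (1 - p))%:E * gconv (fun w => (Phi w `^ p)%R) z)%E.
Proof.
move=> mPhi Phi0 m0 p1; have mr := measurable_reflect z.
have mP := measurable_powR_comp p mPhi.
apply: (@le_trans _ _ (\int[L]_w ((m * g (z - w))%:E + (m `^ (1 - p) * (g (z - w) * Phi w `^ p))%:E))%E).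
  apply: ge0_le_integral => //.
  - by move=> w _; rewrite lee_fin mulr_ge0.
  - by apply/measurable_EFinP; exact: measurable_funM.
  - by apply: emeasurable_funD; apply/measurable_EFinP; apply: measurable_funM => //; exact: measurable_funM.
  - move=> w _; rewrite -EFinD lee_fin.
    have := ler_wpM2l (g0 (z - w)) (le_powR_split (Phi0 w) m0 p1).
    rewrite mulrDr [g _ * m]mulrC; congr (_ <= _ + _); ring.
rewrite ge0_integralD//; last 4 first.
- by move=> w _; rewrite lee_fin mulr_ge0// ltW.
- by apply/measurable_EFinP; exact: measurable_funM.
- by move=> w _; rewrite lee_fin !mulr_ge0 ?powR_ge0.
- by apply/measurable_EFinP; apply: measurable_funM => //; exact: measurable_funM.
apply: leeD.
  under eq_integral do rewrite EFinM.
  rewrite ge0_integralZl//; last 3 first.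
  - exact/measurable_EFinP.
  - by move=> w _; rewrite lee_fin.
  - by rewrite lee_fin ltW.
  by rewrite integral_reflect EFinM lee_wpmul2l// lee_fin ltW.
under eq_integral do rewrite EFinM.
rewrite ge0_integralZl//.
- by apply/measurable_EFinP; exact: measurable_funM.
- by move=> w _; rewrite lee_fin mulr_ge0 ?powR_ge0.
- by rewrite lee_fin powR_ge0.
Qed.

Lemma gconv_ae_le Phi z M : measurable_fun setT Phi -> (forall w, 0 <= Phi w) -> 0 <= M ->
  (\forall w \ae L, Phi w <= M) -> (gconv Phi z <= (M * A)%:E)%E.
Proof.
move=> mPhi Phi0 M0 h; have mr := measurable_reflect z.
apply: (@le_trans _ _ (\int[L]_w (M%:E * (g (z - w))%:E))%E).
  apply: ae_ge0_le_integral => //.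
  - by move=> w _; rewrite lee_fin mulr_ge0.
  - by apply/measurable_EFinP; exact: measurable_funM.
  - by move=> w _; rewrite mule_ge0 ?lee_fin.
  - by apply: emeasurable_funM => //; exact/measurable_EFinP.
  - by apply: filterS h => w hw _; rewrite -EFinM lee_fin mulrC ler_wpM2r.
rewrite ge0_integralZl//; last 2 first.
- exact/measurable_EFinP.
- by move=> w _; rewrite lee_fin.
by rewrite integral_reflect EFinM lee_wpmul2l.
Qed.

Lemma integral_gconv Phi : measurable_fun setT Phi -> (forall w, 0 <= Phi w) ->
  (\int[L]_z gconv Phi z <= A%:E * \int[L]_w (Phi w)%:E)%E.
Proof.
move=> mPhi Phi0.
have m2 : measurable_fun setT (fun q : Cn R n * Cn R n => (g (q.1 - q.2) * Phi q.2)%:E).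
  apply/measurable_EFinP; apply: measurable_funM.
    apply: (measurableT_comp mg); apply: measurable_CnB; [exact: measurable_fst|exact: measurable_snd].
  exact: (measurableT_comp mPhi measurable_snd).
rewrite /gconv (fubini_tonelli (fun q : Cn R n * Cn R n => (g (q.1 - q.2) * Phi q.2)%:E)) //; last first.
  by move=> q; rewrite lee_fin mulr_ge0.
rewrite -ge0_integralZl//; last 3 first.
- exact/measurable_EFinP.
- by move=> w _; rewrite lee_fin.
- by rewrite lee_fin kernel_mass_ge0.
apply: ge0_le_integral => //.
- by move=> w _; apply: integral_ge0 => z _; rewrite lee_fin mulr_ge0.
- apply: (measurable_fun_fubini_tonelli_G (fun q : Cn R n * Cn R n => (g (q.1 - q.2) * Phi q.2)%:E)) => //.
  by move=> q; rewrite lee_fin mulr_ge0.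
- by apply: emeasurable_funM => //; exact/measurable_EFinP.
move=> w _ /=; under eq_integral do rewrite mulrC EFinM.
have ms : measurable_fun setT (fun z : Cn R n => g (z - w)).
  by apply: (measurableT_comp mg); apply: measurable_CnB; [exact: measurable_id|exact: measurable_cst].
rewrite ge0_integralZl//; last 3 first.
- exact/measurable_EFinP.
- by move=> z _; rewrite lee_fin.
- by rewrite lee_fin.
by rewrite integral_shift muleC lee_wpmul2r// lee_fin.
Qed.

Lemma measurable_gconv Phi : measurable_fun setT Phi -> (forall w, 0 <= Phi w) ->
  measurable_fun setT (gconv Phi).
Proof.
move=> mPhi Phi0.
apply: (measurable_fun_fubini_tonelli_F (fun q : Cn R n * Cn R n => (g (q.1 - q.2) * Phi q.2)%:E)) => //.
  apply/measurable_EFinP; apply: measurable_funM.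
    apply: (measurableT_comp mg); apply: measurable_CnB; [exact: measurable_fst|exact: measurable_snd].
  exact: (measurableT_comp mPhi measurable_snd).
by move=> q; rewrite lee_fin mulr_ge0.
Qed.

(* The convexity inequality [(g * Phi)^p <= |g|_1^(p-1) (g * Phi^p)] is replaced
   by the cruder bound with [(|g|_1 + 1)^p], which follows from [le_powR_split]
   with [m = (g * Phi) z / (|g|_1 + 1)]. *)
Lemma powR_gconv_le Phi Psi p z : measurable_fun setT Phi -> (forall w, 0 <= Phi w) ->
  0 <= Psi z -> 1 <= p -> ((Psi z)%:E <= gconv Phi z)%E ->
  ((Psi z `^ p)%:E <= ((A + 1) `^ p)%:E * gconv (fun w => (Phi w `^ p)%R) z)%E.
Proof.
move=> mPhi Phi0 Psi0 p1 h; have A0 := kernel_mass_ge0.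
have p0 : 0 < p by exact: lt_le_trans p1.
have A1 : 0 < A + 1 by rewrite ltr_wpDl.
set y := Psi z / (A + 1).
have PE : Psi z = (A + 1) * y by rewrite /y mulrC mulfVK// gt_eqF.
have y0 : 0 <= y by rewrite divr_ge0// ltW.
rewrite PE powRM ?(ltW A1)// EFinM lee_wpmul2l ?lee_fin ?powR_ge0//.
rewrite leNgt; apply/negP => hlt.
have J0 : (0 <= gconv (fun w => (Phi w `^ p)%R) z)%E.
  by apply: integral_ge0 => w _; rewrite lee_fin mulr_ge0 ?powR_ge0.
have yp : 0 < y.
  rewrite lt_def y0 andbT; apply: contraTneq hlt => ->.
  by rewrite powR0 ?gt_eqF// -leNgt.
have := le_trans h (gconv_split z mPhi Phi0 yp p1).
move: hlt J0; case: (gconv _ z) => [j| |]//= hlt j0.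
rewrite -EFinM -EFinD lee_fin PE; rewrite lte_fin in hlt.
apply/negP; rewrite -ltNge mulrDl mul1r [A * y]mulrC ltrD2l.
have e : y = y `^ (1 - p) * y `^ p.
  rewrite -powRD; first by rewrite subrK powRr1.
  by rewrite (gt_eqF yp) implybT.
by rewrite [ltRHS]e ltr_pM2l ?powR_gt0.
Qed.

(** Young's inequality with one constant for all exponents: [A (A + 1)^p <= (A + 1)^(2 p)] because
    [p >= 1], and [A <= (A + 1)^2] in the supremum case. *)
Lemma wbound_gconv k t Phi Psi M : 0 < t -> 0 <= M ->
  measurable_fun setT Phi -> measurable_fun setT Psi ->
  (forall w, 0 <= Phi w) -> (forall w, 0 <= Psi w) ->
  (forall z, (Psi z)%:E <= gconv Phi z)%E ->
  wbound k t Phi M -> wbound k t Psi ((A + 1) ^+ 2 * M).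
Proof.
move=> t0 M0 mPhi mPsi Phi0 Psi0 h; have A0 := kernel_mass_ge0.
have A1 : 0 < A + 1 by rewrite ltr_wpDl.
have sup_case : (\forall z \ae L, Phi z <= M) -> \forall z \ae L, Psi z <= (A + 1) ^+ 2 * M.
  move=> hM; apply: aeW => z; rewrite -lee_fin; apply: le_trans (h z) _.
  apply: le_trans (gconv_ae_le z mPhi Phi0 M0 hM) _.
  by rewrite lee_fin mulrC ler_wpM2r//; nra.
case: k => [p p1| |] //= hM.
have p0 : 0 < p by exact: lt_le_trans p1.
set c := (pi * (2 * t / p)) ^+ n in hM *.
have c0 : 0 <= c by rewrite exprn_ge0// mulr_ge0 ?pi_ge0// divr_ge0 ?mulr_ge0 ?ltW.
have mP := measurable_powR_comp p mPhi.
have mG := measurable_gconv mP (fun w => powR_ge0 (Phi w) p).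
apply: (@le_trans _ _ (\int[L]_z (((A + 1) `^ p)%:E * gconv (fun w => (Phi w `^ p)%R) z))%E).
  apply: ge0_le_integral => //.
  - by move=> z _; rewrite lee_fin powR_ge0.
  - by apply/measurable_EFinP; exact: measurable_powR_comp.
  - exact: emeasurable_funM.
  - by move=> z _; exact: powR_gconv_le.
rewrite ge0_integralZl//; last 2 first.
- by move=> z _; apply: integral_ge0 => w _; rewrite lee_fin mulr_ge0 ?powR_ge0.
- by rewrite lee_fin powR_ge0.
apply: le_trans (lee_wpmul2l _ (le_trans (integral_gconv mP (fun w => powR_ge0 (Phi w) p)) (lee_wpmul2l _ hM))) _.
- by rewrite lee_fin powR_ge0.
- by rewrite lee_fin.
rewrite -!EFinM lee_fin powRM ?exprn_ge0 ?(ltW A1)//.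
rewrite expr2 powRM ?(ltW A1)//.
rewrite (_ : (A + 1) `^ p * (A * (c * M `^ p)) = c * (A * (A + 1) `^ p * M `^ p)); last by ring.
rewrite ler_wpM2l// ler_wpM2r ?powR_ge0// ler_wpM2r ?powR_ge0//.
apply: (@le_trans _ _ (A + 1)); first by rewrite lerDl.
by apply: le1r_powR => //; rewrite lerDr.
Qed.

(** Splitting at [m = M], the first term uses the mass of the kernel and the second that it is at
    most 1. This is where an integral bound becomes a pointwise one. *)
Lemma gconv_wbound_le k t Phi M z : 0 < t -> 0 < M -> (forall z, g z <= 1) ->
  measurable_fun setT Phi -> (forall w, 0 <= Phi w) -> wbound k t Phi M ->
  (gconv Phi z <= (M * (A + (pi * (2 * t / (if k is FockP p _ then p else 1))) ^+ n))%:E)%E.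
Proof.
move=> t0 M0 g1 mPhi Phi0; have A0 := kernel_mass_ge0.
have sup_case : (\forall z \ae L, Phi z <= M) -> (gconv Phi z <= (M * (A + (pi * (2 * t / 1)) ^+ n))%:E)%E.
  move=> hM; apply: le_trans (gconv_ae_le z mPhi Phi0 (ltW M0) hM) _.
  rewrite lee_fin ler_wpM2l ?(ltW M0)// lerDl exprn_ge0// mulr_ge0 ?pi_ge0//.
  by rewrite divr_ge0// mulr_ge0// ltW.
case: k => [p p1| |] //= hM.
have p0 : 0 < p by exact: lt_le_trans p1.
have mP := measurable_powR_comp p mPhi.
apply: le_trans (gconv_split z mPhi Phi0 M0 p1) _.
set c := (pi * (2 * t / p)) ^+ n in hM *.
rewrite mulrDr EFinD leeD2l//.
have h1 : (gconv (fun w => (Phi w `^ p)%R) z <= (c * M `^ p)%:E)%E.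
  apply: le_trans hM; apply: ge0_le_integral => //.
  - by move=> w _; rewrite lee_fin mulr_ge0 ?powR_ge0.
  - by apply/measurable_EFinP; apply: measurable_funM => //; exact: measurable_reflect.
  - exact/measurable_EFinP.
  - by move=> w _; rewrite lee_fin ler_piMl ?powR_ge0.
apply: le_trans (lee_wpmul2l _ h1) _; first by rewrite lee_fin powR_ge0.
rewrite -EFinM lee_fin mulrCA mulrC ler_wpM2r//.
  by rewrite exprn_ge0// mulr_ge0 ?pi_ge0// divr_ge0 ?mulr_ge0 ?ltW.
rewrite -powRD ?subrK ?powRr1 ?(ltW M0)//.
by rewrite (gt_eqF M0) implybT.
Qed.

End NormedConvolution.

Lemma powR_cvg_seq {R : realType} (u : nat -> R) (l p : R) : 0 < p -> (forall j, 0 <= u j) ->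
  u @ \oo --> l -> (fun j => u j `^ p) @ \oo --> l `^ p.
Proof.
move=> p0 u0 ul.
have l0 : 0 <= l.
  rewrite -(cvg_lim (@norm_hausdorff _ _) ul); apply: limr_ge; last exact: nearW.
  by apply/cvg_ex; exists l.
(* At [l = 0] the power need not be differentiable, so that limit is checked directly. *)
move: l0; rewrite le_eqVlt => /orP[/eqP l0|l0]; last first.
  have h : {for l, continuous (@powR R ^~ p)}.
    apply: differentiable_continuous; apply/derivable1_diffP.
    by apply: derivable_powR; rewrite in_itv /= l0.
  exact: (continuous_cvg _ h ul).
rewrite -l0 in ul *; rewrite powR0 ?gt_eqF//; apply/cvgrPdist_lt => e e0.
move/cvgrPdist_lt : ul => /(_ (e `^ p^-1) (powR_gt0 _ e0)) [K _ hK].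
exists K => // j /= /hK; rewrite !sub0r !normrN !ger0_norm ?powR_ge0// => h.
have -> : e = (e `^ p^-1) `^ p by rewrite -powRrM mulVf ?gt_eqF// powRr1// ltW.
by apply: gt0_ltr_powR; rewrite ?nnegrE ?powR_ge0.
Qed.

Section FockNormAPI.
Context {R : realType} {n : nat}.
Variables (k : fock_kind R) (t : R).
Hypothesis t0 : 0 < t.
Implicit Types (phi psi f g : Cn R n -> C R) (z w a : Cn R n) (M b : R).
Local Notation L := (@lebC R n).
Local Notation N := (fock_norm k t).

Lemma fock_norm_trans phi psi (K : R) : cmfun phi -> cmfun psi -> 0 <= K ->
  (forall M, 0 <= M -> wbound k t (wmod t phi) M -> wbound k t (wmod t psi) (K * M)) ->
  (N phi < +oo)%E -> (N psi <= K%:E * N phi)%E.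
Proof.
move=> mphi mpsi K0 h Nphi.
have Nf : N phi \is a fin_num by rewrite ge0_fin_numE// fock_norm_ge0.
have M0 : 0 <= fine (N phi) by rewrite fine_ge0// fock_norm_ge0.
rewrite -(fineK Nf) -EFinM; apply/fock_norm_leP => //; first by rewrite mulr_ge0.
by apply: h => //; apply/fock_norm_leP => //; rewrite fineK.
Qed.

Lemma wbound_scale (Phi : Cn R n -> R) c M : measurable_fun setT Phi -> (forall z, 0 <= Phi z) ->
  0 <= c -> 0 <= M -> wbound k t Phi M -> wbound k t (fun z => c * Phi z) (c * M).
Proof.
move=> mPhi Phi0 c0 M0.
have sup_case : (\forall z \ae L, Phi z <= M) -> \forall z \ae L, c * Phi z <= c * M.
  by apply: filterS => z h; rewrite ler_wpM2l.
case: k => [p p1| |] //= hM.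
under eq_integral do rewrite powRM// EFinM.
rewrite ge0_integralZl//; last 3 first.
- by apply/measurable_EFinP; exact: measurable_powR_comp.
- by move=> z _; rewrite lee_fin powR_ge0.
- by rewrite lee_fin powR_ge0.
by rewrite powRM// mulrCA EFinM lee_wpmul2l// lee_fin powR_ge0.
Qed.

(** The factor [eta] is kept out of the kernel: absorbing it would give [(eta * A + 1)^2], which
    does not become small with [eta]. *)
Lemma fock_norm_young phi psi (g : Cn R n -> R) (A eta : R) : cmfun phi -> cmfun psi ->
  measurable_fun setT g -> (forall z, 0 <= g z) -> (\int[L]_z (g z)%:E <= A%:E)%E -> 0 < eta ->
  (forall z, (wmod t psi z)%:E <= eta%:E * gconv g (wmod t phi) z)%E -> (N phi < +oo)%E ->
  (N psi <= (eta * (A + 1) ^+ 2)%:E * N phi)%E.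
Proof.
move=> mphi mpsi mg g0 gA eta0 h; have A0 := kernel_mass_ge0 g0 gA.
have mwphi := measurable_wmod t mphi; have mwpsi := measurable_wmod t mpsi.
apply: fock_norm_trans => // [|M M0 hM].
  by rewrite mulr_ge0 ?sqr_ge0// ltW.
have := wbound_gconv mg g0 gA (k := k) (Psi := fun z => eta^-1 * wmod t psi z) t0 M0 mwphi.
move=> /(_ _ _ _ _ hM) H.
have : wbound k t (fun z => eta * (eta^-1 * wmod t psi z)) (eta * ((A + 1) ^+ 2 * M)).
  apply: wbound_scale.
  - exact: measurable_funM.
  - by move=> z; rewrite mulr_ge0 ?wmod_ge0// invr_ge0 ltW.
  - exact: ltW.
  - by rewrite mulr_ge0 ?sqr_ge0.
  apply: H.
  - exact: measurable_funM.
  - by move=> z; exact: wmod_ge0.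
  - by move=> z; rewrite mulr_ge0 ?wmod_ge0// invr_ge0 ltW.
  move=> z; rewrite EFinM -(@lee_pmul2l _ eta%:E)// ?lte_fin// muleA -!EFinM.
  by rewrite mulfV ?gt_eqF// mul1r; exact: h.
rewrite mulrA; congr wbound; apply/funext => z.
by rewrite mulrA mulfV ?gt_eqF// mul1r.
Qed.

Lemma wmodD f g z : wmod t (f \+ g) z <= wmod t f z + wmod t g z.
Proof. by rewrite /wmod -mulrDl ler_wpM2r ?normcD// ltW ?weight_gt0. Qed.

Lemma fock_normD f g : cmfun f -> cmfun g -> (N (f + g)%R <= N f + N g)%E.
Proof.
move=> mf mg.
have mfg : cmfun (f \+ g) by exact: cmfunD.
have sup_case k' : (k' = FockInf) \/ (k' = FockZero) ->
    (fock_norm k' t (f + g)%R <= fock_norm k' t f + fock_norm k' t g)%E.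
  move=> hk'.
  have [->|Nf] := eqVneq (fock_norm k' t f) +oo%E.
    by rewrite addye ?leey// -ltNye (lt_le_trans _ (fock_norm_ge0 _ _ _)).
  have [->|Ng] := eqVneq (fock_norm k' t g) +oo%E.
    by rewrite addey ?leey// -ltNye (lt_le_trans _ (fock_norm_ge0 _ _ _)).
  have Ff : fock_norm k' t f \is a fin_num by rewrite ge0_fin_numE ?fock_norm_ge0// ltey.
  have Fg : fock_norm k' t g \is a fin_num by rewrite ge0_fin_numE ?fock_norm_ge0// ltey.
  have f0 : 0 <= fine (fock_norm k' t f) by rewrite fine_ge0 ?fock_norm_ge0.
  have g0 : 0 <= fine (fock_norm k' t g) by rewrite fine_ge0 ?fock_norm_ge0.
  have h1 := (fock_norm_leP k' t0 mf f0).1; have h2 := (fock_norm_leP k' t0 mg g0).1.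
  rewrite !fineK// in h1 h2; have {}h1 := h1 (lexx _); have {}h2 := h2 (lexx _).
  rewrite -(fineK Ff) -(fineK Fg) -EFinD; apply/(fock_norm_leP k' t0 mfg (addr_ge0 f0 g0)).
  move: h1 h2; case: hk' => -> /= h1 h2; near=> z;
    apply: le_trans (wmodD f g z) _; apply: lerD; near: z; [exact: h1|exact: h2|exact: h1|exact: h2].
case: k => [p p1| |]; [|by apply: sup_case; left|by apply: sup_case; right].
have p0 : 0 < p by exact: lt_le_trans p1.
pose u (x : n.-tuple (R2 R)) := normc (f (to_Cn x)).
pose v (x : n.-tuple (R2 R)) := normc (g (to_Cn x)).
have mu : measurable_fun setT u by exact: (measurableT_comp (measurable_normc mf) (@measurable_to_Cn R n)).
have mv : measurable_fun setT v by exact: (measurableT_comp (measurable_normc mg) (@measurable_to_Cn R n)).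
apply: le_trans (minkowski_EFin (gauss (2 * t / p)) mu mv p1).
have mx : measurable_fun setT (fun x : n.-tuple (R2 R) => normc ((f + g) (to_Cn x))).
  exact: (measurableT_comp (measurable_normc mfg) (@measurable_to_Cn R n)).
have pp (h : n.-tuple (R2 R) -> R) : measurable_fun setT h -> measurable_fun setT (fun x => `|(h x)%:E| `^ p)%E.
  move=> mh; rewrite (_ : (fun x => _) = (fun x => (`|h x| `^ p)%:E))//.
  apply/measurable_EFinP; apply: (measurableT_comp (f := (@powR R)^~ p)); first exact: measurable_powR.
  exact: measurableT_comp.
rewrite /= unlock; apply: gt0_ler_poweR.
- by rewrite invr_ge0 ltW.
- by rewrite in_itv /= leey andbT; apply: integral_ge0 => x _; rewrite lee_fin powR_ge0.
- by rewrite in_itv /= leey andbT; apply: integral_ge0 => x _; rewrite lee_fin powR_ge0.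
apply: ge0_le_integral => //.
- by move=> x _; rewrite lee_fin powR_ge0.
- exact: pp.
- by apply: pp; exact: measurable_funD.
move=> x _ /=; rewrite lee_fin; apply: ge0_ler_powR; rewrite ?nnegrE ?(ltW p0)//.
by rewrite ger0_norm ?normc_ge0// ger0_norm ?addr_ge0 ?normc_ge0//; exact: normcD.
Unshelve. all: by end_near. Qed.

Lemma fock_normZ c f : cmfun f -> (N f < +oo)%E -> (N (c *: f)%R <= (normc c)%:E * N f)%E.
Proof.
move=> mf; apply: fock_norm_trans => //.
- by apply: cmfunM => //; exact: cmfun_cst.
- exact: normc_ge0.
move=> M M0 hM; have := wbound_scale (measurable_wmod t mf) (wmod_ge0 t f) (normc_ge0 c) M0 hM.
congr wbound; apply/funext => z; by rewrite /wmod mulrA -normcM.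
Qed.

Lemma fock_norm_cst0 : N (0 : Cn R n -> C R) = 0%E.
Proof.
apply/eqP; rewrite eq_le fock_norm_ge0 andbT; apply/fock_norm_leP => //.
have E : wmod t (0 : Cn R n -> C R) = fun=> 0 :> R.
  by apply/funext => z; rewrite /wmod normc0 mul0r.
rewrite E; have sup_case : \forall z \ae L, (0 : R) <= 0 by exact: aeW.
case: k => [p p1| |] //=; have p0 : 0 < p by exact: lt_le_trans p1.
by rewrite powR0 ?gt_eqF// mulr0 integral0.
Qed.

(** Lower semicontinuity of the norm under pointwise convergence; it transfers norm bounds to limits
    in the completeness proofs below. *)
Lemma fock_norm_fatou (F : nat -> Cn R n -> C R) f M : (forall j, cmfun (F j)) ->
  (forall z, ccvg (F ^~ z) (f z)) -> 0 <= M -> (forall j, (N (F j) <= M%:E)%E) -> (N f <= M%:E)%E.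
Proof.
move=> mF Ff M0 hM; have mf := cmfun_cvg mF Ff.
apply/fock_norm_leP => //.
have {}hM j : wbound k t (wmod t (F j)) M by apply/fock_norm_leP.
have cw z : (fun j => wmod t (F j) z) @ \oo --> wmod t f z.
  apply: cvgMl; apply/cvgrPdist_lt => e e0; have [K hK] := Ff z e e0.
  exists K => // j /= /hK hj; apply: le_lt_trans hj; rewrite normc_distC.
  rewrite ler_norml; apply/andP; split.
    by have := normcD (F j z - f z) (f z); rewrite subrK normc_distC; lra.
  by have := normcD (f z - F j z) (F j z); rewrite subrK; lra.
have sup_case : (forall j, \forall z \ae L, wmod t (F j) z <= M) -> \forall z \ae L, wmod t f z <= M.
  move=> h; have {}h : \forall z \ae L, forall j, wmod t (F j) z <= M by apply/ae_foralln.
  apply: filterS h => z hz; rewrite -(cvg_lim (@norm_hausdorff _ _) (cw z)).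
  by apply: limr_le; [apply/cvg_ex; exists (wmod t f z); exact: cw|exact: nearW].
case: k hM => [p p1| |] //= hM.
have p0 : 0 < p by exact: lt_le_trans p1.
have mp j : measurable_fun setT (fun z => (wmod t (F j) z `^ p)%:E).
  by apply/measurable_EFinP; apply: measurable_powR_comp; exact: measurable_wmod.
have fat := @fatou _ _ _ L setT measurableT (fun j z => (wmod t (F j) z `^ p)%:E) mp
  (fun j z _ => powR_ge0 (wmod t (F j) z) p).
apply: le_trans (_ : _ <= \int[L]_z limn_einf (fun j => (wmod t (F j) z `^ p)%:E))%E _.
  rewrite le_eqVlt; apply/orP; left; apply/eqP; apply: eq_integral => z _.
  have c1 : (fun j => (wmod t (F j) z `^ p)%:E) @ \oo --> (wmod t f z `^ p)%:E.
    apply: cvg_EFin; first exact: nearW.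
    by apply: powR_cvg_seq => // j; exact: wmod_ge0.
  by rewrite is_cvg_limn_einfE ?(cvg_lim _ c1)//; apply/cvg_ex; exists (wmod t f z `^ p)%:E.
apply: le_trans fat _.
rewrite limn_einf_lim; set u := fun j => _.
have -> : limn (einfs u) = ereal_sup (range (einfs u)) by apply/cvg_lim => //; exact: cvg_einfs_sup.
apply: ge_ereal_sup => _ [j _ <-].
apply: le_trans (hM j); apply: ereal_inf_lbound; exists j => //=.
Qed.

End FockNormAPI.

(** * Pointwise bounds in Fock spaces *)

Section PointEvaluation.
Context {R : realType} {n : nat}.
Implicit Types (phi F f : Cn R n -> C R) (z w v : Cn R n) (s t a M : R).
Local Notation L := (@lebC R n).
Local Notation Re := (@complex.Re R).

(** Not normalized: its maximum is 1, as [gconv_wbound_le] requires, and its mass is [gmass a]. *)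
Definition gker a v : R := expR (- (a * sqnorm v)).

Lemma measurable_gker a : measurable_fun setT (gker a). Proof. exact: measurable_gaussian. Qed.
Lemma gker_gt0 a v : 0 < gker a v. Proof. exact: expR_gt0. Qed.
Lemma gker_ge0 a v : 0 <= gker a v. Proof. exact: expR_ge0. Qed.
Lemma gker_le1 a v : 0 <= a -> gker a v <= 1.
Proof. by move=> a0; rewrite -expR0 ler_expR oppr_le0 mulr_ge0 ?sqnorm_ge0. Qed.
Lemma integral_gker a : 0 < a -> (\int[L]_z (gker a z)%:E <= ((pi / a) ^+ n)%:E)%E.
Proof. by move=> a0; rewrite integral_gaussian. Qed.

Definition gmass a : R := (pi / a) ^+ n.
Lemma gmass_ge0 a : 0 < a -> 0 <= gmass a.
Proof. by move=> a0; rewrite exprn_ge0// divr_ge0 ?pi_ge0 ?ltW. Qed.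

Lemma gauss_const_gt0 t : 0 < t -> 0 < (pi * t) ^- n :> R.
Proof. by move=> t0; rewrite invr_gt0 exprn_gt0// mulr_gt0 ?pi_gt0. Qed.

Section kernel_gconv.
Variables (t : R) (F : Cn R n -> C R) (z : Cn R n).
Hypotheses (t0 : 0 < t) (mF : cmfun F).
Hypothesis fin : (gconv (gker (2 * t)^-1) (wmod t F) z < +oo)%E.

Let kerE : (\int[L]_w (normc ((gauss_density t w)%:C%C * (F w * cexp (dot z w / t%:C%C))))%:E =
  ((weight t z)^-1 * (pi * t) ^- n)%:E * gconv (gker (2 * t)^-1) (wmod t F) z)%E.
Proof.
rewrite /gconv -ge0_integralZl//; last 3 first.
- apply/measurable_EFinP; apply: measurable_funM; last exact: measurable_wmod.
  by apply: measurable_reflect; exact: measurable_gker.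
- by move=> w _; rewrite lee_fin mulr_ge0 ?gker_ge0 ?wmod_ge0.
- by rewrite lee_fin mulr_ge0 ?(ltW (gauss_const_gt0 t0))// invr_ge0 ltW ?weight_gt0.
apply: eq_integral => w _; rewrite -EFinM; congr (_%:E).
by rewrite /gker -mulrA -normc_kernel// [RHS]mulrC mulfK// gt_eqF// weight_gt0.
Qed.

Lemma cL1_kernel_gconv :
  cL1 L (fun w => (gauss_density t w)%:C%C * (F w * cexp (dot z w / t%:C%C))).
Proof.
split; first exact: cmfun_kernel.
rewrite kerE; apply: lte_mul_pinfty => //.
by rewrite lee_fin mulr_ge0 ?(ltW (gauss_const_gt0 t0))// invr_ge0 ltW ?weight_gt0.
Qed.

Lemma wmod_Pt_gconv :
  ((wmod t (Pt t F) z)%:E <= ((pi * t) ^- n)%:E * gconv (gker (2 * t)^-1) (wmod t F) z)%E.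
Proof.
have := normc_cint_le cL1_kernel_gconv; rewrite kerE -/(Pt t F z) => h.
rewrite /wmod mulrC EFinM; apply: le_trans (lee_wpmul2l _ h) _.
  by rewrite lee_fin ltW ?weight_gt0.
by rewrite muleA -EFinM mulVKf// gt_eqF// weight_gt0.
Qed.

End kernel_gconv.

(** By the reproducing formula the weighted modulus of [phi] is dominated by its own Gaussian
    convolution. The finiteness of that convolution also supplies the integrability which the
    formula requires. *)
Lemma fock_point_eval k t : 0 < t -> exists2 K : R, 0 < K & forall phi, entire phi ->
  (fock_norm k t phi < +oo)%E -> forall z, wmod t phi z <= K * fine (fock_norm k t phi).
Proof.
move=> t0; pose a := (2 * t)^-1; have a0 : 0 < a by rewrite invr_gt0 mulr_gt0.
pose c := gmass a + (pi * (2 * t / (if k is FockP p _ then p else 1))) ^+ n.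
have c0 : 0 <= c.
  rewrite addr_ge0 ?gmass_ge0// exprn_ge0// mulr_ge0 ?pi_ge0// divr_ge0 ?mulr_ge0 ?(ltW t0)//.
  by case: (k) => // p p1; apply: le_trans p1.
exists ((pi * t) ^- n * (c + 1)) => [|phi ephi Nphi z].
  by rewrite mulr_gt0 ?gauss_const_gt0// ltr_wpDl.
have mphi := entire_cmfun ephi; have mw := measurable_wmod t mphi.
have N0 := fock_norm_ge0 k t phi.
have f0 : 0 <= fine (fock_norm k t phi) by rewrite fine_ge0.
apply/ler_addgt0Pr => e e0.
have C0 : 0 < (pi * t) ^- n * (c + 1) by rewrite mulr_gt0 ?gauss_const_gt0// ltr_wpDl.
(* Slightly above the norm, because [gconv_wbound_le] needs a positive bound and the norm may
   vanish. *)
pose M := fine (fock_norm k t phi) + e / ((pi * t) ^- n * (c + 1)).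
have M0 : 0 < M by rewrite ltr_wpDl// divr_gt0.
have hM : wbound k t (wmod t phi) M.
  apply/fock_norm_leP => //; first exact: ltW.
  rewrite -[fock_norm _ _ _]fineK ?ge0_fin_numE// lee_fin lerDl.
  by rewrite ltW// divr_gt0.
have hg := gconv_wbound_le (@measurable_gker a) (gker_ge0 a) (integral_gker a0) z t0 M0
  (fun v => gker_le1 v (ltW a0)) mw (wmod_ge0 t phi) hM.
have fin : (gconv (gker (2 * t)^-1) (wmod t phi) z < +oo)%E by apply: le_lt_trans hg _; rewrite ltry.
have E : Pt t phi z = phi z by apply: reproducing => //; exact: cL1_kernel_gconv.
have := wmod_Pt_gconv t0 mphi fin; rewrite /wmod E -/(wmod t phi z) => h.
rewrite -lee_fin; apply: le_trans h _.
apply: le_trans (lee_wpmul2l _ hg) _; first by rewrite lee_fin ltW// gauss_const_gt0.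
rewrite -EFinM lee_fin -/(gmass a) -/c.
have -> : (pi * t) ^- n * (c + 1) * fine (fock_norm k t phi) + e = (pi * t) ^- n * (c + 1) * M.
  by rewrite /M; move: (gt_eqF C0); set C := _ * (c + 1) => C1; rewrite mulrDr mulrCA mulfV ?C1// mulr1.
rewrite -mulrA ler_wpM2l ?(ltW (gauss_const_gt0 t0))// mulrC ler_wpM2r ?(ltW M0)//.
by rewrite lerDl.
Qed.

(** The constant does not depend on the centre [z0]; this makes the norms of coherent states uniform
    after normalization. *)
Lemma fock_norm_gaussian k t a : 0 < t -> 0 < a -> exists2 K : R, 0 < K & forall phi z0 b,
  cmfun phi -> 0 <= b -> (forall z, wmod t phi z <= b * gker a (z - z0)) ->
  (fock_norm k t phi <= (b * K)%:E)%E.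
Proof.
move=> t0 a0.
exists (1 + gmass a / (pi * (2 * t / (if k is FockP p _ then p else 1))) ^+ n).
  rewrite ltr_wpDr// divr_ge0 ?gmass_ge0// exprn_ge0// mulr_ge0 ?pi_ge0// divr_ge0 ?mulr_ge0 ?(ltW t0)//.
  by case: (k) => // p p1; apply: le_trans p1.
move=> phi z0 b mphi b0 h.
set K := 1 + _.
have K1 : 1 <= K.
  rewrite /K lerDl divr_ge0 ?gmass_ge0// exprn_ge0// mulr_ge0 ?pi_ge0// divr_ge0 ?mulr_ge0 ?(ltW t0)//.
  by case: (k) => // p p1; apply: le_trans p1.
have K0 : 0 <= K by apply: le_trans K1.
apply/fock_norm_leP => //; first by rewrite mulr_ge0.
have sup_case : \forall z \ae L, wmod t phi z <= b * K.
  apply: aeW => z; apply: le_trans (h z) _; rewrite ler_wpM2l//.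
  by apply: le_trans K1; exact: gker_le1 (ltW a0).
rewrite /K in K1 K0 sup_case *.
case: k K K1 K0 sup_case => [p p1| |] //= K K1 K0 _.
have p0 : 0 < p by exact: lt_le_trans p1.
rewrite -/K; set c := (pi * (2 * t / p)) ^+ n.
have c0 : 0 < c by rewrite exprn_gt0// mulr_gt0 ?pi_gt0// divr_gt0 ?mulr_gt0.
have ms : measurable_fun setT (fun z : Cn R n => gker a (z - z0)).
  by apply: (measurableT_comp (measurable_gker a)); apply: measurable_CnB; [exact: measurable_id|exact: measurable_cst].
apply: (@le_trans _ _ (\int[L]_z ((b `^ p)%:E * (gker a (z - z0))%:E))%E).
  apply: ge0_le_integral => //.
  - by move=> z _; rewrite lee_fin powR_ge0.
  - by apply/measurable_EFinP; apply: measurable_powR_comp; exact: measurable_wmod.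
  - by apply: emeasurable_funM => //; exact/measurable_EFinP.
  move=> z _; rewrite -EFinM lee_fin.
  apply: (@le_trans _ _ ((b * gker a (z - z0)) `^ p)).
    by apply: ge0_ler_powR; rewrite ?nnegrE ?(ltW p0) ?wmod_ge0 ?mulr_ge0 ?gker_ge0.
  rewrite powRM ?gker_ge0// ler_wpM2l ?powR_ge0//.
  rewrite /powR gt_eqF ?gker_gt0// expRK /gker ler_expR -{2}[- _]mul1r.
  by rewrite ler_wnM2r// oppr_le0 mulr_ge0 ?sqnorm_ge0// ltW.
rewrite ge0_integralZl//; last 3 first.
- exact/measurable_EFinP.
- by move=> z _; rewrite lee_fin gker_ge0.
- by rewrite lee_fin powR_ge0.
rewrite (integral_shift (@measurable_gker a) (gker_ge0 a)).
apply: le_trans (lee_wpmul2l _ (integral_gker a0)) _; first by rewrite lee_fin powR_ge0.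
rewrite -EFinM lee_fin powRM// mulrCA ler_wpM2l ?powR_ge0// -/(gmass a) -/c.
rewrite -[leLHS](mulfVK (negbT (gt_eqF c0))) mulrC ler_wpM2l ?(ltW c0)//.
apply: le_trans (le1r_powR K1 p1).
by rewrite /K -/c lerDr.
Qed.

End PointEvaluation.

(** * Toeplitz operators and spaces of operators *)

Section VanishingAtInfinity.
Context {R : realType} {n : nat}.
Implicit Types (f : Cn R n -> C R) (z w h : Cn R n).

Definition eps_continuous (g : Cn R n -> R) : Prop := forall z e, 0 < e ->
  exists2 d : R, 0 < d & forall w, sqnorm (w - z) < d -> `|g w - g z| < e.

Lemma eps_continuousW (g : Cn R n -> R) : eps_continuous g -> continuous g.
Proof.
move=> h z A /(nbhs_ballP (g z) A).1 [e /= e0 hA].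
have [d d0 hd] := h z e e0.
pose r := Num.sqrt (d / n.+1%:R).
have r0 : 0 < r by rewrite sqrtr_gt0 divr_gt0.
apply: (nbhs_ballP z (g @^-1` A)).2; exists (r%:C)%C; first by rewrite /= ltcR.
move=> w /(sqnorm_mx_ball r0) hzw; apply: hA.
rewrite -ball_normE /ball_ /= distrC; apply: hd.
rewrite sqnormBC; apply: le_lt_trans hzw _.
by rewrite sqr_sqrtr ?divr_ge0 ?ltW// mulrCA gtr_pMr// ltr_pdivrMr// mul1r ltr_nat.
Qed.

Lemma eps_continuous_comp (g : Cn R n -> R) (h : R -> R) :
  eps_continuous g -> continuous h -> eps_continuous (fun z => h (g z)).
Proof.
move=> cg ch z e e0.
have := ch (g z); move/cvgrPdist_lt => /(_ e e0) h1.
have [d /= d0 hd] := (nbhs_ballP _ _).1 h1.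
have [d' d'0 hd'] := cg z d d0; exists d' => // w /hd' hw.
rewrite distrC; apply: hd; rewrite -ball_normE /ball_ /= distrC; exact: hw.
Qed.

Lemma eps_continuous_sqnorm : eps_continuous (@sqnorm R n).
Proof.
move=> z e e0; pose a := 2 * (sqnorm z + 1) / e.
have z1 : 0 < sqnorm z + 1 by rewrite ltr_wpDl ?sqnorm_ge0.
have a0 : 0 < a by rewrite divr_gt0// mulr_gt0.
exists (e / (2 * (1 + a))); first by rewrite divr_gt0// mulr_gt0// addr_gt0.
move=> w; rewrite ltr_pdivlMr ?mulr_gt0 ?addr_gt0// => hw.
have E : sqnorm w = sqnorm (w - z) + sqnorm z + 2 * complex.Re (dot (w - z) z).
  by rewrite -sqnormD subrK.
have h1 := normc_dot_le (w - z) z a0.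
have h2 := le_Re_normc (dot (w - z) z).
have h3 : sqnorm z / a <= e / 2.
  rewrite ler_pdivrMr// (_ : e / 2 * a = sqnorm z + 1) ?lerDl//.
  by rewrite /a; field; rewrite gt_eqF.
rewrite (_ : sqnorm w - sqnorm z = sqnorm (w - z) + 2 * complex.Re (dot (w - z) z)); last first.
  by rewrite {1}E; ring.
apply: le_lt_trans (ler_normD _ _) _.
rewrite (ger0_norm (sqnorm_ge0 _)) normrM ger0_norm//.
move: h1 h2 h3 hw; move: (sqnorm (w - z)) (normc _) `|complex.Re _| (sqnorm z / a) => x y u v.
nra.
Qed.

Lemma eps_continuous_weight t : eps_continuous (@weight R n t).
Proof.
have -> : @weight R n t = fun z => expR (- (sqnorm z) / (2 * t)) by [].
apply: (@eps_continuous_comp (@sqnorm R n) (fun x => expR (- x / (2 * t)))).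
  exact: eps_continuous_sqnorm.
move=> x; apply: continuous_comp; last exact: continuous_expR.
by apply: cvgMl; apply: cvgN; exact: cvg_id.
Qed.

Lemma continuous_mul_real f (g : Cn R n -> R) : continuous f -> eps_continuous g ->
  continuous (fun z => f z * (g z)%:C%C).
Proof.
move=> cf cg z; have h : {for z, continuous (fun z => (g z)%:C%C : C R)}.
  apply/continuous_epsP => e e0; have [d d0 hd] := cg z e e0.
  by exists d => // w /hd; rewrite -rmorphB normcR.
exact: (cvgM (cf z) h).
Qed.

Lemma continuous_real_imag : continuous (fun p : R * R => (p.1 +i* p.2)%C : C R).
Proof.
move=> -[x y] A /(nbhs_ballP _ A).1 [_ /= /posc_real[e e0 ->] hA].
have e2 : 0 < e / 2 by rewrite divr_gt0.
apply: (nbhs_ballP (x, y) _).2; exists (e / 2) => // -[x' y'] /= [].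
rewrite -!ball_normE /ball_ /= => h1 h2; apply: hA.
rewrite -ball_normE /ball_ /= norm_normc ltcR.
apply: le_lt_trans (normc_le_ReIm _) _; rewrite /=; lra.
Qed.

(** Compact sets are exchanged for sublevel sets of [sqnorm]: a continuous function is bounded on a
    compact set, and conversely a sublevel set lies in a product of compact squares. *)
Lemma C0P f : C0 f <-> continuous f /\
  forall e : R, 0 < e -> exists r : R, forall z, r < sqnorm z -> normc (f z) < e.
Proof.
split=> [[cf h]|[cf h]]; split=> // e e0.
  have [K cK hK] := h e e0.
  have [K0|/set0P K0] := eqVneq K set0.
    by exists 0 => z _; apply: hK; rewrite K0.
  have [c _ hc] := compact_EVT_max K0 cK (continuous_subspaceT (eps_continuousW eps_continuous_sqnorm)).
  by exists (sqnorm c) => z hz; apply: hK => Kz; have := hc z (mem_set Kz); rewrite leNgt hz.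
have [r hr] := h e e0.
(* This number dominates the square root of [r], whatever its sign. *)
pose s := `|r| + 1.
pose A := (fun p : R * R => (p.1 +i* p.2)%C : C R) @` (`[- s, s]%classic `*` `[- s, s]%classic).
have cA : compact A.
  apply: continuous_compact; first by apply: continuous_subspaceT; exact: continuous_real_imag.
  by apply: compact_setX; exact: segment_compact.
exists [set v : Cn R n | forall i, A (v ord0 i)]; first by apply: (@rV_compact (C R) n (fun=> A)).
move=> z /existsNP[j hj]; apply: hr; rewrite ltNge; apply/negP => hz.
apply: hj; exists (complex.Re (z ord0 j), complex.Im (z ord0 j)); last by case: (z ord0 j).
have key (x : R) : `|x| <= normc (z ord0 j) -> - s <= x <= s.
  move=> hx; rewrite -ler_norml; apply: le_trans hx _.
  have := le_trans (normc_coord_le z j) hz => h2.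
  have r1 := ler_norm r; have r2 := normr_ge0 r.
  rewrite -(@ler_pXn2r _ 2)// ?nnegrE ?normc_ge0 ?addr_ge0//.
  apply: le_trans h2 _; rewrite /s; nra.
by split; rewrite /= in_itv /=; apply: key; [exact: le_Re_normc|exact: le_Im_normc].
Qed.

End VanishingAtInfinity.

(** * Boundedness of Toeplitz operators *)

Section ToeplitzBounded.
Context {R : realType} {n : nat}.
Variables (k : fock_kind R) (t : R).
Hypothesis t0 : 0 < t.
Implicit Types (phi psi f g : Cn R n -> C R) (z w : Cn R n) (B M : R).
Local Notation L := (@lebC R n).
Local Notation N := (fock_norm k t).
Local Notation Fk := (fock_space k t).
Local Notation a := ((2 * t)^-1).

Lemma twice_inv_gt0 : 0 < a. Proof. by rewrite invr_gt0 mulr_gt0. Qed.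

Lemma fock_space_entire phi : Fk phi -> entire phi. Proof. by case. Qed.
Lemma fock_space_cmfun phi : Fk phi -> cmfun phi. Proof. by case=> /cmeasurableE. Qed.
Lemma fock_space_fin phi : Fk phi -> (N phi < +oo)%E. Proof. by case. Qed.

(** Every Fock space embeds into [F_t^oo], so the integrability of kernels can be treated with a
    pointwise bound [M], independently of the kind of space. *)
Lemma fock_space_bounded phi : Fk phi -> exists2 M, 0 <= M & forall z, wmod t phi z <= M.
Proof.
move=> [_ fin ephi _]; have [K K0 hK] := fock_point_eval (n := n) k t0.
exists (K * fine (N phi)); last exact: hK.
by rewrite mulr_ge0 ?fine_ge0 ?fock_norm_ge0// ltW.
Qed.

Lemma fock_spaceE phi : entire phi -> (N phi < +oo)%E ->
  (if k is FockZero then C0 (fun z => phi z * (weight t z)%:C%C) else True) -> Fk phi.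
Proof. by move=> ephi fin h; split => //; apply/cmeasurableE; exact: entire_cmfun. Qed.

Lemma wmod_mul_le f phi B z : (forall z, normc (f z) <= B) ->
  wmod t (fun_mul f phi) z <= B * wmod t phi z.
Proof.
move=> hB; rewrite /wmod /fun_mul /= normcM -mulrA ler_wpM2r//; exact: wmod_ge0.
Qed.

Lemma wmod_mul_bounded f phi B M : (forall z, normc (f z) <= B) -> (forall z, wmod t phi z <= M) ->
  forall z, wmod t (fun_mul f phi) z <= B * M.
Proof.
move=> hB hM z; apply: le_trans (wmod_mul_le phi z hB) _; apply: ler_wpM2l => //.
exact: le_trans (normc_ge0 _) (hB z).
Qed.

Lemma toeplitzE f phi : cmfun f -> cmfun phi -> toeplitz t f phi = Pt t (fun_mul f phi).
Proof. by move=> mf mphi; rewrite /toeplitz fock_projectionE//; exact: cmfunM. Qed.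

Lemma gconv_bounded_fin phi M z : (forall z, wmod t phi z <= M) -> cmfun phi ->
  (gconv (gker a) (wmod t phi) z < +oo)%E.
Proof.
move=> hM mphi.
have M0 : 0 <= M by apply: le_trans (hM 0); exact: wmod_ge0.
apply: le_lt_trans (gconv_ae_le (@measurable_gker R n a) (gker_ge0 a) (integral_gker twice_inv_gt0) z
  (measurable_wmod t mphi) (wmod_ge0 t phi) M0 (aeW _ hM)) _.
by rewrite ltry.
Qed.

Lemma toeplitz_gconv f phi B M z : cmfun f -> 0 <= B -> (forall z, normc (f z) <= B) ->
  cmfun phi -> (forall z, wmod t phi z <= M) ->
  ((wmod t (toeplitz t f phi) z)%:E <= ((pi * t) ^- n * B)%:E * gconv (gker a) (wmod t phi) z)%E.
Proof.
move=> mf B0 hB mphi hM; rewrite toeplitzE//.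
have mfp : cmfun (fun_mul f phi) by exact: cmfunM.
have hfp := wmod_mul_bounded hB hM.
apply: le_trans (wmod_Pt_gconv t0 mfp (gconv_bounded_fin z hfp mfp)) _.
rewrite EFinM -muleA; apply: lee_wpmul2l.
  by rewrite lee_fin ltW// gauss_const_gt0.
have mr : measurable_fun setT (fun w : Cn R n => gker a (z - w)).
  by apply: measurable_reflect; exact: measurable_gker.
rewrite /gconv -ge0_integralZl//; last 2 first.
- by apply/measurable_EFinP; apply: measurable_funM => //; exact: measurable_wmod.
- by move=> w _; rewrite lee_fin mulr_ge0 ?gker_ge0 ?wmod_ge0.
apply: ge0_le_integral => //.
- by move=> w _; rewrite lee_fin mulr_ge0 ?gker_ge0 ?wmod_ge0.
- by apply/measurable_EFinP; apply: measurable_funM => //; exact: measurable_wmod.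
- apply: emeasurable_funM => //; apply/measurable_EFinP; apply: measurable_funM => //; exact: measurable_wmod.
- by move=> w _; rewrite -EFinM lee_fin [leRHS]mulrCA ler_wpM2l ?gker_ge0// wmod_mul_le.
Qed.

Lemma toeplitz_entire f phi B M : cmfun f -> (forall z, normc (f z) <= B) ->
  cmfun phi -> (forall z, wmod t phi z <= M) -> entire (toeplitz t f phi).
Proof.
move=> mf hB mphi hM; rewrite toeplitzE//.
by apply: entire_Pt t0 _ (wmod_mul_bounded hB hM); exact: cmfunM.
Qed.

Lemma toeplitz_norm f phi B : cmfun f -> 0 < B -> (forall z, normc (f z) <= B) -> Fk phi ->
  (N (toeplitz t f phi) <= ((pi * t) ^- n * B * (@gmass R n a + 1) ^+ 2)%:E * N phi)%E.
Proof.
move=> mf B0 hB Fphi; have [M M0 hM] := fock_space_bounded Fphi.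
have mphi := fock_space_cmfun Fphi.
apply: (fock_norm_young t0 mphi _ (@measurable_gker R n a) (gker_ge0 a) (integral_gker twice_inv_gt0)).
- by apply: entire_cmfun; exact: (toeplitz_entire mf hB mphi hM).
- by rewrite mulr_gt0// gauss_const_gt0.
- by move=> z; exact: (toeplitz_gconv _ mf (ltW B0) hB mphi hM).
- exact: fock_space_fin.
Qed.

(** Convolution with a Gaussian preserves vanishing at infinity: far points contribute little
    because [phi] is small there, near points because the Gaussian is small between them and [z]. *)
Lemma toeplitz_C0 f phi B : cmfun f -> 0 <= B -> (forall z, normc (f z) <= B) -> Fk phi ->
  C0 (fun z => phi z * (weight t z)%:C%C) ->
  C0 (fun z => toeplitz t f phi z * (weight t z)%:C%C).
Proof.
move=> mf B0 hB Fphi /C0P[_ h0].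
have [M M0 hM] := fock_space_bounded Fphi.
have mphi := fock_space_cmfun Fphi.
have et := toeplitz_entire mf hB mphi hM.
apply/C0P; split.
  apply: continuous_mul_real; first exact: entire_continuous.
  exact: eps_continuous_weight.
have nw g z : normc (g z * (weight t z)%:C%C) = wmod t g z.
  by rewrite normcM normcR ger0_norm// ltW ?weight_gt0.
move=> e e0.
pose c := (pi * t) ^- n * B + 1.
have c0 : 0 < c by rewrite ltr_wpDl// mulr_ge0// ltW ?gauss_const_gt0.
pose A := @gmass R n a + 1.
have A0 : 0 < A by rewrite ltr_wpDl// gmass_ge0// twice_inv_gt0.
have [r hr] := h0 (e / (2 * c * A)) (divr_gt0 e0 (mulr_gt0 (mulr_gt0 (ltr0Sn _ 1) c0) A0)).
pose a2 := (4 * t)^-1; have a20 : 0 < a2 by rewrite invr_gt0 mulr_gt0.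
pose A2 := @gmass R n a2 + 1.
have A20 : 0 < A2 by rewrite ltr_wpDl// gmass_ge0.
(* Beyond the threshold below, [e^(-x) <= 1 / x] bounds the Gaussian factor by [e / D], and this [D]
   then makes the near part at most [e / 4]. *)
pose D := M * expR (a2 * `|r|) * A2 * c * 4 + 1.
have D0 : 0 < D by rewrite ltr_wpDl// !mulr_ge0 ?expR_ge0// ltW.
exists (2 * (D / (e * a2))) => z hz; rewrite nw.
(* For [w] near the origin the exponent [a = 2 * a2] is halved: one half yields the decay in [z],
   the other keeps a Gaussian integrable in [w]. *)
have hG w : gker a (z - w) * wmod t phi w <=
    e / (2 * c * A) * gker a (z - w) + M * expR (a2 * `|r|) * expR (- (a2 * (sqnorm z / 2))) * gker a2 (z - w).
  have [wr|wr] := ltP r (sqnorm w).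
    rewrite mulrC; apply: ler_wpDr; first by rewrite !mulr_ge0 ?expR_ge0.
    by rewrite ler_wpM2r ?gker_ge0// ltW// -nw hr.
  apply: ler_wpDl; first by rewrite mulr_ge0 ?gker_ge0// divr_ge0 ?(ltW e0)// !mulr_ge0 ?ltW.
  apply: le_trans (ler_wpM2l (gker_ge0 _ _) (hM w)) _.
  rewrite mulrC -!mulrA ler_wpM2l// /gker -!expRD ler_expR.
  have hs : sqnorm z <= 2 * (sqnorm (z - w) + sqnorm w) by rewrite -{1}(subrK w z) sqnormD_le.
  have -> : a = a2 + a2 by rewrite /a2; field; rewrite gt_eqF.
  have wr' : sqnorm w <= `|r| := le_trans wr (ler_norm r).
  have := ler_wpM2l (ltW a20) hs; have := ler_wpM2l (ltW a20) wr'; rewrite !mulrDr => h1 h2.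
  lra.
rewrite -lte_fin.
apply: le_lt_trans (toeplitz_gconv z mf B0 hB mphi hM) _.
have hc : (gconv (gker a) (wmod t phi) z <=
   (e / (2 * c * A) * @gmass R n a + M * expR (a2 * `|r|) * expR (- (a2 * (sqnorm z / 2))) * @gmass R n a2)%:E)%E.
  pose u := M * expR (a2 * `|r|) * expR (- (a2 * (sqnorm z / 2))).
  have u0 : 0 <= u by rewrite !mulr_ge0 ?expR_ge0.
  pose v := e / (2 * c * A).
  have v0 : 0 <= v by rewrite divr_ge0 ?(ltW e0)// !mulr_ge0 ?ltW.
  have mr b : measurable_fun setT (fun w : Cn R n => (gker b (z - w))%:E).
    by apply/measurable_EFinP; apply: measurable_reflect; exact: measurable_gker.
  apply: (@le_trans _ _ (\int[L]_w (v%:E * (gker a (z - w))%:E + u%:E * (gker a2 (z - w))%:E))%E).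
    apply: ge0_le_integral => //.
    - by move=> w _; rewrite lee_fin mulr_ge0 ?gker_ge0 ?wmod_ge0.
    - by apply/measurable_EFinP; apply: measurable_funM; [apply: measurable_reflect; exact: measurable_gker|exact: measurable_wmod].
    - by apply: emeasurable_funD; exact: emeasurable_funM.
    - by move=> w _; rewrite -!EFinM -EFinD lee_fin; exact: hG.
  rewrite ge0_integralD//; last 4 first.
  - by move=> w _; rewrite mule_ge0 ?lee_fin ?gker_ge0.
  - exact: emeasurable_funM.
  - by move=> w _; rewrite mule_ge0 ?lee_fin ?gker_ge0.
  - exact: emeasurable_funM.
  have gg b (b0 : 0 < b) : (\int[L]_w (gker b (z - w))%:E <= (@gmass R n b)%:E)%E.
    by rewrite (integral_reflect (@measurable_gker R n b) (gker_ge0 b)); exact: integral_gker.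
  have gz b (x : R) : 0 < b -> 0 <= x ->
      (\int[L]_w (x%:E * (gker b (z - w))%:E) <= (x * @gmass R n b)%:E)%E.
    move=> b0 x0; rewrite ge0_integralZl//; last by move=> w _; rewrite lee_fin gker_ge0.
    by rewrite EFinM; apply: lee_wpmul2l; [rewrite lee_fin|exact: gg].
  by rewrite EFinD; apply: leeD; apply: gz => //; exact: twice_inv_gt0.
apply: le_lt_trans (lee_wpmul2l _ hc) _.
  by rewrite lee_fin mulr_ge0// ltW ?gauss_const_gt0.
rewrite -EFinM lte_fin.
set Y := M * expR (a2 * `|r|) * expR (- (a2 * (sqnorm z / 2))) * @gmass R n a2.
have gA : @gmass R n a <= A by rewrite lerDl.
have gA0 : 0 <= @gmass R n a by rewrite gmass_ge0// twice_inv_gt0.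
have T1 : e / (2 * c * A) * @gmass R n a * c <= e / 2.
  rewrite (_ : e / (2 * c * A) * @gmass R n a * c = e / 2 * (@gmass R n a / A)); last first.
    by field; rewrite !gt_eqF.
  by rewrite ler_piMr ?divr_ge0 ?(ltW e0)// ler_pdivrMr// mul1r.
have ez : expR (- (a2 * (sqnorm z / 2))) <= e / D.
  have hx : D / e < a2 * (sqnorm z / 2).
    move: hz; rewrite -ltr_pdivlMl// => hz.
    have := ltr_pM2l a20 (D / (e * a2)) (2^-1 * sqnorm z); rewrite hz => /idP.
    rewrite [2^-1 * _]mulrC; apply: le_lt_trans; rewrite le_eqVlt; apply/orP; left; apply/eqP.
    by field; rewrite !gt_eqF.
  rewrite expRN -[e / D]invrK lef_pV2 ?posrE ?expR_gt0 ?invr_gt0 ?divr_gt0//.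
  rewrite invf_div; apply: le_trans (ltW hx) _.
  by apply: le_trans (expR_ge1Dx _); rewrite lerDr.
have T2 : Y * c <= e / 4.
  have g2 : @gmass R n a2 <= A2 by rewrite lerDl.
  have g20 : 0 <= @gmass R n a2 by rewrite gmass_ge0.
  pose Q := M * expR (a2 * `|r|).
  have Q0 : 0 <= Q by rewrite mulr_ge0 ?expR_ge0.
  have : Y * c <= Q * (e / D) * A2 * c.
    rewrite /Y -/Q ler_wpM2r ?(ltW c0)//; apply: ler_pM; rewrite ?mulr_ge0 ?expR_ge0//.
    by rewrite ler_wpM2l.
  move=> /le_trans; apply.
  rewrite (_ : Q * (e / D) * A2 * c = e / 4 * ((Q * A2 * c * 4) / D)); last first.
    by field; rewrite gt_eqF.
  rewrite ler_piMr ?divr_ge0 ?(ltW e0)// ler_pdivrMr// mul1r /D -/Q lerDl//.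
have Y0 : 0 <= Y by rewrite !mulr_ge0 ?expR_ge0 ?gmass_ge0.
have X0 : 0 <= e / (2 * c * A) * @gmass R n a by rewrite mulr_ge0// divr_ge0 ?(ltW e0)// !mulr_ge0 ?ltW.
apply: (@le_lt_trans _ _ (c * (e / (2 * c * A) * @gmass R n a + Y))).
  by rewrite ler_wpM2r ?addr_ge0// lerDl.
rewrite mulrDr ![c * _]mulrC; lra.
Qed.

Lemma toeplitz_fock f phi B : cmfun f -> 0 < B -> (forall z, normc (f z) <= B) -> Fk phi ->
  Fk (toeplitz t f phi).
Proof.
move=> mf B0 hB Fphi; have [M M0 hM] := fock_space_bounded Fphi.
have mphi := fock_space_cmfun Fphi.
apply: fock_spaceE.
- exact: (toeplitz_entire mf hB mphi hM).
- apply: le_lt_trans (toeplitz_norm mf B0 hB Fphi) _.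
  apply: lte_mul_pinfty => //; last exact: fock_space_fin.
  by rewrite lee_fin mulr_ge0 ?sqr_ge0// mulr_ge0 ?(ltW B0)// ltW// gauss_const_gt0.
- have := toeplitz_C0 mf (ltW B0) hB Fphi; case: Fphi => _ _ _.
  by case: (k) => // h /(_ h).
Qed.

Lemma toeplitz_linear f B c phi psi : cmfun f -> (forall z, normc (f z) <= B) ->
  Fk phi -> Fk psi ->
  toeplitz t f (c *: phi + psi) = c *: toeplitz t f phi + toeplitz t f psi.
Proof.
move=> mf hB Fphi Fpsi.
have [M M0 hM] := fock_space_bounded Fphi; have [M' M'0 hM'] := fock_space_bounded Fpsi.
have mphi := fock_space_cmfun Fphi; have mpsi := fock_space_cmfun Fpsi.
have mc : cmfun (c *: phi + psi).
  by apply: (cmfunD (f := fun z => c * phi z)) => //; apply: cmfunM => //; exact: cmfun_cst.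
rewrite !toeplitzE//; apply/funext => z.
have L1 := cL1_kernel z t0 (cmfunM mf mphi) (wmod_mul_bounded hB hM).
have L2 := cL1_kernel z t0 (cmfunM mf mpsi) (wmod_mul_bounded hB hM').
have E := cintD (cL1Z c L1) L2; rewrite (cintZ c L1) in E.
apply: etrans E; apply: eq_cint => w.
by rewrite /fun_mul /= -[(c *: phi + psi) w]/(c * phi w + psi w); ring.
Qed.

End ToeplitzBounded.

Lemma complex_cauchy_cvg {R : realType} (u : nat -> C R) :
  (forall e : R, 0 < e -> exists K : nat, forall j l, (K <= j)%N -> (K <= l)%N -> normc (u j - u l) < e) ->
  exists l, ccvg u l.
Proof.
move=> h.
have key (p : C R -> R) : (forall a b, `|p a - p b| <= normc (a - b)) ->
    exists l : R, (fun j => p (u j)) @ \oo --> l.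
  move=> hp; apply/cvg_ex; apply: cauchy_cvg; apply/cauchy_ballP => e e0.
  have [K hK] := h e e0; pose S := (fun j => p (u j)) @` [set j | (K <= j)%N].
  have FS : \forall x \near (fun j => p (u j)) @ \oo, S x by exists K => // j Kj; exists j.
  exists (S, S) => //= -[_ _] [/= [j Kj <-] [l Kl <-]]; rewrite -ball_normE /ball_ /=.
  exact: le_lt_trans (hp _ _) (hK j l Kj Kl).
have [x hx] := key (@complex.Re R) (fun a b => ltac:(rewrite -ReB; exact: le_Re_normc)).
have [y hy] := key (@complex.Im R) (fun a b => ltac:(rewrite -ImB; exact: le_Im_normc)).
by exists (x +i* y)%C; apply: ccvg_ReIm.
Qed.

(** * Bounded operators and the operator norm *)

Section OperatorNorm.
Context {R : realType} {n : nat}.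
Variables (k : fock_kind R) (t : R).
Hypothesis t0 : 0 < t.
Implicit Types (phi psi f g : Cn R n -> C R) (A B : (Cn R n -> C R) -> (Cn R n -> C R)).
Implicit Types (z w : Cn R n) (K M : R) (c : C R).
Local Notation N := (@fock_norm R n k t).
Local Notation Fk := (@fock_space R n k t).
Local Notation W := (@bounded_operators R n k t).
Local Notation opN := (@op_norm R n k t).

Lemma wmodZ c phi z : wmod t (c *: phi) z = normc c * wmod t phi z.
Proof. by rewrite /wmod mulrA -normcM. Qed.

Lemma wmodB phi psi z : wmod t (phi - psi) z <= wmod t phi z + wmod t psi z.
Proof. by rewrite /wmod -mulrDl ler_wpM2r ?normcB// ltW ?weight_gt0. Qed.

Lemma normc_weight phi z : normc (phi z * (weight t z)%:C%C) = wmod t phi z.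
Proof. by rewrite normcM normcR ger0_norm// ltW ?weight_gt0. Qed.

Lemma cmfun_lin c phi psi : cmfun phi -> cmfun psi -> cmfun (c *: phi + psi).
Proof.
move=> m1 m2; apply: (cmfunD (f := fun z => c * phi z)) => //.
by apply: cmfunM => //; exact: cmfun_cst.
Qed.

Lemma fock_norm_lin c phi psi : cmfun phi -> cmfun psi -> (N phi < +oo)%E ->
  (N (c *: phi + psi)%R <= (normc c)%:E * N phi + N psi)%E.
Proof.
move=> m1 m2 fin; apply: le_trans (fock_normD k t0 _ m2) _.
  by apply: cmfunM => //; exact: cmfun_cst.
by rewrite leeD2r// fock_normZ.
Qed.

Lemma C0_lin c phi psi : C0 (fun z => phi z * (weight t z)%:C%C) ->
  C0 (fun z => psi z * (weight t z)%:C%C) -> entire (c *: phi + psi) ->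
  C0 (fun z => (c *: phi + psi) z * (weight t z)%:C%C).
Proof.
move=> /C0P[_ h1] /C0P[_ h2] ee; apply/C0P; split.
  apply: continuous_mul_real; first exact: entire_continuous.
  exact: eps_continuous_weight.
move=> e e0; have c0 : 0 < normc c + 1 by rewrite ltr_wpDl ?normc_ge0.
have [r1 hr1] := h1 (e / 2 / (normc c + 1)) (divr_gt0 (divr_gt0 e0 (ltr0Sn _ 1)) c0).
have [r2 hr2] := h2 (e / 2) (divr_gt0 e0 (ltr0Sn _ 1)).
exists (Num.max r1 r2) => z; rewrite gt_max => /andP[z1 z2].
have := hr1 z z1; have := hr2 z z2; rewrite !normc_weight => k2 k1.
apply: (@le_lt_trans _ _ (normc c * wmod t phi z + wmod t psi z)).
  by rewrite -wmodZ /wmod -mulrDl ler_wpM2r ?normcD// ltW ?weight_gt0.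
rewrite ltr_pdivlMr// in k1.
move: k1 (wmod_ge0 t phi z); rewrite mulrDr mulr1 mulrC => k1 p0.
lra.
Qed.

Lemma fock_space_lin c phi psi : Fk phi -> Fk psi -> Fk (c *: phi + psi).
Proof.
move=> F1 F2; have ee : entire (c *: phi + psi).
  apply: (@entireD _ _ (fun z => c * phi z)); last exact: fock_space_entire F2.
  by apply: entireZ; exact: fock_space_entire F1.
apply: fock_spaceE => //.
  apply: le_lt_trans (fock_norm_lin c (fock_space_cmfun F1) (fock_space_cmfun F2) (fock_space_fin F1)) _.
  rewrite lte_add_pinfty ?(fock_space_fin F2)// lte_mul_pinfty ?(fock_space_fin F1)//.
  by rewrite lee_fin normc_ge0.
by have := @C0_lin c phi psi; case: F1 => _ _ _; case: F2 => _ _ _; case: (k) => // h1 h2; exact.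
Qed.

Lemma fock_space0 : Fk 0.
Proof.
have e0 : entire (0 : Cn R n -> C R) by move=> z; exact: differentiable_cst.
apply: fock_spaceE => //; first by rewrite fock_norm_cst0// ltry.
case: (k) => //; apply/C0P; split.
  apply: continuous_mul_real; first exact: entire_continuous.
  exact: eps_continuous_weight.
by move=> e e0'; exists 0 => z _; rewrite mul0r normc0.
Qed.

Lemma fock_spaceZ c phi : Fk phi -> Fk (c *: phi).
Proof. by move=> F1; rewrite -[c *: phi]addr0; exact: (fock_space_lin c F1 fock_space0). Qed.

Lemma fock_spaceB phi psi : Fk phi -> Fk psi -> Fk (phi - psi).
Proof.
by move=> F1 F2; rewrite -scaleN1r addrC; exact: fock_space_lin.
Qed.

(** Definiteness holds pointwise, not just almost everywhere, thanks to the bound on point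
    evaluations. *)
Lemma fock_norm_eq0 phi : Fk phi -> N phi = 0%E -> phi = 0.
Proof.
move=> F1 N0; have [K K0 hK] := fock_point_eval (n := n) k t0.
apply/funext => z; apply: normc_eq0.
have := hK phi (fock_space_entire F1) (fock_space_fin F1) z; rewrite N0 mulr0 => h.
have : wmod t phi z == 0 by rewrite eq_le h wmod_ge0.
by rewrite mulf_eq0 (gt_eqF (weight_gt0 _ _)) orbF => /eqP.
Qed.

Definition op_linear A := forall c phi psi, Fk phi -> Fk psi -> A (c *: phi + psi) = c *: A phi + A psi.

Lemma op_linear0 A : op_linear A -> A 0 = 0.
Proof.
move=> lA; have := lA (-1) 0 0 fock_space0 fock_space0; rewrite scaler0 addr0 scaleN1r addNr.
exact.
Qed.

Lemma op_linearZ A c phi : op_linear A -> Fk phi -> A (c *: phi) = c *: A phi.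
Proof.
by move=> lA F1; have := lA c phi 0 F1 fock_space0; rewrite (op_linear0 lA) !addr0.
Qed.

Lemma op_norm_ge0 A : (0 <= opN A)%E.
Proof.
apply: le_trans (fock_norm_ge0 k t (A 0)) _; apply: ereal_sup_ubound.
exists (0 : Cn R n -> C R); last by [].
by split; [exact: fock_space0|rewrite (fock_norm_cst0 k t0)].
Qed.

Lemma op_norm_le A K : 0 <= K ->
  (forall phi, Fk phi -> (N (A phi) <= K%:E * N phi)%E) -> (opN A <= K%:E)%E.
Proof.
move=> K0 h; apply: ge_ereal_sup => _ [phi [F1 N1] <-].
by apply: le_trans (h _ F1) _; rewrite -[leRHS]mule1 lee_wpmul2l.
Qed.

Lemma op_norm_bound A phi : op_linear A -> (forall psi, Fk psi -> Fk (A psi)) -> (opN A < +oo)%E ->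
  Fk phi -> (N (A phi) <= opN A * N phi)%E.
Proof.
move=> lA FA finA F1.
have Nf : N phi \is a fin_num by rewrite ge0_fin_numE ?fock_norm_ge0// (fock_space_fin F1).
have Of : opN A \is a fin_num by rewrite ge0_fin_numE ?op_norm_ge0.
have [N0|N0] := eqVneq (N phi) 0%E.
  by rewrite (fock_norm_eq0 F1 N0) (op_linear0 lA) (fock_norm_cst0 k t0) mule0.
pose r := fine (N phi).
have r0 : 0 < r by rewrite fine_gt0// lt_def N0 fock_norm_ge0 /= (fock_space_fin F1).
have rE : N phi = r%:E by rewrite fineK.
have F2 : Fk ((r^-1)%:C%C *: phi) by exact: fock_spaceZ.
have : (N (A ((r^-1)%:C%C *: phi)) <= opN A)%E.
  apply: ereal_sup_ubound; exists ((r^-1)%:C%C *: phi) => //; split=> //.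
  apply: le_trans (fock_normZ t0 _ (fock_space_cmfun F1) (fock_space_fin F1)) _.
  by rewrite normcR ger0_norm ?invr_ge0 ?(ltW r0)// rE -EFinM mulVf// gt_eqF.
rewrite op_linearZ// => h.
have -> : A phi = r%:C%C *: ((r^-1)%:C%C *: A phi).
  by rewrite scalerA -rmorphM mulfV ?gt_eqF// scale1r.
have F3 : Fk ((r^-1)%:C%C *: A phi) by apply: fock_spaceZ; exact: FA.
apply: le_trans (fock_normZ t0 _ (fock_space_cmfun F3) (fock_space_fin F3)) _.
by rewrite normcR ger0_norm ?(ltW r0)// rE muleC; apply: lee_wpmul2r => //; rewrite lee_fin ltW.
Qed.

Lemma bounded_opP A : W A -> [/\ op_linear A, (forall psi, Fk psi -> Fk (A psi)) & (opN A < +oo)%E].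
Proof. by case=> h1 h2 h3; split. Qed.

Lemma bounded_op_bound A phi : W A -> Fk phi -> (N (A phi) <= opN A * N phi)%E.
Proof. by move=> /bounded_opP[h1 h2 h3]; exact: op_norm_bound. Qed.

Lemma op_norm_lin c A B : W A -> W B -> (opN (c *: A + B)%R <= (normc c)%:E * opN A + opN B)%E.
Proof.
move=> WA WB.
have OA : opN A \is a fin_num by rewrite ge0_fin_numE ?op_norm_ge0//; case: WA.
have OB : opN B \is a fin_num by rewrite ge0_fin_numE ?op_norm_ge0//; case: WB.
rewrite -(fineK OA) -(fineK OB) -EFinM -EFinD; apply: op_norm_le.
  by rewrite addr_ge0 ?mulr_ge0 ?normc_ge0 ?fine_ge0 ?op_norm_ge0.
move=> phi F1; have FA := let: And3 h _ _ := WA in h phi F1; have FB := let: And3 h _ _ := WB in h phi F1.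
apply: le_trans (fock_norm_lin c (fock_space_cmfun FA) (fock_space_cmfun FB) (fock_space_fin FA)) _.
rewrite EFinD EFinM !fineK// ge0_muleDl ?mule_ge0 ?op_norm_ge0 ?lee_fin ?normc_ge0//.
apply: leeD; last exact: bounded_op_bound.
by rewrite -muleA; apply: lee_wpmul2l; [rewrite lee_fin normc_ge0|exact: bounded_op_bound].
Qed.

Lemma bounded_op_lin c A B : W A -> W B -> W (c *: A + B).
Proof.
move=> WA WB; split.
- move=> phi F1; apply: fock_space_lin; first by case: WA => h _ _; exact: h.
  by case: WB => h _ _; exact: h.
- move=> c' g h Fg Fh; rewrite -[(c *: A + B) _]/(c *: A (c' *: g + h) + B (c' *: g + h)).
  rewrite -[(c *: A + B) g]/(c *: A g + B g) -[(c *: A + B) h]/(c *: A h + B h).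
  have [_ lA _] := WA; have [_ lB _] := WB; rewrite lA// lB//.
  apply/funext => z; rewrite !fctE /GRing.scale /=; ring.
- apply: le_lt_trans (op_norm_lin c WA WB) _.
  have [_ _ OA] := WA; have [_ _ OB] := WB.
  by rewrite lte_add_pinfty// lte_mul_pinfty// lee_fin normc_ge0.
Qed.

Lemma bounded_op0 : W 0.
Proof.
split.
- by move=> phi _; exact: fock_space0.
- move=> c g h _ _; rewrite -[(0 : (Cn R n -> C R) -> _) _]/(0 : Cn R n -> C R).
  by rewrite -[LHS]/(0 : Cn R n -> C R) -[(0 : (Cn R n -> C R) -> Cn R n -> C R) g]/(0 : Cn R n -> C R) -[(0 : (Cn R n -> C R) -> Cn R n -> C R) h]/(0 : Cn R n -> C R) scaler0 addr0.
- apply: (@le_lt_trans _ _ 0%:E); last by rewrite ltry.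
  apply: op_norm_le => // phi _.
  by rewrite -[(0 : (Cn R n -> C R) -> _) phi]/(0 : Cn R n -> C R) fock_norm_cst0// mul0e.
Qed.

Lemma op_norm_mul A B : W A -> W B -> (opN (op_mul A B) <= opN A * opN B)%E.
Proof.
move=> WA WB.
have OA : opN A \is a fin_num by rewrite ge0_fin_numE ?op_norm_ge0//; case: WA.
have OB : opN B \is a fin_num by rewrite ge0_fin_numE ?op_norm_ge0//; case: WB.
rewrite -(fineK OA) -(fineK OB) -EFinM; apply: op_norm_le.
  by rewrite mulr_ge0 ?fine_ge0 ?op_norm_ge0.
move=> phi F1; have FB := let: And3 h _ _ := WB in h phi F1.
apply: le_trans (bounded_op_bound WA FB) _; rewrite EFinM !fineK// -muleA.
by apply: lee_wpmul2l; [exact: op_norm_ge0|exact: bounded_op_bound].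
Qed.

Lemma bounded_op_mul A B : W A -> W B -> W (op_mul A B).
Proof.
move=> WA WB; split.
- by move=> phi F1; case: WA => h _ _; apply: h; case: WB => h _ _; exact: h.
- move=> c g h Fg Fh; rewrite /op_mul /=; have [FB lB _] := WB; have [_ lA _] := WA.
  by rewrite lB// lA//; exact: FB.
- apply: le_lt_trans (op_norm_mul WA WB) _.
  have [_ _ OA] := WA; have [_ _ OB] := WB.
  have fA : opN A \is a fin_num by rewrite ge0_fin_numE ?op_norm_ge0.
  have fB : opN B \is a fin_num by rewrite ge0_fin_numE ?op_norm_ge0.
  by rewrite -(fineK fA) -(fineK fB) -EFinM ltry.
Qed.

End OperatorNorm.

Section FockComplete.
Context {R : realType} {n : nat}.
Variables (k : fock_kind R) (t : R).
Hypothesis t0 : 0 < t.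
Implicit Types (phi psi f g : Cn R n -> C R).
Local Notation N := (@fock_norm R n k t).
Local Notation Fk := (@fock_space R n k t).

(** Point evaluation makes a Cauchy sequence converge uniformly in weighted modulus. The limit is
    fixed by [Pt t] and is therefore entire by [entire_Pt]. Only pointwise convergence is asserted,
    since norm bounds are recovered by [fock_norm_fatou]. *)
Lemma fock_complete (F : nat -> Cn R n -> C R) : (forall j, Fk (F j)) ->
  (forall e : R, 0 < e -> exists J : nat, forall j l, (J <= j)%N -> (J <= l)%N ->
     (N (F j - F l)%R <= e%:E)%E) ->
  exists2 phi, Fk phi & forall z, ccvg (F ^~ z) (phi z).
Proof.
move=> FF hF; have [K K0 hK] := fock_point_eval (n := n) k t0.
have hw e : 0 < e -> exists J : nat, forall j l, (J <= j)%N -> (J <= l)%N ->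
    forall z, wmod t (F j - F l) z <= e.
  move=> e0; have [J hJ] := hF (e / K) (divr_gt0 e0 K0); exists J => j l Jj Jl z.
  have FB := fock_spaceB t0 (FF j) (FF l).
  apply: le_trans (hK _ (fock_space_entire FB) (fock_space_fin FB) z) _.
  rewrite mulrC -ler_pdivlMr// -lee_fin fineK ?hJ//.
  by rewrite ge0_fin_numE ?fock_norm_ge0// (fock_space_fin FB).
have lim z : exists l, ccvg (F ^~ z) l.
  apply: complex_cauchy_cvg => e e0.
  have w0 := weight_gt0 t z.
  have [J hJ] := hw (e / 2 * weight t z) (mulr_gt0 (divr_gt0 e0 (ltr0Sn _ 1)) w0).
  exists J => j l Jj Jl; have := hJ j l Jj Jl z.
  rewrite /wmod ler_pM2r// => /le_lt_trans; apply.
  by rewrite gtr_pMr// invf_lt1// ltr1n.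
have [phi hphi] := choice lim.
have hu e : 0 < e -> exists J : nat, forall j, (J <= j)%N -> forall z, wmod t (F j - phi) z <= e.
  move=> e0; have [J hJ] := hw e e0; exists J => j Jj z.
  apply/ler_addgt0Pr => d d0; have w0 := weight_gt0 t z.
  have [J' hJ'] := hphi z (d / weight t z) (divr_gt0 d0 w0).
  pose l := maxn J J'; have h1 := hJ j l Jj (leq_maxl _ _) z.
  have := hJ' l (leq_maxr _ _); rewrite ltr_pdivlMr// => /ltW h2.
  apply: le_trans (lerD h1 h2); rewrite /wmod -mulrDl ler_wpM2r ?(ltW w0)//.
  apply: le_trans (normcD _ _); rewrite le_eqVlt; apply/orP; left; apply/eqP; congr normc.
  by rewrite -[(F j - phi) z]/(F j z - phi z) -[(F j - F l) z]/(F j z - F l z) addrA subrK.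
have mF j : cmfun (F j) := fock_space_cmfun (FF j).
have mphi : cmfun phi by exact: cmfun_cvg hphi.
have mB j : cmfun (F j - phi) by exact: (cmfunB (mF j) mphi).
have a0 := twice_inv_gt0 t0; pose a : R := (2 * t)^-1.
(* Each [F j] is fixed by [Pt t], and both sides are continuous for the uniform weighted modulus:
   the difference is at most the error plus its convolution. *)
have phiP : Pt t phi = phi.
  pose c := (pi * t) ^- n * @gmass R n a.
  have c0 : 0 <= c by rewrite mulr_ge0 ?gmass_ge0// ltW// gauss_const_gt0.
  apply/funext => z; apply/eqP; rewrite -subr_eq0; apply/eqP; apply: normc_eq0; apply/eqP.
  rewrite eq_le normc_ge0 andbT; apply/ler_addgt0Pr => e e0; rewrite add0r.
  have w0 := weight_gt0 t z.
  have [J hJ] := hu (e * weight t z / (c + 1)) (divr_gt0 (mulr_gt0 e0 w0) (ltr_wpDl c0 ltr01)).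
  have h1 := hJ J (leqnn _).
  have [M M0 hM] := fock_space_bounded t0 (FF J).
  have hMphi w : wmod t phi w <= M + e * weight t z / (c + 1).
    apply: le_trans (lerD (hM w) (h1 w)); rewrite -{1}[phi](subKr (F J)).
    exact: wmodB.
  have E : Pt t (F J - phi) z = F J z - Pt t phi z.
    rewrite -{2}(Pt_entire_id t0 (fock_space_entire (FF J)) hM).
    have L1 := cL1_kernel z t0 (mF J) hM; have L2 := cL1_kernel z t0 mphi hMphi.
    rewrite /Pt -(cintB L1 L2); apply: eq_cint => w.
    by rewrite -[(F J - phi) w]/(F J w - phi w); ring.
  rewrite -[leRHS](mulfK (lt0r_neq0 w0)) ler_pdivlMr//.
  have h2 : wmod t (Pt t (F J - phi)) z <= c * (e * weight t z / (c + 1)).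
    rewrite -lee_fin; have fin := gconv_bounded_fin t0 z h1 (mB J).
    apply: le_trans (wmod_Pt_gconv t0 (mB J) fin) _.
    rewrite /c -mulrA EFinM; apply: lee_wpmul2l; first by rewrite lee_fin ltW// gauss_const_gt0.
    have d0 : 0 <= e * weight t z / (c + 1).
      by rewrite divr_ge0 ?mulr_ge0 ?(ltW e0) ?(ltW w0)// addr_ge0.
    rewrite [(@gmass _ _ _ * _)%R]mulrC.
    have := gconv_ae_le (@measurable_gker R n a) (gker_ge0 a) (integral_gker a0) z
      (measurable_wmod t (mB J)) (wmod_ge0 t _) d0 (aeW _ h1).
    by move=> /le_trans; apply; rewrite lee_fin /gmass mulrC.
  apply: (@le_trans _ _ (wmod t (F J - phi) z + wmod t (Pt t (F J - phi)) z)).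
    rewrite /wmod -mulrDl ler_wpM2r ?(ltW w0)// E.
    rewrite -[(F J - phi) z]/(F J z - phi z); apply: le_trans (normcB _ _).
    by rewrite le_eqVlt; apply/orP; left; apply/eqP; congr normc; ring.
  apply: le_trans (lerD (h1 z) h2) _; rewrite -{1}[_ / (c + 1)]mul1r -mulrDl addrC.
  by rewrite mulrC mulfVK// gt_eqF// ltr_wpDl.
have [J hJ] := hu 1 ltr01; have [M M0 hM] := fock_space_bounded t0 (FF J).
have hMphi w : wmod t phi w <= M + 1.
  apply: le_trans (lerD (hM w) (hJ J (leqnn _) w)); rewrite -{1}[phi](subKr (F J)).
  exact: wmodB.
have ephi : entire phi by rewrite -phiP; exact: (entire_Pt t0 mphi hMphi).
exists phi => //; apply: fock_spaceE => //.
  have [J' hJ'] := hF 1 ltr01.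
  have fN : N (F J') \is a fin_num by rewrite ge0_fin_numE ?fock_norm_ge0// (fock_space_fin (FF J')).
  apply: (@le_lt_trans _ _ (1 + fine (N (F J')))%:E); last by rewrite ltry.
  apply: (@fock_norm_fatou _ _ k t t0 (fun j => F (j + J')%N)) => //.
  - move=> z e e0; have [J1 h1] := hphi z e e0; exists J1 => j Jj.
    by apply: h1; exact: leq_trans Jj (leq_addr _ _).
  - by rewrite addr_ge0// fine_ge0// fock_norm_ge0.
  - move=> j; rewrite -{1}[F (j + J')%N](subrK (F J')).
    have FB := fock_spaceB t0 (FF (j + J')%N) (FF J').
    apply: le_trans (fock_normD k t0 (fock_space_cmfun FB) (mF J')) _.
    by rewrite EFinD fineK// leeD2r// hJ'// leq_addl.
have : if k is FockZero then forall j, C0 (fun z => F j z * (weight t z)%:C%C) else True.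
  by move: FF; case: (k) => // FF j; case: (FF j).
case: (k) => // hC; apply/C0P; split.
  apply: continuous_mul_real; first exact: entire_continuous.
  exact: eps_continuous_weight.
move=> e e0; have [J1 hJ1] := hu (e / 2) (divr_gt0 e0 (ltr0Sn _ 1)).
have /C0P[_ /(_ (e / 2) (divr_gt0 e0 (ltr0Sn _ 1)))[r hr]] := hC J1.
exists r => z /hr; rewrite !normc_weight => h2.
rewrite [ltRHS]splitr.
apply: le_lt_trans (ltr_leD h2 (hJ1 J1 (leqnn _) z)); rewrite -{1}[phi](subKr (F J1)).
exact: wmodB.
Qed.

End FockComplete.

(** * The algebra BUC and its closed subspaces *)

Section BUCFunctions.
Context {R : realType} {n : nat}.
Implicit Types (f g : Cn R n -> C R) (z w : Cn R n) (D : set (Cn R n -> C R)).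

Lemma sup_norm_leP f (M : R) : (sup_norm f <= M%:E)%E <-> forall z, normc (f z) <= M.
Proof.
split=> [h z|h]; last by apply: ge_ereal_sup => _ [z _ <-]; rewrite lee_fin.
by rewrite -lee_fin; apply: le_trans h; apply: ereal_sup_ubound; exists z.
Qed.

Lemma sup_norm_lt f (M e : R) : M < e -> (forall z, normc (f z) <= M) -> (sup_norm f < e%:E)%E.
Proof. by move=> Me h; apply: (@le_lt_trans _ _ M%:E); [apply/sup_norm_leP|rewrite lte_fin]. Qed.

Lemma BUC_bounded f : BUC f -> exists2 B : R, 0 < B & forall z, normc (f z) <= B.
Proof.
move=> [fin _].
have s0 : (0 <= sup_norm f)%E.
  apply: (@le_trans _ _ (normc (f 0))%:E); first by rewrite lee_fin normc_ge0.
  by apply: ereal_sup_ubound; exists 0.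
have E : sup_norm f = (fine (sup_norm f))%:E by rewrite fineK// ge0_fin_numE.
exists (fine (sup_norm f) + 1); first by rewrite ltr_wpDl// fine_ge0.
by apply/sup_norm_leP; rewrite E lee_fin lerDl.
Qed.

Lemma BUC_bounded_le f (B : R) : (forall z, normc (f z) <= B) -> unif_continuous f -> BUC f.
Proof. by move=> hB uf; split => //; move/sup_norm_leP : hB => /le_lt_trans; apply; rewrite ltry. Qed.

Lemma unif_continuous_cmfun f : unif_continuous f -> cmfun f.
Proof.
move=> /unif_continuous_epsP uf.
by split; apply: measurable_continuous => z e /uf[d d0 hd]; exists d => // w /hd;
  apply: le_lt_trans; rewrite -?ReB -?ImB ?le_Re_normc ?le_Im_normc.
Qed.

Lemma BUC_cmfun f : BUC f -> cmfun f.
Proof. by move=> [_ /unif_continuous_cmfun]. Qed.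

Lemma unif_continuous_limit f : (forall e : R, 0 < e -> exists2 g, unif_continuous g &
  forall z, normc (f z - g z) <= e) -> unif_continuous f.
Proof.
move=> h; apply/unif_continuous_epsP => e e0.
have e3 : 0 < e / 4 by rewrite divr_gt0.
have [g /unif_continuous_epsP ug hg] := h _ e3; have [d d0 hd] := ug _ e3.
exists d => // z w /hd hzw; have hz := hg z; have hw := hg w.
have -> : f z - f w = (f z - g z) + (g z - g w) - (f w - g w) by ring.
apply: le_lt_trans (normcB _ _) _; apply: le_lt_trans (lerD (normcD _ _) (lexx _)) _.
lra.
Qed.

Lemma BUC_mul f g : BUC f -> BUC g -> BUC (fun_mul f g).
Proof.
move=> Bf Bg; have [A A0 hA] := BUC_bounded Bf; have [B B0 hB] := BUC_bounded Bg.
apply: (@BUC_bounded_le _ (A * B)).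
  by move=> z; rewrite /fun_mul /= normcM ler_pM ?normc_ge0.
apply/unif_continuous_epsP => e e0.
have [_ /unif_continuous_epsP uf] := Bf; have [_ /unif_continuous_epsP ug] := Bg.
have [d d0 hd] := uf (e / 2 / B) (divr_gt0 (divr_gt0 e0 (ltr0Sn _ 1)) B0).
have [d' d'0 hd'] := ug (e / 2 / A) (divr_gt0 (divr_gt0 e0 (ltr0Sn _ 1)) A0).
exists (Num.min d d'); first by rewrite lt_min d0.
move=> z w; rewrite lt_min => /andP[/hd h1 /hd' h2]; rewrite /fun_mul /=.
have -> : f z * g z - f w * g w = (f z - f w) * g z + f w * (g z - g w) by ring.
apply: le_lt_trans (normcD _ _) _; rewrite !normcM [ltRHS]splitr.
rewrite ltr_pdivlMr// in h1; rewrite ltr_pdivlMr// mulrC in h2.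
apply: ltrD; first by apply: le_lt_trans h1; rewrite ler_wpM2l ?normc_ge0.
by apply: le_lt_trans h2; rewrite ler_wpM2r ?normc_ge0.
Qed.

Lemma BUC_dilate f (c : R) : 0 < c -> BUC f -> BUC (fun z => f (c%:C%C *: z)).
Proof.
move=> c0 Bf; have [A A0 hA] := BUC_bounded Bf; apply: (@BUC_bounded_le _ A) => //.
have [_ /unif_continuous_epsP uf] := Bf; apply/unif_continuous_epsP => e /uf[d d0 hd].
exists (d / c ^+ 2); first by rewrite divr_gt0// exprn_gt0.
by move=> z w h; apply: hd; rewrite -scalerBr sqnormZR mulrC -ltr_pdivlMr ?exprn_gt0.
Qed.

Lemma BUC_complete D : is_closed_subspace BUC sup_norm D -> is_complete sup_norm D.
Proof.
move=> [DB sD clD] u Du hu.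
have hn e : 0 < e -> exists K : nat, forall j l, (K <= j)%N -> (K <= l)%N ->
    forall z, normc (u j z - u l z) < e.
  move=> e0; have [K hK] := hu e e0; exists K => j l Kj Kl z.
  rewrite -lte_fin; apply: le_lt_trans (hK j l Kj Kl).
  by apply: ereal_sup_ubound; exists z.
have lim z : exists l, ccvg (u ^~ z) l.
  by apply: complex_cauchy_cvg => e /hn[K hK]; exists K => j l Kj Kl; exact: hK.
have [f hf] := choice lim.
have hu' e : 0 < e -> exists K : nat, forall j, (K <= j)%N -> forall z, normc (u j z - f z) <= e.
  move=> /hn[K hK]; exists K => j Kj z; apply/ler_addgt0Pr => d d0.
  have [K' hK'] := hf z d d0; pose l := maxn K K'.
  have -> : u j z - f z = (u j z - u l z) + (u l z - f z) by ring.
  apply: le_trans (normcD _ _) _; apply: lerD; first by rewrite ltW// hK// leq_maxl.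
  by rewrite ltW// hK'// leq_maxr.
have Bf : BUC f.
  have [K hK] := hu' 1 ltr01; have [B B0 hB] := BUC_bounded (DB _ (Du K)).
  apply: (@BUC_bounded_le _ (B + 1)).
    move=> z; rewrite -[f z](subKr (u K z)); apply: le_trans (normcB _ _) _.
    by rewrite lerD// hK.
  apply: unif_continuous_limit => e /hu'[K' hK']; exists (u K'); first by case: (DB _ (Du K')).
  by move=> z; rewrite normc_distC hK'.
have cv e : 0 < e -> exists K : nat, forall j, (K <= j)%N -> (sup_norm (u j - f)%R < e%:E)%E.
  move=> e0; have [K hK] := hu' (e / 2) (divr_gt0 e0 (ltr0Sn _ 1)); exists K => j Kj.
  by apply: (@sup_norm_lt _ (e / 2)); [rewrite gtr_pMr// invf_lt1// ltr1n|exact: hK].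
exists f => //; apply: clD => // e /cv[K hK]; exists (u K) => //.
suff -> : sup_norm (f - u K) = sup_norm (u K - f) by exact: hK.
by congr ereal_sup; apply/seteqP; split=> _ [z _ <-]; exists z => //; congr EFin; rewrite normc_distC.
Qed.

Lemma closed_subspace_limit D f : is_closed_subspace BUC sup_norm D -> BUC f ->
  (forall e : R, 0 < e -> exists2 g, D g & forall z, normc (f z - g z) <= e) -> D f.
Proof.
move=> [_ _ clD] Bf h; apply: clD => // e e0.
have [g Dg hg] := h (e / 2) (divr_gt0 e0 (ltr0Sn _ 1)); exists g => //.
by apply: (@sup_norm_lt _ (e / 2)); [rewrite gtr_pMr// invf_lt1// ltr1n|exact: hg].
Qed.

End BUCFunctions.

Section RealOperatorNorm.
Context {R : realType} {n : nat}.
Variables (k : fock_kind R) (t : R).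
Hypothesis t0 : 0 < t.
Implicit Types (phi psi f g : Cn R n -> C R) (A B : (Cn R n -> C R) -> (Cn R n -> C R)).
Implicit Types (K M : R) (c : C R) (D E : set (Cn R n -> C R)).
Local Notation N := (@fock_norm R n k t).
Local Notation Fk := (@fock_space R n k t).
Local Notation W := (@bounded_operators R n k t).
Local Notation opN := (@op_norm R n k t).

(** Real-valued, hence 0 on an operator of infinite norm; it agrees with [op_norm] on bounded
    operators by [oprE]. *)
Definition opr A : R := fine (opN A).

Lemma opr_ge0 A : 0 <= opr A.
Proof. by rewrite fine_ge0// op_norm_ge0. Qed.

Lemma oprE A : W A -> opN A = (opr A)%:E.
Proof. by move=> [_ _ h]; rewrite fineK// ge0_fin_numE// op_norm_ge0. Qed.

Lemma opr_bound A phi : W A -> Fk phi -> (N (A phi) <= (opr A)%:E * N phi)%E.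
Proof. by move=> WA F1; rewrite -(oprE WA); exact: bounded_op_bound. Qed.

Lemma opr_le A K : W A -> 0 <= K ->
  (forall phi, Fk phi -> (N (A phi) <= K%:E * N phi)%E) -> opr A <= K.
Proof. by move=> WA K0 h; rewrite -lee_fin -(oprE WA); exact: op_norm_le. Qed.

Lemma op_norm_ext A B : (forall phi, Fk phi -> A phi = B phi) -> opN A = opN B.
Proof.
move=> h; congr ereal_sup; apply/seteqP; split=> _ [phi [F1 N1] <-]; exists phi => //.
  by rewrite h.
by rewrite h.
Qed.

Lemma opr_ext A B : (forall phi, Fk phi -> A phi = B phi) -> opr A = opr B.
Proof. by move=> /op_norm_ext h; rewrite /opr h. Qed.

Lemma opr_lin c A B : W A -> W B -> opr (c *: A + B) <= normc c * opr A + opr B.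
Proof.
move=> WA WB; have WC := bounded_op_lin t0 c WA WB.
by rewrite -lee_fin -(oprE WC) EFinD EFinM -(oprE WA) -(oprE WB); exact: op_norm_lin.
Qed.

Lemma bounded_opB A B : W A -> W B -> W (A - B).
Proof. by move=> WA WB; rewrite addrC -scaleN1r; exact: bounded_op_lin. Qed.

Lemma oprD A B : W A -> W B -> opr (A + B) <= opr A + opr B.
Proof. by move=> WA WB; have := opr_lin 1 WA WB; rewrite scale1r normc1 mul1r. Qed.

Lemma opr_dist A B : W A -> W B -> opr (A - B) = opr (B - A).
Proof.
move=> WA WB; apply/le_anti/andP.
suff h A' B' : W A' -> W B' -> opr (A' - B') <= opr (B' - A') by split; exact: h.
move=> WA' WB'; have h0 : opr 0 <= 0.
  apply: (opr_le (bounded_op0 k t0) (lexx 0)) => phi F1.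
  rewrite -[(0 : (Cn R n -> C R) -> _) phi]/(0 : Cn R n -> C R) (fock_norm_cst0 k t0).
  by rewrite mul0e.
have E : A' - B' = (-1 : C R) *: (B' - A') + 0 by rewrite scaleN1r opprB addr0.
have h1 := opr_lin (-1) (bounded_opB WB' WA') (bounded_op0 k t0).
rewrite -E normcN normc1 mul1r in h1.
by rewrite -[leRHS]addr0; exact: (le_trans h1 (lerD (lexx _) h0)).
Qed.

Lemma oprM A B : W A -> W B -> opr (op_mul A B) <= opr A * opr B.
Proof.
move=> WA WB; have WC := bounded_op_mul t0 WA WB.
by rewrite -lee_fin -(oprE WC) EFinM -(oprE WA) -(oprE WB); exact: op_norm_mul.
Qed.

(** The limit operator is built pointwise on each [phi] by [fock_complete]; Fatou's lemma applied to
    [A j phi - A l phi] as [l] grows upgrades this to convergence in operator norm. *)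
Lemma bounded_operators_complete (A : nat -> (Cn R n -> C R) -> (Cn R n -> C R)) :
  (forall j, W (A j)) ->
  (forall e : R, 0 < e -> exists J : nat, forall j l, (J <= j)%N -> (J <= l)%N -> opr (A j - A l) < e) ->
  exists2 V, W V & forall e : R, 0 < e -> exists J : nat, forall j, (J <= j)%N -> opr (A j - V) <= e.
Proof.
move=> WA hA.
have FA j phi : Fk phi -> Fk (A j phi) by move=> F1; case: (WA j) => h _ _; exact: h.
have hN j l phi : Fk phi -> (N (A j phi - A l phi)%R <= (opr (A j - A l))%:E * N phi)%E.
  by move=> F1; exact: (opr_bound (bounded_opB (WA j) (WA l)) F1).
(* The implication makes the statement total, as [choice] requires; outside the Fock space the value
   of the limit is irrelevant. *)
have lim phi : exists psi, Fk phi -> Fk psi /\ forall z, ccvg (fun j => A j phi z) (psi z).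
  have [F1|nF1] := pselect (Fk phi); last by exists 0.
  have [] := @fock_complete R n k t t0 (fun j => A j phi).
  - by move=> j; exact: FA.
  - move=> e e0.
    have Np0 : 0 < fine (N phi) + 1 by rewrite ltr_wpDl// fine_ge0// fock_norm_ge0.
    have [J hJ] := hA (e / (fine (N phi) + 1)) (divr_gt0 e0 Np0).
    exists J => j l Jj Jl; apply: le_trans (hN j l phi F1) _.
    have fN : N phi \is a fin_num by rewrite ge0_fin_numE ?fock_norm_ge0// (fock_space_fin F1).
    rewrite -(fineK fN) -EFinM lee_fin.
    have := hJ j l Jj Jl; rewrite ltr_pdivlMr// => /ltW; apply: le_trans.
    by rewrite ler_wpM2l ?opr_ge0// lerDl.
  - by move=> psi Fpsi hpsi; exists psi.
have [V hV] := choice lim.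
have FV phi : Fk phi -> Fk (V phi) by move=> /hV[].
have cV phi : Fk phi -> forall z, ccvg (fun j => A j phi z) (V phi z) by move=> /hV[].
have hAV e : 0 < e -> exists J : nat, forall j, (J <= j)%N ->
    forall phi, Fk phi -> (N (A j phi - V phi)%R <= e%:E * N phi)%E.
  move=> e0; have [J hJ] := hA e e0; exists J => j Jj phi F1.
  have fN : N phi \is a fin_num by rewrite ge0_fin_numE ?fock_norm_ge0// (fock_space_fin F1).
  rewrite -(fineK fN) -EFinM.
  apply: (@fock_norm_fatou _ _ k t t0 (fun l => A j phi - A (l + J)%N phi)) => //.
  - by move=> l; apply: cmfunB; apply: fock_space_cmfun; exact: FA.
  - move=> z d d0; have [J1 h1] := cV phi F1 z d d0; exists J1 => l Jl.
    rewrite -[(A j phi - _) z]/(A j phi z - A (l + J)%N phi z).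
    rewrite -[(A j phi - V phi) z]/(A j phi z - V phi z) normc_distC.
    rewrite (_ : _ - (_ - _) = A (l + J)%N phi z - V phi z); last by ring.
    by apply: h1; exact: leq_trans Jl (leq_addr _ _).
  - by rewrite mulr_ge0 ?(ltW e0)// fine_ge0// fock_norm_ge0.
  - move=> l; apply: le_trans (hN _ _ _ F1) _; rewrite EFinM (fineK fN).
    by apply: lee_wpmul2r; [exact: fock_norm_ge0|rewrite lee_fin ltW// hJ// leq_addl].
have lV c g h : Fk g -> Fk h -> V (c *: g + h) = c *: V g + V h.
  move=> Fg Fh; apply/funext => z.
  have F3 := fock_space_lin t0 c Fg Fh.
  apply: (ccvg_unique (cV _ F3 z)) => e e0.
  have c1 : 0 < normc c + 1 by rewrite ltr_wpDl ?normc_ge0.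
  have [J1 h1] := cV _ Fg z (e / 2 / (normc c + 1)) (divr_gt0 (divr_gt0 e0 (ltr0Sn _ 1)) c1).
  have [J2 h2] := cV _ Fh z (e / 2) (divr_gt0 e0 (ltr0Sn _ 1)).
  exists (maxn J1 J2) => j; rewrite geq_max => /andP[/h1 + /h2 k2].
  rewrite ltr_pdivlMr// => k1.
  have [_ lA _] := WA j; rewrite lA//.
  rewrite -[(c *: A j g + A j h) z]/(c * A j g z + A j h z) -[(c *: V g + V h) z]/(c * V g z + V h z).
  rewrite (_ : _ - _ = c * (A j g z - V g z) + (A j h z - V h z)); last by ring.
  apply: le_lt_trans (normcD _ _) _; rewrite normcM [ltRHS]splitr ltrD//.
  by apply: le_lt_trans k1; rewrite mulrC ler_wpM2l ?normc_ge0// lerDl.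
have WV : W V.
  split=> //; have [J hJ] := hAV 1 ltr01.
  apply: (@le_lt_trans _ _ (opr (A J) + 1)%:E); last by rewrite ltry.
  apply: op_norm_le; first by rewrite addr_ge0 ?opr_ge0.
  move=> phi F1; rewrite -[V phi](subKr (A J phi)) -scaleN1r addrC.
  have FB := fock_spaceB t0 (FA J phi F1) (FV _ F1).
  apply: le_trans (fock_norm_lin t0 (-1) (fock_space_cmfun FB) (fock_space_cmfun (FA J _ F1)) (fock_space_fin FB)) _.
  rewrite normcN normc1 mul1e EFinD ge0_muleDl ?lee_fin ?opr_ge0// addeC.
  by apply: leeD; [exact: opr_bound|exact: hJ].
exists V => // e e0; have [J hJ] := hAV e e0; exists J => j Jj.
by apply: opr_le; [exact: bounded_opB|exact: ltW|move=> phi F1; exact: hJ].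
Qed.

End RealOperatorNorm.

(** * Closed spans of Toeplitz operators *)

Section ToeplitzSpaces.
Context {R : realType} {n : nat}.
Variables (k : fock_kind R) (t : R).
Hypothesis t0 : 0 < t.
Implicit Types (phi psi f g : Cn R n -> C R) (A B u v : (Cn R n -> C R) -> (Cn R n -> C R)).
Implicit Types (c : C R) (D E G : set (Cn R n -> C R)).
Local Notation N := (@fock_norm R n k t).
Local Notation Fk := (@fock_space R n k t).
Local Notation W := (@bounded_operators R n k t).
Local Notation opr := (@opr R n k t).
Local Notation T := (@toeplitz R n t).

Lemma bounded_toeplitz f : BUC f -> W (T f).
Proof.
move=> Bf; have [B B0 hB] := BUC_bounded Bf; have mf := BUC_cmfun Bf; split.
- by move=> phi F1; exact: (toeplitz_fock t0 mf B0 hB F1).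
- by move=> c phi psi F1 F2; exact: (toeplitz_linear t0 c mf hB F1 F2).
- apply: (@le_lt_trans _ _ ((pi * t) ^- n * B * (@gmass R n (2 * t)^-1 + 1) ^+ 2)%:E); last by rewrite ltry.
  apply: op_norm_le => [|phi F1]; last exact: (toeplitz_norm t0 mf B0 hB F1).
  by rewrite mulr_ge0 ?sqr_ge0// mulr_ge0 ?(ltW B0)// ltW// gauss_const_gt0.
Qed.

Lemma toeplitz_lin c f g phi : BUC f -> BUC g -> Fk phi ->
  T (c *: f + g) phi = c *: T f phi + T g phi.
Proof.
move=> Bf Bg F1; have [M M0 hM] := fock_space_bounded t0 F1.
have mphi := fock_space_cmfun F1; have mf := BUC_cmfun Bf; have mg := BUC_cmfun Bg.
have [A A0 hA] := BUC_bounded Bf; have [B B0 hB] := BUC_bounded Bg.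
rewrite (toeplitzE t (cmfun_lin c mf mg) mphi) (toeplitzE t mf mphi) (toeplitzE t mg mphi); apply/funext => z.
have L1 := cL1_kernel z t0 (cmfunM mf mphi) (wmod_mul_bounded hA hM).
have L2 := cL1_kernel z t0 (cmfunM mg mphi) (wmod_mul_bounded hB hM).
have H := cintD (cL1Z c L1) L2; rewrite (cintZ c L1) in H.
apply: etrans H; apply: eq_cint => w.
by rewrite /fun_mul /= -[(c *: f + g) w]/(c * f w + g w); ring.
Qed.

Lemma BUC0 : BUC (0 : Cn R n -> C R).
Proof.
apply: (@BUC_bounded_le _ _ _ 0) => [z|]; first by rewrite normc0.
by apply/unif_continuous_epsP => e e0; exists 1 => // z w _; rewrite subrr normc0.
Qed.

Lemma toeplitz0 phi : Fk phi -> T 0 phi = 0.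
Proof.
move=> F1; have := toeplitz_lin (-1) BUC0 BUC0 F1.
by rewrite scaler0 addr0 scaleN1r addNr.
Qed.

(** Linearity in the symbol lets one symbol represent a whole combination, so [Tlin] is just the
    closure of the Toeplitz operators. The equality is restricted to the Fock space, on which alone
    linearity in the symbol is known. *)
Lemma lin_span_toeplitz D v : D `<=` BUC -> is_subspace D ->
  lin_span [set T f | f in D] v -> exists2 f, D f & forall phi, Fk phi -> v phi = T f phi.
Proof.
move=> DB [D0 DL] [m [c [s [hs ->]]]].
pose P := fun w : (Cn R n -> C R) -> (Cn R n -> C R) =>
  exists2 f, D f & forall phi, Fk phi -> w phi = T f phi.
rewrite -/(P _); apply: (@big_ind _ P).
- by exists 0 => // phi F1; rewrite toeplitz0.
- move=> u w [f Df hf] [g Dg hg]; exists (1 *: f + g); first exact: DL.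
  move=> phi F1; rewrite (toeplitz_lin 1 (DB _ Df) (DB _ Dg) F1) scale1r -(hf phi F1) -(hg phi F1).
  by [].
- move=> i _; have [f Df <-] := hs i; exists (c i *: f + 0); first exact: DL.
  by move=> phi F1; rewrite (toeplitz_lin (c i) (DB _ Df) BUC0 F1) toeplitz0// addr0.
Qed.

Lemma TlinP D u : D `<=` BUC -> is_subspace D ->
  (Tlin k t D u <-> W u /\ forall e : R, 0 < e -> exists2 f, D f & opr (u - T f) < e).
Proof.
move=> DB sD; split=> [[Wu h]|[Wu h]]; split=> // e e0.
  have [v sv hv] := h e e0; have [f Df hf] := lin_span_toeplitz DB sD sv; exists f => //.
  have WB := bounded_opB t0 Wu (bounded_toeplitz (DB _ Df)).
  rewrite -lte_fin -(oprE t0 WB).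
  apply: le_lt_trans hv; rewrite le_eqVlt; apply/orP; left; apply/eqP.
  by apply: op_norm_ext => phi F1; rewrite -[(u - _) phi]/(u phi - T f phi) -(hf phi F1).
have [f Df hf] := h e e0; exists (T f).
  exists 1%N, (fun=> 1), (fun=> T f); split; first by move=> i; exists f.
  by rewrite big_ord_recl big_ord0 addr0 scale1r.
by rewrite (oprE t0 (bounded_opB t0 Wu (bounded_toeplitz (DB _ Df)))) lte_fin.
Qed.

Lemma Tlin_toeplitz D f : D `<=` BUC -> is_subspace D -> D f -> Tlin k t D (T f).
Proof.
move=> DB sD Df; apply/TlinP => //; split; first by apply: bounded_toeplitz; exact: DB.
move=> e e0; exists f => //; rewrite subrr; apply: le_lt_trans e0.
apply: (opr_le t0 (bounded_op0 k t0) (lexx 0)) => phi F1.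
rewrite -[(0 : (Cn R n -> C R) -> _) phi]/(0 : Cn R n -> C R) (fock_norm_cst0 k t0).
by rewrite mul0e.
Qed.

Lemma Tlin_mono D E : D `<=` E -> Tlin k t D `<=` Tlin k t E.
Proof.
move=> DE u [Wu h]; split => // e /h[v [m [c [s [hs ->]]]] hv]; exists (\sum_(i < m) c i *: s i) => //.
by exists m, c, s; split=> // i; have [f Df <-] := hs i; exists f => //; exact: DE.
Qed.

Lemma Tlin_closed D u : D `<=` BUC -> is_subspace D -> W u ->
  (forall e : R, 0 < e -> exists2 v, Tlin k t D v & opr (u - v) <= e) -> Tlin k t D u.
Proof.
move=> DB sD Wu h; apply/TlinP => //; split=> // e e0.
have [v /(TlinP _ DB sD)[Wv hv] huv] := h (e / 2) (divr_gt0 e0 (ltr0Sn _ 1)).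
have [f Df hf] := hv (e / 2) (divr_gt0 e0 (ltr0Sn _ 1)); exists f => //.
have WT := bounded_toeplitz (DB _ Df).
rewrite -[u](subrK v) -addrA; apply: le_lt_trans (oprD t0 (bounded_opB t0 Wu Wv) (bounded_opB t0 Wv WT)) _.
by rewrite [ltRHS]splitr ler_ltD.
Qed.

Lemma Tlin_subspace D : D `<=` BUC -> is_subspace D -> is_subspace (Tlin k t D).
Proof.
move=> DB sD; split.
  apply: (Tlin_closed DB sD (bounded_op0 k t0)) => e e0; exists (T 0).
    by apply: Tlin_toeplitz => //; case: sD.
  rewrite (@opr_ext _ _ _ _ _ 0) => [|phi F1].
    apply: (opr_le t0 (bounded_op0 k t0) (ltW e0)) => phi F1.
    rewrite -[(0 : (Cn R n -> C R) -> _) phi]/(0 : Cn R n -> C R) (fock_norm_cst0 k t0).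
    by rewrite mule_ge0 ?fock_norm_ge0// lee_fin ltW.
  rewrite -[(0 - T 0) phi]/((0 : Cn R n -> C R) - T 0 phi) toeplitz0// subr0.
  by [].
move=> c u v /(TlinP _ DB sD)[Wu hu] /(TlinP _ DB sD)[Wv hv].
have WL := bounded_op_lin t0 c Wu Wv; apply/TlinP => //; split=> // e e0.
have c1 : 0 < normc c + 1 by rewrite ltr_wpDl ?normc_ge0.
have [f Df hf] := hu (e / 2 / (normc c + 1)) (divr_gt0 (divr_gt0 e0 (ltr0Sn _ 1)) c1).
have [g Dg hg] := hv (e / 2) (divr_gt0 e0 (ltr0Sn _ 1)).
have WB1 := bounded_opB t0 Wu (bounded_toeplitz (DB _ Df)).
have WB2 := bounded_opB t0 Wv (bounded_toeplitz (DB _ Dg)).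
exists (c *: f + g); first by case: sD => _; exact.
rewrite (@opr_ext _ _ _ _ _ (c *: (u - T f) + (v - T g))) => [|phi F1]; last first.
  rewrite -[LHS]/(c *: u phi + v phi - T (c *: f + g) phi).
  rewrite -[RHS]/(c *: (u phi - T f phi) + (v phi - T g phi)).
  rewrite (toeplitz_lin c (DB _ Df) (DB _ Dg) F1) scalerBr opprD.
  by rewrite addrACA.
apply: le_lt_trans (opr_lin t0 c WB1 WB2) _; rewrite [ltRHS]splitr ler_ltD//.
rewrite ltr_pdivlMr// in hf; apply: le_trans (ltW hf).
by rewrite mulrC ler_wpM2l ?opr_ge0// lerDl.
Qed.

Lemma Tlin_complete D : D `<=` BUC -> is_subspace D -> is_complete (op_norm k t) (Tlin k t D).
Proof.
move=> DB sD u Tu hu.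
have Wu j : W (u j) by case: (Tu j).
have [|V WV hV] := bounded_operators_complete t0 Wu.
  move=> e /hu[J hJ]; exists J => j l Jj Jl.
  by rewrite -lte_fin -(oprE t0 (bounded_opB t0 (Wu j) (Wu l))) hJ.
exists V.
  apply: Tlin_closed => // e /hV[J hJ]; exists (u J) => //.
  by rewrite opr_dist// hJ.
move=> e e0; have [J hJ] := hV (e / 2) (divr_gt0 e0 (ltr0Sn _ 1)); exists J => j Jj.
rewrite (oprE t0 (bounded_opB t0 (Wu j) WV)) lte_fin; apply: le_lt_trans (hJ j Jj) _.
by rewrite gtr_pMr// invf_lt1// ltr1n.
Qed.

(** Density argument based on [u v - T_f T_g = (u - T_f) v + T_f (v - T_g)]. *)
Lemma Tlin_mul D E G u v : D `<=` BUC -> is_subspace D -> E `<=` BUC -> is_subspace E ->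
  G `<=` BUC -> is_subspace G ->
  (forall f g, D f -> E g -> Tlin k t G (op_mul (T f) (T g))) ->
  Tlin k t D u -> Tlin k t E v -> Tlin k t G (op_mul u v).
Proof.
move=> DB sD EB sE GB sG h /(TlinP _ DB sD)[Wu hu] /(TlinP _ EB sE)[Wv hv].
apply: Tlin_closed => //; first exact: bounded_op_mul.
move=> e e0; have e2 : 0 < e / 2 by rewrite divr_gt0.
have v1 : 0 < opr v + 1 by rewrite ltr_wpDl ?opr_ge0.
have [f Df hf] := hu (e / 2 / (opr v + 1)) (divr_gt0 e2 v1).
have f1 : 0 < opr (T f) + 1 by rewrite ltr_wpDl ?opr_ge0.
(* The tolerance for [g] depends on the norm of [T f], so [f] has to be fixed before. *)
have [g Eg hg] := hv (e / 2 / (opr (T f) + 1)) (divr_gt0 e2 f1).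
have Wf := bounded_toeplitz (DB _ Df); have Wg := bounded_toeplitz (EB _ Eg).
have WB1 := bounded_opB t0 Wu Wf; have WB2 := bounded_opB t0 Wv Wg.
exists (op_mul (T f) (T g)); first exact: h.
rewrite (@opr_ext _ _ _ _ _ (op_mul (u - T f) v + op_mul (T f) (v - T g))) => [|phi F1]; last first.
  have [Fv _ _] := Wv; have [Fg _ _] := Wg; have [_ lf _] := Wf.
  rewrite -[LHS]/(u (v phi) - T f (T g phi)).
  rewrite -[RHS]/(u (v phi) - T f (v phi) + T f (v phi - T g phi)).
  have -> : v phi - T g phi = (-1 : C R) *: T g phi + v phi by rewrite scaleN1r addrC.
  rewrite (lf _ _ _ (Fg _ F1) (Fv _ F1)) scaleN1r [- _ + _]addrC addrA subrK.
  by [].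
apply: le_trans (oprD t0 (bounded_op_mul t0 WB1 Wv) (bounded_op_mul t0 Wf WB2)) _.
rewrite [leRHS]splitr; apply: lerD.
  apply: le_trans (oprM t0 WB1 Wv) _; rewrite ltr_pdivlMr// in hf.
  by apply: le_trans (ltW hf); rewrite ler_wpM2l ?opr_ge0// lerDl.
apply: le_trans (oprM t0 Wf WB2) _; rewrite ltr_pdivlMr// in hg.
by apply: le_trans (ltW hg); rewrite mulrC ler_wpM2l ?opr_ge0// lerDl.
Qed.

End ToeplitzSpaces.

(** * Products of Toeplitz operators *)

Section IteratedIntegrals.
Context {R : realType} d1 d2 (T1 : measurableType d1) (T2 : measurableType d2).
Variables (m1 : {sigma_finite_measure set T1 -> \bar R})
          (m2 : {sigma_finite_measure set T2 -> \bar R}).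
Local Notation Re := (@complex.Re R).
Local Notation Im := (@complex.Im R).

Lemma measurable_normc_EFin d (T : measurableType d) (f : T -> C R) : cmfun f ->
  measurable_fun setT (fun x => (normc (f x))%:E).
Proof. by move=> mf; apply/measurable_EFinP; exact: measurable_normc. Qed.

Lemma cint_product (f : T1 * T2 -> C R) : cmfun f ->
  (forall x, cL1 m2 (fun y => f (x, y))) ->
  (\int[m1]_x \int[m2]_y (normc (f (x, y)))%:E < +oo)%E ->
  cint (product_sfmeasure m1 m2) f = cint m1 (fun x => cint m2 (fun y => f (x, y))).
Proof.
move=> mf h2 fin.
have Lf : cL1 (product_sfmeasure m1 m2) f.
  split => //; rewrite (@fubini_tonelli1 _ _ _ _ _ m1 m2 (fun q => (normc (f q))%:E))//.
    exact: measurable_normc_EFin.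
  by move=> x; rewrite lee_fin normc_ge0.
have key (p : C R -> R) :
    (product_sfmeasure m1 m2).-integrable setT (EFin \o (fun q => p (f q))) ->
    (forall x, m2.-integrable setT (EFin \o (fun y => p (f (x, y))))) ->
    (\int[product_sfmeasure m1 m2]_q p (f q) = \int[m1]_x \int[m2]_y p (f (x, y)))%R.
  move=> ip i2; rewrite /Rintegral; congr fine.
  rewrite -(integral12_prod_meas1 ip); apply: eq_integral => x _.
  by rewrite fineK//; apply: integrable_fin_num => //; exact: i2.
by apply: complex_eqP; rewrite /cint /=; apply: key;
  [exact: cL1_Re Lf|move=> x; exact: cL1_Re (h2 x)|exact: cL1_Im Lf|move=> x; exact: cL1_Im (h2 x)].
Qed.

Lemma cL1_cint_section (f : T1 * T2 -> C R) : cmfun f ->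
  (forall x, cL1 m2 (fun y => f (x, y))) ->
  (\int[m1]_x \int[m2]_y (normc (f (x, y)))%:E < +oo)%E ->
  cL1 m1 (fun x => cint m2 (fun y => f (x, y))).
Proof.
move=> mf h2 fin; split; first exact: cmfun_cint.
apply: le_lt_trans fin; apply: ge0_le_integral => //.
- by move=> x _; rewrite lee_fin normc_ge0.
- by apply: measurable_normc_EFin; exact: cmfun_cint.
- apply: (measurable_fun_fubini_tonelli_F (fun q => (normc (f q))%:E)) => //.
    exact: measurable_normc_EFin.
  by move=> q; rewrite lee_fin normc_ge0.
- by move=> x _; exact: normc_cint_le (h2 x).
Qed.

End IteratedIntegrals.

Section TwistedFubini.
Context {R : realType} {n : nat} d (T : measurableType d).
Variable nu : {sigma_finite_measure set T -> \bar R}.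
Local Notation L := (@lebC R n).
Variables (K : T -> C R) (H : T -> Cn R n -> C R) (G : Cn R n -> C R) (s : T -> Cn R n) (B M : R).
Hypotheses (LK : cL1 nu K) (LG : cL1 L G).
Hypotheses (mH : cmfun (fun q : T * Cn R n => H q.1 q.2)) (ms : measurable_fun setT s).
Hypotheses (hB : forall p u, normc (H p u) <= B) (hM : forall u, normc (G u) <= M).

Let B0 (p : T) : 0 <= B.
Proof. exact: le_trans (normc_ge0 _) (hB p 0). Qed.

Let bound p u v : normc (K p * H p u * G v) <= B * normc (K p) * normc (G v).
Proof. by rewrite !normcM ler_wpM2r ?normc_ge0// mulrC ler_wpM2r ?normc_ge0. Qed.

(** Exchange the integrals, translate [u] by [s p] for each fixed [p], exchange back. It moves the
    translations inside a symbol onto the function to which the operator is applied. *)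
Lemma twisted_fubini :
  cint L (fun u => cint nu (fun p => K p * H p u * G u)) =
  cint L (fun u => cint nu (fun p => K p * H p (u - s p) * G (u - s p))).
Proof.
have mK := proj1 LK; have mG := proj1 LG.
have LG1 p : cL1 L (fun u => G (u - s p)) := cL1_mpres (mpres_shift (- s p)) LG.
have mu1 : measurable_fun setT (fun q : T * Cn R n => q.2 - s q.1).
  by apply: measurable_CnB; [exact: measurable_snd|apply: (measurableT_comp ms); exact: measurable_fst].
have mK1 : cmfun (fun q : T * Cn R n => K q.1) by exact: (@cmfun_comp _ _ _ _ _ _ _ measurable_fst mK).
have m0 : cmfun (fun q : T * Cn R n => K q.1 * H q.1 q.2 * G q.2).
  by apply: cmfunM; [exact: cmfunM|exact: (@cmfun_comp _ _ _ _ _ _ _ measurable_snd mG)].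
have m1 : cmfun (fun q : T * Cn R n => K q.1 * H q.1 (q.2 - s q.1) * G (q.2 - s q.1)).
  apply: cmfunM; last exact: (@cmfun_comp _ _ _ _ _ _ _ mu1 mG).
  apply: cmfunM => //; apply: (@cmfun_comp _ _ _ _ _ (fun q : T * Cn R n => (q.1, q.2 - s q.1)) _ _ mH).
  by apply/measurable_fun_pair => //=; exact: measurable_fst.
have fK : (\int[nu]_p (normc (K p))%:E < +oo)%E := proj2 LK.
have sec d' (T' : measurableType d') (mu : {measure set T' -> \bar R}) (a : T' -> C R) (b : T' -> R) c :
    cmfun a -> measurable_fun setT b -> (forall x, 0 <= b x) -> 0 <= c -> (\int[mu]_x (b x)%:E < +oo)%E ->
    (forall x, normc (a x) <= c * b x) -> cL1 mu a.
  move=> ma mb b0 c0 fb hab; apply: (cL1_dom ma _ hab); first exact: measurable_funM.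
  under eq_integral do rewrite EFinM.
  rewrite ge0_integralZl ?lte_mul_pinfty//; first exact/measurable_EFinP.
  by move=> x _; rewrite lee_fin.
have M0 : 0 <= M by exact: le_trans (normc_ge0 _) (hM 0).
have secu p : cL1 L (fun u => K p * H p u * G u).
  apply: (sec _ _ L _ (fun u => normc (G u)) (B * normc (K p))); last by move=> u; exact: bound.
  - exact: (@cmfun_comp _ _ _ _ _ (fun u => (p, u)) _ (measurable_pair1 p) m0).
  - exact: measurable_normc.
  - by move=> u; exact: normc_ge0.
  - by rewrite mulr_ge0 ?normc_ge0 ?(B0 p).
  - by case: LG.
have secu1 p : cL1 L (fun u => K p * H p (u - s p) * G (u - s p)).
  exact: (cL1_mpres (mpres_shift (- s p)) (secu p)).
have secp u v : cmfun (fun p => K p * H p (v p) * G (u p)) ->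
    cL1 nu (fun p => K p * H p (v p) * G (u p)).
  (* [T] may have no points, in which case nothing makes [B] nonnegative; hence its absolute
     value. *)
  move=> m; apply: (sec _ _ nu _ (fun p => normc (K p)) (`|B| * M)) => //.
  - exact: measurable_normc.
  - by move=> p; exact: normc_ge0.
  - by rewrite mulr_ge0.
  - move=> p; apply: le_trans (bound _ _ _) _; rewrite mulrAC ler_wpM2r ?normc_ge0//.
    by rewrite ler_pM ?normc_ge0 ?(B0 p)// ler_norm.
have secp0 u : cL1 nu (fun p => K p * H p u * G u).
  apply: (secp (fun=> u) (fun=> u)).
  exact: (@cmfun_comp _ _ _ _ _ (fun p => (p, u)) _ (measurable_pair2 u) m0).
have secp1 u : cL1 nu (fun p => K p * H p (u - s p) * G (u - s p)).
  apply: (secp (fun p => u - s p) (fun p => u - s p)).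
  exact: (@cmfun_comp _ _ _ _ _ (fun p => (p, u)) _ (measurable_pair2 u) m1).
have I0 : (\int[nu]_p \int[L]_u (normc (K p * H p u * G u))%:E < +oo)%E.
  have fG : (\int[L]_u (normc (G u))%:E)%E \is a fin_num.
    rewrite ge0_fin_numE; first by case: LG.
    by apply: integral_ge0 => u _; rewrite lee_fin normc_ge0.
  pose c := fine (\int[L]_u (normc (G u))%:E)%E.
  have c0 : 0 <= c by rewrite fine_ge0// integral_ge0// => u _; rewrite lee_fin normc_ge0.
  apply: (@le_lt_trans _ _ (\int[nu]_p ((`|B| * c)%:E * (normc (K p))%:E))%E).
    apply: ge0_le_integral => //.
    - by move=> p _; apply: integral_ge0 => u _; rewrite lee_fin normc_ge0.
    - apply: (measurable_fun_fubini_tonelli_F (fun q : T * Cn R n => (normc (K q.1 * H q.1 q.2 * G q.2))%:E)).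
        exact: measurable_normc_EFin.
      by move=> q; rewrite lee_fin normc_ge0.
    - by apply: emeasurable_funM => //; exact: measurable_normc_EFin.
    - move=> p _; apply: (@le_trans _ _ (\int[L]_u ((`|B| * normc (K p))%:E * (normc (G u))%:E))%E).
        apply: ge0_le_integral => //.
        + by move=> u _; rewrite lee_fin normc_ge0.
        + by apply: measurable_normc_EFin; case: (secu p).
        + by apply: emeasurable_funM => //; exact: measurable_normc_EFin.
        + move=> u _; rewrite -EFinM lee_fin; apply: le_trans (bound _ _ _) _.
          by rewrite -!mulrA ler_wpM2r ?mulr_ge0 ?normc_ge0// ler_norm.
      rewrite ge0_integralZl//; last 3 first.
      - exact: measurable_normc_EFin.
      - by move=> u _; rewrite lee_fin normc_ge0.
      - by rewrite lee_fin mulr_ge0 ?normc_ge0.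
      by rewrite -{1}(fineK fG) -!EFinM lee_fin -/c mulrAC.
  rewrite ge0_integralZl ?lte_mul_pinfty ?lee_fin ?mulr_ge0//.
    exact: measurable_normc_EFin.
  by move=> p _; rewrite lee_fin normc_ge0.
have I1 : (\int[nu]_p \int[L]_u (normc (K p * H p (u - s p) * G (u - s p)))%:E < +oo)%E.
  apply: le_lt_trans I0; apply: ge0_le_integral => //.
  - by move=> p _; apply: integral_ge0 => u _; rewrite lee_fin normc_ge0.
  - apply: (measurable_fun_fubini_tonelli_F (fun q : T * Cn R n =>
      (normc (K q.1 * H q.1 (q.2 - s q.1) * G (q.2 - s q.1)))%:E)).
      exact: measurable_normc_EFin.
    by move=> q; rewrite lee_fin normc_ge0.
  - apply: (measurable_fun_fubini_tonelli_F (fun q : T * Cn R n => (normc (K q.1 * H q.1 q.2 * G q.2))%:E)).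
      exact: measurable_normc_EFin.
    by move=> q; rewrite lee_fin normc_ge0.
  - move=> p _; rewrite (integral_mpres (mpres_shift (- s p)) (f := fun u => (normc (K p * H p u * G u))%:E))//.
    by apply: measurable_normc_EFin; case: (secu p).
rewrite -(cint_fubini m0 secu secp0 I0) -(cint_fubini m1 secu1 secp1 I1).
apply: eq_cint => p; symmetry.
by apply: (cint_mpres (f := fun u => K p * H p u * G u) (mpres_shift (- s p))); case: (secu p).
Qed.

End TwistedFubini.

(** * Integrals with values in a closed subspace *)

Section IntegralsInClosedSubspaces.
Context {R : realType} {n : nat} d (T : measurableType d).
Variable nu : {measure set T -> \bar R}.

Lemma cmfun_discretized (m : T -> nat) (F : nat -> C R) :
  (forall i, measurable (m @^-1` [set i])) -> cmfun (fun p => F (m p)).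
Proof.
move=> mm; split.
  exact: (@measurable_discretized _ _ m _ _ (fun i => complex.Re (F i)) mm).
exact: (@measurable_discretized _ _ m _ _ (fun i => complex.Im (F i)) mm).
Qed.

Variables (D : set (Cn R n -> C R)) (K : T -> C R) (H : T -> Cn R n -> C R) (B : R).
Hypotheses (clD : is_closed_subspace BUC sup_norm D) (LK : cL1 nu K) (B0 : 0 <= B).
Hypotheses (hB : forall p u, normc (H p u) <= B) (DH : forall p, D (H p)).
Hypothesis disc : forall e : R, 0 < e -> exists (m : T -> nat) (r : nat -> T),
  (forall i, measurable (m @^-1` [set i])) /\ forall p u, normc (H p u - H (r (m p)) u) <= e.

Lemma cmfun_discretizable u : cmfun (fun p => H p u).
Proof.
have h (j : nat) : 0 < j.+1%:R^-1 :> R by rewrite invr_gt0.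
pose m j := projT1 (cid (disc (h j))).
pose r j := projT1 (cid (projT2 (cid (disc (h j))))).
have hmr j := projT2 (cid (projT2 (cid (disc (h j))))).
apply: (@cmfun_cvg _ _ _ (fun j p => H (r j (m j p)) u)).
  by move=> j; apply: (@cmfun_discretized (m j) (fun i => H (r j i) u)); case: (hmr j).
move=> p e e0; exists (Num.truncn e^-1) => j Kj; rewrite normc_distC.
apply: le_lt_trans (proj2 (hmr j) p u) _.
rewrite -[ltRHS]invrK ltf_pV2 ?posrE ?invr_gt0//.
by apply: lt_le_trans (truncnS_gt _) _; rewrite ler_nat.
Qed.

Let LKH (H' : T -> C R) : cmfun H' -> (forall p, normc (H' p) <= B) -> cL1 nu (fun p => K p * H' p).
Proof.
move=> mH hH'; have [mK fK] := LK.
apply: (@cL1_dom _ _ _ _ _ (fun p => B * normc (K p))).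
- exact: cmfunM.
- by apply: measurable_funM => //; exact: measurable_normc.
- by move=> p; rewrite normcM mulrC ler_wpM2r ?normc_ge0.
- under eq_integral do rewrite EFinM.
  rewrite ge0_integralZl ?lte_mul_pinfty//; first exact: measurable_normc_EFin.
  by move=> p _; rewrite lee_fin normc_ge0.
Qed.

(** In substance a Bochner integral in the closed space [D]. The parameter is discretized uniformly
    in [u], only finitely many cells are kept, and what results is a finite combination of functions
    [H (r i)]. *)
Lemma cint_closed_subspace : D (fun u => cint nu (fun p => K p * H p u)).
Proof.
have [mK fK] := LK; have [DB [D0 DL] _] := clD.
have fin : (\int[nu]_p (normc (K p))%:E)%E \is a fin_num.
  by rewrite ge0_fin_numE// integral_ge0// => p _; rewrite lee_fin normc_ge0.
pose c := fine (\int[nu]_p (normc (K p))%:E)%E.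
have c0 : 0 <= c by rewrite fine_ge0// integral_ge0// => p _; rewrite lee_fin normc_ge0.
have cE : (\int[nu]_p (normc (K p))%:E)%E = c%:E by rewrite fineK.
have approx e : 0 < e -> exists2 g, D g & forall u, normc (cint nu (fun p => K p * H p u) - g u) <= e.
  move=> e0; have c1 : 0 < c + 1 by rewrite ltr_wpDl.
  have [m [r [mm hmr]]] := disc (divr_gt0 (divr_gt0 e0 (ltr0Sn _ 1)) c1).
  set dl := e / 2 / (c + 1) in hmr.
  pose one i p : C R := (m p == i)%:R.
  have mone i : cmfun (one i) by exact: (@cmfun_discretized m (fun j => (j == i)%:R)).
  pose low N p : C R := (m p < N)%:R.
  have mlow N : cmfun (low N) by exact: (@cmfun_discretized m (fun j => (j < N)%:R)).
  pose tail N p : R := normc (K p) * (~~ (m p < N)%N)%:R.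
  have mtail N : cmfun (fun p => (tail N p)%:C%C : C R).
    apply: (@cmfun_ext _ _ _ (fun p => (normc (K p))%:C%C * ((~~ (m p < N)%N)%:R)%:C%C)) => [p|].
      by rewrite /tail rmorphM.
    apply: cmfunM; first by split; [exact: measurable_normc|exact: measurable_cst].
    exact: (@cmfun_discretized m (fun j => ((~~ (j < N)%N)%:R)%:C%C)).
  have tail0 N p : 0 <= tail N p by rewrite mulr_ge0 ?normc_ge0.
  have taille N p : tail N p <= normc (K p).
    by rewrite ler_piMr ?normc_ge0//; case: (~~ _).
  (* The mass of [K] outside the first [N] cells tends to 0 by dominated convergence; this justifies
     keeping finitely many cells. *)
  have cvlow : ccvg (fun N => cint nu (fun p => (tail N p)%:C%C)) (cint nu (fun=> 0)).
    apply: (@cint_DCT _ _ _ _ _ _ (fun p => normc (K p))) => //.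
    - exact: measurable_normc.
    - by move=> N p; rewrite normcR ger0_norm.
    - move=> p e' e'0; exists (m p).+1 => N hN; rewrite /tail hN mulr0 subrr normc0.
      exact: e'0.
  rewrite cint0 in cvlow.
  have B1 : 0 < B + 1 by rewrite ltr_wpDl.
  have [N hN0] := cvlow _ (divr_gt0 (divr_gt0 e0 (ltr0Sn _ 1)) B1).
  have {hN0} := hN0 N (leqnn _); rewrite subr0 => hN.
  have mtl : measurable_fun setT (tail N) by case: (mtail N).
  have ftail : (\int[nu]_p (tail N p)%:E < +oo)%E.
    by apply: le_lt_trans fK; apply: le_ge0_integral => //; exact: measurable_normc.
  have Etail : (\int[nu]_p (tail N p)%:E <= (e / 2 / (B + 1))%:E)%E.
    apply: (@le_trans _ _ (complex.Re (cint nu (fun p => (tail N p)%:C%C)))%:E).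
      rewrite /cint /= /Rintegral fineK// ge0_fin_numE//.
      by apply: integral_ge0 => p _; rewrite lee_fin.
    by rewrite lee_fin; apply: le_trans (Re_le_normc _) (ltW hN).
  have mHr u : cmfun (fun p => H (r (m p)) u) by exact: (@cmfun_discretized m (fun i => H (r i) u)).
  pose g u := cint nu (fun p => K p * (low N p * H (r (m p)) u)).
  have LK1 i : cL1 nu (fun p => K p * one i p).
    apply: (@cL1_dom _ _ _ _ _ (fun p => normc (K p))) => //; first exact: cmfunM.
      exact: measurable_normc.
    by move=> p; rewrite normcM ler_piMr ?normc_ge0// /one; case: (_ == _); rewrite ?normc1 ?normc0.
  exists g.
    have -> : g = fun u => \sum_(i <- enum 'I_N) cint nu (fun p => K p * one i p) * H (r i) u.
      apply/funext => u; rewrite /g.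
      have E p : K p * (low N p * H (r (m p)) u) =
          \sum_(i <- enum 'I_N) H (r i) u * (K p * one i p).
        rewrite big_enum /= /low /one; have [mN|mN] := ltnP (m p) N.
          rewrite (bigD1 (Ordinal mN))//= eqxx /= mulr1n mul1r mulr1 big1 ?addr0; first by rewrite mulrC.
          move=> i ni; rewrite (_ : (m p == i) = false) ?mulr0//.
          by apply: contra_neqF ni => /eqP mi; exact/val_inj.
        rewrite big1 ?mul0r ?mulr0// => i _; rewrite (_ : (m p == i) = false) ?mulr0//.
        by apply: gtn_eqF; exact: leq_trans (ltn_ord i) mN.
      rewrite (eq_cint _ E) cint_sum; last by move=> i; apply: cL1Z; exact: LK1.
      by apply: eq_bigr => i _; rewrite (cintZ _ (LK1 i)) mulrC.
    elim: (enum 'I_N) => [|i s IH].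
      by rewrite (_ : (fun _ => _) = 0)//; apply/funext => u; rewrite big_nil.
    have := DL (cint nu (fun p => K p * one i p)) _ _ (DH (r i)) IH; congr D.
    by apply/funext => u; rewrite big_cons.
  move=> u; have mH := cmfun_discretizable u.
  have L1 : cL1 nu (fun p => K p * H p u) by exact: LKH.
  have L2 : cL1 nu (fun p => K p * (low N p * H (r (m p)) u)).
    apply: LKH; first exact: cmfunM.
    by move=> p; rewrite /low; case: (_ < _)%N; rewrite ?mul1r ?mul0r ?normc0.
  rewrite /g -(cintB L1 L2) -lee_fin.
  have bnd p : normc (K p * H p u - K p * (low N p * H (r (m p)) u)) <= dl * normc (K p) + B * tail N p.
    rewrite -mulrBr normcM /low /tail; case: (_ < _)%N; rewrite ?mul1r ?mul0r ?subr0 ?mulr0 ?mulr1 ?addr0.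
      by rewrite mulrC ler_wpM2r ?normc_ge0.
    rewrite mulrC; apply: ler_wpDl; last by rewrite ler_wpM2r ?normc_ge0.
    by rewrite mulr_ge0 ?normc_ge0// divr_ge0 ?divr_ge0 ?(ltW e0) ?(ltW c1).
  have dl0 : 0 <= dl by rewrite divr_ge0 ?divr_ge0 ?(ltW e0) ?(ltW c1).
  have mKn : measurable_fun setT (fun p => normc (K p)) by exact: measurable_normc.
  have Ebnd : (\int[nu]_p (dl * normc (K p) + B * tail N p)%:E <= e%:E)%E.
    under eq_integral do rewrite EFinD (EFinM dl) (EFinM B).
    rewrite ge0_integralD//; last 4 first.
    - by move=> p _; rewrite -EFinM lee_fin mulr_ge0 ?normc_ge0.
    - by apply: emeasurable_funM => //; exact/measurable_EFinP.
    - by move=> p _; rewrite -EFinM lee_fin mulr_ge0.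
    - by apply: emeasurable_funM => //; exact/measurable_EFinP.
    have mKE := measurable_normc_EFin mK.
    have mtE : measurable_fun setT (fun p => (tail N p)%:E) by exact/measurable_EFinP.
    have nK0 p : setT p -> (0 <= (normc (K p))%:E)%E by rewrite lee_fin normc_ge0.
    have nt0 p : setT p -> (0 <= (tail N p)%:E)%E by rewrite lee_fin tail0.
    rewrite !ge0_integralZl//.
    rewrite cE; apply: le_trans (leeD (lexx _) (lee_wpmul2l _ Etail)) _.
      by rewrite lee_fin.
    rewrite -!EFinM -EFinD lee_fin [leRHS]splitr lerD//.
      by rewrite /dl mulrAC ler_pdivrMr// ler_wpM2l ?divr_ge0 ?(ltW e0)// lerDl.
    by rewrite mulrA ler_pdivrMr// mulrC ler_wpM2l ?divr_ge0 ?(ltW e0)// lerDl.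
  apply: (le_trans _ Ebnd); apply: normc_cint_dom => //.
  - by case: (cL1B L1 L2).
  - by apply: measurable_funD; exact: measurable_funM.
  - apply: le_lt_trans Ebnd _; exact: ltry.
have Bh : BUC (fun u => cint nu (fun p => K p * H p u)).
  have [g Dg hg] := approx 1 ltr01; have [A A0 hA] := BUC_bounded (DB _ Dg).
  apply: (@BUC_bounded_le _ _ _ (A + 1)).
    move=> u; rewrite -[cint _ _](subrK (g u)) addrC; apply: le_trans (normcD _ _) _.
    by rewrite lerD.
  by apply: unif_continuous_limit => e /approx[g' Dg' hg']; exists g' => //; case: (DB _ Dg').
exact: closed_subspace_limit clD Bh approx.
Qed.

End IntegralsInClosedSubspaces.

Section GaussianDomination.
Context {R : realType} {n : nat}.
Implicit Types (z w u v : Cn R n) (a b C M : R) (Phi : Cn R n -> R).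
Local Notation L := (@lebC R n).

Lemma integral_gker_reflect C a z : 0 < a -> 0 <= C ->
  (\int[L]_w (C * gker a (z - w))%:E = (C * @gmass R n a)%:E)%E.
Proof.
move=> a0 C0; under eq_integral do rewrite EFinM.
have m : measurable_fun setT (fun w : Cn R n => (gker a (z - w))%:E).
  by apply/measurable_EFinP; apply: measurable_reflect; exact: measurable_gker.
have p w : setT w -> (0 <= (gker a (z - w))%:E)%E by rewrite lee_fin gker_ge0.
rewrite ge0_integralZl// (integral_reflect (@measurable_gker R n a) (gker_ge0 a)).
by rewrite integral_gaussian// EFinM.
Qed.

Lemma gker_mono a b v : a <= b -> gker b v <= gker a v.
Proof. by move=> ab; rewrite ler_expR lerN2 ler_wpM2r ?sqnorm_ge0. Qed.

Lemma gker_sym a z w : gker a (z - w) = gker a (w - z).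
Proof. by rewrite /gker sqnormBC. Qed.

(** Parallelogram law: [|z-u|^2 + |u-w|^2] equals [|z-w|^2 / 2] plus twice the square of the
    distance from [u] to the midpoint. The integral over [u] only contributes the mass of a
    Gaussian. *)
Lemma gker_semigroup b Phi z : 0 < b -> measurable_fun setT Phi -> (forall w, 0 <= Phi w) ->
  (\int[L]_u ((gker b (z - u))%:E * gconv (gker b) Phi u) =
   (@gmass R n (2 * b))%:E * gconv (gker (b / 2)) Phi z)%E.
Proof.
move=> b0 mPhi Phi0.
have mg c : measurable_fun setT (fun q : Cn R n * Cn R n => gker c (q.1 - q.2)).
  apply: measurable_expR_comp; apply: measurable_funN; apply: measurable_funM => //.
  by apply: measurable_sqnorm; apply: measurable_CnB; [exact: measurable_fst|exact: measurable_snd].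
have mz c : measurable_fun setT (fun w : Cn R n => gker c (z - w)).
  by apply: measurable_reflect; exact: measurable_gker.
have mr c u : measurable_fun setT (fun w : Cn R n => gker c (u - w)).
  by apply: measurable_reflect; exact: measurable_gker.
pose f (q : Cn R n * Cn R n) := (gker b (z - q.1) * (gker b (q.1 - q.2) * Phi q.2))%:E.
have mf : measurable_fun setT f.
  apply/measurable_EFinP; apply: measurable_funM; first exact: (measurableT_comp (mz b) measurable_fst).
  by apply: measurable_funM => //; exact: (measurableT_comp mPhi measurable_snd).
have f0 q : (0 <= f q)%E by rewrite lee_fin !mulr_ge0 ?gker_ge0.
transitivity (\int[L]_u \int[L]_w f (u, w))%E.
  apply: eq_integral => u _; rewrite /gconv -ge0_integralZl//.
  - by apply/measurable_EFinP; exact: measurable_funM.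
  - by move=> w _; rewrite lee_fin mulr_ge0 ?gker_ge0.
  - by rewrite lee_fin gker_ge0.
rewrite fubini_tonelli// /gconv -ge0_integralZl//; last 3 first.
- by apply/measurable_EFinP; exact: measurable_funM.
- by move=> w _; rewrite lee_fin mulr_ge0 ?gker_ge0.
- by rewrite lee_fin gmass_ge0// mulr_gt0.
apply: eq_integral => w _.
have E u : f (u, w) = ((gker (b / 2) (z - w) * Phi w) * gker (2 * b) ((2^-1)%:C%C *: (z + w) - u))%:E.
  rewrite /f /= mulrA [in RHS]mulrAC; congr (_ * _)%:E; rewrite /gker -!expRD; congr expR.
  have -> : (2^-1)%:C%C *: (z + w) - u = (2^-1)%:C%C *: ((z - u) - (u - w)).
    apply/rowP => j; rewrite !mxE.
    apply: complex_eqP; rewrite ?ReD ?ImD ?ReN ?ImN ?mulRC_Re ?mulRC_Im ?ReD ?ImD ?ReN ?ImN.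
      by rewrite ?ReD ?ReN; field.
    by rewrite ?ImD ?ImN; field.
  have -> : z - w = (z - u) + (u - w) by rewrite addrA subrK.
  by move: (z - u) (u - w) => p q; rewrite sqnormZR sqnormD sqnormB; field.
rewrite (eq_integral _ _ (fun u _ => E u)) integral_gker_reflect ?mulr_gt0//.
  by rewrite mulrC EFinM.
by rewrite mulr_ge0 ?gker_ge0.
Qed.

(** Domination by a chain of Gaussians from [z] to [w] and from [w] to [u] supplies all hypotheses
    of Fubini's theorem; products of two Bergman kernels are of this type. *)
Lemma gauss_dom_fubini (P : Cn R n * Cn R n -> Defs.C R) C a z : 0 < a -> cmfun P ->
  (forall w u, normc (P (w, u)) <= C * (gker a (z - w) * gker a (w - u))) ->
  [/\ forall w, cL1 L (fun u => P (w, u)), forall u, cL1 L (fun w => P (w, u)) &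
      (\int[L]_w \int[L]_u (normc (P (w, u)))%:E < +oo)%E].
Proof.
move=> a0 mP hP.
have C0 : 0 <= C.
  have := le_trans (normc_ge0 _) (hP z z); rewrite pmulr_lge0// mulr_gt0 ?gker_gt0//.
have sec w : cL1 L (fun u => P (w, u)).
  apply: (@cL1_dom _ _ _ _ _ (fun u => C * gker a (w - u))).
  - exact: (@cmfun_comp _ _ _ _ _ (fun u => (w, u)) _ (measurable_pair1 w) mP).
  - by apply: measurable_funM => //; apply: measurable_reflect; exact: measurable_gker.
  - move=> u; apply: le_trans (hP w u) _; rewrite ler_wpM2l// ler_piMl ?gker_ge0//.
    by rewrite gker_le1 ?(ltW a0).
  - by rewrite integral_gker_reflect// ltry.
split=> //.
  move=> u; apply: (@cL1_dom _ _ _ _ _ (fun w => C * gker a (z - w))).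
  - exact: (@cmfun_comp _ _ _ _ _ (fun w => (w, u)) _ (measurable_pair2 u) mP).
  - by apply: measurable_funM => //; apply: measurable_reflect; exact: measurable_gker.
  - move=> w; apply: le_trans (hP w u) _; rewrite ler_wpM2l// ler_piMr ?gker_ge0//.
    by rewrite gker_le1 ?(ltW a0).
  - by rewrite integral_gker_reflect// ltry.
have m0 := @gmass_ge0 R n a a0.
apply: (@le_lt_trans _ _ (\int[L]_w (C * @gmass R n a * gker a (z - w))%:E)%E); last first.
  by rewrite integral_gker_reflect ?mulr_ge0// ltry.
apply: ge0_le_integral => //.
- by move=> w _; apply: integral_ge0 => u _; rewrite lee_fin normc_ge0.
- apply: (measurable_fun_fubini_tonelli_F (fun q => (normc (P q))%:E)) => //.
    exact: measurable_normc_EFin.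
  by move=> q; rewrite lee_fin normc_ge0.
- apply/measurable_EFinP; apply: measurable_funM => //; apply: measurable_reflect; exact: measurable_gker.
- move=> w _; apply: (@le_trans _ _ (\int[L]_u ((C * gker a (z - w)) * gker a (w - u))%:E)%E).
    apply: le_ge0_integral.
    + by apply: measurable_normc; case: (sec w).
    + by apply: measurable_funM => //; apply: measurable_reflect; exact: measurable_gker.
    + by move=> u; exact: normc_ge0.
    + by move=> u; rewrite -mulrA; exact: hP.
  by rewrite integral_gker_reflect ?mulr_ge0 ?gker_ge0// lee_fin mulrAC.
Qed.

End GaussianDomination.

(** * The integral formula for a product of two Toeplitz operators *)

Section ToeplitzProduct.
Context {R : realType} {n : nat}.
Variables (t : R) (f g phi : Cn R n -> C R) (A B M : R).
Hypotheses (t0 : 0 < t) (mf : cmfun f) (mg : cmfun g) (mphi : cmfun phi).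
Hypotheses (hA : forall z, normc (f z) <= A) (hB : forall z, normc (g z) <= B)
  (hM : forall z, wmod t phi z <= M).
Implicit Types (z w u v x : Cn R n).
Local Notation L := (@lebC R n).
Local Notation a := ((2 * t)^-1).

Definition bergman z u : C R := (gauss_density t u)%:C%C * cexp (dot z u / t%:C%C).

Lemma cmfun_bergman d (T : measurableType d) (p q : T -> Cn R n) :
  measurable_fun setT p -> measurable_fun setT q -> cmfun (fun y => bergman (p y) (q y)).
Proof.
move=> mp mq; apply: cmfunM.
  by apply: cmfunR; exact: (measurableT_comp (@measurable_gauss_density_Cn R n t) mq).
by apply: cmfun_cexp; apply: cmfunM; [exact: cmfun_dot|exact: cmfun_cst].
Qed.

Lemma normc_bergman z u : normc (bergman z u) * weight t z = (pi * t) ^- n * (gker a (z - u) * weight t u).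
Proof.
have := @normc_kernel R n t (fun=> 1) z u t0; rewrite /wmod normc1 !mul1r => <-.
by [].
Qed.

Lemma Pt_bergman F z : Pt t F z = cint L (fun u => F u * bergman z u).
Proof. by apply: eq_cint => u; rewrite /bergman mulrCA. Qed.

(** The integrand of [T_f T_g phi (z)] after writing the intermediate variable as [u + x]. By
    [bergman_shift] the mixed terms in [x] and [u] combine into the single factor
    [cexp (dot (z - u) x / t)]. *)
Definition product_kernel z u x : C R :=
  (gauss_density t x)%:C%C * (f (u + x) * g u) * cexp (dot (z - u) x / t%:C%C) * phi u * bergman z u.

Lemma bergman_shift z u x : bergman z (x + u) * bergman (x + u) u =
  (gauss_density t x)%:C%C * cexp (dot (z - u) x / t%:C%C) * bergman z u.
Proof.
have tn : t%:C%C != 0 :> C R by apply: contraTneq t0 => /complexI ->; rewrite ltxx.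
rewrite /bergman !gauss_density_expR// !rmorphM /= -!cexpR.
set c := ((pi * t) ^- n)%:C%C.
have -> : c * cexp (- (t^-1 * sqnorm (x + u)))%:C%C * cexp (dot z (x + u) / t%:C%C) *
    (c * cexp (- (t^-1 * sqnorm u))%:C%C * cexp (dot (x + u) u / t%:C%C)) =
  c * c * (cexp ((- (t^-1 * sqnorm (x + u)))%:C%C + dot z (x + u) / t%:C%C +
     ((- (t^-1 * sqnorm u))%:C%C + dot (x + u) u / t%:C%C))) by rewrite !cexpD; ring.
have -> : c * cexp (- (t^-1 * sqnorm x))%:C%C * cexp (dot (z - u) x / t%:C%C) *
    (c * cexp (- (t^-1 * sqnorm u))%:C%C * cexp (dot z u / t%:C%C)) =
  c * c * (cexp ((- (t^-1 * sqnorm x))%:C%C + dot (z - u) x / t%:C%C +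
     ((- (t^-1 * sqnorm u))%:C%C + dot z u / t%:C%C))) by rewrite !cexpD; ring.
congr (_ * cexp _).
rewrite !rmorphN !rmorphM /= -!dotzz fmorphV !dotDl !dotDr !dotNl.
by field.
Qed.

End ToeplitzProduct.

Section ToeplitzProductFormula.
Context {R : realType} {n : nat}.
Variables (t : R) (f g phi : Cn R n -> C R) (A B M : R) (z : Cn R n).
Hypotheses (t0 : 0 < t) (mf : cmfun f) (mg : cmfun g) (mphi : cmfun phi).
Hypotheses (hA : forall w, normc (f w) <= A) (hB : forall w, normc (g w) <= B)
  (hM : forall w, wmod t phi w <= M).
Implicit Types (w u v x : Cn R n).
Local Notation L := (@lebC R n).
Local Notation a := ((2 * t)^-1).

Let P (q : Cn R n * Cn R n) := f q.1 * (g q.2 * phi q.2) * (bergman t z q.1 * bergman t q.1 q.2).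

Let mP : cmfun P.
Proof.
apply: cmfunM.
  apply: cmfunM; first exact: (@cmfun_comp _ _ _ _ _ _ _ measurable_fst mf).
  exact: (@cmfun_comp _ _ _ _ _ _ _ measurable_snd (cmfunM mg mphi)).
apply: cmfunM; apply: cmfun_bergman; [exact: measurable_cst|exact: measurable_fst|exact: measurable_fst|exact: measurable_snd].
Qed.

Let A0 : 0 <= A. Proof. exact: le_trans (normc_ge0 _) (hA 0). Qed.
Let B0 : 0 <= B. Proof. exact: le_trans (normc_ge0 _) (hB 0). Qed.

Let P_le w u : normc (P (w, u)) <=
  A * B * M * (pi * t) ^- n ^+ 2 / weight t z * (gker a (z - w) * gker a (w - u)).
Proof.
rewrite mulrAC ler_pdivlMr ?weight_gt0// /P /= normcM (normcM (f w)) (normcM (g u)) (normcM (bergman t z w)).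
have E1 := normc_bergman t0 z w; have E2 := normc_bergman t0 w u.
set X := normc (bergman t z w) in E1 *; set Y := normc (bergman t w u) in E2 *.
have -> : normc (f w) * (normc (g u) * normc (phi u)) * (X * Y) * weight t z =
  normc (f w) * normc (g u) * wmod t phi u * ((pi * t) ^- n ^+ 2 * (gker a (z - w) * gker a (w - u))).
  rewrite /wmod; have -> : normc (f w) * (normc (g u) * normc (phi u)) * (X * Y) * weight t z =
    normc (f w) * normc (g u) * normc (phi u) * (X * weight t z * Y) by ring.
  rewrite E1; have -> : (pi * t) ^- n * (gker a (z - w) * weight t w) * Y =
    (pi * t) ^- n * gker a (z - w) * (Y * weight t w) by ring.
  by rewrite E2; ring.
rewrite -[leRHS]mulrA ler_wpM2r//.
  by apply: mulr_ge0; [exact: sqr_ge0|rewrite mulr_ge0 ?gker_ge0].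
apply: (ler_pM (mulr_ge0 (normc_ge0 _) (normc_ge0 _)) (wmod_ge0 t phi u) _ (hM u)).
exact: (ler_pM (normc_ge0 _) (normc_ge0 _) (hA w) (hB u)).
Qed.

Let dom := gauss_dom_fubini (twice_inv_gt0 t0) mP P_le.

Let product_kernel_shift u x : product_kernel t f g phi z u x = P (x + u, u).
Proof.
by rewrite /P /= (mulrC (f _)) -mulrA mulrCA bergman_shift// /product_kernel (addrC u x); ring.
Qed.

Lemma cL1_product_kernel u : cL1 L (product_kernel t f g phi z u).
Proof.
have [_ h _] := dom.
by apply: cL1_ext (cL1_mpres (mpres_shift u) (h u)) => x; rewrite product_kernel_shift.
Qed.

Let cint_product_kernel u : cint L (product_kernel t f g phi z u) = cint L (fun w => P (w, u)).
Proof.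
have [_ h _] := dom; rewrite (eq_cint _ (product_kernel_shift u)).
by apply: (cint_mpres (f := fun w => P (w, u)) (mpres_shift u)); case: (h u).
Qed.

Lemma cL1_cint_product_kernel : cL1 L (fun u => cint L (product_kernel t f g phi z u)).
Proof.
have [h1 h2 h3] := dom; apply: cL1_ext (fun u => esym (cint_product_kernel u)) _.
pose Q (q : Cn R n * Cn R n) := P (q.2, q.1).
have mQ : cmfun Q.
  apply: (@cmfun_comp _ _ _ _ _ (fun q : Cn R n * Cn R n => (q.2, q.1)) _ _ mP).
  by apply/measurable_fun_pair => /=; [exact: measurable_snd|exact: measurable_fst].
have fin : (\int[L]_u \int[L]_w (normc (Q (u, w)))%:E < +oo)%E.
  have mPn := measurable_normc_EFin mP.
  have P0 q : (0 <= (normc (P q))%:E)%E by rewrite lee_fin normc_ge0.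
  by have := @fubini_tonelli _ _ _ _ _ L L _ mPn P0; rewrite /Q /= => <-; exact: h3.
exact: (cL1_cint_section mQ h2 fin).
Qed.

(** The variable of [phi] is integrated last, so that the product can be compared, for each [u],
    with a single Toeplitz operator. *)
Lemma toeplitz_mulE :
  toeplitz t f (toeplitz t g phi) z = cint L (fun u => cint L (product_kernel t f g phi z u)).
Proof.
have [h1 h2 h3] := dom; rewrite toeplitzE//; last first.
  by apply: entire_cmfun; exact: (toeplitz_entire t0 mg hB mphi hM).
rewrite Pt_bergman -(eq_cint _ (fun u => esym (cint_product_kernel u))) -cint_fubini//.
apply: eq_cint => w; rewrite /fun_mul /= toeplitzE// Pt_bergman.
have hgp := wmod_mul_bounded hB hM.
have L1 : cL1 L (fun u => fun_mul g phi u * bergman t w u).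
  apply: cL1_ext (cL1_kernel w t0 (cmfunM mg mphi) hgp) => u.
  by rewrite /bergman mulrCA.
rewrite mulrAC -(cintZ _ L1); apply: eq_cint => u; rewrite /P /fun_mul /=.
set X := bergman t z w; set Y := bergman t w u; ring.
Qed.

End ToeplitzProductFormula.

Section ProductDiscretization.
Context {R : realType} {n : nat}.

Lemma exists_discretization2 (dl : R) : 0 < dl ->
  exists (m : Cn R n * Cn R n -> nat) (r : nat -> Cn R n * Cn R n),
    (forall i, measurable (m @^-1` [set i])) /\
    forall q, sqnorm (q.1 - (r (m q)).1) <= dl /\ sqnorm (q.2 - (r (m q)).2) <= dl.
Proof.
move=> /(@exists_discretization R n)[m [r [mm hr]]].
exists (fun q => pickle (m q.1, m q.2)), (fun i => if unpickle i is Some p then (r p.1, r p.2) else (0, 0)).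
split=> [i|q]; last by rewrite pickleK.
case E : (unpickle i : option (nat * nat)) => [[i1 i2]|]; last first.
  rewrite (_ : _ @^-1` _ = set0) ?measurable0//.
  by apply/seteqP; split=> // q /= qi; move: E; rewrite -qi pickleK.
have [ci|ci] := eqVneq (pickle (i1, i2)) i; last first.
  rewrite (_ : _ @^-1` _ = set0) ?measurable0//.
  by apply/seteqP; split=> // q /= qi; move: E; rewrite -qi pickleK => -[E1 E2]; move: ci; rewrite -qi E1 E2 eqxx.
rewrite (_ : _ @^-1` _ = (m @^-1` [set i1]) `*` (m @^-1` [set i2])); first exact: measurableX.
apply/seteqP; split=> q /=; last by case=> -> ->.
by rewrite -ci => /(pcan_inj pickleK)[].
Qed.

End ProductDiscretization.

(** * The approximating symbol and its Toeplitz operator *)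

Section HeatSymbol.
Context {R : realType} {n : nat}.
Variables (t e r : R) (f g : Cn R n -> C R).
Hypotheses (t0 : 0 < t) (e0 : 0 < e) (et : e < t) (Bf : BUC f) (Bg : BUC g).
Implicit Types (z w u v x y : Cn R n) (q : Cn R n * Cn R n).
Local Notation L := (@lebC R n).
Local Notation LL := (product_sfmeasure L L).
Local Notation b := (e^-1 - t^-1).
Local Notation Re := (@complex.Re R).

(** By [integral_scaled_gaussian] the L^1 norm of [heat_kernel x] is a multiple of
    [e^(|x|^2 / (4 e (1 - e/t)))]. Since [4 (e/t) (1 - e/t) <= 1], the density of mu_t cannot
    compensate this growth for any [e]; hence the cutoff. *)
Definition cut_density x : R := (sqnorm x <= r)%R%:R * gauss_density t x.

(* Chosen so that, after the substitution u -> u - y and multiplication by the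
   Bergman kernel, the integral over y is the reproducing formula at scale e
   for an entire function of y; see [toeplitz_heat_symbolE]. *)
Definition heat_kernel x y : C R :=
  ((pi * e) ^- n * expR (- (b * sqnorm y)))%:C%C * cexp (- (dot y x / e%:C%C)).

Definition heat_symbol u : C R :=
  cint LL (fun q => ((cut_density q.1)%:C%C * heat_kernel q.1 q.2) * (f (u + q.2 + q.1) * g (u + q.2))).

Let b0 : 0 < b.
Proof. by rewrite subr_gt0 ltf_pV2. Qed.

Lemma measurable_cut_density : measurable_fun setT cut_density.
Proof.
apply: measurable_funM; last exact: measurable_gauss_density_Cn.
rewrite (_ : (fun x => _) = fun x => \1_`]-oo, r] (sqnorm x)); last first.
  by apply/funext => x; rewrite indicE mem_setE in_itv.
have ms := @measurable_sqnorm R n _ _ (@id (Cn R n)) (@measurable_id _ _ _).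
have mi : measurable_fun setT (\1_(`]-oo, r]%classic) : R -> R) by exact: measurable_indic.
exact: (measurableT_comp mi ms).
Qed.

Lemma cut_density_ge0 x : 0 <= cut_density x.
Proof. by rewrite mulr_ge0// gauss_density_ge0. Qed.

Lemma cut_density_le x : cut_density x <= gauss_density t x.
Proof. by rewrite ler_piMl ?gauss_density_ge0// lern1 leq_b1. Qed.

Lemma normc_heat_kernel x y : normc (heat_kernel x y) =
  (pi * e) ^- n * expR (- (b * sqnorm y) + Re (dot y (- (e^-1)%:C%C *: x))).
Proof.
rewrite /heat_kernel normcM normcR ger0_norm; last first.
  by rewrite mulr_ge0 ?expR_ge0// ltW// gauss_const_gt0.
rewrite normc_cexp -mulrA -expRD dotZr realCV; congr (_ * expR (_ + Re _)).
have -> : ((- (e^-1)%:C%C)^* = - (e^-1)%:C :> C R)%C by apply: complex_eqP; rewrite /= ?oppr0.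
by rewrite mulNr mulrC.
Qed.

Lemma cmfun_heat_kernel d (T : measurableType d) (p q : T -> Cn R n) :
  measurable_fun setT p -> measurable_fun setT q -> cmfun (fun s => heat_kernel (p s) (q s)).
Proof.
move=> mp mq; apply: cmfunM.
  apply: cmfunR; apply: measurable_funM => //; apply: measurable_expR_comp.
  by apply: measurable_funN; apply: measurable_funM => //; exact: measurable_sqnorm.
by apply: cmfun_cexp; apply: cmfunN; apply: cmfunM; [exact: cmfun_dot|exact: cmfun_cst].
Qed.

Lemma cL1_heat_kernel x : cL1 L (heat_kernel x).
Proof.
apply: (cL1_gaussian_dom (K := (pi * e) ^- n) (v := - (e^-1)%:C%C *: x) b0).
  by apply: cmfun_heat_kernel; [exact: measurable_cst|exact: measurable_id].
by move=> y; rewrite normc_heat_kernel.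
Qed.

Let K q := (cut_density q.1)%:C%C * heat_kernel q.1 q.2.

Let mK : cmfun K.
Proof.
apply: cmfunM; first by apply: cmfunR; exact: (measurableT_comp measurable_cut_density measurable_fst).
by apply: cmfun_heat_kernel; [exact: measurable_fst|exact: measurable_snd].
Qed.

Lemma cut_heat_kernel_fin :
  (\int[L]_x \int[L]_y (normc ((cut_density x)%:C%C * heat_kernel x y))%:E < +oo)%E.
Proof.
pose c := (pi * e) ^- n * ((pi / b) ^+ n * expR (e^-1 ^+ 2 * `|r| / (4 * b))) * (pi * t) ^- n.
have c0 : 0 <= c.
  rewrite /c !mulr_ge0 ?expR_ge0//; first by rewrite ltW ?gauss_const_gt0.
    by rewrite exprn_ge0// divr_ge0 ?pi_ge0 ?ltW.
  by rewrite ltW ?gauss_const_gt0.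
apply: (@le_lt_trans _ _ (\int[L]_x (c * gker t^-1 (0 - x))%:E)%E); last first.
  by rewrite integral_gker_reflect ?invr_gt0// ltry.
apply: ge0_le_integral => //.
- by move=> x _; apply: integral_ge0 => y _; rewrite lee_fin normc_ge0.
- apply: (measurable_fun_fubini_tonelli_F (fun q => (normc (K q))%:E)) => //.
    exact: measurable_normc_EFin.
  by move=> q; rewrite lee_fin normc_ge0.
- apply/measurable_EFinP; apply: measurable_funM => //; apply: measurable_reflect; exact: measurable_gker.
move=> x _.
have -> : (\int[L]_y (normc ((cut_density x)%:C%C * heat_kernel x y))%:E =
    \int[L]_y (cut_density x * (pi * e) ^- n * expR (- (b * sqnorm y) + Re (dot y (- (e^-1)%:C%C *: x))))%:E)%E.
  apply: eq_integral => y _; rewrite normcM normcR (ger0_norm (cut_density_ge0 x)) normc_heat_kernel.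
  by rewrite mulrA.
rewrite integral_scaled_gaussian//; last by rewrite mulr_ge0 ?cut_density_ge0// ltW ?gauss_const_gt0.
rewrite lee_fin scaleNr sqnormN sqnormZR sub0r /gker sqnormN /cut_density gauss_density_expR//.
have [xr|xr] := leP (sqnorm x) r; last by rewrite !mul0r mulr_ge0 ?expR_ge0.
rewrite mul1r /c.
have k1 := @gauss_const_gt0 R n t t0; have k2 := @gauss_const_gt0 R n e e0.
have k3 : 0 <= (pi / b) ^+ n by rewrite exprn_ge0// divr_ge0 ?pi_ge0 ?ltW.
have h : expR (e^-1 ^+ 2 * sqnorm x / (4 * b)) <= expR (e^-1 ^+ 2 * `|r| / (4 * b)).
  rewrite ler_expR ler_wpM2r ?invr_ge0 ?mulr_ge0 ?(ltW b0)// ler_wpM2l ?sqr_ge0//.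
  exact: le_trans xr (ler_norm r).
move: h (expR_ge0 (- (t^-1 * sqnorm x))) k1 k2 k3.
move: (expR _) (expR _) (expR _) ((pi * t) ^- n) ((pi * e) ^- n) ((pi / b) ^+ n) => E1 E2 E3 p1 p2 p3 h k k1 k2 k3.
rewrite [leLHS](_ : _ = p2 * p3 * p1 * E1 * E3); last by ring.
rewrite [leRHS](_ : _ = p2 * p3 * p1 * E1 * E2); last by ring.
by rewrite ler_wpM2l// !mulr_ge0// ltW.
Qed.

End HeatSymbol.

Section HeatSymbolToeplitz.
Context {R : realType} {n : nat}.
Variables (t e r : R) (f g : Cn R n -> C R).
Hypotheses (t0 : 0 < t) (e0 : 0 < e) (et : e < t) (Bf : BUC f) (Bg : BUC g).
Implicit Types (z w u v x y : Cn R n) (q : Cn R n * Cn R n) (D : set (Cn R n -> C R)).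
Local Notation L := (@lebC R n).
Local Notation LL := (product_sfmeasure L L).
Local Notation b := (e^-1 - t^-1).
Local Notation Re := (@complex.Re R).

Let K q := (cut_density t r q.1)%:C%C * heat_kernel t e q.1 q.2.
Let H q u := f (u + q.2 + q.1) * g (u + q.2).

Let mK : cmfun K.
Proof.
apply: cmfunM; first by apply: cmfunR; exact: (measurableT_comp (@measurable_cut_density R n t r) measurable_fst).
by apply: cmfun_heat_kernel; [exact: measurable_fst|exact: measurable_snd].
Qed.

Let secK x : cL1 L (fun y => K (x, y)).
Proof. have h := cL1Z (cut_density t r x)%:C%C (cL1_heat_kernel t0 e0 et x). exact h. Qed.

Let finK := cut_heat_kernel_fin (n := n) r t0 e0 et.

Let LK : cL1 LL K.
Proof.
split; first exact: mK.
have mn := measurable_normc_EFin mK.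
have p q : (0 <= (normc (K q))%:E)%E by rewrite lee_fin normc_ge0.
by rewrite (@fubini_tonelli1 _ _ _ _ _ L L _ mn p); exact: finK.
Qed.

Let mH : cmfun (fun s : (Cn R n * Cn R n) * Cn R n => H s.1 s.2).
Proof.
have m1 : measurable_fun setT (fun s : (Cn R n * Cn R n) * Cn R n => s.1.1).
  by apply: measurableT_comp; [exact: measurable_fst|exact: measurable_fst].
have m2 : measurable_fun setT (fun s : (Cn R n * Cn R n) * Cn R n => s.1.2).
  by apply: measurableT_comp; [exact: measurable_snd|exact: measurable_fst].
have m3 : measurable_fun setT (fun s : (Cn R n * Cn R n) * Cn R n => s.2) by exact: measurable_snd.
have m32 := measurable_CnD m3 m2.
apply: cmfunM; first exact: (@cmfun_comp _ _ _ _ _ _ _ (measurable_CnD m32 m1) (BUC_cmfun Bf)).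
exact: (@cmfun_comp _ _ _ _ _ _ _ m32 (BUC_cmfun Bg)).
Qed.

Lemma heat_symbol_mem D : is_closed_subspace BUC sup_norm D ->
  (forall x y, D (fun u => f (u + y + x) * g (u + y))) -> D (heat_symbol t e r f g).
Proof.
move=> clD hD; have [A A0 hA] := BUC_bounded Bf; have [B B0 hB] := BUC_bounded Bg.
apply: (@cint_closed_subspace _ _ _ _ LL D K H (A * B) clD LK).
- by rewrite mulr_ge0 ?ltW.
- move=> q u; rewrite /H normcM; exact: (ler_pM (normc_ge0 _) (normc_ge0 _) (hA _) (hB _)).
- by move=> q; exact: hD.
move=> dl dl0.
have [_ /unif_continuous_epsP uf] := Bf; have [_ /unif_continuous_epsP ug] := Bg.
have [d1 d10 hd1] := uf (dl / 2 / B) (divr_gt0 (divr_gt0 dl0 (ltr0Sn _ 1)) B0).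
have [d2 d20 hd2] := ug (dl / 2 / A) (divr_gt0 (divr_gt0 dl0 (ltr0Sn _ 1)) A0).
(* An error of [d] in both variables moves the argument of [f] by at most [4 d] in square norm and
   that of [g] by at most [d]; the divisors 5 and 2 make the inequalities strict. *)
pose d := Num.min (d1 / 5) (d2 / 2).
have d0 : 0 < d by rewrite lt_min !divr_gt0.
have [m [s [mm hs]]] := @exists_discretization2 R n d d0; exists m, s; split=> // q u.
have [] := hs q; move: (s (m q)) => q' h1 h2; rewrite /H.
have k1 : d <= d1 / 5 by rewrite ge_min lexx.
have k2 : d <= d2 / 2 by rewrite ge_min lexx orbT.
have /hd1 kf : sqnorm ((u + q.2 + q.1) - (u + q'.2 + q'.1)) < d1.
  rewrite (_ : _ - _ = (q.1 - q'.1) + (q.2 - q'.2)); last first.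
    by rewrite !opprD !addrA [u + q.2]addrC; apply/rowP => j; rewrite !mxE; ring.
  apply: le_lt_trans (sqnormD_le _ _) _; lra.
have /hd2 kg : sqnorm ((u + q.2) - (u + q'.2)) < d2.
  rewrite (_ : _ - _ = q.2 - q'.2); first by lra.
  by apply/rowP => j; rewrite !mxE; ring.
move: kf kg; move: (f (u + q.2 + q.1)) (f (u + q'.2 + q'.1)) (hA (u + q'.2 + q'.1)) => a a' ha'.
move: (g (u + q.2)) (g (u + q'.2)) (hB (u + q.2)) => c c' hc kf kg.
have -> : a * c - a' * c' = (a - a') * c + a' * (c - c') by ring.
apply: le_trans (normcD _ _) _; rewrite !normcM [leRHS]splitr.
rewrite ltr_pdivlMr// in kf; rewrite ltr_pdivlMr// mulrC in kg.
apply: lerD; first by apply: le_trans (ltW kf); rewrite ler_wpM2l ?normc_ge0.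
by apply: le_trans (ltW kg); rewrite ler_wpM2r ?normc_ge0.
Qed.

Variables (phi : Cn R n -> C R) (M : R) (z : Cn R n).
Hypotheses (ephi : entire phi) (hM : forall w, wmod t phi w <= M).

(** What the reproducing formula leaves in place of [phi u]. The shift is of relative size [e / t],
    and the exponential compensates the change of the Bergman kernel to first order around [u]. *)
Definition twisted_point u : C R :=
  let a := (e / t)%:C%C *: (z - u) in phi (u + a) * cexp (- (dot a u / t%:C%C)).

Definition twisted_kernel u x : C R :=
  (cut_density t r x)%:C%C * (f (u + x) * g u) * cexp (dot (z - u) x / t%:C%C) *
  twisted_point u * bergman t z u.

Let G u := phi u * bergman t z u.

Let mphi : cmfun phi. Proof. exact: entire_cmfun. Qed.

Let LG : cL1 L G.
Proof. by apply: cL1_ext (cL1_kernel z t0 mphi hM) => u; rewrite /G /bergman mulrCA. Qed.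

Let bG u : normc (G u) <= (pi * t) ^- n * M / weight t z.
Proof.
have c0 := @gauss_const_gt0 R n t t0.
rewrite ler_pdivlMr ?weight_gt0// /G (normcM (phi u)) -mulrA normc_bergman// mulrCA.
rewrite ler_wpM2l ?(ltW c0)// mulrCA; apply: le_trans (hM u).
by rewrite -/(wmod t phi u) ler_piMl ?wmod_ge0// gker_le1// ltW// twice_inv_gt0.
Qed.

Let tn : t%:C%C != 0 :> C R. Proof. by apply: contraTneq t0 => /complexI ->; rewrite ltxx. Qed.
Let en : e%:C%C != 0 :> C R. Proof. by apply: contraTneq e0 => /complexI ->; rewrite ltxx. Qed.

(** The entire function of [y] to which the reproducing formula at scale [e] is applied, and below
    it the point [p u] of evaluation. The exponent [1/e - 1/t] of [heat_kernel] and the [1/t] of the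
    translated Bergman kernel add up to the Gaussian of scale [e]. *)
Let psi u x y := phi (u + (-1 : C R) *: y) * cexp (1 * dot y ((t^-1)%:C%C *: u - (e^-1)%:C%C *: x)).
Let p u := - ((e / t)%:C%C *: (z - u)).

Let shift_identity u x y : heat_kernel t e x y * G (u - y) =
  bergman t z u * ((gauss_density e y)%:C%C * (psi u x y * cexp (dot (p u) y / e%:C%C))).
Proof.
rewrite /heat_kernel /G /bergman !gauss_density_expR// !rmorphM /= -!cexpR /psi scaleN1r.
set c := ((pi * e) ^- n)%:C%C; set c' := ((pi * t) ^- n)%:C%C; set F := phi (u - y).
transitivity (c * c' * F * cexp ((- (b * sqnorm y))%:C%C - dot y x / e%:C%C +
   (- (t^-1 * sqnorm (u - y)))%:C%C + dot z (u - y) / t%:C%C)).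
  by rewrite !cexpD; ring.
transitivity (c * c' * F * cexp ((- (t^-1 * sqnorm u))%:C%C + dot z u / t%:C%C +
   (- (e^-1 * sqnorm y))%:C%C + 1 * dot y ((t^-1)%:C%C *: u - (e^-1)%:C%C *: x) + dot (p u) y / e%:C%C)); last first.
  by rewrite !cexpD; ring.
congr (_ * cexp _).
rewrite !rmorphN !rmorphM rmorphB /= -!dotzz !fmorphV /p rmorphM /= !fmorphV.
rewrite !dotBr !dotBl !dotNl !dotZl !dotBl !dotZr !conjc_inv !conjc_real.
by field; rewrite tn en.
Qed.

Let entire_psi u x : entire (psi u x).
Proof. by apply: entireM; [exact: entire_comp_affine|exact: entire_cexp_dot]. Qed.

Let bergman_neq0 u : bergman t z u != 0.
Proof.
rewrite /bergman mulf_neq0 ?cexp_neq0//; apply: contraTneq (@gauss_const_gt0 R n t t0) => /complexI.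
by rewrite gauss_density_expR// => /eqP; rewrite mulf_eq0 (gt_eqF (expR_gt0 _)) orbF => /eqP ->; rewrite ltxx.
Qed.

Let cL1_heat_shift u x : cL1 L (fun y => heat_kernel t e x y * G (u - y)).
Proof.
have mG : cmfun (fun y => G (u - y)).
  apply: (@cmfun_comp _ _ _ _ _ (fun y => u - y) _ _ (proj1 LG)).
  by apply: measurable_CnB; [exact: measurable_cst|exact: measurable_id].
have [mh fh] := cL1_heat_kernel (n := n) t0 e0 et x.
pose c := (pi * t) ^- n * M / weight t z.
apply: (@cL1_dom _ _ _ _ _ (fun y => c * normc (heat_kernel t e x y))).
- exact: cmfunM.
- by apply: measurable_funM => //; exact: measurable_normc.
- by move=> y; rewrite (normcM (heat_kernel _ _ _ _)) mulrC ler_wpM2r ?normc_ge0.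
- have c0 : 0 <= c by exact: le_trans (normc_ge0 _) (bG 0).
  have mhn := measurable_normc_EFin mh.
  have p0 y : setT y -> (0 <= (normc (heat_kernel t e x y))%:E)%E by rewrite lee_fin normc_ge0.
  under eq_integral do rewrite EFinM.
  by rewrite ge0_integralZl// lte_mul_pinfty.
Qed.

(** At [y = - (e/t) (z - u)] the factor [cexp (- dot y x / e)] becomes [cexp (dot (z - u) x / t)],
    precisely the one in [product_kernel]. *)
Let reproduce u x :
  cint L (fun y => heat_kernel t e x y * G (u - y)) =
  cexp (dot (z - u) x / t%:C%C) * twisted_point u * bergman t z u.
Proof.
have L1 := cL1_heat_shift u x.
have L2 : cL1 L (fun y => (gauss_density e y)%:C%C * (psi u x y * cexp (dot (p u) y / e%:C%C))).
  apply: cL1_ext (cL1Z (bergman t z u)^-1 L1) => y.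
  by rewrite shift_identity mulKf.
rewrite (eq_cint _ (shift_identity u x)) (cintZ _ L2) (reproducing (entire_psi u x) e0 L2).
rewrite mulrC; congr (_ * _); rewrite /psi /twisted_point /p scaleN1r opprK mul1r mulrCA -cexpD.
congr (_ * cexp _).
rewrite !dotNl !dotBr !dotZr !dotZl !dotBl !conjc_real !rmorphM /= !fmorphV.
by field; rewrite tn en.
Qed.

(** Shifting [u] by [y] through [twisted_fubini] frees [f (u + x) * g u] from [y]; the inner
    integral over [y] is then [reproduce]. *)
Lemma toeplitz_heat_symbolE : BUC (heat_symbol t e r f g) ->
  toeplitz t (heat_symbol t e r f g) phi z = cint L (fun u => cint L (twisted_kernel u)).
Proof.
move=> Bh; have [A A0 hA] := BUC_bounded Bf; have [B B0 hB] := BUC_bounded Bg.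
have bH q u : normc (H q u) <= A * B.
  by rewrite /H normcM; exact: (ler_pM (normc_ge0 _) (normc_ge0 _) (hA _) (hB _)).
rewrite toeplitzE//; last exact: BUC_cmfun.
rewrite Pt_bergman.
have LKH u : cL1 LL (fun q => K q * H q u).
  apply: (@cL1_dom _ _ _ _ _ (fun q => A * B * normc (K q))).
  - apply: cmfunM; first exact: mK.
    exact: (@cmfun_comp _ _ _ _ _ (fun q => (q, u)) _ (measurable_pair2 u) mH).
  - by apply: measurable_funM => //; exact: measurable_normc.
  - by move=> q; rewrite (normcM (K q)) mulrC ler_wpM2r ?normc_ge0.
  - have mn := measurable_normc_EFin mK.
    have p0 q : setT q -> (0 <= (normc (K q))%:E)%E by rewrite lee_fin normc_ge0.
    under eq_integral do rewrite EFinM.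
    by rewrite ge0_integralZl// ?lte_mul_pinfty// ?lee_fin ?mulr_ge0 ?ltW//; case: LK.
transitivity (cint L (fun u => cint LL (fun q => K q * H q u * G u))).
  apply: eq_cint => u; rewrite /fun_mul /= -mulrA -/(G u) mulrC /heat_symbol -(cintZ _ (LKH u)).
  by apply: eq_cint => q; rewrite mulrC.
rewrite (twisted_fubini LK LG mH measurable_snd bH bG); apply: eq_cint => u.
have mG2 : cmfun (fun q : Cn R n * Cn R n => G (u - q.2)).
  apply: (@cmfun_comp _ _ _ _ _ (fun q : Cn R n * Cn R n => u - q.2) _ _ (proj1 LG)).
  by apply: measurable_CnB; [exact: measurable_cst|exact: measurable_snd].
have mf := BUC_cmfun Bf.
pose c := A * B * ((pi * t) ^- n * M / weight t z).
have c0 : 0 <= c by rewrite mulr_ge0 ?(le_trans (normc_ge0 _) (bG 0))// mulr_ge0 ?ltW.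
pose F x := f (u + x) * g u.
have bF x : normc (F x) <= A * B.
  by rewrite /F normcM; exact: (ler_pM (normc_ge0 _) (normc_ge0 _) (hA _) (hB _)).
have E q : K q * H q (u - q.2) * G (u - q.2) = K q * F q.1 * G (u - q.2).
  by rewrite /H /F subrK.
rewrite (eq_cint _ E).
have mF : cmfun (fun q : Cn R n * Cn R n => F q.1).
  apply: cmfunM; last exact: cmfun_cst.
  apply: (@cmfun_comp _ _ _ _ _ (fun q : Cn R n * Cn R n => u + q.1) _ _ mf).
  by apply: measurable_CnD; [exact: measurable_cst|exact: measurable_fst].
have mQ : cmfun (fun q => K q * F q.1 * G (u - q.2)) by apply: cmfunM => //; exact: cmfunM.
have bQ q : normc (K q * F q.1 * G (u - q.2)) <= c * normc (K q).
  rewrite (normcM (K q * _)) (normcM (K q)) mulrAC -mulrA mulrC ler_wpM2r ?normc_ge0// mulrC.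
  exact: (ler_pM (normc_ge0 _) (normc_ge0 _) (bF _) (bG _)).
have mKn : measurable_fun setT (fun q => normc (K q)) by exact: measurable_normc.
have mKx x : measurable_fun setT (fun y => normc (K (x, y))).
  by apply: measurable_normc; case: (secK x).
have Ic x : (\int[L]_y (c * normc (K (x, y)))%:E = c%:E * \int[L]_y (normc (K (x, y)))%:E)%E.
  have p0 y : setT y -> (0 <= (normc (K (x, y)))%:E)%E by rewrite lee_fin normc_ge0.
  have m0 : measurable_fun setT (fun y => (normc (K (x, y)))%:E) by exact/measurable_EFinP.
  by under eq_integral do rewrite EFinM; rewrite ge0_integralZl.
have secQ x : cL1 L (fun y => K (x, y) * F x * G (u - y)).
  apply: (@cL1_dom _ _ _ _ _ (fun y => c * normc (K (x, y)))).
  - exact: (@cmfun_comp _ _ _ _ _ (fun y => (x, y)) _ (measurable_pair1 x) mQ).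
  - exact: measurable_funM.
  - by move=> y; exact: (bQ (x, y)).
  - by rewrite Ic lte_mul_pinfty//; case: (secK x).
have finQ : (\int[L]_x \int[L]_y (normc (K (x, y) * F x * G (u - y)))%:E < +oo)%E.
  have mI : measurable_fun setT (fun x => \int[L]_y (normc (K (x, y)))%:E)%E.
    apply: (measurable_fun_fubini_tonelli_F (fun q => (normc (K q))%:E)) => //.
      exact/measurable_EFinP.
    by move=> q; rewrite lee_fin normc_ge0.
  have I0 x : setT x -> (0 <= \int[L]_y (normc (K (x, y)))%:E)%E.
    by move=> _; apply: integral_ge0 => y _; rewrite lee_fin normc_ge0.
  apply: (@le_lt_trans _ _ (\int[L]_x (c%:E * \int[L]_y (normc (K (x, y)))%:E))%E); last first.
    by rewrite ge0_integralZl// lte_mul_pinfty//; exact: finK.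
  apply: ge0_le_integral => //.
  - by move=> x _; apply: integral_ge0 => y _; rewrite lee_fin normc_ge0.
  - apply: (measurable_fun_fubini_tonelli_F (fun q => (normc (K q * F q.1 * G (u - q.2)))%:E)) => //.
      exact: measurable_normc_EFin.
    by move=> q; rewrite lee_fin normc_ge0.
  - exact: emeasurable_funM.
  - move=> x _; rewrite -Ic; apply: le_ge0_integral.
    + by apply: measurable_normc; case: (secQ x).
    + exact: measurable_funM.
    + by move=> y; exact: normc_ge0.
    + by move=> y; exact: (bQ (x, y)).
rewrite (cint_product mQ secQ finQ); apply: eq_cint => x /=.
have Lh := cL1_heat_shift u x.
transitivity (cint L (fun y => ((cut_density t r x)%:C%C * F x) * (heat_kernel t e x y * G (u - y)))).
  by apply: eq_cint => y; rewrite /K /=; ring.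
by rewrite (cintZ _ Lh) reproduce /twisted_kernel /F !mulrA.
Qed.

End HeatSymbolToeplitz.

(** * The error of the approximation *)

Section TwistEstimate.
Context {R : realType} {n : nat}.
Variables (t e r : R) (f g phi : Cn R n -> C R) (A B M : R) (z : Cn R n).
Hypotheses (t0 : 0 < t) (e0 : 0 < e) (est : e / t <= 8^-1).
Hypotheses (mf : cmfun f) (mg : cmfun g) (ephi : entire phi).
Hypotheses (hA : forall w, normc (f w) <= A) (hB : forall w, normc (g w) <= B)
  (hM : forall w, wmod t phi w <= M).
Implicit Types (w u v x y : Cn R n).
Local Notation L := (@lebC R n).
Local Notation Re := (@complex.Re R).
Local Notation s := (e / t).
Local Notation c := ((pi * t) ^- n).
Local Notation a8 := ((8 * t)^-1).
Local Notation tp := (twisted_point t e phi z).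

Definition smoothed_mod u : R := fine (gconv (gker a8) (wmod t phi) u).

Let a80 : 0 < a8. Proof. by rewrite invr_gt0 mulr_gt0. Qed.
Let c0 : 0 < c. Proof. exact: gauss_const_gt0. Qed.
Let s0 : 0 < s. Proof. exact: divr_gt0. Qed.
Let mphi : cmfun phi. Proof. exact: entire_cmfun. Qed.
Let M0 : 0 <= M. Proof. exact: le_trans (wmod_ge0 t phi 0) (hM 0). Qed.
Let A0 : 0 <= A. Proof. exact: le_trans (normc_ge0 _) (hA 0). Qed.
Let B0 : 0 <= B. Proof. exact: le_trans (normc_ge0 _) (hB 0). Qed.
Let tn : t%:C%C != 0 :> C R. Proof. by apply: contraTneq t0 => /complexI ->; rewrite ltxx. Qed.

Lemma smoothed_modE u : gconv (gker a8) (wmod t phi) u = (smoothed_mod u)%:E.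
Proof.
rewrite fineK// ge0_fin_numE; last first.
  by apply: integral_ge0 => w _; rewrite lee_fin mulr_ge0 ?gker_ge0 ?wmod_ge0.
apply: le_lt_trans (gconv_ae_le (@measurable_gker R n a8) (gker_ge0 a8) (integral_gker a80) u
  (measurable_wmod t mphi) (wmod_ge0 t phi) M0 (aeW _ hM)) _.
by rewrite ltry.
Qed.

Lemma smoothed_mod_ge0 u : 0 <= smoothed_mod u.
Proof. by rewrite fine_ge0// integral_ge0// => w _; rewrite lee_fin mulr_ge0 ?gker_ge0 ?wmod_ge0. Qed.

Lemma measurable_smoothed_mod : measurable_fun setT smoothed_mod.
Proof.
have m := measurable_gconv (@measurable_gker R n a8) (gker_ge0 a8) (measurable_wmod t mphi) (wmod_ge0 t phi).
exact: (measurableT_comp (f := fine) (fine_measurable measurableT) m).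
Qed.

(* With x = 4 s X this is 2 x e^x <= 16 s e^X, because x <= X / 2 and X / 2 <= e^(X / 2). *)
Let small_twist (x X : R) : 0 <= X -> 0 <= x -> x <= 4 * s * X -> 2 * (x * expR x) <= 16 * s * expR X.
Proof.
move=> X0 x0 hx.
have x2 : x <= X / 2.
  apply: le_trans hx _; have : s * X <= 8^-1 * X by rewrite ler_wpM2r.
  lra.
have h1 : X / 2 <= expR (X / 2) by apply: le_trans (expR_ge1Dx _); rewrite lerDr.
have h2 : x * expR x <= 4 * s * X * expR (X / 2).
  by apply: (ler_pM x0 (expR_ge0 _) hx); rewrite ler_expR.
have h3 : X / 2 * expR (X / 2) <= expR X.
  by rewrite {3}(splitr X) expRD ler_wpM2r ?expR_ge0.
have h4 : 0 <= s * (expR X - X / 2 * expR (X / 2)) by rewrite mulr_ge0 ?subr_ge0// ltW.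
move: h2 h4; rewrite mulrBr; nra.
Qed.

Let dot_twist u w : normc (dot ((e / t)%:C%C *: (z - u)) (w - u) / t%:C%C) <=
  4 * s * ((sqnorm (z - u) + sqnorm (u - w)) / (8 * t)).
Proof.
rewrite dotZl realCV normcM (normcM _ (dot _ _)) !normcR (ger0_norm (ltW s0)) ger0_norm ?invr_ge0 ?(ltW t0)//.
rewrite mulrC.
have := normc_dot_le1 (z - u) (w - u); rewrite (sqnormBC w) => h.
rewrite mulrCA (_ : 4 * s * _ = s * (t^-1 * ((sqnorm (z - u) + sqnorm (u - w)) / 2))); last first.
  by field; rewrite gt_eqF.
by rewrite ler_wpM2l ?(ltW s0)// ler_wpM2l ?invr_ge0 ?(ltW t0).
Qed.

(** Both terms are Bergman integrals of [phi], and the ratio of their kernels is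
    [cexp (dot a (b - u) / t)]. The difference therefore carries this exponential minus 1, which is
    of order [e / t]. *)
Lemma twisted_point_close u : normc (tp u - phi u) * weight t u <=
  16 * s * c * expR (sqnorm (z - u) / (8 * t)) * smoothed_mod u.
Proof.
pose a := (e / t)%:C%C *: (z - u).
have w0 := weight_gt0 t u.
have L1 := cL1_kernel (u + a) t0 mphi hM; have L2 := cL1_kernel u t0 mphi hM.
have idP w : phi w = cint L (fun b => phi b * bergman t w b).
  by rewrite -{1}(Pt_entire_id t0 ephi hM) Pt_bergman.
have L1' : cL1 L (fun b => phi b * bergman t (u + a) b).
  by apply: cL1_ext L1 => b; rewrite /bergman mulrCA.
have L2' : cL1 L (fun b => phi b * bergman t u b).
  by apply: cL1_ext L2 => b; rewrite /bergman mulrCA.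
pose F b := phi b * bergman t u b * (cexp (dot a (b - u) / t%:C%C) - 1).
have E : tp u - phi u = cint L F.
  rewrite {1}/twisted_point -/a {1}(idP (u + a)) (idP u) mulrC -(cintZ _ L1') -(cintB (cL1Z _ L1') L2').
  apply: eq_cint => b; rewrite /F mulrBr mulr1; congr (_ - _).
  rewrite /bergman -[cexp _ * _]mulrC -!mulrA; congr (_ * (_ * _)).
  by rewrite -!cexpD; congr cexp; rewrite dotDl dotBr; field.
pose C1 := 16 * s * c * expR (sqnorm (z - u) / (8 * t)) / weight t u.
have C10 : 0 <= C1.
  by rewrite /C1 divr_ge0 ?(ltW w0)// mulr_ge0 ?expR_ge0// mulr_ge0 ?(ltW c0)// mulr_ge0// ltW.
have mF : cmfun F.
  have m2 : cmfun (fun b => phi b * bergman t u b) by case: L2'.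
  apply: cmfunM => //; apply: cmfunB; last exact: cmfun_cst.
  apply: cmfun_cexp; apply: cmfunM; last exact: cmfun_cst.
  by apply: cmfun_dot; [exact: measurable_cst|apply: measurable_CnB; [exact: measurable_id|exact: measurable_cst]].
have bF b : normc (F b) <= C1 * (gker a8 (u - b) * wmod t phi b).
  rewrite /F (normcM (phi b * _)) (normcM (phi b)).
  rewrite -(ler_pM2r w0).
  have EB := normc_bergman t0 u b.
  have -> : normc (phi b) * normc (bergman t u b) * normc (cexp (dot a (b - u) / t%:C%C) - 1) * weight t u =
     wmod t phi b * (c * gker (2 * t)^-1 (u - b)) * normc (cexp (dot a (b - u) / t%:C%C) - 1).
    rewrite /wmod; have -> : normc (phi b) * normc (bergman t u b) * normc (cexp (dot a (b - u) / t%:C%C) - 1) * weight t u =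
      normc (phi b) * (normc (bergman t u b) * weight t u) * normc (cexp (dot a (b - u) / t%:C%C) - 1) by ring.
    by rewrite EB; ring.
  rewrite /C1.
  set X := (sqnorm (z - u) + sqnorm (u - b)) / (8 * t).
  have X0 : 0 <= X by rewrite divr_ge0 ?addr_ge0 ?sqnorm_ge0// mulr_ge0// ltW.
  have hE : normc (cexp (dot a (b - u) / t%:C%C) - 1) <= 16 * s * expR X.
    apply: le_trans (normc_cexpB1 _) _; apply: small_twist => //; first exact: normc_ge0.
    exact: dot_twist.
  apply: le_trans (ler_wpM2l _ hE) _.
    by rewrite mulr_ge0 ?wmod_ge0// mulr_ge0 ?(ltW c0)// gker_ge0.
  (* The Gaussian in [u - b] has exponent [1/(2t)]; the factor [expR X] costs [1/(8t)], which leaves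
     more than the [1/(8t)] required. *)
  have hG : gker (2 * t)^-1 (u - b) * expR X <= expR (sqnorm (z - u) / (8 * t)) * gker a8 (u - b).
    rewrite /gker /X -!expRD ler_expR.
    have := sqnorm_ge0 (u - b); move: (sqnorm (u - b)) (sqnorm (z - u)) => y x y0.
    rewrite -subr_ge0 (_ : _ - _ = y / (4 * t)); first by rewrite divr_ge0// mulr_ge0// ltW.
    by field; rewrite gt_eqF.
  rewrite [leRHS](_ : _ = 16 * s * c * wmod t phi b * (expR (sqnorm (z - u) / (8 * t)) * gker a8 (u - b))); last first.
    by field; rewrite (gt_eqF t0) (gt_eqF w0) expf_neq0 ?mulf_neq0 ?gt_eqF ?pi_gt0.
  rewrite [leLHS](_ : _ = 16 * s * c * wmod t phi b * (gker (2 * t)^-1 (u - b) * expR X)); last by ring.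
  by rewrite ler_wpM2l// mulr_ge0 ?wmod_ge0// mulr_ge0 ?(ltW c0)// mulr_ge0// ltW.
have mG : measurable_fun setT (fun b : Cn R n => gker a8 (u - b) * wmod t phi b).
  apply: measurable_funM; last exact: measurable_wmod.
  by apply: measurable_reflect; exact: measurable_gker.
have IG : (\int[L]_b (C1 * (gker a8 (u - b) * wmod t phi b))%:E = (C1 * smoothed_mod u)%:E)%E.
  under eq_integral do rewrite EFinM.
  rewrite [in RHS]EFinM -smoothed_modE ge0_integralZl//; first exact/measurable_EFinP.
  by move=> b _; rewrite lee_fin mulr_ge0 ?gker_ge0 ?wmod_ge0.
have mG1 : measurable_fun setT (fun b : Cn R n => C1 * (gker a8 (u - b) * wmod t phi b)) by exact: measurable_funM.
have fG : (\int[L]_b (C1 * (gker a8 (u - b) * wmod t phi b))%:E < +oo)%E by rewrite IG ltry.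
have := normc_cint_dom mF mG1 bF fG; rewrite IG lee_fin -E => h.
apply: le_trans (ler_wpM2r (ltW w0) h) _.
by rewrite /C1 mulrAC divfK// gt_eqF.
Qed.

End TwistEstimate.

Section ProductEstimate.
Context {R : realType} {n : nat}.
Variables (t e r : R) (f g phi : Cn R n -> C R) (A B M : R) (z : Cn R n).
Hypotheses (t0 : 0 < t) (e0 : 0 < e) (est : e / t <= 8^-1).
Hypotheses (Bf : BUC f) (Bg : BUC g) (ephi : entire phi).
Hypotheses (hA : forall w, normc (f w) <= A) (hB : forall w, normc (g w) <= B)
  (hM : forall w, wmod t phi w <= M).
Implicit Types (w u v x y : Cn R n).
Local Notation L := (@lebC R n).
Local Notation Re := (@complex.Re R).
Local Notation s := (e / t).
Local Notation c := ((pi * t) ^- n).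
Local Notation a8 := ((8 * t)^-1).
Local Notation tp := (twisted_point t e phi z).
Local Notation sm := (smoothed_mod t phi).
Local Notation PK := (product_kernel t f g phi z).
Local Notation TK := (twisted_kernel t e r f g phi z).

Let a80 : 0 < a8. Proof. by rewrite invr_gt0 mulr_gt0. Qed.
Let c0 : 0 < c. Proof. exact: gauss_const_gt0. Qed.
Let s0 : 0 < s. Proof. exact: divr_gt0. Qed.
Let mphi : cmfun phi. Proof. exact: entire_cmfun. Qed.
Let M0 : 0 <= M. Proof. exact: le_trans (wmod_ge0 t phi 0) (hM 0). Qed.
Let A0 : 0 <= A. Proof. exact: le_trans (normc_ge0 _) (hA 0). Qed.
Let B0 : 0 <= B. Proof. exact: le_trans (normc_ge0 _) (hB 0). Qed.
Let mf := BUC_cmfun Bf.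
Let mg := BUC_cmfun Bg.
Let et : e < t.
Proof. by move: est; rewrite ler_pdivrMr// => h; apply: le_lt_trans h _; rewrite gtr_pMl// invf_lt1// ltr1n. Qed.

Let Re_dot_v u x : Re (dot (z - u) x / t%:C%C) = Re (dot x ((t^-1)%:C%C *: (z - u))).
Proof. by rewrite realCV mulrC mulRC_Re dotZr conjc_real mulRC_Re Re_dotC. Qed.

Let sq_v u : sqnorm ((t^-1)%:C%C *: (z - u)) = t^-1 ^+ 2 * sqnorm (z - u).
Proof. exact: sqnormZR. Qed.

Let F_le u x : normc (f (u + x) * g u) <= A * B.
Proof. by rewrite normcM; exact: (ler_pM (normc_ge0 _) (normc_ge0 _) (hA _) (hB _)). Qed.

Let cmF : cmfun (fun q : Cn R n * Cn R n => f (q.1 + q.2) * g q.1).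
Proof.
apply: cmfunM; last exact: (@cmfun_comp _ _ _ _ _ _ _ measurable_fst mg).
apply: (@cmfun_comp _ _ _ _ _ (fun q : Cn R n * Cn R n => q.1 + q.2) _ _ mf).
by apply: measurable_CnD; [exact: measurable_fst|exact: measurable_snd].
Qed.

Let cmTK : cmfun (fun q : Cn R n * Cn R n => TK q.1 q.2).
Proof.
have mv : measurable_fun setT (fun q : Cn R n * Cn R n => z - q.1).
  by apply: measurable_CnB; [exact: measurable_cst|exact: measurable_fst].
have ma : measurable_fun setT (fun q : Cn R n * Cn R n => (e / t)%:C%C *: (z - q.1)).
  by apply: measurable_CnZ => //; exact: cmfun_cst.
apply: cmfunM; last by apply: cmfun_bergman; [exact: measurable_cst|exact: measurable_fst].
apply: cmfunM.
  apply: cmfunM; last first.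
    apply: cmfun_cexp; apply: cmfunM; last exact: cmfun_cst.
    by apply: cmfun_dot => //; exact: measurable_snd.
  apply: cmfunM; last exact: cmF.
  by apply: cmfunR; exact: (measurableT_comp (@measurable_cut_density R n t r) measurable_snd).
apply: cmfunM.
  apply: (@cmfun_comp _ _ _ _ _ (fun q : Cn R n * Cn R n => q.1 + (e / t)%:C%C *: (z - q.1)) _ _ mphi).
  by apply: measurable_CnD => //; exact: measurable_fst.
apply: cmfun_cexp; apply: cmfunN; apply: cmfunM; last exact: cmfun_cst.
by apply: cmfun_dot => //; exact: measurable_fst.
Qed.

Let secTK u : cL1 L (TK u).
Proof.
apply: (cL1_gaussian_dom (K := c * (A * B) * normc (tp u * bergman t z u)) (a := t^-1)
  (v := (t^-1)%:C%C *: (z - u))); first by rewrite invr_gt0.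
  exact: (@cmfun_comp _ _ _ _ _ (fun x => (u, x)) _ (measurable_pair1 u) cmTK).
move=> x; rewrite /twisted_kernel -mulrA normcM.
rewrite [leRHS]mulrAC ler_wpM2r ?normc_ge0// (normcM (_ * (f _ * g _))) normcM normcR normc_cexp Re_dot_v.
rewrite (ger0_norm (cut_density_ge0 _ _ _)) expRD.
have h := cut_density_le t r x; rewrite gauss_density_expR// in h.
rewrite [leRHS](_ : _ = (c * expR (- (t^-1 * sqnorm x))) * (A * B) * expR (Re (dot x ((t^-1)%:C%C *: (z - u))))); last by ring.
rewrite ler_wpM2r ?expR_ge0//.
exact: (ler_pM (cut_density_ge0 _ _ _) (normc_ge0 _) h (F_le u x)).
Qed.

Let secPK u : cL1 L (PK u) := cL1_product_kernel z t0 mf mg mphi hA hB hM u.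
Let LPK := cL1_cint_product_kernel z t0 mf mg mphi hA hB hM.

Let Dl u := normc (tp u - phi u) * weight t u.
Let C1 u := A * B * c * gker (2 * t)^-1 (z - u) * c.

(** Inside the cutoff the two kernels differ only by [phi u] against its twisted value. Outside, the
    twisted kernel vanishes and a quarter of the Gaussian exponent in [x] is traded for the small
    factor [e^(-r/(4t))]. *)
Let diff_le u x : normc (PK u x - TK u x) * weight t z <=
  C1 u * Dl u * expR (- (t^-1 * sqnorm x) + Re (dot x ((t^-1)%:C%C *: (z - u)))) +
  C1 u * (expR (- (r / (4 * t))) * wmod t phi u) *
    expR (- (3 / (4 * t) * sqnorm x) + Re (dot x ((t^-1)%:C%C *: (z - u)))).
Proof.
have D0 : 0 <= Dl u by rewrite /Dl mulr_ge0 ?normc_ge0// ltW ?weight_gt0.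
have key (p : C R) : normc ((gauss_density t x)%:C%C * (f (u + x) * g u) * cexp (dot (z - u) x / t%:C%C) * p * bergman t z u) * weight t z
   <= C1 u * (normc p * weight t u) * expR (- (t^-1 * sqnorm x) + Re (dot x ((t^-1)%:C%C *: (z - u)))).
  rewrite (normcM (_ * p)) (normcM _ p) (normcM _ (cexp _)) (normcM _ (f _ * _)) normcR normc_cexp Re_dot_v.
  rewrite ger0_norm ?gauss_density_ge0// gauss_density_expR// -mulrA normc_bergman// expRD /C1.
  set E1 := expR _; set E2 := expR _; set k := gker _ _.
  rewrite [leLHS](_ : _ = (c * E1 * E2 * normc p * c * k * weight t u) * normc (f (u + x) * g u)); last by ring.
  rewrite [leRHS](_ : _ = (c * E1 * E2 * normc p * c * k * weight t u) * (A * B)); last by ring.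
  rewrite ler_wpM2l//.
  have k0 : 0 <= k by exact: gker_ge0.
  have E10 : 0 <= E1 by exact: expR_ge0.
  have E20 : 0 <= E2 by exact: expR_ge0.
  have w0 := ltW (weight_gt0 t u); have c0' := ltW c0.
  have np0 := normc_ge0 p.
  by do 6 (apply: mulr_ge0 => //).
have C10 : 0 <= C1 u by rewrite /C1 mulr_ge0 ?(ltW c0)// mulr_ge0 ?gker_ge0// mulr_ge0 ?(ltW c0)// mulr_ge0.
have p0 : 0 <= wmod t phi u := wmod_ge0 t phi u.
have [xr|xr] := leP (sqnorm x) r.
  apply: ler_wpDr; first by rewrite mulr_ge0 ?expR_ge0// mulr_ge0// mulr_ge0 ?expR_ge0.
  have -> : PK u x - TK u x = (gauss_density t x)%:C%C * (f (u + x) * g u) * cexp (dot (z - u) x / t%:C%C) * (phi u - tp u) * bergman t z u.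
    by rewrite /product_kernel /twisted_kernel /cut_density xr mul1r; ring.
  by apply: le_trans (key _) _; rewrite /Dl (normc_distC (phi u)).
apply: ler_wpDl; first by rewrite mulr_ge0 ?expR_ge0// mulr_ge0.
have -> : PK u x - TK u x = (gauss_density t x)%:C%C * (f (u + x) * g u) * cexp (dot (z - u) x / t%:C%C) * phi u * bergman t z u.
  by rewrite /product_kernel /twisted_kernel /cut_density leNgt xr /= !mul0r subr0.
apply: le_trans (key _) _; rewrite -/(wmod t phi u).
set d := Re (dot x _).
have hE : expR (- (t^-1 * sqnorm x) + d) <= expR (- (r / (4 * t))) * expR (- (3 / (4 * t) * sqnorm x) + d).
  rewrite -expRD ler_expR addrA lerD2r -subr_ge0 (_ : _ - _ = (sqnorm x - r) / (4 * t)).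
    by rewrite divr_ge0 ?subr_ge0 ?(ltW xr)// mulr_ge0// ltW.
  by field; rewrite gt_eqF.
apply: le_trans (ler_wpM2l (mulr_ge0 C10 p0) hE) _.
by rewrite le_eqVlt; apply/orP; left; apply/eqP; ring.
Qed.

(** The two sources of error: [16 s] comes from [twisted_point_close], and [(4/3)^n] is the loss of
    mass normalization when the Gaussian in [x] has exponent [3/(4t)] instead of [1/t]. *)
Let eta0 := A * B * c * (16 * s * c).
Let eta1 := A * B * c * ((4 / 3) ^+ n * expR (- (r / (4 * t)))).
Let dom u := eta0 * (gker a8 (z - u) * sm u) + eta1 * (gker a8 (z - u) * wmod t phi u).

Let eta00 : 0 <= eta0. 
Proof.
exact: (mulr_ge0 (mulr_ge0 (mulr_ge0 A0 B0) (ltW c0)) (mulr_ge0 (mulr_ge0 (ler0n _ 16) (ltW s0)) (ltW c0))).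
Qed.
Let eta10 : 0 <= eta1.
Proof.
apply: (mulr_ge0 (mulr_ge0 (mulr_ge0 A0 B0) (ltW c0))).
by rewrite mulr_ge0 ?expR_ge0// exprn_ge0.
Qed.

Let diff_section u : normc (cint L (PK u) - cint L (TK u)) * weight t z <= dom u.
Proof.
have D0 : 0 <= Dl u by rewrite /Dl mulr_ge0 ?normc_ge0// ltW ?weight_gt0.
have C10 : 0 <= C1 u by rewrite /C1 mulr_ge0 ?(ltW c0)// mulr_ge0 ?gker_ge0// mulr_ge0 ?(ltW c0)// mulr_ge0.
have w0 := weight_gt0 t z.
pose l := (t^-1)%:C%C *: (z - u).
pose G1 x := C1 u * Dl u * expR (- (t^-1 * sqnorm x) + Re (dot x l)).
pose G2 x := C1 u * (expR (- (r / (4 * t))) * wmod t phi u) * expR (- (3 / (4 * t) * sqnorm x) + Re (dot x l)).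
have LD := cL1B (secPK u) (secTK u).
have p1 : 0 < t^-1 by rewrite invr_gt0.
have p2 : 0 < 3 / (4 * t) by rewrite divr_gt0// mulr_gt0.
have q1 : 0 <= C1 u * Dl u by rewrite mulr_ge0.
have q2 : 0 <= C1 u * (expR (- (r / (4 * t))) * wmod t phi u).
  by rewrite mulr_ge0// mulr_ge0 ?expR_ge0 ?wmod_ge0.
have mG1 : measurable_fun setT G1 by apply: measurable_funM => //; exact: measurable_gaussian_linear.
have mG2 : measurable_fun setT G2 by apply: measurable_funM => //; exact: measurable_gaussian_linear.
have IG : (\int[L]_x (G1 x + G2 x)%:E =
    (C1 u * Dl u * ((pi / t^-1) ^+ n * expR (sqnorm l / (4 * t^-1))) +
     C1 u * (expR (- (r / (4 * t))) * wmod t phi u) * ((pi / (3 / (4 * t))) ^+ n * expR (sqnorm l / (4 * (3 / (4 * t))))))%:E)%E.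
  under eq_integral do rewrite EFinD.
  rewrite ge0_integralD//.
  - by rewrite EFinD !integral_scaled_gaussian.
  - by move=> x _; rewrite lee_fin mulr_ge0 ?expR_ge0.
  - exact/measurable_EFinP.
  - by move=> x _; rewrite lee_fin mulr_ge0 ?expR_ge0.
  - exact/measurable_EFinP.
have I1 : ((normc (cint L (PK u) - cint L (TK u)) * weight t z)%:E <= \int[L]_x (G1 x + G2 x)%:E)%E.
  have := cintZ (weight t z)%:C%C LD; rewrite (cintB (secPK u) (secTK u)) => EW.
  have -> : normc (cint L (PK u) - cint L (TK u)) * weight t z =
     normc (cint L (fun x => (weight t z)%:C%C * (PK u x - TK u x))).
    by rewrite EW normcM normcR ger0_norm ?(ltW w0)// mulrC.
  apply: normc_cint_dom.
  - by apply: cmfunM; [exact: cmfun_cst|case: LD].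
  - exact: measurable_funD.
  - by move=> x; rewrite normcM normcR ger0_norm ?(ltW w0)// mulrC; exact: diff_le.
  - by rewrite IG ltry.
rewrite IG lee_fin in I1; apply: le_trans I1 _.
have cc : c * (pi / t^-1) ^+ n = 1.
  by rewrite invrK mulVf// expf_neq0// mulf_neq0 ?gt_eqF ?pi_gt0.
have cc2 : c * (pi / (3 / (4 * t))) ^+ n = (4 / 3) ^+ n.
  have -> : pi / (3 / (4 * t)) = (4 / 3) * (pi * t) by field; rewrite gt_eqF.
  by rewrite (exprMn _ (4 / 3)) mulrCA mulVf ?mulr1// expf_neq0// mulf_neq0 ?gt_eqF ?pi_gt0.
rewrite /l sq_v /dom /C1; apply: lerD.
  rewrite [leLHS](_ : _ = A * B * c * (c * (pi / t^-1) ^+ n) * (gker (2 * t)^-1 (z - u) * expR (t^-1 ^+ 2 * sqnorm (z - u) / (4 * t^-1)) * Dl u)); last by ring.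
  rewrite cc mulr1.
  have h := twisted_point_close z t0 e0 est ephi hM u.
  set k := gker (2 * t)^-1 _; set E := expR _.
  have kE0 : 0 <= k * E := mulr_ge0 (gker_ge0 _ _) (expR_ge0 _).
  have abc0 : 0 <= A * B * c by exact: (mulr_ge0 (mulr_ge0 A0 B0) (ltW c0)).
  apply: le_trans (ler_wpM2l abc0 (ler_wpM2l kE0 h)) _.
  set E8 := expR (_ / (8 * t)).
  (* Exponents in [|z-u|^2]: [1/(2t)] from the Bergman kernel, minus [1/(4t)] from the integral over
     [x], minus [1/(8t)] from the twist, leaves exactly [1/(8t)]. *)
  have hk : k * E * E8 <= gker a8 (z - u).
    rewrite /k /E /E8 /gker -!expRD ler_expR le_eqVlt; apply/orP; left; apply/eqP.
    by field; rewrite gt_eqF.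
  have es0 : 0 <= eta0 * sm u by rewrite mulr_ge0// smoothed_mod_ge0.
  apply: (@le_trans _ _ (eta0 * sm u * (k * E * E8))).
    by rewrite le_eqVlt; apply/orP; left; apply/eqP; rewrite /eta0; ring.
  apply: le_trans (ler_wpM2l es0 hk) _.
  by rewrite le_eqVlt; apply/orP; left; apply/eqP; ring.
rewrite [leLHS](_ : _ = A * B * c * (c * (pi / (3 / (4 * t))) ^+ n) * expR (- (r / (4 * t))) *
   (gker (2 * t)^-1 (z - u) * expR (t^-1 ^+ 2 * sqnorm (z - u) / (4 * (3 / (4 * t)))) * wmod t phi u)); last by ring.
rewrite cc2.
set k := gker (2 * t)^-1 _; set E := expR (_ / (4 * (3 / (4 * t)))); set E' := expR (- (r / _)).
(* Here the integral over [x] costs [1/(3t)], because its Gaussian is wider;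
   [1/(2t) - 1/(3t) = 1/(6t)] still exceeds [1/(8t)]. *)
have hk : k * E <= gker a8 (z - u).
  rewrite /k /E /gker -!expRD ler_expR.
  have := sqnorm_ge0 (z - u); move: (sqnorm (z - u)) => y y0.
  rewrite -subr_ge0 (_ : _ - _ = y / (24 * t)); first by rewrite divr_ge0// mulr_ge0// ltW.
  by field; rewrite gt_eqF.
have es0 : 0 <= eta1 * wmod t phi u by rewrite mulr_ge0// wmod_ge0.
apply: (@le_trans _ _ (eta1 * wmod t phi u * (k * E))).
  by rewrite le_eqVlt; apply/orP; left; apply/eqP; rewrite /eta1 -/E'; ring.
apply: le_trans (ler_wpM2l es0 hk) _.
by rewrite le_eqVlt; apply/orP; left; apply/eqP; ring.
Qed.

(** A pointwise bound that mentions no norm: a small constant times a Gaussian convolution of the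
    weighted modulus, to which [fock_norm_young] applies for every kind of space. *)
Lemma product_estimate : BUC (heat_symbol t e r f g) ->
  ((wmod t (toeplitz t f (toeplitz t g phi) - toeplitz t (heat_symbol t e r f g) phi) z)%:E <=
   (A * B * c * (16 * s * c * @gmass R n (2 * a8) + (4 / 3) ^+ n * expR (- (r / (4 * t)))))%:E *
   gconv (gker (a8 / 2)) (wmod t phi) z)%E.
Proof.
move=> Bh; have w0 := weight_gt0 t z.
have mw := measurable_wmod t mphi.
have msm := measurable_smoothed_mod t ephi.
have mk b : measurable_fun setT (fun u : Cn R n => gker b (z - u)).
  by apply: measurable_reflect; exact: measurable_gker.
have m1 : measurable_fun setT (fun u : Cn R n => gker a8 (z - u) * sm u) by exact: measurable_funM.
have m2 : measurable_fun setT (fun u : Cn R n => gker a8 (z - u) * wmod t phi u) by exact: measurable_funM.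
have mdom : measurable_fun setT dom by apply: measurable_funD; exact: measurable_funM.
have n1 u : setT u -> (0 <= (gker a8 (z - u) * sm u)%:E)%E by rewrite lee_fin mulr_ge0 ?gker_ge0 ?smoothed_mod_ge0.
have n2 u : setT u -> (0 <= (gker a8 (z - u) * wmod t phi u)%:E)%E by rewrite lee_fin mulr_ge0 ?gker_ge0 ?wmod_ge0.
have dom0 u : 0 <= dom u.
  by rewrite addr_ge0// mulr_ge0// mulr_ge0 ?gker_ge0 ?smoothed_mod_ge0 ?wmod_ge0.
have gfin b : 0 < b -> (gconv (gker b) (wmod t phi) z < +oo)%E.
  move=> b0; apply: le_lt_trans (gconv_ae_le (@measurable_gker R n b) (gker_ge0 b) (integral_gker b0) z
    mw (wmod_ge0 t phi) M0 (aeW _ hM)) _.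
  by rewrite ltry.
have Idom : (\int[L]_u (dom u)%:E <=
   (eta0 * @gmass R n (2 * a8) + eta1)%:E * gconv (gker (a8 / 2)) (wmod t phi) z)%E.
  have -> : (\int[L]_u (dom u)%:E = eta0%:E * (\int[L]_u (gker a8 (z - u) * sm u)%:E) +
      eta1%:E * (\int[L]_u (gker a8 (z - u) * wmod t phi u)%:E))%E.
    rewrite -!ge0_integralZl//; try exact/measurable_EFinP.
    rewrite -ge0_integralD//.
    - by move=> u _; rewrite -EFinM lee_fin mulr_ge0// mulr_ge0 ?gker_ge0 ?smoothed_mod_ge0.
    - by apply: emeasurable_funM => //; exact/measurable_EFinP.
    - by move=> u _; rewrite -EFinM lee_fin mulr_ge0// mulr_ge0 ?gker_ge0 ?wmod_ge0.
    - by apply: emeasurable_funM => //; exact/measurable_EFinP.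
  (* The smoothed modulus is itself a convolution, so the semigroup law merges the two Gaussians
     into one of exponent [1/(16t)]. *)
  have -> : (\int[L]_u (gker a8 (z - u) * sm u)%:E = (@gmass R n (2 * a8))%:E * gconv (gker (a8 / 2)) (wmod t phi) z)%E.
    rewrite -(gker_semigroup z a80 mw (wmod_ge0 t phi)); apply: eq_integral => u _.
    by rewrite (smoothed_modE t0 ephi hM) EFinM.
  have g0 : (0 <= gconv (gker (a8 / 2)) (wmod t phi) z)%E.
    by apply: integral_ge0 => u _; rewrite lee_fin mulr_ge0 ?gker_ge0 ?wmod_ge0.
  have gm := @gmass_ge0 R n (2 * a8) (mulr_gt0 (ltr0Sn _ 1) a80).
  have p1 : (0 <= (eta0 * @gmass R n (2 * a8))%:E)%E by rewrite lee_fin mulr_ge0.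
  have p2 : (0 <= eta1%:E)%E by rewrite lee_fin.
  rewrite EFinD (ge0_muleDl _ p1 p2) EFinM muleA.
  apply: leeD => //; apply: lee_wpmul2l; first by rewrite lee_fin.
  have mh : measurable_fun setT (fun u : Cn R n => gker (a8 / 2) (z - u) * wmod t phi u).
    exact: measurable_funM.
  apply: (le_ge0_integral _ m2 mh) => u; first by rewrite mulr_ge0 ?gker_ge0 ?wmod_ge0.
  by rewrite ler_wpM2r ?wmod_ge0// gker_mono// ler_pdivrMr// ler_peMr ?(ltW a80)// ler1n.
have fdom : (\int[L]_u (dom u)%:E < +oo)%E.
  apply: le_lt_trans Idom _; apply: lte_mul_pinfty => //; last by rewrite gfin// divr_gt0.
  rewrite lee_fin addr_ge0// mulr_ge0//.
  by rewrite gmass_ge0// mulr_gt0.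
have mTK : cmfun (fun u => cint L (TK u)) by exact: (cmfun_cint L (f := fun q => TK q.1 q.2) cmTK).
have LDiff : cL1 L (fun u => (weight t z)%:C%C * (cint L (PK u) - cint L (TK u))).
  apply: (@cL1_dom _ _ _ _ _ dom) => //.
    apply: cmfunM; first exact: cmfun_cst.
    by apply: cmfunB => //; case: LPK.
  by move=> u; rewrite normcM normcR ger0_norm ?(ltW w0)// mulrC; exact: diff_section.
(* Integrability of the twisted side needs no estimate of its own: it is the integrable product side
   minus an integrable difference. *)
have LTK : cL1 L (fun u => cint L (TK u)).
  apply: cL1_ext (cL1B LPK (cL1Z ((weight t z)^-1)%:C%C LDiff)) => u.
  rewrite mulrA -rmorphM mulVf ?gt_eqF// mul1r.
  by rewrite opprB addrC subrK.
have E : normc (cint L (fun u => (weight t z)%:C%C * (cint L (PK u) - cint L (TK u)))) =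
  wmod t (toeplitz t f (toeplitz t g phi) - toeplitz t (heat_symbol t e r f g) phi) z.
  rewrite (cintZ _ (cL1B LPK LTK)) (cintB LPK LTK) normcM normcR ger0_norm ?(ltW w0)// mulrC /wmod.
  rewrite -(toeplitz_mulE z t0 mf mg mphi hA hB hM) -(toeplitz_heat_symbolE t0 e0 et Bf Bg z ephi hM Bh).
  by [].
rewrite -E.
apply: le_trans (normc_cint_dom _ mdom _ fdom) _.
- by case: LDiff.
- by move=> u; rewrite normcM normcR ger0_norm ?(ltW w0)// mulrC; exact: diff_section.
apply: le_trans Idom _; apply: lee_wpmul2r.
  by apply: integral_ge0 => u _; rewrite lee_fin mulr_ge0 ?gker_ge0 ?wmod_ge0.
by rewrite lee_fin le_eqVlt; apply/orP; left; apply/eqP; rewrite /eta0 /eta1; ring.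
Qed.

End ProductEstimate.

Section ProductsOfToeplitz.
Context {R : realType} {n : nat}.
Variables (k : fock_kind R) (t : R).
Hypothesis t0 : 0 < t.

(** The hypothesis only concerns products of translates of the two given symbols, so the lemma
    serves algebras and one-sided ideals alike. *)
Lemma toeplitz_mul_Tlin (D : set (Cn R n -> C R)) f g : is_closed_subspace BUC sup_norm D ->
  BUC f -> BUC g -> (forall x y, D (fun u => f (u + y + x) * g (u + y))) ->
  Tlin k t D (op_mul (toeplitz t f) (toeplitz t g)).
Proof.
move=> clD Bf Bg hD; have [DB sD _] := clD.
have [A A0 hA] := BUC_bounded Bf; have [B B0 hB] := BUC_bounded Bg.
have Wf := bounded_toeplitz k t0 Bf; have Wg := bounded_toeplitz k t0 Bg.
have Wfg := bounded_op_mul t0 Wf Wg.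
apply: Tlin_closed => // dl dl0.
pose a8 := (8 * t)^-1; have a80 : 0 < a8 by rewrite invr_gt0 mulr_gt0.
have a160 : 0 < a8 / 2 by rewrite divr_gt0.
pose c := (pi * t) ^- n : R; have c0 : 0 < c by exact: gauss_const_gt0.
pose K0 := (@gmass R n (a8 / 2) + 1) ^+ 2.
have K00 : 0 < K0 by rewrite exprn_gt0// ltr_wpDl// gmass_ge0.
pose Q := A * B * c * K0; have Q0 : 0 < Q by rewrite mulr_gt0// mulr_gt0// mulr_gt0.
pose g2 := @gmass R n (2 * a8); have g20 : 0 <= g2 by rewrite gmass_ge0// mulr_gt0.
pose q := 16 * c * g2 + 1; have q0 : 0 < q by rewrite ltr_wpDl// mulr_ge0// mulr_ge0// ltW.
(* The ratio [e / t]: [8^-1] is the range of [product_estimate], and the second bound brings the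
   twisting error below [dl / 2]. *)
pose s := Num.min 8^-1 (dl / (2 * Q * q)).
have s0 : 0 < s by rewrite lt_min invr_gt0 divr_gt0 ?ltr0n// mulr_gt0// mulr_gt0.
(* With [r = 4 * t * X] the tail factor is [expR (- X) <= 1 / X], and this [X] brings the cutoff
   error below [dl / 2]. *)
pose X := 2 * Q * (4 / 3) ^+ n / dl.
have p43 : 0 < (4 / 3) ^+ n :> R by apply: exprn_gt0; exact: divr_gt0.
have X0 : 0 < X := divr_gt0 (mulr_gt0 (mulr_gt0 (ltr0Sn _ 1) Q0) p43) dl0.
pose e := s * t; have e0 : 0 < e by rewrite mulr_gt0.
pose r := 4 * t * X.
have est : e / t <= 8^-1 by rewrite /e mulfK ?gt_eqF// ge_min lexx.
have et : e < t.
  by move: est; rewrite ler_pdivrMr// => h; apply: le_lt_trans h _; rewrite gtr_pMl// invf_lt1// ltr1n.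
have Dh := heat_symbol_mem r t0 e0 et Bf Bg clD hD.
exists (toeplitz t (heat_symbol t e r f g)); first exact: Tlin_toeplitz.
have Bh := DB _ Dh; have Wh := bounded_toeplitz k t0 Bh.
have WB := bounded_opB t0 Wfg Wh.
pose eta := A * B * c * (16 * (e / t) * c * g2 + (4 / 3) ^+ n * expR (- (r / (4 * t)))).
have eta0 : 0 < eta.
  apply: mulr_gt0; first by rewrite mulr_gt0// mulr_gt0.
  rewrite ltr_wpDl//; last exact: (mulr_gt0 p43 (expR_gt0 _)).
  by rewrite mulr_ge0// mulr_ge0 ?(ltW c0)// mulr_ge0// divr_ge0 ?ltW.
have etaE : eta * K0 <= dl.
  have -> : eta * K0 = Q * s * (16 * c * g2) + Q * (4 / 3) ^+ n * expR (- X).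
    have rE : r / (4 * t) = X by rewrite /r mulrAC mulfV ?mul1r// mulf_neq0// gt_eqF.
    by rewrite /eta rE /Q /e mulfK ?gt_eqF//; ring.
  rewrite [leRHS]splitr; apply: lerD.
    have h1 : s <= dl / (2 * Q * q) by rewrite ge_min lexx orbT.
    have Qq : 0 <= Q * q by rewrite mulr_ge0// ltW.
    apply: (@le_trans _ _ (Q * s * q)).
      by rewrite ler_wpM2l ?lerDl// mulr_ge0// ltW.
    rewrite mulrAC; apply: le_trans (ler_wpM2l Qq h1) _.
    by rewrite le_eqVlt; apply/orP; left; apply/eqP; field; rewrite (gt_eqF Q0) (gt_eqF q0).
  have -> : Q * (4 / 3) ^+ n = dl / 2 * X by rewrite /X; field; rewrite gt_eqF.
  rewrite -mulrA ler_piMr ?divr_ge0 ?(ltW dl0)// expRN ler_pdivrMr ?expR_gt0// mul1r.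
  by apply: le_trans (expR_ge1Dx _); rewrite lerDr.
apply: le_trans etaE; apply: (opr_le t0 WB); first by rewrite mulr_ge0 ?ltW.
move=> phi F1; have [M M0 hM] := fock_space_bounded t0 F1.
have ephi := fock_space_entire F1.
have FB : fock_space k t ((op_mul (toeplitz t f) (toeplitz t g) - toeplitz t (heat_symbol t e r f g)) phi).
  by case: WB => h _ _; exact: h.
apply: (fock_norm_young t0 (fock_space_cmfun F1) (fock_space_cmfun FB) (@measurable_gker R n (a8 / 2))
  (gker_ge0 (a8 / 2)) (integral_gker a160) eta0 _ (fock_space_fin F1)).
move=> z; exact: (product_estimate z t0 e0 est Bf Bg ephi hA hB hM Bh).
Qed.

End ProductsOfToeplitz.

(** * The Berezin transform *)

Section ProductDomination.
Context {R : realType} {n : nat}.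
Local Notation L := (@lebC R n).

Lemma gker_dom_iterated (P : Cn R n * Cn R n -> Defs.C R) (C a : R) : 0 < a -> cmfun P ->
  (forall u x, normc (P (u, x)) <= C * (gker a u * gker a x)) ->
  [/\ forall u, cL1 L (fun x => P (u, x)), cL1 L (fun u => cint L (fun x => P (u, x))) &
      normc (cint L (fun u => cint L (fun x => P (u, x)))) <= C * @gmass R n a ^+ 2].
Proof.
move=> a0 mP hP.
have C0 : 0 <= C.
  by have := le_trans (normc_ge0 _) (hP 0 0); rewrite pmulr_lge0// mulr_gt0 ?gker_gt0.
have gm := @gmass_ge0 R n a a0.
have mk := @measurable_gker R n a.
have Ig (b : R) : 0 <= b -> (\int[L]_x (b * gker a x)%:E = (b * @gmass R n a)%:E)%E.
  move=> b0; rewrite -(integral_gker_reflect 0 a0 b0); apply: eq_integral => x _.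
  by rewrite gker_sym subr0.
have sec u : cL1 L (fun x => P (u, x)).
  apply: (@cL1_dom _ _ _ _ _ (fun x => C * gker a u * gker a x)).
  - exact: (@cmfun_comp _ _ _ _ _ (fun x => (u, x)) _ (measurable_pair1 u) mP).
  - exact: measurable_funM.
  - by move=> x; rewrite -mulrA; exact: hP.
  - by rewrite Ig ?mulr_ge0 ?gker_ge0// ltry.
have bsec u : normc (cint L (fun x => P (u, x))) <= C * @gmass R n a * gker a u.
  have mG : measurable_fun setT (fun x : Cn R n => C * gker a u * gker a x) by exact: measurable_funM.
  have bG x : normc (P (u, x)) <= C * gker a u * gker a x by rewrite -mulrA; exact: hP.
  have IG := Ig (C * gker a u) (mulr_ge0 C0 (gker_ge0 _ _)).
  have fG : (\int[L]_x (C * gker a u * gker a x)%:E < +oo)%E by rewrite IG ltry.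
  rewrite -lee_fin; apply: le_trans (normc_cint_dom (proj1 (sec u)) mG bG fG) _.
  by rewrite IG lee_fin mulrAC.
have mo : cmfun (fun u => cint L (fun x => P (u, x))) := cmfun_cint L mP.
have md : measurable_fun setT (fun u : Cn R n => C * @gmass R n a * gker a u) by exact: measurable_funM.
have Id : (\int[L]_u (C * @gmass R n a * gker a u)%:E = (C * @gmass R n a ^+ 2)%:E)%E.
  by rewrite Ig ?mulr_ge0// expr2 mulrA.
have Lo : cL1 L (fun u => cint L (fun x => P (u, x))).
  by apply: (cL1_dom mo md bsec); rewrite Id ltry.
split=> //; rewrite -lee_fin -Id; apply: (normc_cint_dom mo md bsec).
by rewrite Id ltry.
Qed.

End ProductDomination.

Section Berezin.
Context {R : realType} {n : nat}.
Variables (k : fock_kind R) (t : R).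
Hypothesis t0 : 0 < t.
Implicit Types (f g h : Cn R n -> C R) (z w u x : Cn R n) (D : set (Cn R n -> C R)).
Implicit Types (A : (Cn R n -> C R) -> (Cn R n -> C R)).
Local Notation L := (@lebC R n).
Local Notation Re := (@complex.Re R).
Local Notation a := ((2 * t)^-1).
Local Notation c := ((pi * t) ^- n).

Definition coherent z w : C R := cexp (dot w z / t%:C%C).

(** The pairing of [A k_z] with [k_z], for the normalized reproducing kernel [k_z], is the value of
    [A (coherent z)] at [z] divided by [e^(|z|^2/t)]. In this form no inner product is involved and
    it makes sense on every Fock space. *)
Definition berezin A z : C R := (expR (- (t^-1 * sqnorm z)))%:C%C * A (coherent z) z.

Let tn : t%:C%C != 0 :> C R. Proof. by apply: contraTneq t0 => /complexI ->; rewrite ltxx. Qed.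

Lemma entire_coherent z : entire (coherent z).
Proof.
have -> : coherent z = fun w => cexp ((t%:C%C)^-1 * dot w z) by apply/funext => w; rewrite /coherent mulrC.
exact: entire_cexp_dot.
Qed.

Lemma wmod_coherent z w : wmod t (coherent z) w = expR (sqnorm z / (2 * t)) * gker a (w - z).
Proof.
rewrite /wmod /weight /coherent normc_cexp realCV [dot w z * _]mulrC mulRC_Re /gker -!expRD; congr expR.
by rewrite sqnormB; field; rewrite gt_eqF.
Qed.

Lemma wmod_coherent_le z w : wmod t (coherent z) w <= expR (sqnorm z / (2 * t)).
Proof. by rewrite wmod_coherent ler_piMr ?expR_ge0// gker_le1// ltW// twice_inv_gt0. Qed.

Lemma fock_coherent : exists2 K : R, 0 < K & forall z, fock_space k t (coherent z) /\
  (fock_norm k t (coherent z) <= (expR (sqnorm z / (2 * t)) * K)%:E)%E.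
Proof.
have [K K0 hK] := fock_norm_gaussian (n := n) k t0 (twice_inv_gt0 t0); exists K => // z.
have N : (fock_norm k t (coherent z) <= (expR (sqnorm z / (2 * t)) * K)%:E)%E.
  apply: (hK _ z); first by apply: entire_cmfun; exact: entire_coherent.
    exact: expR_ge0.
  by move=> w; rewrite wmod_coherent.
split=> //; apply: fock_spaceE; first exact: entire_coherent.
  by apply: le_lt_trans N _; rewrite ltry.
case: (k) => //; apply/C0P; split.
  apply: continuous_mul_real; first by apply: entire_continuous; exact: entire_coherent.
  exact: eps_continuous_weight.
move=> e e0; have E0 := expR_gt0 (sqnorm z / (2 * t)).
pose X := expR (sqnorm z / (2 * t)) / e; have X0 : 0 < X by rewrite divr_gt0.
exists (2 * (sqnorm z + X / a)) => w hw; rewrite normc_weight wmod_coherent.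
have a0 := twice_inv_gt0 t0.
have h1 : X < a * sqnorm (w - z).
  rewrite mulrC -ltr_pdivrMr//.
  have : sqnorm w <= 2 * (sqnorm (w - z) + sqnorm z) by rewrite -{1}(subrK z w) sqnormD_le.
  lra.
have h2 : X < expR (a * sqnorm (w - z)).
  by apply: lt_le_trans h1 _; apply: le_trans (expR_ge1Dx _); rewrite lerDr.
by rewrite /gker expRN ltr_pdivrMr ?expR_gt0// [ltRHS]mulrC -ltr_pdivrMr.
Qed.

(** Point evaluation at [z] and the norm of the coherent state each contribute [e^(|z|^2/(2t))]; the
    normalization cancels both. *)
Lemma berezin_bound : exists2 K : R, 0 < K & forall A, bounded_operators k t A ->
  forall z, normc (berezin A z) <= K * opr k t A.
Proof.
have [K K0 hK] := fock_coherent; have [K' K'0 hK'] := fock_point_eval (n := n) k t0.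
exists (K' * K); first exact: mulr_gt0.
move=> A WA z; have [F1 N1] := hK z.
have FA : fock_space k t (A (coherent z)) by case: WA => h _ _; exact: h.
have h1 := hK' _ (fock_space_entire FA) (fock_space_fin FA) z.
have h2 : fine (fock_norm k t (A (coherent z))) <= opr k t A * (expR (sqnorm z / (2 * t)) * K).
  rewrite -lee_fin fineK; last by rewrite ge0_fin_numE ?fock_norm_ge0// (fock_space_fin FA).
  apply: le_trans (opr_bound t0 WA F1) _; rewrite EFinM; apply: lee_wpmul2l => //.
  by rewrite lee_fin opr_ge0.
have h3 := le_trans h1 (ler_wpM2l (ltW K'0) h2).
rewrite /berezin normcM normcR ger0_norm ?expR_ge0//.
have ww : expR (- (t^-1 * sqnorm z)) = weight t z * weight t z.
  by rewrite /weight -expRD; congr expR; field; rewrite gt_eqF.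
rewrite [leLHS](_ : _ = weight t z * wmod t (A (coherent z)) z); last by rewrite ww /wmod; ring.
apply: le_trans (ler_wpM2l (ltW (weight_gt0 t z)) h3) _.
have EW : weight t z * expR (sqnorm z / (2 * t)) = 1.
  by rewrite /weight mulNr expRN mulVf// gt_eqF// expR_gt0.
rewrite [leLHS](_ : _ = K' * K * opr k t A * (weight t z * expR (sqnorm z / (2 * t)))); last by ring.
by rewrite EW mulr1.
Qed.

(** After normalization the oscillating factors disappear and a Gaussian centred at [z] remains;
    this is why Berezin transforms of Toeplitz operators are convolutions. *)
Lemma coherent_bergman z w : (expR (- (t^-1 * sqnorm z)))%:C%C * (coherent z w * bergman t z w) =
  (gauss_density t (w - z))%:C%C.
Proof.
rewrite /coherent /bergman !gauss_density_expR// !rmorphM /= -!cexpR.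
rewrite (_ : _ * _ = ((pi * t) ^- n)%:C%C * cexp ((- (t^-1 * sqnorm z))%:C%C + dot w z / t%:C%C +
  (- (t^-1 * sqnorm w))%:C%C + dot z w / t%:C%C)); last by rewrite !cexpD; ring.
congr (_ * cexp _).
rewrite !rmorphN !rmorphM /= -!dotzz fmorphV !dotBl !dotBr.
by field.
Qed.

Lemma berezin_toeplitz h z : BUC h ->
  berezin (toeplitz t h) z = cint L (fun w => (gauss_density t w)%:C%C * h (z + w)).
Proof.
move=> Bh; have [B B0 hB] := BUC_bounded Bh; have mh := BUC_cmfun Bh.
have mc := entire_cmfun (entire_coherent z).
have LK : cL1 L (fun w => fun_mul h (coherent z) w * bergman t z w).
  apply: cL1_ext (cL1_kernel z t0 (cmfunM mh mc) (wmod_mul_bounded hB (wmod_coherent_le z))) => w.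
  by rewrite /bergman mulrCA.
rewrite /berezin toeplitzE// Pt_bergman -(cintZ _ LK).
transitivity (cint L (fun w => (gauss_density t (w - z))%:C%C * h w)).
  by apply: eq_cint => w; rewrite -coherent_bergman /fun_mul /=; ring.
have mg : cmfun (fun w => (gauss_density t (w - z))%:C%C * h w).
  apply: cmfunM => //; apply: cmfunR.
  apply: (measurableT_comp (@measurable_gauss_density_Cn R n t)).
  by apply: measurable_CnB; [exact: measurable_id|exact: measurable_cst].
rewrite -(cint_mpres (mpres_shift z) mg); apply: eq_cint => w.
by rewrite addrK addrC.
Qed.

Lemma cL1_gauss : cL1 L (fun w : Cn R n => (gauss_density t w)%:C%C).
Proof.
apply: (cL1_gaussian_dom (K := c) (a := t^-1) (v := 0)); first by rewrite invr_gt0.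
  by apply: cmfunR; exact: measurable_gauss_density_Cn.
move=> w; rewrite normcR ger0_norm ?gauss_density_ge0// gauss_density_expR// dot0r addr0.
exact: lexx.
Qed.

Lemma berezin_toeplitz_mem D h : is_closed_subspace BUC sup_norm D -> alpha_invariant D ->
  D h -> D (berezin (toeplitz t h)).
Proof.
move=> clD aD Dh; have [DB _ _] := clD; have Bh := DB _ Dh; have [B B0 hB] := BUC_bounded Bh.
have -> : berezin (toeplitz t h) = fun z => cint L (fun w => (gauss_density t w)%:C%C * h (z + w)).
  by apply/funext => z; exact: berezin_toeplitz.
apply: (@cint_closed_subspace _ _ _ _ L D _ (fun w z => h (z + w)) B clD cL1_gauss (ltW B0)).
- by move=> w z; exact: hB.
- move=> w; have := aD (- w) h Dh; congr D; apply/funext => z.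
  by rewrite opprK.
move=> dl dl0; have [_ /unif_continuous_epsP uf] := Bh; have [d d0 hd] := uf dl dl0.
have [m [s [mm hs]]] := @exists_discretization R n (d / 2) (divr_gt0 d0 (ltr0Sn _ 1)).
exists m, s; split=> // w z; apply: ltW; apply: hd.
rewrite opprD addrACA subrr add0r; apply: le_lt_trans (hs w) _.
by rewrite gtr_pMr// invf_lt1// ltr1n.
Qed.

Lemma berezin_mem D A : is_closed_subspace BUC sup_norm D -> alpha_invariant D ->
  Tlin k t D A -> D (berezin A).
Proof.
move=> clD aD TA; have [DB sD _] := clD.
have [WA hA] := (TlinP k t0 A DB sD).1 TA.
have [K K0 hK] := berezin_bound.
have approx e : 0 < e -> exists2 g, D g & forall z, normc (berezin A z - g z) <= e.
  move=> e0; have [h Dh hh] := hA (e / K) (divr_gt0 e0 K0).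
  exists (berezin (toeplitz t h)); first exact: berezin_toeplitz_mem.
  move=> z; have WB := bounded_opB t0 WA (bounded_toeplitz k t0 (DB _ Dh)).
  have := hK _ WB z; rewrite ltr_pdivlMr// mulrC in hh.
  rewrite /berezin -[(A - _) (coherent z) z]/(A (coherent z) z - toeplitz t h (coherent z) z).
  by rewrite mulrBr => /le_trans; apply; exact: ltW.
apply: (closed_subspace_limit clD _ approx).
have [g Dg hg] := approx 1 ltr01; have [B B0 hB] := BUC_bounded (DB _ Dg).
apply: (@BUC_bounded_le _ _ _ (B + 1)).
  move=> z; rewrite -[berezin A z](subrK (g z)) addrC; apply: le_trans (normcD _ _) _.
  by rewrite lerD.
by apply: unif_continuous_limit => e /approx[g' Dg' hg']; exists g' => //; case: (DB _ Dg').
Qed.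

(** What [product_kernel] becomes on coherent states, once [u] is measured from [z]: the Berezin
    transform of [T_f T_g] is the integral of [f (z + u + x) * g (z + u)] against this complex
    weight. *)
Definition moyal_weight u x : C R :=
  (gauss_density t u)%:C%C * (gauss_density t x)%:C%C * cexp (- (dot u x / t%:C%C)).

(** The exponential of [- dot u x / t] costs at most half of each Gaussian exponent, so the weight
    remains absolutely integrable. *)
Lemma normc_moyal_weight u x : normc (moyal_weight u x) <= c ^+ 2 * (gker a u * gker a x).
Proof.
rewrite /moyal_weight normcM (normcM _%:C%C) !normcR !ger0_norm ?gauss_density_ge0// !gauss_density_expR//.
rewrite normc_cexp realCV ReN [dot u x * _]mulrC mulRC_Re /gker.
set E1 := expR _; set E2 := expR _; set E3 := expR _.
have -> : c * E1 * (c * E2) * E3 = c ^+ 2 * (E1 * E2 * E3) by ring.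
rewrite ler_wpM2l ?sqr_ge0// /E1 /E2 /E3 -!expRD ler_expR.
have h : `|Re (dot u x)| <= (sqnorm u + sqnorm x) / 2.
  exact: le_trans (le_Re_normc _) (normc_dot_le1 u x).
have h2 : - Re (dot u x) <= (sqnorm u + sqnorm x) / 2.
  by apply: le_trans h; rewrite -normrN ler_norm.
have ti : 0 <= t^-1 by rewrite invr_ge0 ltW.
have := ler_wpM2l ti h2; rewrite mulrN => h3.
have -> : (2 * t)^-1 = t^-1 / 2 by rewrite invfM mulrC.
move: h3; move: (t^-1) (Re _) (sqnorm u) (sqnorm x) => y d p q h3; nra.
Qed.

Lemma cmfun_moyal_weight : cmfun (fun q : Cn R n * Cn R n => moyal_weight q.1 q.2).
Proof.
apply: cmfunM.
  apply: cmfunM; apply: cmfunR.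
    exact: (measurableT_comp (@measurable_gauss_density_Cn R n t) measurable_fst).
  exact: (measurableT_comp (@measurable_gauss_density_Cn R n t) measurable_snd).
apply: cmfun_cexp; apply: cmfunN; apply: cmfunM; last exact: cmfun_cst.
by apply: cmfun_dot; [exact: measurable_fst|exact: measurable_snd].
Qed.

Lemma berezin_toeplitz_mul f g z : BUC f -> BUC g ->
  berezin (op_mul (toeplitz t f) (toeplitz t g)) z =
  cint L (fun u => cint L (fun x => moyal_weight u x * (f (z + u + x) * g (z + u)))).
Proof.
move=> Bf Bg; have [A A0 hA] := BUC_bounded Bf; have [B B0 hB] := BUC_bounded Bg.
have mf := BUC_cmfun Bf; have mg := BUC_cmfun Bg.
have mc := entire_cmfun (entire_coherent z).
rewrite /berezin /op_mul /= (toeplitz_mulE z t0 mf mg mc hA hB (wmod_coherent_le z)).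
have LP := cL1_cint_product_kernel z t0 mf mg mc hA hB (wmod_coherent_le z).
have sec := cL1_product_kernel z t0 mf mg mc hA hB (wmod_coherent_le z).
rewrite -(cintZ _ LP) -(cint_mpres (mpres_shift z) (proj1 (cL1Z _ LP))).
apply: eq_cint => u; rewrite -(cintZ _ (sec _)); apply: eq_cint => x.
have E := coherent_bergman z (u + z); rewrite addrK in E.
rewrite /product_kernel /moyal_weight -E [u + z]addrC opprD addrA subrr add0r dotNl mulNr.
ring.
Qed.

(** Read off from the product formula for the constant symbols 1 at [z = 0]: [T_1] fixes the
    coherent state there. *)
Lemma moyal_weight_mass : cint L (fun u => cint L (moyal_weight u)) = 1.
Proof.
have B1 : BUC ((fun=> 1) : Cn R n -> C R).
  apply: (@BUC_bounded_le _ _ _ 1) => [z|]; first by rewrite normc1.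
  by apply/unif_continuous_epsP => e e0; exists 1 => // z w _; rewrite subrr normc0.
have T1 : toeplitz t (fun=> 1) (coherent 0) = coherent 0.
  rewrite toeplitzE; last by apply: entire_cmfun; exact: entire_coherent.
    have -> : fun_mul (fun=> 1) (coherent 0) = coherent 0 by apply/funext => w; exact: mul1r.
    exact: (Pt_entire_id t0 (entire_coherent 0) (wmod_coherent_le 0)).
  exact: cmfun_cst.
have := berezin_toeplitz_mul 0 B1 B1; rewrite /berezin /op_mul /= !T1 => E.
have E1 : (expR (- (t^-1 * sqnorm (0 : Cn R n))))%:C%C * coherent (0 : Cn R n) 0 = 1.
  by rewrite sqnorm0 mulr0 oppr0 expR0 /coherent dot0l mul0r cexp0 mulr1.
rewrite -E1 E.
by apply: eq_cint => u; apply: eq_cint => x; rewrite !mulr1.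
Qed.

End Berezin.

(** * The semiclassical limit by dilation of symbols *)

Section SemiclassicalLimit.
Context {R : realType} {n : nat}.
Variables (k : fock_kind R) (t : R).
Hypothesis t0 : 0 < t.
Implicit Types (f g : Cn R n -> C R) (z w u x : Cn R n) (D : set (Cn R n -> C R)).
Local Notation L := (@lebC R n).

(** For [|h|^2 >= d] the oscillation, at most [2 A], is also at most [2 A |h|^2 / d]. A modulus of
    continuity quadratic in [h] can be integrated against a Gaussian. *)
Lemma BUC_quadratic_modulus f (A d e : R) : 0 < d -> (forall z, normc (f z) <= A) ->
  (forall z w, sqnorm (z - w) < d -> normc (f z - f w) < e) ->
  forall z h, normc (f (z + h) - f z) <= e + 2 * A * (sqnorm h / d).
Proof.
move=> d0 hA hd z h; have A0 := le_trans (normc_ge0 _) (hA 0).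
have e0 : 0 < e by have := hd 0 0; rewrite subrr sqnorm0 subrr normc0; apply.
have [hh|hh] := ltP (sqnorm h) d.
  apply: ler_wpDr; first exact: (mulr_ge0 (mulr_ge0 (ler0n _ 2) A0) (divr_ge0 (sqnorm_ge0 _) (ltW d0))).
  by apply: ltW; apply: hd; rewrite addrAC subrr add0r.
apply: ler_wpDl; first exact: ltW.
apply: (@le_trans _ _ (2 * A)); first by apply: le_trans (normcB _ _) _; rewrite mulrDl !mul1r lerD.
by rewrite ler_peMr ?mulr_ge0// ler_pdivlMr// mul1r.
Qed.

(** After undoing the dilation, the Berezin transform of the product averages
    [f (z + l (u + x)) * g (z + l u)] against a weight of mass 1. Small [l] forces the arguments
    towards [z], uniformly in [z]. *)
Lemma fun_mul_mem D f g : is_closed_subspace BUC sup_norm D -> alpha_invariant D -> delta_invariant D ->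
  BUC f -> BUC g ->
  (forall l : R, 0 < l -> Tlin k t D (op_mul (toeplitz t (fun z => f (l%:C%C *: z)))
     (toeplitz t (fun z => g (l%:C%C *: z))))) ->
  D (fun_mul f g).
Proof.
move=> clD aD dD Bf Bg hT; apply: (closed_subspace_limit clD); first exact: BUC_mul.
have [A A0 hA] := BUC_bounded Bf; have [B B0 hB] := BUC_bounded Bg.
move=> e e0.
(* Half of the exponent [1/(2t)] of the weight is reserved for absorbing the quadratic term
   [|u|^2 + |x|^2]. *)
pose a4 := (4 * t)^-1; have a40 : 0 < a4 by rewrite invr_gt0 mulr_gt0.
pose c2 : R := (pi * t) ^- n ^+ 2; have c20 : 0 < c2 by rewrite exprn_gt0// gauss_const_gt0.
pose m : R := @gmass R n a4 ^+ 2.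
have m0 : 0 <= m by exact: sqr_ge0.
have m1 : 0 < m + 1 by rewrite ltr_wpDl.
pose K := c2 * (m + 1); have K0 : 0 < K by exact: mulr_gt0.
pose e1 := e / 2 / ((A + B) * K).
have AB0 : 0 < (A + B) * K by rewrite mulr_gt0// addr_gt0.
have e10 : 0 < e1 by exact: (divr_gt0 (divr_gt0 e0 (ltr0Sn _ 1)) AB0).
have [_ /unif_continuous_epsP uf] := Bf; have [_ /unif_continuous_epsP ug] := Bg.
have [d1 d10 hd1] := uf e1 e10; have [d2 d20 hd2] := ug e1 e10.
have qf := BUC_quadratic_modulus d10 hA hd1; have qg := BUC_quadratic_modulus d20 hB hd2.
(* Collects the quadratic terms of both moduli: each has the factor [2 A B], and for [f] there is
   another 2 from [|u + x|^2 <= 2 (|u|^2 + |x|^2)]. *)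
pose Q := A * B * (4 / d1 + 2 / d2).
have Q0 : 0 < Q by apply: mulr_gt0; [exact: mulr_gt0|apply: addr_gt0; exact: divr_gt0].
have QK0 : 0 < Q * (4 * t) * K by rewrite mulr_gt0// mulr_gt0// mulr_gt0.
(* Balanced so that the quadratic part contributes [e / 2] in total, as the uniform part does
   through [e1]. *)
pose l := Num.sqrt (e / 2 / (Q * (4 * t) * K)).
have le0 : 0 < e / 2 / (Q * (4 * t) * K) := divr_gt0 (divr_gt0 e0 (ltr0Sn _ 1)) QK0.
have l0 : 0 < l by rewrite sqrtr_gt0.
have l2 : l ^+ 2 = e / 2 / (Q * (4 * t) * K) by rewrite sqr_sqrtr// ltW.
have Bfl := BUC_dilate l0 Bf; have Bgl := BUC_dilate l0 Bg.
pose b := berezin t (op_mul (toeplitz t (fun z => f (l%:C%C *: z))) (toeplitz t (fun z => g (l%:C%C *: z)))).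
have Db : D b by apply: (berezin_mem t0 clD aD (k := k)); exact: hT.
exists (fun z => b ((l^-1)%:C%C *: z)).
  by have := dD l^-1 _ b Db; rewrite invr_gt0; apply.
move=> z.
have lz : l%:C%C *: ((l^-1)%:C%C *: z) = z.
  by rewrite scalerA -rmorphM mulfV ?scale1r// gt_eqF.
rewrite /b (berezin_toeplitz_mul t0 _ Bfl Bgl).
pose F u x := f (z + l%:C%C *: (u + x)) * g (z + l%:C%C *: u).
have FE u x : f (l%:C%C *: ((l^-1)%:C%C *: z + u + x)) * g (l%:C%C *: ((l^-1)%:C%C *: z + u)) = F u x.
  by rewrite -addrA !(scalerDr l%:C%C (_ *: z)) lz.
have bW := @normc_moyal_weight R n t t0.
have mW := @cmfun_moyal_weight R n t.
have hmono (u x : Cn R n) : gker (2 * t)^-1 u * gker (2 * t)^-1 x <= gker a4 u * gker a4 x.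
  have h : a4 <= (2 * t)^-1 by rewrite lef_pV2 ?posrE ?mulr_gt0// ler_pM2r// ler_nat.
  by apply: ler_pM; rewrite ?gker_ge0 ?gker_mono.
have bF u x : normc (F u x) <= A * B.
  by rewrite /F normcM; exact: (ler_pM (normc_ge0 _) (normc_ge0 _) (hA _) (hB _)).
have mF : cmfun (fun q : Cn R n * Cn R n => F q.1 q.2).
  have mu : measurable_fun setT (fun q : Cn R n * Cn R n => z + l%:C%C *: q.1).
    apply: measurable_CnD; first exact: measurable_cst.
    by apply: measurable_CnZ; [exact: cmfun_cst|exact: measurable_fst].
  have mux : measurable_fun setT (fun q : Cn R n * Cn R n => z + l%:C%C *: (q.1 + q.2)).
    apply: measurable_CnD; first exact: measurable_cst.
    apply: measurable_CnZ; first exact: cmfun_cst.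
    by apply: measurable_CnD; [exact: measurable_fst|exact: measurable_snd].
  apply: cmfunM; first exact: (@cmfun_comp _ _ _ _ _ _ _ mux (BUC_cmfun Bf)).
  exact: (@cmfun_comp _ _ _ _ _ _ _ mu (BUC_cmfun Bg)).
pose P1 (q : Cn R n * Cn R n) := moyal_weight t q.1 q.2 * F q.1 q.2.
pose P2 (q : Cn R n * Cn R n) := moyal_weight t q.1 q.2 * fun_mul f g z.
have mP1 : cmfun P1 by exact: cmfunM.
have mP2 : cmfun P2 by apply: cmfunM => //; exact: cmfun_cst.
have bP1 u x : normc (P1 (u, x)) <= c2 * (A * B) * (gker a4 u * gker a4 x).
  rewrite /P1 /= normcM mulrAC.
  apply: ler_pM (bF u x); rewrite ?normc_ge0//; apply: le_trans (bW u x) _.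
  by rewrite ler_wpM2l ?(ltW c20).
have bP2 u x : normc (P2 (u, x)) <= c2 * (A * B) * (gker a4 u * gker a4 x).
  rewrite /P2 /= normcM mulrAC.
  have bz : normc (fun_mul f g z) <= A * B.
    by rewrite /fun_mul /= normcM; exact: (ler_pM (normc_ge0 _) (normc_ge0 _) (hA _) (hB _)).
  apply: ler_pM bz; rewrite ?normc_ge0//; apply: le_trans (bW u x) _.
  by rewrite ler_wpM2l ?(ltW c20).
have [s1 o1 _] := gker_dom_iterated a40 mP1 bP1; have [s2 o2 _] := gker_dom_iterated a40 mP2 bP2.
have mP : cmfun (fun q => P1 q - P2 q) by exact: cmfunB.
have bP u x : normc (P1 (u, x) - P2 (u, x)) <=
    c2 * ((A + B) * e1 + l ^+ 2 * Q * (4 * t)) * (gker a4 u * gker a4 x).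
  rewrite /P1 /P2 -mulrBr normcM /=.
  pose Y := sqnorm u + sqnorm x.
  have Y0 : 0 <= Y by rewrite addr_ge0 ?sqnorm_ge0.
  have bd : normc (F u x - fun_mul f g z) <= (A + B) * e1 + l ^+ 2 * Q * Y.
    rewrite /F /fun_mul /=.
    have h1 := qf z (l%:C%C *: (u + x)); have h2 := qg z (l%:C%C *: u).
    set X1 := f (z + _) in h1 *; set X2 := g (z + _) in h2 *.
    have -> : X1 * X2 - f z * g z = (X1 - f z) * X2 + f z * (X2 - g z) by ring.
    apply: le_trans (normcD _ _) _; rewrite !normcM.
    have hX2 : normc X2 <= B by exact: hB.
    have h3 : normc (X1 - f z) * normc X2 <= (e1 + 2 * A * (sqnorm (l%:C%C *: (u + x)) / d1)) * B.
      exact: (ler_pM (normc_ge0 _) (normc_ge0 _) h1 hX2).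
    have h4 : normc (f z) * normc (X2 - g z) <= A * (e1 + 2 * B * (sqnorm (l%:C%C *: u) / d2)).
      exact: (ler_pM (normc_ge0 _) (normc_ge0 _) (hA z) h2).
    apply: le_trans (lerD h3 h4) _; rewrite !sqnormZR.
    have k1 : l ^+ 2 * sqnorm (u + x) / d1 <= l ^+ 2 * (2 * Y) / d1.
      by rewrite ler_wpM2r ?invr_ge0 ?(ltW d10)// ler_wpM2l ?sqr_ge0// sqnormD_le.
    have k2 : l ^+ 2 * sqnorm u / d2 <= l ^+ 2 * Y / d2.
      by rewrite ler_wpM2r ?invr_ge0 ?(ltW d20)// ler_wpM2l ?sqr_ge0// lerDl sqnorm_ge0.
    have a2 : 0 <= 2 * A * B by rewrite mulr_ge0 ?(ltW B0)// mulr_ge0 ?(ltW A0).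
    have q1 := ler_wpM2l a2 k1; have q2 := ler_wpM2l a2 k2.
    have -> : (A + B) * e1 + l ^+ 2 * Q * Y = A * e1 + B * e1 +
        (2 * A * B * (l ^+ 2 * (2 * Y) / d1) + 2 * A * B * (l ^+ 2 * Y / d2)).
      by rewrite /Q; field; rewrite (gt_eqF d10) (gt_eqF d20).
    apply: le_trans (lerD (lexx (A * e1 + B * e1)) (lerD q1 q2)).
    by rewrite le_eqVlt; apply/orP; left; apply/eqP; ring.
  have YE : gker (2 * t)^-1 u * gker (2 * t)^-1 x * Y <= 4 * t * (gker a4 u * gker a4 x).
    have t4 : 0 < 4 * t by rewrite mulr_gt0.
    have hY : Y <= 4 * t * expR (a4 * Y).
      rewrite mulrC -ler_pdivrMr// mulrC; apply: le_trans (expR_ge1Dx _); rewrite lerDr//.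
    apply: le_trans (ler_wpM2l (mulr_ge0 (gker_ge0 _ _) (gker_ge0 _ _)) hY) _.
    rewrite mulrCA ler_wpM2l ?(ltW t4)// /gker -!expRD ler_expR le_eqVlt; apply/orP; left; apply/eqP.
    by rewrite /a4 /Y; field; rewrite gt_eqF.
  apply: le_trans (ler_pM (normc_ge0 _) (normc_ge0 _) (bW u x) bd) _.
  have p1 : 0 <= (A + B) * e1 by rewrite mulr_ge0 ?(ltW e10)// addr_ge0 ?ltW.
  have p2 : 0 <= l ^+ 2 * Q by rewrite mulr_ge0 ?sqr_ge0 ?(ltW Q0).
  rewrite -/c2; have hm := hmono u x.
  move: YE hm; set G := gker (2 * t)^-1 u * _; set G4 := gker a4 u * _ => YE hm.
  rewrite [leLHS](_ : _ = c2 * ((A + B) * e1 * G + l ^+ 2 * Q * (G * Y))); last by ring.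
  rewrite [leRHS](_ : _ = c2 * ((A + B) * e1 * G4 + l ^+ 2 * Q * (4 * t * G4))); last by ring.
  exact: (ler_wpM2l (ltW c20) (lerD (ler_wpM2l p1 hm) (ler_wpM2l p2 YE))).
have [_ _ bnd] := gker_dom_iterated a40 mP bP.
rewrite normc_distC.
have -> : cint L (fun u => cint L (fun x => moyal_weight t u x *
    (f (l%:C%C *: ((l^-1)%:C%C *: z + u + x)) * g (l%:C%C *: ((l^-1)%:C%C *: z + u))))) - fun_mul f g z =
  cint L (fun u => cint L (fun x => P1 (u, x) - P2 (u, x))).
  have E2 : fun_mul f g z = cint L (fun u => cint L (fun x => P2 (u, x))).
    have LM : forall u, cL1 L (moyal_weight t u) /\ cL1 L (fun u => cint L (moyal_weight t u)).
      have bM u x : normc (moyal_weight t u x) <= c2 * (gker a4 u * gker a4 x).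
        by apply: le_trans (bW u x) _; rewrite ler_wpM2l ?(ltW c20).
      have [q1 q2 _] := gker_dom_iterated a40 mW bM.
      by move=> u; split; [exact: q1|exact: q2].
    rewrite -{1}[fun_mul f g z]mulr1 -(moyal_weight_mass t0 (n := n)) -(cintZ _ (proj2 (LM 0))).
    apply: eq_cint => u; rewrite -(cintZ _ (proj1 (LM u))); apply: eq_cint => x.
    by rewrite /P2 mulrC.
  rewrite E2 -(cintB _ o2); last first.
    by apply: cL1_ext o1 => u; apply: eq_cint => x; rewrite /P1 /= FE.
  apply: eq_cint => u; rewrite (cintB (s1 u) (s2 u)); congr (_ - _).
  by apply: eq_cint => x; rewrite /P1 /= FE.
apply: le_trans bnd _.
have ee : c2 * ((A + B) * e1 + l ^+ 2 * Q * (4 * t)) * (m + 1) = e.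
  rewrite l2 /e1 /K; field.
  by rewrite ?(gt_eqF c20) ?(gt_eqF m1) ?(gt_eqF t0) ?(gt_eqF Q0) ?(gt_eqF (addr_gt0 A0 B0)).
rewrite -ee -/m ler_wpM2l ?lerDl//.
rewrite mulr_ge0 ?(ltW c20)// addr_ge0//; first by rewrite mulr_ge0 ?(ltW e10)// addr_ge0 ?ltW.
exact: (mulr_ge0 (mulr_ge0 (sqr_ge0 _) (ltW Q0)) (mulr_ge0 (ler0n _ 4) (ltW t0))).
Qed.

End SemiclassicalLimit.

(** * From products of symbols to products of operators and back *)

Section SymbolProducts.
Context {R : realType} {n : nat}.
Variables (k : fock_kind R) (t : R) (D E G : set (Cn R n -> C R)).
Hypotheses (t0 : 0 < t) (clD : is_closed_subspace BUC sup_norm D)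
  (clE : is_closed_subspace BUC sup_norm E) (clG : is_closed_subspace BUC sup_norm G).

(** Three spaces are kept apart so that one statement covers the algebra (all equal) and both kinds
    of ideals ([E = G] or [D = G] the ideal). *)
Lemma Tlin_op_mul u v : alpha_invariant D -> alpha_invariant E ->
  (forall f g, D f -> E g -> G (fun_mul f g)) ->
  Tlin k t D u -> Tlin k t E v -> Tlin k t G (op_mul u v).
Proof.
move=> aD aE h; have [DB sD _] := clD; have [EB sE _] := clE; have [GB sG _] := clG.
apply: Tlin_mul => // f g Df Eg; apply: toeplitz_mul_Tlin => //; [exact: DB|exact: EB|].
move=> x y; apply: (h (fun u => f (u + y + x)) (fun u => g (u + y))).
  have := aD (- (y + x)) f Df; congr D; apply/funext => w.
  by rewrite opprK addrA.
by have := aE (- y) g Eg; congr E; apply/funext => w; rewrite opprK.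
Qed.

(** A single [t] is enough: dilation invariance of [D] and [E] makes all dilated Toeplitz operators
    available at this same [t]. *)
Lemma fun_mul_Tlin f g : delta_invariant D -> delta_invariant E ->
  alpha_invariant G -> delta_invariant G ->
  (forall u v, Tlin k t D u -> Tlin k t E v -> Tlin k t G (op_mul u v)) ->
  D f -> E g -> G (fun_mul f g).
Proof.
move=> dD dE aG dG h Df Eg; have [DB sD _] := clD; have [EB sE _] := clE.
apply: (fun_mul_mem t0 clG aG dG (DB _ Df) (EB _ Eg) (k := k)) => l l0.
by apply: h; apply: Tlin_toeplitz => //; [exact: dD|exact: dE].
Qed.

End SymbolProducts.

Theorem theorem5p3 (R : realType) (n : nat) (k : fock_kind R)
    (D0 : set (Cn R n -> C R)) :
  is_closed_subspace BUC sup_norm D0 ->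
  alpha_invariant D0 -> delta_invariant D0 ->
  let algebra1 := is_banach_algebra sup_norm fun_mul D0 in
  let algebra_at (t : R) :=
    is_banach_algebra (op_norm k t) op_mul (Tlin k t D0) in
  let algebra2 := forall t : R, 0 < t -> algebra_at t in
  let algebra3 := exists2 t0 : R, 0 < t0 & algebra_at t0 in
  ((algebra1 <-> algebra2) /\ (algebra1 <-> algebra3)) /\
  (algebra1 /\ algebra2 /\ algebra3 ->
   forall I0 : set (Cn R n -> C R),
     I0 `<=` D0 ->
     is_closed_subspace BUC sup_norm I0 ->
     alpha_invariant I0 -> delta_invariant I0 ->
     forall side : ideal_side,
       let ideal1 := is_ideal TwoSidedIdeal fun_mul D0 I0 in
       let ideal_at (t : R) := is_ideal side op_mul (Tlin k t D0) (Tlin k t I0) in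
       let ideal2 := forall t : R, 0 < t -> ideal_at t in
       let ideal3 := exists2 t0 : R, 0 < t0 & ideal_at t0 in
       (ideal1 <-> ideal2) /\ (ideal1 <-> ideal3)).
Proof.
move=> clD aD dD algebra1 algebra_at algebra2 algebra3.
have [DB sD _] := clD.
have from1 t : 0 < t -> algebra1 -> algebra_at t.
  move=> t0 [_ mulD _]; split; first exact: Tlin_subspace.
    by move=> u v; exact: (Tlin_op_mul t0 clD clD clD aD aD mulD).
  exact: Tlin_complete.
have to1 t : 0 < t -> algebra_at t -> algebra1.
  move=> t0 [_ mulT _]; split => //; last exact: BUC_complete.
  by move=> f g; exact: (fun_mul_Tlin t0 clD clD clD dD dD aD dD mulT).
split.
  split; split.
  - by move=> h t t0; exact: from1.
  - by move=> h; exact: (to1 1 ltr01 (h 1 ltr01)).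
  - by move=> h; exists 1; [exact: ltr01|exact: (from1 1 ltr01 h)].
  - by case=> t t0; exact: to1.
move=> _ I0 ID clI aI dI side ideal1 ideal_at ideal2 ideal3.
have [IB sI _] := clI.
have ifrom1 t : 0 < t -> ideal1 -> ideal_at t.
  move=> t0 [_ _ [hl hr]]; split; [exact: Tlin_mono|exact: Tlin_subspace|].
  have left u v : Tlin k t D0 u -> Tlin k t I0 v -> Tlin k t I0 (op_mul u v).
    exact: (Tlin_op_mul t0 clD clI clI aD aI hl).
  have right u v : Tlin k t D0 u -> Tlin k t I0 v -> Tlin k t I0 (op_mul v u).
    move=> Du Iv; apply: (Tlin_op_mul t0 clI clD clI aI aD _ Iv Du) => f g If Dg.
    exact: hr.
  by case: (side); [exact: left|exact: right|split; [exact: left|exact: right]].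
have ito1 t : 0 < t -> ideal_at t -> ideal1.
  move=> t0 [_ _ h].
  (* Commutativity of symbols lets a one-sided hypothesis on operators, of either side, yield the
     two-sided ideal property of [I0]. *)
  have mulC f g : fun_mul f g = fun_mul g f :> (Cn R n -> C R).
    by apply/funext => z; exact: mulrC.
  have left f g : D0 f -> I0 g -> I0 (fun_mul f g).
    have viaL : (forall u v, Tlin k t D0 u -> Tlin k t I0 v -> Tlin k t I0 (op_mul u v)) ->
        D0 f -> I0 g -> I0 (fun_mul f g).
      exact: (fun_mul_Tlin t0 clD clI clI dD dI aI dI).
    have viaR : (forall u v, Tlin k t D0 u -> Tlin k t I0 v -> Tlin k t I0 (op_mul v u)) ->
        D0 f -> I0 g -> I0 (fun_mul f g).
      move=> hr Df Ig; rewrite mulC; apply: (fun_mul_Tlin t0 clI clD clI dI dD aI dI _ Ig Df).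
      by move=> u v Iu Dv; exact: hr.
    by case: (side) h => h;
      [exact: viaL|exact: viaR|case: h => h _; exact: viaL].
  split=> //; split=> // f g Df Ig; rewrite mulC; exact: left.
split; split.
- by move=> h t t0; exact: ifrom1.
- by move=> h; exact: (ito1 1 ltr01 (h 1 ltr01)).
- by move=> h; exists 1; [exact: ltr01|exact: (ifrom1 1 ltr01 h)].
- by case=> t t0; exact: ito1.
Qed.
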